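(* Let $g\geq 3$ be an integer, let $\mathbf{k}$ be an algebraically closed field of characteristic $p$, and suppose $p=0$ or $p\geq\frac{g+2}{2}$. Let $\mathcal{T}\subseteq\mathbf{P}^g$ be the tangential variety of the rational normal curve of degree $g$ over $\mathbf{k}$ and let $b_{i,j}=\dim_{\mathbf{k}}K_{i,j}(\mathcal{T},\mathcal{O}_{\mathcal{T}}(1))$. Then $$b_{i,2}\neq 0\quad\text{if and only if}\quad\frac{g-2}{2}\leq i\leq g-3.$$
   Context: The rational normal curve $\Gamma\subseteq\mathbf{P}^g$ is the image of $\mathbf{P}^1$ under $[a:b]\mapsto[a^g:a^{g-1}b:\cdots:b^g]$. Its tangential variety $\mathcal{T}$ is the surface swept out by the tangent lines to $\Gamma$, with reduced structure. Equivalently, in homogeneous coordinates $z_0,\ldots,z_g$ on $\mathbf{P}^g$, the homogeneous ideal of $\mathcal{T}$ is the kernel of the ring map $\mathbf{k}[z_0,\ldots,z_g]\to\mathbf{k}[t,u,v]$, $z_i\mapsto u\,t^i+i\,v\,t^{i-1}$. Koszul cohomology: for a projective variety $X$ over $\mathbf{k}$ and a very ample line bundle $L$ on $X$, put $S=\operatorname{Sym}H^0(X,L)$ and let $\Gamma_X(L)=\bigoplus_{n\geq 0}H^0(X,L^{n})$, a graded $S$-module. Then $K_{i,j}(X,L):=\operatorname{Tor}_i^S(\Gamma_X(L),\mathbf{k})_{i+j}$. For $X=\mathcal{T}$ and $L=\mathcal{O}_{\mathcal{T}}(1)$, $H^0(\mathcal{T},\mathcal{O}_{\mathcal{T}}(1))$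 is the span of $z_0,\ldots,z_g$. *)

(* Defs.v *)
From Stdlib Require Import ClassicalEpsilon.
From HB Require Import structures.
From mathcomp Require Import all_boot all_order all_algebra.
From mathcomp Require Export mpoly.
From mathcomp Require Import zify.

Set Implicit Arguments.
Unset Strict Implicit.
Unset Printing Implicit Defensive.

Import GRing.Theory.
Local Open Scope ring_scope.

(** Graded Tor over a polynomial ring [S = k[x_0, ..., x_{n-1}]]. *)

(* An S-linear map of finite free modules [S^B -> S^B'] is given by the matrix
   [phi] with [e_b |-> \sum_b' phi b b' e_b'].  Tensored with an S-module M it
   becomes the following map [M^B -> M^B']; for [M = S^o] it is the map itself. *)
Definition free_map (S : comNzRingType) (M : lmodType S) (B B' : finType)
    (phi : B -> B' -> S) (x : {ffun B -> M}) : {ffun B' -> M} :=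
  [ffun b' => \sum_b phi b b' *: x b].

(* A graded free resolution of the residue field [k = S / (x_0, ..., x_{n-1})]
   by finitely generated free modules [P_i = \bigoplus_b S(- res_deg b)],
   [b] ranging over [res_basis i]; the augmentation [P_0 -> k] maps [e_b] to
   [res_aug b], and [S] acts on [k] through constant coefficients. *)
Record residue_res (k : fieldType) (n : nat) := ResidueRes {
  res_basis : nat -> finType;
  res_deg : forall i, res_basis i -> nat;
  res_d : forall i, res_basis i.+1 -> res_basis i -> {mpoly k[n]};
  res_aug : res_basis 0%N -> k;
  res_d_homog : forall i (b : res_basis i.+1) (b' : res_basis i),
    if (res_deg b' <= res_deg b)%N
    then res_d b b' \is (res_deg b - res_deg b')%N.-homog
    else res_d b b' == 0;
  res_aug_homog : forall b, res_aug b != 0 -> res_deg b = 0%N;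
  res_aug_surj : exists b, res_aug b != 0;
  res_exact0 : forall x : {ffun res_basis 0%N -> {mpoly k[n]}^o},
    \sum_b (x b : {mpoly k[n]})@_0%MM * res_aug b = 0
    <-> exists y, x = free_map (@res_d 0%N) y;
  res_exact : forall i (x : {ffun res_basis i.+1 -> {mpoly k[n]}^o}),
    free_map (@res_d i) x = 0 <-> exists y, x = free_map (@res_d i.+1) y
}.

(* Such resolutions exist: the Koszul complex is one. *)

Section Koszul.
Variables (k : fieldType) (n : nat).
Local Notation S := {mpoly k[n]}.
Implicit Types (A B : {set 'I_n}) (a b c : 'I_n) (X : {set 'I_n} -> S).

Definition koszul_sign a A : S := (-1) ^+ #|[set b in A | (b < a)%N]|.

Definition koszul_basis (i : nat) : finType := {A : {set 'I_n} | #|A| == i}.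

Definition koszul_d i (b : koszul_basis i.+1) (b' : koszul_basis i) : S :=
  \sum_(a | (a \notin val b') && (val b == a |: val b'))
    koszul_sign a (val b') * 'X_a.

Let D X A : S := \sum_(a | a \notin A) koszul_sign a A * 'X_a * X (a |: A).

Let ext i (x : {ffun koszul_basis i -> S^o}) A : S :=
  if insub A is Some b then x b else 0.

Let extE i (x : {ffun koszul_basis i -> S^o}) (b : koszul_basis i) :
  ext x (val b) = x b.
Proof. by rewrite /ext valK. Qed.

Let ext0 i (x : {ffun koszul_basis i -> S^o}) A : #|A| != i -> ext x A = 0.
Proof. by move=> h; rewrite /ext insubN. Qed.

Let free_mapE i (x : {ffun koszul_basis i.+1 -> S^o}) (b' : koszul_basis i) :
  free_map (@koszul_d i) x b' = D (ext x) (val b').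
Proof.
rewrite ffunE /D.
under eq_bigr do rewrite /koszul_d scaler_suml.
rewrite (exchange_big_dep (fun a => a \notin val b')) /=; last first.
  by move=> b a _ /andP[].
apply: eq_bigr => a ha.
have hc : #|a |: val b'| == i.+1.
  by rewrite cardsU1 ha (eqP (valP b')).
rewrite (big_pred1 (Sub (a |: val b') hc : koszul_basis i.+1)) => [|b] /=.
  by rewrite -[in RHS](SubK (koszul_basis i.+1) hc) extE.
by rewrite ha /= -val_eqE.
Qed.

Let sign_swap a c A : a \notin A -> c \notin A -> (a < c)%N ->
  koszul_sign a A * koszul_sign c (a |: A)
  = - (koszul_sign c A * koszul_sign a (c |: A)).
Proof.
move=> ha hc lac.
have h1 : [set b in a |: A | (b < c)%N] = a |: [set b in A | (b < c)%N].
  apply/setP => b; rewrite !inE; case: eqP => [->|] //=.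
have h2 : [set b in c |: A | (b < a)%N] = [set b in A | (b < a)%N].
  apply/setP => b; rewrite !inE; case: (b =P c) => [->|] //=.
  by rewrite (negbTE hc); lia.
rewrite /koszul_sign h1 h2 cardsU1 inE (negbTE ha) /= exprS mulN1r mulrN.
by rewrite mulrC.
Qed.

Let DD X A : D (D X) A = 0.
Proof.
pose F a c := koszul_sign a A * 'X_a * (koszul_sign c (a |: A) * 'X_c
   * X (c |: (a |: A))).
have FN a c : a \notin A -> c \notin A -> (a < c)%N -> F a c = - F c a.
  move=> ha hc lac; rewrite /F setUCA.
  have := sign_swap ha hc lac.
  set s1 := koszul_sign a A; set s2 := koszul_sign c (a |: A).
  set s3 := koszul_sign c A; set s4 := koszul_sign a (c |: A) => e.
  rewrite mulrA mulrACA e mulNr mulNr; congr (- _).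
  by rewrite [RHS]mulrA [in RHS]mulrACA; congr (_ * _ * _); rewrite mulrC.
transitivity (\sum_(a | a \notin A) \sum_(c | (c \notin A) && (c != a)) F a c).
  apply: eq_bigr => a ha; rewrite mulr_sumr; apply: eq_bigl => c.
  by rewrite !inE negb_or andbC.
transitivity (\sum_(a | a \notin A) \sum_(c | (c \notin A) && (a < c)%N) F a c
  + \sum_(a | a \notin A) \sum_(c | (c \notin A) && (c < a)%N) F a c).
  rewrite -big_split /=; apply: eq_bigr => a ha.
  rewrite (bigID (fun c : 'I_n => (a < c)%N)) /=; congr (_ + _).
    apply: eq_bigl => c; rewrite -andbA; congr (_ && _).
    by rewrite -val_eqE /=; lia.
  apply: eq_bigl => c; rewrite -andbA; congr (_ && _).
  by rewrite -val_eqE /=; lia.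
rewrite [X in _ + X](exchange_big_dep (fun c => c \notin A)) /=; last first.
  by move=> a c _ /andP[].
rewrite -big_split /= big1 // => a ha.
rewrite [X in _ + X](eq_bigl (fun c => (c \notin A) && (a < c)%N)); last first.
  by move=> c; rewrite ha.
rewrite -big_split /= big1 // => c /andP[hc lac].
by rewrite FN // addNr.
Qed.

(* Contracting homotopy, one monomial at a time: for the least [a] that occurs
   in [m] or in [A], [m e_A] goes to [(m / x_a) e_(a |: A)] or to 0. *)
Let below a (m : 'X_{1..n}) : bool := [forall b : 'I_n, (b < a)%N ==> (m b == 0%N)].

Let quo a (p : S) : S :=
  \sum_(m <- msupp p | (0 < m a)%N && below a m) p@_m *: 'X_[(m - U_(a))%MM].

Let H X A : S :=
  \sum_(a | (a \in A) && [forall b in A, (a <= b)%N]) quo a (X (A :\ a)).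

Let mcoeff_quo a p m : (quo a p)@_m = if below a m then p@_(m + U_(a))%MM else 0.
Proof.
have belowD : below a (m + U_(a))%MM = below a m.
  apply: eq_forallb => b; rewrite mnmDE mnm1E -val_eqE /=.
  by case: ltngtP => //=; rewrite addn0.
have cancel (m' : 'X_{1..n}) : (0 < m' a)%N ->
    ((m' - U_(a))%MM == m) = (m' == (m + U_(a))%MM).
  move=> h; apply/eqP/eqP => [<-|->]; last by rewrite addmK.
  by rewrite submK // lep1mP -lt0n.
rewrite /quo raddf_sum /=.
under eq_bigr => m' _ do rewrite mcoeffZ mcoeffX.
rewrite -big_filter.
have [hin|hin] := boolP ((m + U_(a))%MM \in
   [seq m' : 'X_{1..n} <- msupp p | (0 < m' a)%N && below a m']); last first.
  rewrite big1_seq => [|m' /andP[_ hm']].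
    move: hin; rewrite mem_filter belowD mnmDE mnm1E eqxx addn1 ltn0Sn /=.
    by case: ifP => //= _ /memN_msupp_eq0 ->.
  have := hm'; rewrite mem_filter => /andP[/andP[h0 _] _].
  rewrite cancel //; case: eqP => [e|]; last by rewrite mulr0.
  by rewrite -e hm' in hin.
rewrite (bigD1_seq _ hin) ?filter_uniq ?msupp_uniq //= addmK eqxx mulr1.
rewrite big1_seq ?addr0 => [|m' /andP[hne hm']].
  by move: hin; rewrite mem_filter belowD => /andP[/andP[_ ->]].
move: hm'; rewrite mem_filter => /andP[/andP[h0 _] _].
by rewrite cancel // (negbTE hne) mulr0.
Qed.

Let min_unique A a c : (a \in A) && [forall b in A, (a <= b)%N] ->
  (c \in A) && [forall b in A, (c <= b)%N] = (c == a).
Proof.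
move=> /andP[ha /forall_inP ma]; apply/idP/eqP => [/andP[hc /forall_inP mc]|->].
  by apply/val_inj/eqP; rewrite eqn_leq mc // ma.
by rewrite ha; apply/forall_inP.
Qed.

Let HE X A a : (a \in A) && [forall b in A, (a <= b)%N] ->
  H X A = quo a (X (A :\ a)).
Proof. by move=> h; apply: big_pred1 => c; apply: min_unique. Qed.

Let mcoeff_sX a A p m : (koszul_sign a A * 'X_a * p)@_m =
  (-1) ^+ #|[set b in A | (b < a)%N]|
  * (if (0 < m a)%N then p@_(m - U_(a))%MM else 0).
Proof.
rewrite /koszul_sign -mulrA.
suff <- : ('X_a * p)@_m = if (0 < m a)%N then p@_(m - U_(a))%MM else 0.
  rewrite -signr_odd -[in RHS]signr_odd; case: odd;
    by rewrite ?mulN1r ?mcoeffN ?mul1r.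
rewrite [in LHS](mpolyE p) mulr_sumr raddf_sum /=.
under eq_bigr => m' _ do
  rewrite -scalerAr -mpolyXD mcoeffZ mcoeffX mulr_natr mulrb.
case: ifP => h; last first.
  rewrite big1 // => m' _; case: eqP => // e.
  by move: h; rewrite -e mnmDE mnm1E eqxx.
have e m' : ((U_(a) + m')%MM == m) = (m' == (m - U_(a))%MM).
  by apply/eqP/eqP => [<-|->]; rewrite addmC ?addmK // submK // lep1mP -lt0n.
under eq_bigr => m' _ do rewrite e.
have [hin|hin] := boolP ((m - U_(a))%MM \in msupp p).
  rewrite (bigD1_seq _ hin) ?msupp_uniq //= eqxx big1 ?addr0 //.
  by move=> m' /negbTE ->.
rewrite memN_msupp_eq0 // big1_seq // => m' /= hm'.
by case: eqP => // e'; rewrite e' (negbTE hin) in hm'.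
Qed.

Let homotopy X : (forall A, D X A = 0) -> (X set0)@_0%MM = 0 ->
  forall B, D (H X) B = X B.
Proof.
move=> DX0 X00 B; apply/mpolyP => m.
rewrite /D raddf_sum /=.
under eq_bigr => c _ do rewrite mcoeff_sX.
pose w b := (b \in B) || (0 < m b)%N.
have [a0 wa0|w0] := pickP w; last first.
  have m0 : m = 0%MM.
    apply/mnmP => b; rewrite mnm0E.
    by have /negbT := w0 b; rewrite negb_or -leqNgt leqn0 => /andP[_ /eqP].
  have B0 : B = set0.
    apply/setP => b; rewrite inE.
    by have /negbT := w0 b; rewrite negb_or => /andP[/negbTE].
  rewrite B0 m0 X00 big1 // => c _.
  by rewrite mnm0E mulr0.
have [a wa mina] := @arg_minnP _ a0 w (fun b => val b) wa0.
have belowa c : (c \notin B) -> (0 < m c)%N -> below a (m - U_(c))%MM.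
  move=> _ _; apply/forallP => b; apply/implyP => lba.
  have : ~~ w b by apply/negP => /mina /=; lia.
  by rewrite /w negb_or -leqNgt leqn0 => /andP[_ /eqP mb]; rewrite mnmBE mb.
have signa A : {subset A <= B} -> #|[set b in A | (b < a)%N]| = 0%N.
  move=> sAB; apply: eq_card0 => b; rewrite !inE; apply/negP => /andP[hb lba].
  have /mina /= : w b by rewrite /w sAB.
  by lia.
have [aB|aB] := boolP (a \in B).
  have := DX0 (B :\ a) => /(congr1 (mcoeff (m + U_(a))%MM)).
  rewrite /D raddf_sum mcoeff0 /=.
  under eq_bigr => c _ do rewrite mcoeff_sX.
  rewrite (bigD1 a) /= ?setD11 // signa => [|b]; last by rewrite inE => /andP[].
  rewrite expr0 mul1r mnmDE mnm1E eqxx addn1 ltn0Sn addmK setD1K //.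
  move/eqP; rewrite addr_eq0 => /eqP ->.
  rewrite -sumrN; apply: eq_big => [c|c hc].
    by rewrite !inE; case: (c =P a) => [->|]; rewrite ?aB ?andbT.
  have ca : c != a by apply: contraNneq hc => ->.
  rewrite mnmDE mnm1E eq_sym (negbTE ca) addn0.
  case: ifP => mc; last by rewrite !mulr0 oppr0.
  have lac : (a < c)%N.
    rewrite ltn_neqAle eq_sym ca /=; apply: mina.
    by rewrite /w mc orbT.
  rewrite (@HE _ _ a); last first.
    rewrite !inE aB orbT; apply/forall_inP => b; rewrite !inE => /orP[/eqP->|hb].
      exact: ltnW.
    by apply: mina; rewrite /w hb.
  rewrite mcoeff_quo belowa //.
  have -> : [set b in B | (b < c)%N] = a |: [set b in B :\ a | (b < c)%N].
    by apply/setP => b; rewrite !inE; case: (b =P a) => [->|] //=; rewrite aB lac.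
  rewrite cardsU1 !inE eqxx /= exprS mulN1r mulNr; congr (- (_ * _)).
  have -> : (c |: B) :\ a = c |: (B :\ a).
    by apply/setP => b; rewrite !inE; case: (b =P c) => [->|] //=; rewrite ca.
  congr (mcoeff _ _); apply/mnmP => b.
  rewrite !mnmDE !mnmBE !mnmDE !mnm1E.
  by case: (c =P b) => [<-|] //=; lia.
have ma : (0 < m a)%N by move: wa; rewrite /w (negbTE aB).
rewrite (bigD1 a) //= ma signa // expr0 mul1r.
rewrite (@HE _ _ a); last first.
  rewrite !inE eqxx; apply/forall_inP => b; rewrite !inE => /orP[/eqP->|hb] //.
  by apply: mina; rewrite /w hb.
rewrite mcoeff_quo belowa // submK ?lep1mP -?lt0n //.
have -> : (a |: B) :\ a = B.
  by apply/setP => b; rewrite !inE; case: (b =P a) => [->|] //=; rewrite (negbTE aB).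
rewrite big1 ?addr0 // => c /andP[hc ca].
case: ifP => mc; last by rewrite mulr0.
rewrite /H raddf_sum /= big1 ?mulr0 // => a' /andP[ha' _].
rewrite mcoeff_quo; case: ifP => // /forallP /(_ a) /implyP.
have laa' : (a < a')%N.
  have wa' : w a'.
    by move: ha'; rewrite !inE /w => /orP[/eqP->|->]; rewrite ?mc ?orbT.
  rewrite ltn_neqAle mina // andbT; apply: contraNneq aB => /val_inj e.
  by move: ha'; rewrite -e !inE eq_sym (negbTE ca).
move/(_ laa'); rewrite mnmBE mnm1E (negbTE ca) subn0.
by move/eqP => e; rewrite e in ma.
Qed.

Let exact_of i (x : {ffun koszul_basis i -> S^o}) :
  (forall A, D (ext x) A = 0) -> (ext x set0)@_0%MM = 0 ->
  exists y, x = free_map (@koszul_d i) y.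
Proof.
move=> h0 h1; exists [ffun b => H (ext x) (val b)].
apply/ffunP => b; rewrite free_mapE -extE -(homotopy h0 h1).
apply: eq_bigr => a ha; congr (_ * _).
have hc : #|a |: val b| == i.+1 by rewrite cardsU1 ha (eqP (valP b)).
by rewrite -[a |: val b](SubK (koszul_basis i.+1) hc) extE ffunE.
Qed.

Fact koszul_d_homog i (b : koszul_basis i.+1) (b' : koszul_basis i) :
  if (i <= i.+1)%N then koszul_d b b' \is (i.+1 - i)%N.-homog
  else koszul_d b b' == 0.
Proof.
rewrite leqnSn subSnn; apply: rpred_sum => a _.
rewrite /koszul_sign -signr_odd; have h : ('X_a : S) \is 1.-homog.
  by rewrite dhomogX; apply/eqP; apply: mdeg1.
by case: odd; rewrite ?mulN1r ?rpredN // mul1r.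
Qed.

Fact koszul_exact0 (x : {ffun koszul_basis 0 -> S^o}) :
  \sum_b (x b : S)@_0%MM * 1 = 0 <-> exists y, x = free_map (@koszul_d 0) y.
Proof.
have h0 : #|set0 : {set 'I_n}| == 0%N by rewrite cards0.
pose b0 : koszul_basis 0 := Sub set0 h0.
have allb0 (b : koszul_basis 0) : b = b0.
  by apply/val_inj/eqP; rewrite /= -cards_eq0 (valP b).
have -> : \sum_b (x b : S)@_0%MM * 1 = (ext x set0)@_0%MM.
  rewrite (big_pred1 b0) => [|b]; last by rewrite [b]allb0 /= eqxx.
  by rewrite mulr1 -extE.
split=> [h|[y ->]].
  apply: exact_of => // A; apply: big1 => a ha.
  by rewrite ext0 ?mulr0 // cardsU1 ha.
have -> : (set0 : {set 'I_n}) = val b0 by [].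
rewrite extE free_mapE /D raddf_sum big1 //= => a _.
by rewrite mcoeff_sX mnm0E mulr0.
Qed.

Fact koszul_exact i (x : {ffun koszul_basis i.+1 -> S^o}) :
  free_map (@koszul_d i) x = 0 <-> exists y, x = free_map (@koszul_d i.+1) y.
Proof.
split=> [h|[y ->]].
  apply: exact_of; last by rewrite ext0 ?mcoeff0 // cards0.
  move=> A; have [hA|hA] := boolP (#|A| == i).
    rewrite -[A](SubK (koszul_basis i) hA) -free_mapE h.
    by rewrite ffunE.
  apply: big1 => a ha; rewrite ext0 ?mulr0 // cardsU1 ha.
  by apply: contraNneq hA; rewrite add1n => -[->].
apply/ffunP => b; rewrite free_mapE ffunE -[RHS](DD (ext y) (val b)).
apply: eq_bigr => a ha; congr (_ * _).
have hc : #|a |: val b| == i.+1 by rewrite cardsU1 ha (eqP (valP b)).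
by rewrite -[a |: val b](SubK (koszul_basis i.+1) hc) extE free_mapE.
Qed.

Fact koszul_aug_surj : exists b : koszul_basis 0, (1 : k) != 0.
Proof.
have h0 : #|set0 : {set 'I_n}| == 0%N by rewrite cards0.
by exists (Sub set0 h0); apply: oner_neq0.
Qed.

Definition koszul_res : residue_res k n :=
  @ResidueRes k n koszul_basis (fun i _ => i) koszul_d (fun _ => 1)
    koszul_d_homog (fun _ _ => erefl) koszul_aug_surj koszul_exact0
    koszul_exact.

End Koszul.

Section Tor.
Variables (k : fieldType) (n : nat) (P : residue_res k n).
Variable M : lmodType {mpoly k[n]}.
(* The graded module is [\bigoplus_d Mgr d], a submodule of the ambient [M]. *)
Variable Mgr : nat -> M -> Prop.

(* The degree-d part of [P_i \otimes_S \bigoplus_d Mgr d]. *)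
Definition tensor_deg i d (x : {ffun res_basis P i -> M}) : Prop :=
  forall b, if (res_deg b <= d)%N then Mgr (d - res_deg b) (x b) else x b = 0.

Definition tor_cycle i d : {ffun res_basis P i -> M} -> Prop :=
  match i with
  | 0%N => fun x => tensor_deg d x
  | i'.+1 => fun x => tensor_deg d x /\ free_map (@res_d _ _ P i') x = 0
  end.

Definition tor_boundary i d (x : {ffun res_basis P i -> M}) : Prop :=
  exists2 y, tensor_deg d y & x = free_map (@res_d _ _ P i) y.

End Tor.

(* The k-vector space [Z / (Z \cap B)] has dimension m.  Scalars of k act on
   the S-module V as constant polynomials. *)
Definition has_quot_dim (k : fieldType) (n : nat) (V : lmodType {mpoly k[n]})
    (Z B : V -> Prop) (m : nat) : Prop :=
  exists v : 'I_m -> V,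
    [/\ forall j, Z (v j),
        forall c : 'I_m -> k, B (\sum_j (c j)%:MP *: v j) -> forall j, c j = 0
      & forall z, Z z ->
          exists c : 'I_m -> k, B (z - \sum_j (c j)%:MP *: v j)].

(* [None] stands for infinite dimension. *)
Definition quot_dim (k : fieldType) (n : nat) (V : lmodType {mpoly k[n]})
    (Z B : V -> Prop) : option nat :=
  epsilon (inhabits None) (fun o =>
    if o is Some m then has_quot_dim Z B m
    else forall m, ~ has_quot_dim Z B m).

(* [dim_k Tor_i^S(\bigoplus_d Mgr d, k)_d], computed from the resolution P. *)
Definition tor_dim (k : fieldType) (n : nat) (P : residue_res k n)
    (M : lmodType {mpoly k[n]}) (Mgr : nat -> M -> Prop) (i d : nat) :
    option nat :=
  quot_dim (@tor_cycle k n P M Mgr i d) (@tor_boundary k n P M Mgr i d).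

(** The tangential variety of the rational normal curve. *)

(* The ring map [k[z_0, ..., z_g] -> k[t, u, v]], [z_i |-> u t^i + i v t^(i-1)].
   Its kernel is the homogeneous ideal I of the tangential variety T, so its
   image is the homogeneous coordinate ring S/I, an integral domain. *)
Definition tangent_map (k : fieldType) (g : nat) (p : {mpoly k[g.+1]}) :
    {mpoly k[3]} :=
  let t := 'X_(inord 0) in let u := 'X_(inord 1) in let v := 'X_(inord 2) in
  p \mPo [tuple u * t ^+ i + (v * t ^+ i.-1) *+ i | i < g.+1].

(* The field [k(t, u, v)], an S-module via [tangent_map]. *)
Definition tangent_field (k : fieldType) (g : nat) : Type :=
  {fraction {mpoly k[3]}}.

Section TangentField.
Variables (k : fieldType) (g : nat).

HB.instance Definition _ :=
  GRing.Field.copy (tangent_field k g) {fraction {mpoly k[3]}}.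

Definition tangent_inj (p : {mpoly k[g.+1]}) : tangent_field k g :=
  tofrac (tangent_map p).

Definition tangent_scale (p : {mpoly k[g.+1]}) (f : tangent_field k g) :
    tangent_field k g := tangent_inj p * f.

Fact tangent_scaleA p q f :
  tangent_scale p (tangent_scale q f) = tangent_scale (p * q) f.
Proof.
by rewrite /tangent_scale /tangent_inj /tangent_map !rmorphM mulrA.
Qed.

Fact tangent_scale1 : left_id 1 tangent_scale.
Proof.
by move=> f; rewrite /tangent_scale /tangent_inj /tangent_map !rmorph1 mul1r.
Qed.

Fact tangent_scaleDr : right_distributive tangent_scale +%R.
Proof. by move=> p f h; rewrite /tangent_scale mulrDr. Qed.

Fact tangent_scaleDl f : {morph tangent_scale^~ f : p q / p + q}.
Proof.
by move=> p q; rewrite /tangent_scale /tangent_inj /tangent_map !rmorphD mulrDl.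
Qed.

HB.instance Definition _ :=
  GRing.Zmodule_isLmodule.Build {mpoly k[g.+1]} (tangent_field k g)
    tangent_scaleA tangent_scale1 tangent_scaleDr tangent_scaleDl.

(* [H^0(T, O_T(n))].  As [T = Proj (S/I)] is integral and covered by the opens
   [z_i <> 0], a section of [O_T(n)] is an element of the function field of the
   cone lying in the degree-n part of each localization [(S/I)[1/z_i]]. *)
Definition tangent_section (n : nat) (f : tangent_field k g) : Prop :=
  forall i : 'I_g.+1, exists (N : nat) (p : {mpoly k[g.+1]}),
    p \is (n + N)%N.-homog /\ f * tangent_inj 'X_i ^+ N = tangent_inj p.

(* [b_{i,j} = dim_k K_{i,j}(T, O_T(1))], where [K_{i,j}(T, O_T(1))] is
   [Tor_i^S(\bigoplus_{n >= 0} H^0(T, O_T(n)), k)_{i+j}]. *)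
Definition tangent_betti (P : residue_res k g.+1) (i j : nat) : option nat :=
  tor_dim P tangent_section i (i + j)%N.

End TangentField.

(* [p] is the characteristic of [k]. *)
Definition has_char (k : fieldType) (p : nat) : Prop :=
  if p == 0%N then [pchar k] =i pred0 else p \in [pchar k].

(* Main.v *)
Require Import Defs.
From Stdlib Require Import ClassicalEpsilon FunctionalExtensionality.
From HB Require Import structures.
From mathcomp Require Import all_boot all_order all_algebra.
From mathcomp Require Import ring zify.

(* With w = v / u, a section of O(n) is u^n X for a polynomial X in k[t][w]: for
   n = 1, X = A + A' w with A of degree at most g in t, and for n = 2,
   X = a + a' w + b w^2, where a and b have bounded degrees and their two top
   coefficients are proportional.  In the Koszul complex, K_{i,2} becomes the
   space of pairs (a, b) of alternating i-tensors over k[t] with <e, a> = 0,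
   <e, b> + <e', a'> = 0 and <e', b> = 0, where e = (1, t, ..., t^g) and primes
   are derivatives in t, modulo the pairs (<e, A>, <e', A'>).

   A tensor killed by e is divisible by x - t in each slot, which allows one to
   remove a; then b is divisible by (x - t)^2 in each slot, with a quotient of
   degree at most 2N - 2 in t, N = g - 1 - i.  The products of the (x - t)^r u,
   0 < r <= i + 1, for u of degree N, provide boundaries whose quotients are the
   W(u, t^b) (u /\ x u /\ ... /\ x^(i-1) u), with W the Wronskian.  By duality
   these span if the only forms F_0, ..., F_(2N-2) of degree i in the
   coefficients of u with sum_e F_e W(u, t^b)_e = 0 for all b <= N are zero.
   This holds for i <= N - 2: substituting u = (x - a) v lowers N, until
   i = N - 2.  In that case F is contracted with the top forms, and everything
   reduces to the exactness, up to powers of the values u(a), of a Koszul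
   complex on the W(u, x^b); it is homotopically trivial where u(a) <> 0,
   because there W(u, .) splits by Taylor expansion (this inverts 1, ..., N).
   For (g - 2) / 2 <= i <= g - 3 there are instead more quotients b than
   boundaries, by a dimension count. *)

Set Implicit Arguments.
Unset Strict Implicit.
Unset Printing Implicit Defensive.

Import GRing.Theory.
Local Open Scope ring_scope.

(** * Alternating tensors *)

Section Tensors.
Variable P : comNzRingType.
Implicit Types (f g h : nat -> P) (al be : seq nat -> P) (n : nat).

(** The bound on p comes from one place. Lowering N stops at N = i + 2, where the Taylor expansion
    inverts 1, ..., i + 2; for 2 i < g - 2 each such l satisfies 2 l < g + 2, so it is nonzero in k.
    Since g >= 3 this covers l = 2, so antisymmetric tensors vanish at repeated indices. The
    obstacle in the case i = N - 2 is that a splitting at a point a gives exactness only after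
    multiplication by a power of u(a). To remove these powers, u is written in Lagrange coordinates:
    its values at N + 1 points become, up to constants, the variables x_0, ..., x_N. Exactness then
    holds modulo powers of variables, and x_j is regular modulo powers of the others; N + 1 points
    are enough for the length of the complex. The power of x_0 that survives is x_0^(N-1), invisible
    to forms of degree N - 2. In terms of N = g - 1 - i the range of non-vanishing is 2 <= N <= i +
    1. An arbitrary resolution is compared with the Koszul complex by lifting maps and
    homotopies. *)

(* A tensor is its function of coordinates: [al [:: a1; ..; aj]] is the
   coefficient of [e_a1 (x) .. (x) e_aj]. *)
Definition contr n f al : seq nat -> P := fun s => \sum_(a < n) f a * al (val a :: s).

(** Expansion along the first slot instead of a sum over permutations: the antiderivation rule
    [contr_wedge] and the rule [wedgeC] then hold for all tensors, alternating or not. *)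
Fixpoint wedge g al (s : seq nat) : P :=
  if s is a :: s' then g a * al s' - wedge g (fun r => al (a :: r)) s' else 0.

Definition ip n f g : P := \sum_(a < n) f a * g a.

Definition alt al := forall s1 a b s2,
  al (s1 ++ a :: b :: s2) = - al (s1 ++ b :: a :: s2).

Definition supp n al := forall s, ~~ all (fun a => (a < n)%N) s -> al s = 0.

Definition tdeg j al := forall s, size s != j -> al s = 0.

Lemma wedge_lin (I : Type) (r : seq I) g (c : I -> P) (F : I -> seq nat -> P) s :
  wedge g (fun s => \sum_(i <- r) c i * F i s) s
  = \sum_(i <- r) c i * wedge g (F i) s.
Proof.
elim: s F => [|a s IH] F /=; first by rewrite big1 // => i _; rewrite mulr0.
rewrite (IH (fun i r => F i (a :: r))) mulr_sumr -sumrB.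
by apply: eq_bigr => i _; ring.
Qed.

Lemma wedgeD g al be s :
  wedge g (fun s => al s + be s) s = wedge g al s + wedge g be s.
Proof. by elim: s al be => [|a s IH] al be /=; rewrite ?IH; ring. Qed.

Lemma wedgeN g al s : wedge g (fun s => - al s) s = - wedge g al s.
Proof. by elim: s al => [|a s IH] al /=; rewrite ?IH; ring. Qed.

Lemma wedgeZ g c al s : wedge g (fun s => c * al s) s = c * wedge g al s.
Proof. by elim: s al => [|a s IH] al /=; rewrite ?IH; ring. Qed.

Lemma wedge_linl (I : Type) (r : seq I) (c : I -> P) (G : I -> nat -> P) al s :
  wedge (fun a => \sum_(i <- r) c i * G i a) al s
  = \sum_(i <- r) c i * wedge (G i) al s.
Proof.
elim: s al => [|a s IH] al /=; first by rewrite big1 // => i _; rewrite mulr0.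
rewrite IH mulr_suml -sumrB.
by apply: eq_bigr => i _; ring.
Qed.

Lemma wedgeDl g h al s :
  wedge (fun a => g a + h a) al s = wedge g al s + wedge h al s.
Proof. by elim: s al => [|a s IH] al /=; rewrite ?IH; ring. Qed.

Lemma wedgeZl c g al s : wedge (fun a => c * g a) al s = c * wedge g al s.
Proof. by elim: s al => [|a s IH] al /=; rewrite ?IH; ring. Qed.

Lemma wedge_eq g al be : al =1 be -> wedge g al =1 wedge g be.
Proof. by move=> /functional_extensionality ->. Qed.

Lemma contr_lin n f (I : Type) (r : seq I) (c : I -> P) (F : I -> seq nat -> P) s :
  contr n f (fun s => \sum_(i <- r) c i * F i s) s
  = \sum_(i <- r) c i * contr n f (F i) s.
Proof.
rewrite /contr; under eq_bigr do rewrite mulr_sumr.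
rewrite exchange_big; apply: eq_bigr => i _; rewrite mulr_sumr.
by apply: eq_bigr => a _; ring.
Qed.

Lemma contrD n f al be s :
  contr n f (fun s => al s + be s) s = contr n f al s + contr n f be s.
Proof. by rewrite /contr -big_split; apply: eq_bigr => a _; rewrite mulrDr. Qed.

Lemma contrN n f al s : contr n f (fun s => - al s) s = - contr n f al s.
Proof. by rewrite /contr -sumrN; apply: eq_bigr => a _; rewrite mulrN. Qed.

Lemma contrZ n f c al s : contr n f (fun s => c * al s) s = c * contr n f al s.
Proof. by rewrite /contr mulr_sumr; apply: eq_bigr => a _; ring. Qed.

Lemma contrDl n f h al s :
  contr n (fun a => f a + h a) al s = contr n f al s + contr n h al s.
Proof. by rewrite /contr -big_split; apply: eq_bigr => a _; rewrite mulrDl. Qed.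

Lemma contrZl n f c al s : contr n (fun a => c * f a) al s = c * contr n f al s.
Proof. by rewrite /contr mulr_sumr; apply: eq_bigr => a _; ring. Qed.

Lemma contr_linl n (I : Type) (r : seq I) (c : I -> P) (G : I -> nat -> P) al s :
  contr n (fun a => \sum_(i <- r) c i * G i a) al s
  = \sum_(i <- r) c i * contr n (G i) al s.
Proof.
rewrite /contr; under eq_bigr do rewrite mulr_suml.
rewrite exchange_big; apply: eq_bigr => i _; rewrite mulr_sumr.
by apply: eq_bigr => a _; ring.
Qed.

Lemma contr_wedge n f g al s :
  contr n f (wedge g al) s = ip n f g * al s - wedge g (contr n f al) s.
Proof.
rewrite /contr /ip /= mulr_suml wedge_lin -sumrB.
by apply: eq_bigr => a _; rewrite /=; ring.
Qed.

Lemma wedgeC g h al s : wedge g (wedge h al) s = - wedge h (wedge g al) s.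
Proof.
elim: s al => [|a s IH] al /=; first by rewrite oppr0.
rewrite !(wedgeD _ (fun r => _ * _)) !wedgeN !wedgeZ.
by rewrite (IH (fun r => al (a :: r))); ring.
Qed.

Lemma alt_cons al a : alt al -> alt (fun r => al (a :: r)).
Proof. by move=> h s1 b c s2; apply: (h (a :: s1)). Qed.

Lemma alt_wedge g al : alt al -> alt (wedge g al).
Proof.
move=> h s1; elim: s1 al h => [|x s1 IH] al h a b s2 /=.
  have -> : (fun r => al (a :: b :: r)) = (fun r => - al (b :: a :: r)).
    by apply: functional_extensionality => r; apply: (h [::]).
  by rewrite wedgeN; ring.
by rewrite (h s1) (IH _ (alt_cons x h)); ring.
Qed.

Lemma alt_contr n f al : alt al -> alt (contr n f al).
Proof.
move=> h s1 a b s2; rewrite /contr -sumrN; apply: eq_bigr => c _.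
by rewrite -!cat_cons h mulrN.
Qed.

Lemma contrC n f h al : alt al ->
  forall s, contr n f (contr n h al) s = - contr n h (contr n f al) s.
Proof.
move=> ha s; rewrite /contr.
under eq_bigr do rewrite mulr_sumr.
rewrite exchange_big -sumrN; apply: eq_bigr => b _.
rewrite mulr_sumr -sumrN; apply: eq_bigr => a _.
by rewrite (ha [::] b a s) /=; ring.
Qed.

Lemma tdeg_wedge j g al : tdeg j al -> tdeg j.+1 (wedge g al).
Proof.
move=> h s; elim: s j al h => [|a s IH] j al h //= hs.
rewrite h // mulr0 sub0r; apply/eqP; rewrite oppr_eq0; apply/eqP.
case: j h hs => [|j] h hs.
  rewrite [X in wedge _ X](_ : _ = fun r => 0 * al r); last first.
    by apply: functional_extensionality => r; rewrite h // mul0r.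
  by rewrite wedgeZ mul0r.
by apply: (IH j) => // r hr; apply: h; rewrite /= eqSS.
Qed.

Lemma tdeg_contr j n f al : tdeg j.+1 al -> tdeg j (contr n f al).
Proof.
by move=> h s hs; rewrite /contr big1 // => a _; rewrite h ?mulr0 //= eqSS.
Qed.

Lemma supp_wedge n g al : (forall a, (n <= a)%N -> g a = 0) ->
  supp n al -> supp n (wedge g al).
Proof.
move=> hg h s; elim: s al h => [|a s IH] al h //=.
rewrite negb_and -leqNgt => hs.
have [ha|ha] := leqP n a.
  rewrite hg // mul0r sub0r; apply/eqP; rewrite oppr_eq0; apply/eqP.
  rewrite [X in wedge _ X](_ : _ = fun r => 0 * al r); last first.
    by apply: functional_extensionality => r; rewrite h /= ?mul0r // ltnNge ha.
  by rewrite wedgeZ mul0r.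
move: hs; rewrite leqNgt ha /= => hs.
rewrite h // mulr0 sub0r IH ?oppr0 // => r hr.
by apply: h; rewrite /= negb_and hr orbT.
Qed.

Lemma supp_contr n n' f al : supp n al -> supp n (contr n' f al).
Proof.
move=> h s hs; rewrite /contr big1 // => a _.
by rewrite h ?mulr0 //= negb_and hs orbT.
Qed.

(* The vanishing at lists with a repeated entry needs 2 to be regular. *)
Lemma alt_uniq al : (forall x : P, x + x = 0 -> x = 0) -> alt al ->
  forall s, ~~ uniq s -> al s = 0.
Proof.
move=> two h s.
have adj s1 a s2 : al (s1 ++ a :: a :: s2) = 0.
  by apply: two; rewrite {1}h addNr.
have rep s1 a s2 s3 : al (s1 ++ a :: s2 ++ a :: s3) = 0.
  elim: s2 s1 => [|b s2 IH] s1 /=; first exact: adj.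
  by rewrite h -cat_rcons IH oppr0.
suff H s0 : ~~ uniq s -> al (s0 ++ s) = 0 by apply: (H [::]).
elim: s s0 => [|a s IH] s0 //=; rewrite negb_and negbK => /orP[/path.splitPr[s2 s3]|hs].
  exact: rep.
by rewrite -cat_rcons IH.
Qed.

End Tensors.

Section TensMap.
Variables (P Q : comNzRingType) (F : {additive P -> Q}).

Lemma wedge_map (g : nat -> P) (g' : nat -> Q) al :
  (forall a x, F (g a * x) = g' a * F x) ->
  forall s, F (wedge g al s) = wedge g' (F \o al) s.
Proof.
move=> h s; elim: s al => [|a s IH] al /=; first exact: raddf0.
by rewrite raddfB h /= IH.
Qed.

Lemma contr_map n (f : nat -> P) (f' : nat -> Q) al :
  (forall a x, F (f a * x) = f' a * F x) ->
  forall s, F (contr n f al s) = contr n f' (F \o al) s.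
Proof.
by move=> h s; rewrite /contr raddf_sum; apply: eq_bigr => a _; rewrite h.
Qed.

End TensMap.

(** * A Koszul complex built from Wronskians *)

Section NumberOperator.
Variables (P : idomainType) (m n : nat) (w sg : 'I_m -> nat -> P).
Variables (u ta : 'I_m -> P) (c : P).
Hypothesis c_neq0 : c != 0.
Hypothesis w_supp : forall b a, (n <= a)%N -> w b a = 0.
Hypothesis uw0 : forall a, \sum_b u b * w b a = 0.
Hypothesis sgw : forall b b', ip n (sg b') (w b) + ta b * u b' = c *+ (b == b').

(** The derivation of the exterior algebra extending v -> sum_b <sg_b, v> w_b. By [sgw] and [uw0]
    this map sends each w_b to c w_b, so it is c times a projection onto the span of the w_b. *)
Definition Npi (al : seq nat -> P) s := \sum_b wedge (w b) (contr n (sg b) al) s.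
Definition Nop x (al : seq nat -> P) s := Npi al s - x * al s.
Definition Nops xs al := foldr Nop al xs.

Lemma alt_sum (I : Type) (t : seq I) (F : I -> seq nat -> P) :
  (forall i, alt (F i)) -> alt (fun s => \sum_(i <- t) F i s).
Proof. by move=> h s1 a b s2; rewrite -sumrN; apply: eq_bigr => i _; apply: h. Qed.

Lemma alt_Npi al : alt al -> alt (Npi al).
Proof. by move=> h; apply: alt_sum => b; apply/alt_wedge/alt_contr. Qed.

Lemma alt_Nop x al : alt al -> alt (Nop x al).
Proof. by move=> h s1 a b s2; rewrite /Nop alt_Npi // h; ring. Qed.

Lemma supp_Nop x al : supp n al -> supp n (Nop x al).
Proof.
move=> h s hs; rewrite /Nop h // mulr0 subr0 /Npi big1 // => b _.
by apply: (supp_wedge (w_supp b)) hs; apply: supp_contr.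
Qed.

Lemma tdeg_Nop j x al : tdeg j al -> tdeg j (Nop x al).
Proof.
move=> h s hs; rewrite /Nop h // mulr0 subr0 /Npi big1 // => b _.
case: j h hs => [|j] h hs; last by apply: tdeg_wedge hs; apply: tdeg_contr.
rewrite [X in wedge _ X](_ : _ = fun s => 0 * al s) ?wedgeZ ?mul0r //.
apply: functional_extensionality => t.
by rewrite /contr big1 ?mul0r // => a _; rewrite h // mulr0.
Qed.

Lemma Nops_inv xs al j : alt al -> supp n al -> tdeg j al ->
  [/\ alt (Nops xs al), supp n (Nops xs al) & tdeg j (Nops xs al)].
Proof.
move=> h1 h2 h3; elim: xs => [|x xs [i1 i2 i3]] //=.
by split; [exact: alt_Nop | exact: supp_Nop | exact: tdeg_Nop].
Qed.

(** The transpose of the endomorphism that [Npi] extends. *)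
Definition pull (f : nat -> P) a := \sum_b ip n f (w b) * sg b a.

Lemma contr_Npi f al s : alt al ->
  contr n f (Npi al) s = contr n (pull f) al s + Npi (contr n f al) s.
Proof.
move=> h; rewrite /Npi.
rewrite (_ : (fun t => \sum_b wedge (w b) (contr n (sg b) al) t)
  = (fun t => \sum_b 1 * wedge (w b) (contr n (sg b) al) t)); last first.
  by apply: functional_extensionality => t; apply: eq_bigr => b _; rewrite mul1r.
rewrite contr_lin contr_linl -big_split; apply: eq_bigr => b _.
rewrite /= mul1r contr_wedge.
rewrite (_ : contr n f (contr n (sg b) al) = fun t => - contr n (sg b) (contr n f al) t).
  by rewrite wedgeN opprK.
by apply: functional_extensionality => t; apply: contrC.
Qed.

Lemma ip_pull f b : ip n (pull f) (w b) = c * ip n f (w b).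
Proof.
rewrite /ip /pull; under eq_bigr do rewrite mulr_suml.
rewrite exchange_big /=.
transitivity (\sum_b' ip n f (w b') * (c *+ (b == b') - ta b * u b')).
  apply: eq_bigr => b' _; rewrite -sgw addrK /ip [in RHS]mulr_sumr.
  by apply: eq_bigr => a _; ring.
rewrite (eq_bigr (fun b' => ip n f (w b') * (c *+ (b == b'))
  - ip n f (w b') * (ta b * u b'))); last by move=> b' _; ring.
rewrite big_split sumrN /= (bigD1 b) //= eqxx mulr1n big1 ?addr0; last first.
  by move=> b' hb; rewrite eq_sym (negbTE hb) mulr0n mulr0.
rewrite (_ : \sum_b' _ = 0) ?subr0; first by rewrite mulrC.
transitivity (ta b * \sum_(a < n) f a * \sum_b' u b' * w b' a).
  rewrite mulr_sumr; under eq_bigr do rewrite /ip mulr_suml.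
  rewrite exchange_big; apply: eq_bigr => a _.
  by rewrite !mulr_sumr; apply: eq_bigr => b' _; ring.
by rewrite big1 ?mulr0 // => a _; rewrite uw0 mulr0.
Qed.

Lemma pull_pull f a : pull (pull f) a = c * pull f a.
Proof.
by rewrite /pull mulr_sumr; apply: eq_bigr => b _; rewrite ip_pull mulrA.
Qed.

(** c f = cofac f + pull f splits a covector, up to c, into eigenvectors of [pull] for 0 and c.
    Contraction with the first commutes with [Npi]; contraction with the second shifts its
    eigenvalues by c. *)
Definition cofac f a := c * f a - pull f a.

Lemma pull_cofac f : pull (cofac f) = fun=> 0.
Proof.
apply: functional_extensionality => a.
transitivity (c * pull f a - pull (pull f) a); last by rewrite pull_pull subrr.
rewrite /pull mulr_sumr -sumrB; apply: eq_bigr => b _.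
rewrite mulrA -mulrBl; congr (_ * _); rewrite /ip mulr_sumr -sumrB.
by apply: eq_bigr => a' _; rewrite /cofac /pull; ring.
Qed.

Lemma contr0 (al : seq nat -> P) s : contr n (fun=> 0) al s = 0.
Proof. by rewrite /contr big1 // => a _; rewrite mul0r. Qed.

Lemma alt_Nops xs al : alt al -> alt (Nops xs al).
Proof. by move=> h; elim: xs => [|y ys i] //=; apply: alt_Nop. Qed.

Lemma contr_cofac_Nops f xs al : alt al ->
  contr n (cofac f) (Nops xs al) =1 Nops xs (contr n (cofac f) al).
Proof.
move=> h; elim: xs => [|x xs IH] s //=.
rewrite {1}/Nop (contrD _ _ (Npi _) (fun s => - (x * _))) contrN contrZ.
rewrite contr_Npi; last exact: alt_Nops.
rewrite pull_cofac contr0 add0r IH /Nop; congr (_ - _).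
by rewrite (functional_extensionality _ _ IH).
Qed.

Lemma contr_pull_Nops f xs al : alt al ->
  contr n (pull f) (Nops xs al)
  =1 Nops [seq x - c | x <- xs] (contr n (pull f) al).
Proof.
move=> h; elim: xs => [|x xs IH] s //=.
rewrite {1}/Nop (contrD _ _ (Npi _) (fun s => - (x * _))) contrN contrZ.
rewrite contr_Npi; last exact: alt_Nops.
rewrite (_ : pull (pull f) = fun a => c * pull f a); last first.
  by apply: functional_extensionality => a; exact: pull_pull.
rewrite contrZl IH /Nop (functional_extensionality _ _ IH).
by ring.
Qed.

Lemma Nop0 x : Nop x (fun=> 0) = fun=> 0.
Proof.
apply: functional_extensionality => s.
rewrite /Nop mulr0 subr0 /Npi big1 // => b _.
rewrite [X in wedge _ X](_ : _ = fun s => 0 * 0) ?wedgeZ ?mul0r //.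
by apply: functional_extensionality => t; rewrite /contr big1 ?mul0r // => a _; rewrite mulr0.
Qed.

Lemma Nops0 xs : Nops xs (fun=> 0) = fun=> 0.
Proof. by elim: xs => //= x xs ->; apply: Nop0. Qed.

Definition spectrum j := [seq c *+ l | l <- iota 0 j.+1].

Lemma spectrum_rcons j : spectrum j.+1 = rcons (spectrum j) (c *+ j.+1).
Proof. by rewrite /spectrum -addn1 iotaD map_cat -cats1 add0n. Qed.

Lemma spectrum_shift j : [seq x - c | x <- spectrum j.+1] = - c :: spectrum j.
Proof.
rewrite /spectrum /= ?mulr0n sub0r ?mulr1n subrr ?mulr0n; congr [:: _, _ & _].
rewrite -map_comp (iotaDl 2 0) (iotaDl 1 0) -!map_comp.
by apply: eq_map => l /=; rewrite !add1n !add2n !mulrS; ring.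
Qed.

(* On alternating tensors of degree j the projection-like operator Npi has
   the eigenvalues 0, c, ..., j c. *)
Lemma Nops_eq0 j al : alt al -> supp n al -> tdeg j al ->
  Nops (spectrum j) al = fun=> 0.
Proof.
elim: j al => [|j IH] al h1 h2 h3.
  apply: functional_extensionality => s.
  rewrite /= /Nop mulr0n mul0r subr0 /Npi big1 // => b _.
  rewrite [X in wedge _ X](_ : _ = fun s => 0 * 0) ?wedgeZ ?mul0r //.
  by apply: functional_extensionality => t; rewrite /contr big1 ?mul0r // => a _;
    rewrite h3 // mulr0.
set xs := spectrum j.+1.
(* A tensor of positive degree is zero if all its contractions are. For [cofac f] the factors 0, c,
   ..., j c already give 0 by induction; for [pull f] the shift turns the spectrum of degree j + 1
   into -c followed by the spectrum of degree j. *)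
have hf f s : contr n f (Nops xs al) s = 0.
  apply: (mulfI c_neq0); rewrite mulr0 -contrZl.
  transitivity (contr n (cofac f) (Nops xs al) s + contr n (pull f) (Nops xs al) s).
    by rewrite -contrDl; congr contr; apply: functional_extensionality => a; rewrite /cofac subrK.
  rewrite contr_cofac_Nops // contr_pull_Nops //.
  have -> : Nops xs (contr n (cofac f) al) s = 0.
    rewrite /xs spectrum_rcons /Nops foldr_rcons -/(Nops _ _).
    rewrite IH //.
    - by apply: alt_Nop; apply: alt_contr.
    - by apply: supp_Nop; apply: supp_contr.
    - by apply: tdeg_Nop; apply: tdeg_contr.
  rewrite add0r spectrum_shift (_ : Nops (- c :: spectrum j) _ = Nop (- c) (Nops (spectrum j) (contr n (pull f) al))) // IH ?Nop0 //.
  - by apply: alt_contr.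
  - by apply: supp_contr.
  - by apply: tdeg_contr.
have [_ k2 k3] := Nops_inv xs h1 h2 h3.
apply: functional_extensionality => -[|a s]; first by rewrite k3.
have [ha|ha] := ltnP a n; last by rewrite k2 //= ltnNge ha.
rewrite -(hf (fun a' => (a' == a)%:R) s) /contr (bigD1 (Ordinal ha)) //= eqxx mul1r.
rewrite big1 ?addr0 // => b; rewrite -val_eqE /= => /negbTE ->.
by rewrite mul0r.
Qed.

End NumberOperator.

(* In [k[x_0..x_(m-1), X_0..X_(m-1)]] the degree in the X_b alone; the [lshift]
   variables play the role of scalars. *)
Definition xdeg m (e : 'X_{1..m + m}) : nat := \sum_(b < m) e (rshift m b).
Fact xdeg0 m : @xdeg m 0%MM = 0%N.
Proof. by rewrite /xdeg big1 // => b _; rewrite mnm0E. Qed.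
Fact xdegD m : {morph @xdeg m : e e' / (e + e')%MM >-> (e + e')%N}.
Proof. by move=> e e'; rewrite /xdeg -big_split; apply: eq_bigr => b _; rewrite mnmDE. Qed.
HB.instance Definition _ m := isMeasure.Build (m + m) (@xdeg m) (@xdeg0 m) (@xdegD m).

Section XDegree.
Variables (k : fieldType) (m : nat).
Local Notation P := {mpoly k[m + m]}.
Implicit Types (p q : P) (b : 'I_m).

Definition dX b p : P := p^`M(rshift m b).
Definition xX b : P := 'X_(rshift m b).
Definition xc p := forall b, dX b p = 0.

Lemma euler d p : p \is d.-homog for (@xdeg m) -> \sum_b xX b * dX b p = p *+ d.
Proof.
move/dhomogP => h; rewrite {2}(mpolyE p) -sumrMnl /dX.
under eq_bigr => b _ do rewrite {1}(mpolyE p) raddf_sum mulr_sumr.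
rewrite exchange_big [LHS]big_seq [RHS]big_seq; apply: eq_bigr => e he.
rewrite -(h _ he) /xdeg /= -sumrMnr; apply: eq_bigr => b _.
rewrite mderivZ mderivX scalerA -scalerAr -mpolyXD mulrC.
case: (posnP (e (rshift m b))) => [->|he0]; first by rewrite mul0r scale0r mulr0n.
rewrite addmC submK ?lep1mP -?lt0n // -scalerA scaler_nat //.
Qed.

Lemma dX_homog d b p : p \is d.-homog for (@xdeg m) -> dX b p \is d.-1.-homog for (@xdeg m).
Proof.
move/dhomogP => h; apply/dhomogP => e; rewrite mcoeff_msupp mcoeff_mderiv => he.
have /h : (e + U_(rshift m b))%MM \in msupp p.
  by rewrite mcoeff_msupp; apply: contraNneq he => ->; rewrite mul0rn.
rewrite /= xdegD => <-; rewrite [xdeg U_(_)]/xdeg (bigD1 b) //= mnm1E eqxx.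
rewrite big1 => [|b' hb]; first by rewrite addn0 addn1.
by rewrite mnm1E (inj_eq (@rshift_inj _ _)) eq_sym (negbTE hb).
Qed.

Lemma xX_homog b : xX b \is 1.-homog for (@xdeg m).
Proof.
rewrite dhomogX; apply/eqP; rewrite /= /xdeg (bigD1 b) //= mnm1E eqxx.
rewrite big1 => [|b' hb]; first by rewrite addn0.
by rewrite mnm1E (inj_eq (@rshift_inj _ _)) eq_sym (negbTE hb).
Qed.

Lemma homog0_xc p : p \is 0.-homog for (@xdeg m) -> xc p.
Proof.
move/dhomogP => h b; apply/mpolyP => e; rewrite mcoeff_mderiv mcoeff0.
have [|/memN_msupp_eq0 ->] := boolP ((e + U_(rshift m b))%MM \in msupp p); last by rewrite mul0rn.
by move/h; rewrite /= xdegD {2}/xdeg (bigD1 b) //= mnm1E eqxx; lia.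
Qed.

Lemma dXM b p q : xc p -> dX b (p * q) = p * dX b q.
Proof. by move=> h; rewrite /dX mderivM -/(dX b p) h mul0r add0r. Qed.

Lemma dXXM b b' q : dX b (xX b' * q) = q *+ (b == b') + xX b' * dX b q.
Proof.
rewrite /dX /xX mderivM mderivX mnm1E (inj_eq (@rshift_inj _ _)) eq_sym.
case: eqP => [->|_]; last by rewrite scale0r mul0r.
rewrite scale1r (_ : (_ - _)%MM = 0%MM) ?mpolyX0 ?mul1r //.
by apply/mnmP => x; rewrite mnmBE subnn mnm0E.
Qed.

Lemma dXC b b' p : dX b (dX b' p) = dX b' (dX b p).
Proof. exact: mderiv_comm. Qed.

HB.instance Definition _ b := GRing.Additive.copy (dX b) (mderiv (R:=k) (rshift m b)).

End XDegree.

Section Complex.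
Variables (k : fieldType) (m n : nat).
Local Notation P := {mpoly k[m + m]}.
Hypothesis two : (2%:R : k) != 0.
Variables (w : 'I_m -> nat -> P) (u : 'I_m -> P).
Hypothesis w_xc : forall b a, xc (w b a).
Hypothesis u_xc : forall b, xc (u b).
Hypothesis uw0 : forall a, \sum_b u b * w b a = 0.
Implicit Types (al be : seq nat -> P) (z : bool -> seq nat -> P).

Definition U : P := \sum_b u b * xX k b.
Definition Wop al s := \sum_b wedge (w b) (fun r => dX b (al r)) s.
(* On pairs (phi, psi), indexed by [false] and [true], the differential is
   (phi, psi) |-> (W phi + U psi, - W psi). *)
Definition koszulD z (e : bool) s :=
  if e then - Wop (z true) s else Wop (z false) s + U * z true s.

Lemma two_reg (x : P) : x + x = 0 -> x = 0.
Proof.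
rewrite -mulr2n -mulr_natl => /eqP; rewrite mulf_eq0 => /orP[|/eqP //].
by rewrite -mpolyC_nat mpolyC_eq0 (negbTE two).
Qed.

Lemma dX_wedge b g al s : (forall a, xc (g a)) ->
  dX b (wedge g al s) = wedge g (fun r => dX b (al r)) s.
Proof.
move=> h; rewrite (@wedge_map P P (dX b) g g) // => a x.
exact: dXM.
Qed.

Lemma WopZ c al s : xc c -> Wop (fun r => c * al r) s = c * Wop al s.
Proof.
move=> h; rewrite /Wop mulr_sumr; apply: eq_bigr => b _; rewrite -wedgeZ.
by apply: wedge_eq => r; rewrite dXM.
Qed.

Lemma WopD al be s : Wop (fun r => al r + be r) s = Wop al s + Wop be s.
Proof.
rewrite /Wop -big_split; apply: eq_bigr => b _ /=; rewrite -wedgeD.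
by apply: wedge_eq => r; rewrite raddfD.
Qed.

Lemma WopN al s : Wop (fun r => - al r) s = - Wop al s.
Proof.
rewrite /Wop -sumrN; apply: eq_bigr => b _; rewrite -wedgeN.
by apply: wedge_eq => r; rewrite raddfN.
Qed.

Lemma WopB al be s : Wop (fun r => al r - be r) s = Wop al s - Wop be s.
Proof. by rewrite WopD WopN. Qed.

Lemma wedge_sum (I : Type) (t : seq I) g (F : I -> seq nat -> P) s :
  wedge g (fun s => \sum_(i <- t) F i s) s = \sum_(i <- t) wedge g (F i) s.
Proof.
have := @wedge_lin P I t g (fun=> 1) F s.
rewrite (_ : (fun _ => \sum_(i <- t) 1 * _) = fun s => \sum_(i <- t) F i s); last first.
  by apply: functional_extensionality => r; apply: eq_bigr => i _; rewrite mul1r.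
by move=> ->; apply: eq_bigr => i _; rewrite mul1r.
Qed.

(** Second derivatives are symmetric and wedges antisymmetric, so the double sum is its own
    opposite. *)
Lemma WopW al s : Wop (Wop al) s = 0.
Proof.
have E : Wop (Wop al) s = \sum_b \sum_b'
    wedge (w b) (wedge (w b') (fun r => dX b (dX b' (al r)))) s.
  apply: eq_bigr => b _; rewrite -wedge_sum; apply: wedge_eq => r.
  rewrite /Wop raddf_sum /=; apply: eq_bigr => b' _.
  by rewrite dX_wedge.
apply: two_reg; rewrite {1}E {1}exchange_big E -big_split big1 // => b _.
rewrite -big_split big1 // => b' _ /=.
rewrite wedgeC addrC; apply/eqP; rewrite subr_eq0; apply/eqP; apply: wedge_eq.
by apply: wedge_eq => r; rewrite dXC.
Qed.

(** The commutator of [Wop] with multiplication by U is the wedge with sum_b u_b w_b, which is 0. *)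
Lemma WopU al s : Wop (fun r => U * al r) s = U * Wop al s.
Proof.
rewrite /Wop mulr_sumr.
transitivity (\sum_b (u b * wedge (w b) al s + U * wedge (w b) (fun r => dX b (al r)) s)).
  apply: eq_bigr => b _; rewrite -!wedgeZ -wedgeD; apply: wedge_eq => r.
  rewrite /U mulr_suml raddf_sum /=.
  rewrite (eq_bigr (fun b' => (u b' * al r) *+ (b == b') + u b' * xX k b' * dX b (al r))); last first.
    by move=> b' _; rewrite -mulrA dXM // dXXM mulrDr mulrnAr mulrA.
  rewrite big_split -mulr_suml /=; congr (_ + _).
  rewrite (bigD1 b) //= eqxx mulr1n big1 ?addr0 // => b' hb.
  by rewrite eq_sym (negbTE hb) mulr0n.
rewrite big_split -[RHS]add0r; congr (_ + _).
rewrite -wedge_linl (_ : (fun a => _) = fun a => 0 * (fun=> 0) a); first by rewrite wedgeZl mul0r.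
by apply: functional_extensionality => a; rewrite uw0 mul0r.
Qed.

Lemma koszulDK z e s : koszulD (koszulD z) e s = 0.
Proof.
case: e => /=; first by rewrite WopN WopW !oppr0.
by rewrite WopD WopW add0r WopU mulrN subrr.
Qed.

Section Homotopy.
Variables (sg : 'I_m -> nat -> P) (ta : 'I_m -> P) (c : P).
Hypothesis c_xc : xc c.
Hypothesis sg_xc : forall b a, xc (sg b a).
Hypothesis ta_xc : forall b, xc (ta b).
Hypothesis sgw : forall b b', ip n (sg b') (w b) + ta b * u b' = c *+ (b == b').
Hypothesis tau : \sum_b ta b * u b = c.

Definition Sop al s := \sum_b xX k b * contr n (sg b) al s.
Definition Top al s := \sum_b ta b * dX b (al s).
Definition koszulS z (e : bool) s :=
  if e then Top (z false) s - Sop (z true) s else Sop (z false) s.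

Lemma dX_contr b f al s : (forall a, xc (f a)) ->
  dX b (contr n f al s) = contr n f (fun r => dX b (al r)) s.
Proof.
move=> h; rewrite (@contr_map P P (dX b) n f f) // => a x.
exact: dXM.
Qed.

(** [Wop] after [Sop] gives [Npi] plus terms with both a derivative and a contraction. These cancel
    against [Sop] after [Wop], and [sgw] turns what remains, together with the term U [Top], into c
    times the Euler operator. *)
Lemma WS al s d : \sum_b xX k b * dX b (al s) = al s *+ d ->
  Wop (Sop al) s + Sop (Wop al) s + U * Top al s
  = Npi n w sg al s + c * (al s *+ d).
Proof.
move=> hE.
have -> : Wop (Sop al) s = Npi n w sg al s
    + \sum_b \sum_b' xX k b' * wedge (w b) (contr n (sg b') (fun r => dX b (al r))) s.
  rewrite -big_split; apply: eq_bigr => b _ /=.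
  rewrite -wedge_lin -wedgeD; apply: wedge_eq => r.
  rewrite /Sop raddf_sum /=.
  under eq_bigr => b' _ do rewrite dXXM.
  rewrite big_split /=; congr (_ + _).
    rewrite (bigD1 b) //= eqxx mulr1n big1 ?addr0 // => b' hb.
    by rewrite eq_sym (negbTE hb) mulr0n.
  by apply: eq_bigr => b' _; rewrite dX_contr.
have -> : Sop (Wop al) s = \sum_b \sum_b' xX k b' * (ip n (sg b') (w b) * dX b (al s))
    - \sum_b \sum_b' xX k b' * wedge (w b) (contr n (sg b') (fun r => dX b (al r))) s.
  transitivity (\sum_b' \sum_b xX k b' * (ip n (sg b') (w b) * dX b (al s)
      - wedge (w b) (contr n (sg b') (fun r => dX b (al r))) s)).
    apply: eq_bigr => b' _; rewrite -mulr_sumr; congr (_ * _).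
    have := @contr_lin P n (sg b') _ (index_enum 'I_m) (fun=> 1)
      (fun b => wedge (w b) (fun r => dX b (al r))) s.
    rewrite (_ : (fun _ => \sum_(i <- _) 1 * _) = Wop al); last first.
      by apply: functional_extensionality => r; apply: eq_bigr => b _; rewrite mul1r.
    by move=> ->; apply: eq_bigr => b _; rewrite mul1r contr_wedge.
  rewrite exchange_big -sumrB; apply: eq_bigr => b _; rewrite -sumrB.
  by apply: eq_bigr => b' _; rewrite mulrBr.
have -> : U * Top al s = \sum_b \sum_b' xX k b' * (ta b * u b' * dX b (al s)).
  rewrite /U /Top mulr_sumr; apply: eq_bigr => b _; rewrite mulr_suml.
  by apply: eq_bigr => b' _; ring.
have ar (a1 a2 a3 a4 : P) : a1 + a2 + (a3 - a2) + a4 = a1 + (a3 + a4) by ring.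
rewrite ar.
rewrite -hE mulr_sumr -big_split; congr (_ + _); apply: eq_bigr => b _ /=.
rewrite -big_split /= (bigD1 b) //= big1 ?addr0 => [|b' hb].
  by rewrite -mulrDr -mulrDl sgw eqxx mulr1n; ring.
by rewrite -mulrDr -mulrDl sgw eq_sym (negbTE hb) mulr0n mul0r mulr0.
Qed.

Lemma SopU al s : Sop (fun r => U * al r) s = U * Sop al s.
Proof. by rewrite /Sop mulr_sumr; apply: eq_bigr => b _; rewrite contrZ; ring. Qed.

Lemma TopU al s : Top (fun r => U * al r) s = c * al s + U * Top al s.
Proof.
rewrite /Top -tau mulr_suml mulr_sumr -big_split; apply: eq_bigr => b _ /=.
have -> : dX b (U * al s) = u b * al s + U * dX b (al s).
  rewrite {1}/U mulr_suml raddf_sum /=.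
  rewrite (eq_bigr (fun b' => (u b' * al s) *+ (b == b') + u b' * xX k b' * dX b (al s))); last first.
    by move=> b' _; rewrite -mulrA dXM // dXXM mulrDr mulrnAr mulrA.
  rewrite big_split -mulr_suml /=; congr (_ + _).
  rewrite (bigD1 b) //= eqxx mulr1n big1 ?addr0 // => b' hb.
  by rewrite eq_sym (negbTE hb) mulr0n.
ring.
Qed.

Lemma TopW al s : Top (Wop al) s = Wop (Top al) s.
Proof.
rewrite /Top /Wop.
transitivity (\sum_b \sum_b' ta b * wedge (w b') (fun r => dX b (dX b' (al r))) s).
  apply: eq_bigr => b _; rewrite raddf_sum /= mulr_sumr; apply: eq_bigr => b' _.
  by rewrite dX_wedge.
rewrite exchange_big; apply: eq_bigr => b' _ /=.
rewrite -wedge_lin; apply: wedge_eq => r; rewrite raddf_sum /=.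
by apply: eq_bigr => b _; rewrite dXM // dXC.
Qed.

Lemma TopD al be s : Top (fun r => al r + be r) s = Top al s + Top be s.
Proof. by rewrite /Top -big_split; apply: eq_bigr => b _; rewrite raddfD mulrDr. Qed.

Lemma SopN al s : Sop (fun r => - al r) s = - Sop al s.
Proof. by rewrite /Sop -sumrN; apply: eq_bigr => b _; rewrite contrN mulrN. Qed.

Lemma SopD al be s : Sop (fun r => al r + be r) s = Sop al s + Sop be s.
Proof. by rewrite /Sop -big_split; apply: eq_bigr => b _; rewrite contrD mulrDr. Qed.

(** For [e = true] the X-degree is i - 2 while the coefficient is i - 1: the additional c comes from
    [tau] through [TopU]. At i = 1 the subtraction i - 2 is truncated, which is why [z true] has to
    vanish there. *)
Lemma koszulS_homotopy i z e s : (0 < i)%N ->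
  (forall e s, z e s \is (i - 2 * e)%N.-homog for (@xdeg m)) ->
  ((i < 2)%N -> z true = fun=> 0) ->
  koszulD (koszulS z) e s + koszulS (koszulD z) e s = Npi n w sg (z e) s + c * (z e s *+ (i - e)).
Proof.
move=> i0 hz hz1.
have hWS e' : Wop (Sop (z e')) s + Sop (Wop (z e')) s + U * Top (z e') s
  = Npi n w sg (z e') s + c * (z e' s *+ (i - 2 * e')) by apply/WS/euler/hz.
case: e => /=; last first.
  have := hWS false; rewrite muln0 subn0 => <-.
  rewrite SopD SopU; ring.
have := hWS true; rewrite muln1 WopB -TopW => h.
rewrite TopD TopU (SopN (Wop _)).
have -> : c * (z true s *+ (i - 1)) = c * (z true s *+ (i - 2)) + c * z true s.
  have [i2|i2] := ltnP i 2; first by rewrite hz1 // !mul0rn mulr0 addr0.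
  by rewrite (_ : i - 1 = (i - 2).+1)%N ?mulrSr ?mulrDr //; lia.
by rewrite [RHS]addrA -h; ring.
Qed.

End Homotopy.
End Complex.

(** * Monomial ideals and exactness modulo powers of the variables *)

Section Quotient.
Variables (k : fieldType) (n : nat).
Implicit Types (p q : {mpoly k[n]}) (x : 'I_n) (e t : nat).

Definition shiftm x e (mm : 'X_{1..n}) : 'X_{1..n} := [multinom (mm y + e * (x == y))%N | y < n].

Lemma mcoeff_varM x e p mm : ('X_x ^+ e * p)@_(shiftm x e mm) = p@_mm.
Proof.
elim: e mm => [|e IH] mm.
  rewrite expr0 mul1r; congr (_@__); apply/mnmP => y; rewrite mnmE; lia.
rewrite exprS -mulrA mulrC -[RHS]IH.
rewrite (_ : shiftm x e.+1 mm = (U_(x) + shiftm x e mm)%MM); last first.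
  by apply/mnmP => y; rewrite mnmDE !mnmE; case: eqP => _ /=; lia.
by rewrite mcoeffMX.
Qed.

Lemma mcoeff_varM0 x e p (mm : 'X_{1..n}) : (mm x < e)%N -> ('X_x ^+ e * p)@_mm = 0.
Proof.
move=> h; rewrite mcoeffM big1 // => -[m1 m2] /= /eqP e1.
rewrite mpolyXn mcoeffX; case: eqP => [e2|]; last by rewrite mul0r.
have := congr1 (fun f : 'X_{1..n} => f x) e1.
by rewrite mnmDE -e2 mulmnE mnm1E eqxx; lia.
Qed.

Definition quov x e p : {mpoly k[n]} :=
  \sum_(mm <- msupp p | (e <= mm x)%N)
     p@_mm *: 'X_[[multinom (mm y - e * (x == y))%N | y < n]].

Lemma mcoeff_quov x e p (mm : 'X_{1..n}) : (quov x e p)@_mm = p@_(shiftm x e mm).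
Proof.
rewrite /quov raddf_sum /=.
under eq_bigr => m' _ do rewrite mcoeffZ mcoeffX.
have key (m' : 'X_{1..n}) : (e <= m' x)%N ->
    ([multinom (m' y - e * (x == y))%N | y < n] == mm) = (m' == shiftm x e mm).
  move=> h; apply/eqP/eqP => [<-|->]; apply/mnmP => y; rewrite !mnmE;
    by case: eqP => [<-|_] /=; lia.
have [hin|hin] := boolP (shiftm x e mm \in msupp p).
  rewrite big_mkcond (bigD1_seq _ hin) ?msupp_uniq //=.
  have -> : (e <= shiftm x e mm x)%N by rewrite mnmE eqxx; lia.
  rewrite key ?eqxx ?mulr1; last by rewrite mnmE eqxx; lia.
  rewrite big1 ?addr0 // => m' h2; case: ifP => // h1; rewrite key // (negbTE h2).
  by rewrite mulr0.
rewrite memN_msupp_eq0 // big1_seq // => m' /andP[h1 h2]; rewrite key //.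
by case: eqP => [e1|]; rewrite ?mulr0 //; rewrite -e1 h2 in hin.
Qed.

End Quotient.

Section Ideal.
Variables (k : fieldType) (m : nat) (e : nat -> nat).
Local Notation P := {mpoly k[m + m]}.
Implicit Types (p q : P) (t : nat).

(* The ideal generated by [x_j ^ (e j)], [j < t], monomial by monomial. *)
Definition inJ t p := forall mm : 'X_{1..m + m},
  (forall j : 'I_m, (j < t)%N -> (mm (lshift m j) < e j)%N) -> p@_mm = 0.

Lemma inJ0 t : inJ t 0.
Proof. by move=> mm _; rewrite mcoeff0. Qed.

Lemma inJD t p q : inJ t p -> inJ t q -> inJ t (p + q).
Proof. by move=> hp hq mm h; rewrite mcoeffD hp // hq // addr0. Qed.

Lemma inJN t p : inJ t p -> inJ t (- p).
Proof. by move=> hp mm h; rewrite mcoeffN hp // oppr0. Qed.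

Lemma inJB t p q : inJ t p -> inJ t q -> inJ t (p - q).
Proof. by move=> hp hq; apply: inJD hp _; apply: inJN. Qed.

Lemma inJM t p q : inJ t q -> inJ t (p * q).
Proof.
move=> hq mm h; rewrite mcoeffM big1 // => -[m1 m2] /= /eqP e1.
rewrite hq ?mulr0 // => j hj; have := h j hj.
by rewrite (congr1 (fun f : 'X_{1..m + m} => f (lshift m j)) e1) mnmDE; lia.
Qed.

Lemma inJ_sum t (I : Type) (s : seq I) (F : I -> P) :
  (forall i, inJ t (F i)) -> inJ t (\sum_(i <- s) F i).
Proof. by move=> h; elim/big_ind: _ => //; [exact: inJ0 | exact: inJD]. Qed.

Lemma inJ_dX t b p : inJ t p -> inJ t (dX b p).
Proof.
move=> hp mm h; rewrite mcoeff_mderiv hp ?mul0rn // => j hj.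
rewrite mnmDE mnm1E eq_sym eq_lrshift addn0; exact: h.
Qed.

Lemma inJ_var (j : 'I_m) t p : (j < t)%N -> inJ t ('X_(lshift m j) ^+ e j * p).
Proof. by move=> h mm hm; apply: mcoeff_varM0; apply: hm. Qed.

Lemma inJS t p : inJ t p -> inJ t.+1 p.
Proof. by move=> h mm hm; apply: h => j hj; apply: hm; lia. Qed.

(** Membership in [inJ j] puts no condition on the exponent of x_j, and multiplication by a power of
    x_j only shifts that exponent. *)
Lemma inJ_cancel (j : 'I_m) d p : inJ j ('X_(lshift m j) ^+ d * p) -> inJ j p.
Proof.
move=> h mm hm; rewrite -(mcoeff_varM (lshift m j) d) h // => j' hj'.
rewrite mnmE (inj_eq (@lshift_inj _ _)) -val_eqE /=.
have -> : (j == j' :> nat) = false by lia.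
by rewrite muln0 addn0; apply: hm.
Qed.

Lemma inJ_quo (j : 'I_m) p : inJ j.+1 p ->
  inJ j (p - 'X_(lshift m j) ^+ e j * quov (lshift m j) (e j) p).
Proof.
move=> h mm hm; rewrite mcoeffB.
have [l|l] := ltnP (mm (lshift m j)) (e j).
  rewrite mcoeff_varM0 // h ?subr0 // => j' hj'.
  have : (j' < j)%N \/ (j' = j :> nat) by lia.
  by case=> [/hm | /val_inj ->].
pose mm' : 'X_{1..m + m} := [multinom (mm y - e j * (lshift m j == y))%N | y < m + m].
have -> : mm = shiftm (lshift m j) (e j) mm'.
  apply/mnmP => y; rewrite !mnmE; case: eqP => [<-|_] /=; lia.
by rewrite mcoeff_varM mcoeff_quov subrr.
Qed.

Lemma inJ_wedge t g (al : seq nat -> P) s : (forall r, inJ t (al r)) -> inJ t (wedge g al s).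
Proof.
move=> h; elim: s al h => [|a s IH] al h /=; first exact: inJ0.
by apply: inJB; [apply/inJM/h | apply: IH].
Qed.

Lemma inJ_contr t n f (al : seq nat -> P) s : (forall r, inJ t (al r)) -> inJ t (contr n f al s).
Proof. by move=> h; apply: inJ_sum => a; apply/inJM/h. Qed.

End Ideal.

Local Notation xh d := (d.-homog for (@xdeg _)).

Section Class.
Variables (k : fieldType) (m n r : nat).
Local Notation P := {mpoly k[m + m]}.
Variables (w : 'I_m -> nat -> P) (u : 'I_m -> P).
Hypothesis w0 : forall b a, w b a \is xh 0%N.
Hypothesis u0 : forall b, u b \is xh 0%N.
Hypothesis w_supp : forall b a, (n <= a)%N -> w b a = 0.

Implicit Types (al : seq nat -> P) (z : bool -> seq nat -> P).

(** Degree i of the complex: [z false] lies in Sym^i (x) wedge^(r - i) and [z true] in Sym^(i - 2)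
    (x) wedge^(r + 1 - i). The last clause corrects the truncated i - 2. *)
Definition graded_pair i z := [/\ forall e, alt (z e), forall e, supp n (z e),
  forall (e : bool) s, (size s + i != r + e)%N -> z e s = 0,
  forall (e : bool) s, z e s \is xh (i - 2 * e)%N
  & (i < 2)%N -> forall s, z true s = 0].

Lemma homogM0 d (p q : P) : p \is xh 0%N -> q \is xh d -> p * q \is xh d.
Proof. by move=> hp hq; have := dhomogM hp hq; rewrite add0n. Qed.

Lemma C_homog (c : k) : (c%:MP : P) \is xh 0%N.
Proof.
apply/dhomogP => mm; rewrite mcoeff_msupp mcoeffC.
by have [->|_] := eqVneq mm 0%MM; rewrite /= ?xdeg0 ?mulr0 ?eqxx.
Qed.

Lemma wedge_homog d g al s : (forall a, g a \is xh 0%N) ->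
  (forall s, al s \is xh d) -> wedge g al s \is xh d.
Proof.
move=> hg; elim: s al => [|a s IH] al h /=; first exact: rpred0.
by apply: rpredB; [apply: homogM0 | apply: IH].
Qed.

Lemma contr_homog d f al s : (forall a, f a \is xh 0%N) ->
  (forall s, al s \is xh d) -> contr n f al s \is xh d.
Proof. by move=> hf h; apply: rpred_sum => a _; apply: homogM0. Qed.

Lemma ClsD i z z' : graded_pair i z -> graded_pair i z' -> graded_pair i (fun e s => z e s + z' e s).
Proof.
move=> [a1 a2 a3 a4 a5] [b1 b2 b3 b4 b5]; split.
- by move=> e s1 a b s2; rewrite a1 b1 opprD.
- by move=> e s hs; rewrite a2 // b2 // addr0.
- by move=> e s hs; rewrite a3 // b3 // addr0.
- by move=> e s; apply: rpredD.
- by move=> h s; rewrite a5 // b5 // addr0.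
Qed.

Lemma ClsZ i c z : c \is xh 0%N -> graded_pair i z -> graded_pair i (fun e s => c * z e s).
Proof.
move=> hc [a1 a2 a3 a4 a5]; split.
- by move=> e s1 a b s2; rewrite a1 mulrN.
- by move=> e s hs; rewrite a2 // mulr0.
- by move=> e s hs; rewrite a3 // mulr0.
- by move=> e s; apply: homogM0.
- by move=> h s; rewrite a5 // mulr0.
Qed.

Lemma ClsN i z : graded_pair i z -> graded_pair i (fun e s => - z e s).
Proof.
move=> [a1 a2 a3 a4 a5]; split.
- by move=> e s1 a b s2; rewrite a1.
- by move=> e s hs; rewrite a2 // oppr0.
- by move=> e s hs; rewrite a3 // oppr0.
- by move=> e s; rewrite rpredN.
- by move=> h s; rewrite a5 // oppr0.
Qed.

Lemma Cls_quo i x d z : (forall (b : 'I_m), x != rshift m b) ->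
  graded_pair i z -> graded_pair i (fun e s => quov x d (z e s)).
Proof.
have q0 : quov x d (0 : P) = 0 by apply/mpolyP => mm; rewrite mcoeff_quov !mcoeff0.
move=> hx [a1 a2 a3 a4 a5]; split.
- by move=> e s1 a b s2; rewrite a1; apply/mpolyP => mm;
    rewrite mcoeffN !mcoeff_quov mcoeffN.
- by move=> e s hs; rewrite a2.
- by move=> e s hs; rewrite a3.
- move=> e s; apply/dhomogP => mm; rewrite mcoeff_msupp mcoeff_quov -mcoeff_msupp.
  have /dhomogP h := a4 e s; move/h => <-; apply: eq_bigr => b _.
  by rewrite mnmE (negbTE (hx b)) muln0 addn0.
- by move=> h s; rewrite a5.
Qed.

Lemma dX_supp b al : supp n al -> supp n (fun s => dX b (al s)).
Proof. by move=> h s hs; rewrite h // raddf0. Qed.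

Lemma alt_dX b al : alt al -> alt (fun s => dX b (al s)).
Proof. by move=> h s1 x y s2; rewrite h raddfN. Qed.

Lemma supp_sum (I : Type) (t : seq I) (F : I -> seq nat -> P) :
  (forall i, supp n (F i)) -> supp n (fun s => \sum_(i <- t) F i s).
Proof. by move=> h s hs; rewrite big1 // => i _; apply: h. Qed.

Lemma Wop_tdeg al j s : (forall s, size s != j -> al s = 0) ->
  size s != j.+1 -> Wop w al s = 0.
Proof.
move=> h hs; rewrite /Wop big1 // => b _.
by apply: (@tdeg_wedge _ j) hs => r' hr; rewrite h // raddf0.
Qed.

Lemma wedge_nil0 (g : nat -> P) s : wedge g (fun=> 0) s = 0.
Proof.
by elim: s => [|a s IH] //=; rewrite IH mulr0 subrr.
Qed.

Lemma Wop0 al s : (forall s, al s = 0) -> Wop w al s = 0.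
Proof.
move=> h; rewrite /Wop big1 // => b _.
rewrite [X in wedge _ X](_ : _ = fun=> 0) ?wedge_nil0 //.
by apply: functional_extensionality => t; rewrite h raddf0.
Qed.

Lemma alt_Wop al : alt al -> alt (Wop w al).
Proof. by move=> h; apply: alt_sum => b; apply/alt_wedge/alt_dX. Qed.

Lemma supp_Wop al : supp n al -> supp n (Wop w al).
Proof. by move=> h; apply: supp_sum => b; apply: supp_wedge; [exact: w_supp | apply: dX_supp]. Qed.

Lemma Wop_homog d al s : (forall s, al s \is xh d) -> Wop w al s \is xh d.-1.
Proof.
move=> h; apply: rpred_sum => b _; apply: wedge_homog => // s'.
exact: dX_homog.
Qed.

Lemma U_homog : U u \is xh 1%N.
Proof. by apply: rpred_sum => b _; apply: homogM0 => //; apply: xX_homog. Qed.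

Lemma Cls_D i z : (0 < i)%N -> graded_pair i.+1 z -> graded_pair i (koszulD w u z).
Proof.
move=> i0 [a1 a2 a3 a4 a5]; split.
- case=> /=.
    by move=> s1 a b s2; rewrite /koszulD (alt_Wop (a1 true)).
  by move=> s1 a b s2; rewrite /koszulD (alt_Wop (a1 false)) (a1 true) mulrN opprD.
- case=> s hs /=; rewrite (supp_Wop (a2 _)) ?oppr0 // (a2 true) // mulr0 addr0 //.
- case=> s hs /=.
    have [ir|ir] := leqP i r.
      rewrite (@Wop_tdeg _ (r - i)%N) ?oppr0 //; last by apply: contraNneq hs; lia.
      by move=> s' hs'; apply: a3; apply: contraNneq hs' => /=; lia.
    by rewrite Wop0 ?oppr0 // => s'; apply: a3 => /=; apply/eqP; move: hs => /=; lia.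
  rewrite (a3 true) ?mulr0 ?addr0 //; last by move: hs => /=; lia.
  have [ir|ir] := ltnP i r.
    rewrite (@Wop_tdeg _ (r - i.+1)%N) //; last by apply: contraNneq hs => /=; lia.
    by move=> s' hs'; apply: a3; apply: contraNneq hs' => /=; lia.
  by rewrite Wop0 // => s'; apply: a3 => /=; apply/eqP; lia.
- case=> s /=.
    rewrite rpredN; have := @Wop_homog _ (z true) s (a4 true).
    by rewrite (_ : (i.+1 - 2 * true).-1 = i - 2 * true)%N //=; lia.
  apply: rpredD; first by have := @Wop_homog _ (z false) s (a4 false); rewrite /= !muln0 !subn0.
  have [i1|i1] := ltnP i.+1 2; first by lia.
  have := dhomogM U_homog (a4 true s).
  by rewrite (_ : 1 + (i.+1 - 2 * true) = i - 2 * false)%N //=; lia.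
- move=> i2 s /=; have e1 : i = 1%N by lia.
  rewrite /Wop big1 ?oppr0 // => b _.
  rewrite [X in wedge _ X](_ : _ = fun=> 0) ?wedge_nil0 //.
  apply: functional_extensionality => t.
  by apply: homog0_xc; have := a4 true t; rewrite e1.
Qed.

Lemma inJ_D e t z : (forall e' s, inJ e t (z e' s)) ->
  forall (e' : bool) s, inJ e t (koszulD w u z e' s).
Proof.
move=> h e' s.
have hW al : (forall s, inJ e t (al s)) -> inJ e t (Wop w al s).
  by move=> hal; apply: inJ_sum => b; apply: inJ_wedge => s'; apply: inJ_dX.
move: h.
by move=> h; case: e' => /=; [apply/inJN/hW | apply: inJD; [apply: hW | apply: inJM]].
Qed.


Lemma koszulDZ c z e s : c \is xh 0%N ->
  koszulD w u (fun e s => c * z e s) e s = c * koszulD w u z e s.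
Proof.
move=> /homog0_xc hc; case: e => /=; first by rewrite (WopZ w) // mulrN.
by rewrite (WopZ w) // mulrDr mulrCA.
Qed.

Lemma koszulDD z z' e s :
  koszulD w u (fun e s => z e s + z' e s) e s = koszulD w u z e s + koszulD w u z' e s.
Proof. by case: e => /=; rewrite WopD; ring. Qed.

Lemma koszulDN z e s : koszulD w u (fun e s => - z e s) e s = - koszulD w u z e s.
Proof. by case: e => /=; rewrite WopN; ring. Qed.

Section Step.
Variables (sg : 'I_m -> nat -> P) (ta : 'I_m -> P) (c : P).
Hypothesis two : (2%:R : k) != 0.
Hypothesis uw0 : forall a, \sum_b u b * w b a = 0.
Hypothesis c0 : c \is xh 0%N.
Hypothesis c_neq0 : c != 0.
Hypothesis sg0 : forall b a, sg b a \is xh 0%N.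
Hypothesis ta0 : forall b, ta b \is xh 0%N.
Hypothesis sgw : forall b b', ip n (sg b') (w b) + ta b * u b' = c *+ (b == b').
Hypothesis tau : \sum_b ta b * u b = c.

Local Notation S := (koszulS n sg ta).
Local Notation D := (koszulD w u).

Lemma Cls_S i z : (0 < i)%N -> graded_pair i z -> graded_pair i.+1 (S z).
Proof.
move=> i0 [a1 a2 a3 a4 a5].
have altS al : alt al -> alt (Sop n sg al).
  move=> h s1 a b s2; rewrite -sumrN; apply: eq_bigr => x _.
  by rewrite (alt_contr n (sg x) h) mulrN.
have suppS al : supp n al -> supp n (Sop n sg al).
  move=> h s hs; rewrite /Sop big1 // => b _.
  by rewrite (@supp_contr P n n (sg b) al h s hs) mulr0.
have altT al : alt al -> alt (Top ta al).
  move=> h s1 a b s2; rewrite -sumrN; apply: eq_bigr => x _.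
  by rewrite (alt_dX x h) mulrN.
have S0 al s : (forall a, al (a :: s) = 0) -> Sop n sg al s = 0.
  by move=> h; rewrite /Sop big1 // => b _; rewrite /contr big1 ?mulr0 // => a _; rewrite h mulr0.
have T0 al s : al s = 0 -> Top ta al s = 0.
  by move=> h; rewrite /Top big1 // => b _; rewrite h raddf0 mulr0.
have hS d al s : (forall s, al s \is xh d) -> Sop n sg al s \is xh d.+1.
  move=> h; apply: rpred_sum => b _; rewrite -add1n; apply: dhomogM; first exact: xX_homog.
  exact: contr_homog.
have hT d al s : (forall s, al s \is xh d) -> Top ta al s \is xh d.-1.
  by move=> h; apply: rpred_sum => b _; apply: homogM0 => //; apply: dX_homog.
split.
- case=> s1 a b s2; rewrite /koszulS; last exact: altS.
  by rewrite (altT _ (a1 false)) (altS _ (a1 true)) opprB opprK addrC.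
- case=> s hs; rewrite /koszulS; last exact: (suppS _ (a2 false)).
  by rewrite (suppS _ (a2 true)) // T0 ?subr0 // (a2 false).
- case=> s hs; rewrite /koszulS; last first.
    by apply: S0 => a; apply: a3 => /=; move: hs; rewrite /=; lia.
  rewrite T0 ?S0 ?subr0 //.
    by move=> a; apply: a3 => /=; move: hs; rewrite /=; lia.
  by apply: a3 => /=; move: hs; rewrite /=; lia.
- case=> s; rewrite /koszulS; last first.
    by have := hS _ _ s (a4 false); rewrite /= !muln0 !subn0.
  apply: rpredB.
    by have := hT _ _ s (a4 false); rewrite (_ : (i - 2 * false).-1 = i.+1 - 2 * true)%N //=; lia.
  have [i2|i2] := ltnP i 2; first by rewrite S0 ?rpred0 // => a; apply: a5.
  by have := hS _ _ s (a4 true); rewrite (_ : (i - 2 * true).+1 = i.+1 - 2 * true)%N //=; lia.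
- by lia.
Qed.

(** D S + S D - x on graded pairs by [ThE], written through [Npi] so that products of these
    operators are products of [Nop]. *)
Definition Th i x z (e : bool) s :=
  Npi n w sg (z e) s + c * (z e s *+ (i - e)) - x * z e s.
Definition Ths i xs z := foldr (Th i) z xs.

Lemma Ths_Nops i xs z e : Ths i xs z e = Nops n w sg [seq x - c *+ (i - e) | x <- xs] (z e).
Proof.
elim: xs => //= x xs IH; rewrite /Th IH.
by apply: functional_extensionality => s; rewrite /Nop mulrnAr mulrBl mulrnAl opprB addrA addrAC.
Qed.

Lemma Cls_Th i x z : x \is xh 0%N -> graded_pair i z -> graded_pair i (Th i x z).
Proof.
move=> hx hz; have [a1 a2 a3 a4 a5] := hz.
have E e s : Th i x z e s = Nop n w sg (x - c *+ (i - e)) (z e) s.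
  by rewrite /Th /Nop mulrnAr mulrBl mulrnAl opprB addrA addrAC.
have N0 al s : (forall s, al s = 0) -> Nop n w sg x al s = 0.
  move=> h; rewrite /Nop h mulr0 subr0 /Npi big1 // => b _.
  rewrite [X in wedge _ X](_ : _ = fun=> 0) ?wedge_nil0 //.
  by apply: functional_extensionality => t; rewrite /contr big1 // => a _; rewrite h mulr0.
split.
- by move=> e s1 a b s2; rewrite !E; apply: alt_Nop.
- by move=> e s hs; rewrite E; apply: supp_Nop hs.
- move=> e s hs; rewrite E; have [l|l] := leqP i (r + e).
    apply: (@tdeg_Nop _ _ _ _ _ (r + e - i)%N).
      by move=> s' hs'; apply: a3; move: hs'; lia.
    by move: hs; lia.
  have hz0 s' : z e s' = 0 by apply: a3; lia.
  rewrite /Nop hz0 mulr0 subr0 /Npi big1 // => b _.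
  rewrite [X in wedge _ X](_ : _ = fun=> 0) ?wedge_nil0 //.
  by apply: functional_extensionality => t; rewrite /contr big1 // => a _; rewrite hz0 mulr0.
- move=> e s; rewrite /Th; apply: rpredB; last exact: homogM0.
  apply: rpredD; last by apply: homogM0 => //; apply: rpredMn.
  by apply: rpred_sum => b _; apply: wedge_homog => // s'; apply: contr_homog.
- move=> i2 s; have hz0 s' : z true s' = 0 by apply: a5.
  rewrite E /Nop hz0 mulr0 subr0 /Npi big1 // => b _.
  rewrite [X in wedge _ X](_ : _ = fun=> 0) ?wedge_nil0 //.
  by apply: functional_extensionality => t; rewrite /contr big1 // => a _; rewrite hz0 mulr0.
Qed.

Lemma inJ_S e t z : (forall e' s, inJ e t (z e' s)) -> forall (e' : bool) s, inJ e t (S z e' s).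
Proof.
move=> h e' s.
have hS (e1 : bool) s1 : inJ e t (Sop n sg (z e1) s1).
  by apply: inJ_sum => b; apply/inJM/inJ_contr.
have hT (e1 : bool) s1 : inJ e t (Top ta (z e1) s1).
  by apply: inJ_sum => b; apply/inJM/inJ_dX.
by case: e' => /=; [apply: inJB | apply: hS].
Qed.

Lemma ThE i x z e s : (0 < i)%N -> graded_pair i z ->
  Th i x z e s = D (S z) e s + S (D z) e s - x * z e s.
Proof.
move=> i0 [a1 a2 a3 a4 a5]; rewrite /Th.
rewrite (@koszulS_homotopy k m n two w u _ _ sg ta c _ _ sgw tau i z e s) //.
- by move=> b a; apply: homog0_xc.
- by move=> b; apply: homog0_xc.
- by move=> b a; apply: homog0_xc.
- by move=> b; apply: homog0_xc.
- by move=> h; apply: functional_extensionality => s'; apply: a5.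
Qed.

Lemma cn0 l : c *+ l \is xh 0%N.
Proof. exact: rpredMn. Qed.

Lemma inJ_DTh e t i x z : (0 < i)%N -> graded_pair i z -> x \is xh 0%N ->
  (forall e' s, inJ e t (D z e' s)) ->
  forall (e' : bool) s, inJ e t (D (Th i x z) e' s).
Proof.
move=> i0 hz hx h e' s.
rewrite (_ : Th i x z = fun e s => (D (S z) e s + S (D z) e s) + (- x) * z e s); last first.
  apply: functional_extensionality => e1; apply: functional_extensionality => s1.
  by rewrite ThE // mulNr.
rewrite koszulDD koszulDD koszulDZ ?rpredN // koszulDK //; last 2 first.
- by move=> b a; apply: homog0_xc.
- by move=> b; apply: homog0_xc.
rewrite add0r; apply: inJD; last exact: inJM.
by apply: inJ_D; apply: inJ_S.
Qed.

(* With xs a list of multiples of c, the homotopy gives c^|xs| z as a boundary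
   modulo J up to the product of the operators koszulS_homotopy - x. *)
Lemma homotopy_iter e t i ls z : (0 < i)%N -> graded_pair i z ->
  (forall e' s, inJ e t (D z e' s)) ->
  all (fun l => (l%:R : k) != 0) ls ->
  exists2 z', graded_pair i.+1 z' & exists a : k, forall e' s, inJ e t
    (c ^+ size ls * z e' s - D z' e' s - a%:MP * Ths i [seq c *+ l | l <- ls] z e' s).
Proof.
move=> i0 hz hD; elim: ls => [|l ls IH] /=.
  move=> _; exists (fun _ _ => 0).
    split=> //.
    - by move=> e' s1 a b s2; rewrite oppr0.
    - by move=> e' s; rewrite rpred0.
  exists 1 => e' s; rewrite /= expr0 mul1r.
  have -> : D (fun _ _ => 0) e' s = 0.
    by case: e' => /=; rewrite ?mulr0 ?addr0 Wop0 ?oppr0.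
  by rewrite subr0 subrr; apply: inJ0.
case/andP => l0 /IH {IH} [z' hz' [a ha]].
set z0 := Ths i _ z in ha *.
have hz0 : graded_pair i z0 /\ forall e' s, inJ e t (D z0 e' s).
  rewrite /z0; elim: (ls) => [|l' ls' [I1 I2]] //=; split.
    by apply: Cls_Th => //; apply: cn0.
  by apply: inJ_DTh => //; apply: cn0.
case: hz0 => h0 hD0.
(* By [ThE], c l z0 = D (S z0) - Th z0 modulo J, because S (D z0) lies in J; dividing by l advances
   the induction. *)
exists (fun e s => c * z' e s + (a / l%:R)%:MP * S z0 e s).
  apply: ClsD; apply: ClsZ => //.
    exact: C_homog.
  exact: Cls_S.
exists (- a / l%:R) => e' s.
rewrite koszulDD !koszulDZ //; last first.
  exact: C_homog.
rewrite ThE // exprS.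
have -> : c * c ^+ size ls * z e' s - (c * D z' e' s + (a / l%:R)%:MP * D (S z0) e' s)
   - (- a / l%:R)%:MP * (D (S z0) e' s + S (D z0) e' s - c *+ l * z0 e' s)
 = c * (c ^+ size ls * z e' s - D z' e' s - a%:MP * z0 e' s)
   + (a / l%:R)%:MP * S (D z0) e' s.
  have -> : a%:MP = (a / l%:R)%:MP * l%:R :> P.
    have -> : (l%:R : P) = (l%:R : k)%:MP by rewrite mpolyC_nat.
    by rewrite -mpolyCM divfK.
  rewrite mulNr mpolyCN -[c *+ l]mulr_natr; ring.
by apply: inJD; apply: inJM => //; apply: inJ_S.
Qed.

(** The tensor degree of [z e] is r + e - i, so the eigenvalues of Npi + c (i - e) on it are among c
    (i - e), ..., c r. As i > 0 and [z true] vanishes for i = 1, they are among c, ..., c r, and the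
    product of the operators for l = 1, ..., r kills z. *)
Lemma homotopy_pow e t i z : (0 < i)%N -> graded_pair i z ->
  (forall e' s, inJ e t (D z e' s)) ->
  (forall l, (0 < l <= r)%N -> (l%:R : k) != 0) ->
  exists2 z', graded_pair i.+1 z' & forall e' s, inJ e t (c ^+ r * z e' s - D z' e' s).
Proof.
move=> i0 hz hD hl.
have [|z' hz' [a ha]] := @homotopy_iter e t i (iota 1 r) z i0 hz hD.
  by apply/allP => l; rewrite mem_iota => h; apply: hl; lia.
exists z' => // e' s; have := ha e' s; rewrite size_iota.
rewrite (_ : Ths _ _ _ _ _ = 0) ?mulr0 ?subr0 //.
rewrite Ths_Nops; have [a1 a2 a3 a4 a5] := hz.
have N0 xs : (forall s, z e' s = 0) -> Nops n w sg xs (z e') s = 0.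
  move=> h; rewrite (_ : z e' = fun=> 0) ?Nops0 //.
  exact: functional_extensionality.
have [h|h] := boolP ((e' < i)%N && (i <= r + e')%N); last first.
  apply: N0 => s'; move: h; rewrite negb_and -!leqNgt -ltnNge => /orP[h|h].
    by move: h; case: (e') => h; [apply: a5; lia | lia].
  by apply: a3; lia.
rewrite -map_comp (_ : iota 1 r = iota 1 (i - e').-1 ++ iota (i - e') (r + e' - i).+1); last first.
  by rewrite -{2}(_ : 1 + (i - e').-1 = i - e')%N -?iotaD; [congr iota|]; lia.
have NC xs ys al : Nops n w sg (xs ++ ys) al = Nops n w sg xs (Nops n w sg ys al).
  by rewrite /Nops foldr_cat.
rewrite map_cat NC.
set al := Nops _ _ _ _ (z e').
suff -> : al = fun=> 0 by rewrite Nops0.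
rewrite /al.
rewrite -[RHS](@Nops_eq0 P m n w sg u ta c c_neq0 w_supp uw0 sgw (r + e' - i)%N (z e')) //.
  rewrite /Nops /spectrum; congr foldr.
  rewrite -[in LHS](addn0 (i - e')%N) iotaDl -map_comp; apply: eq_map => l /=.
  by rewrite addn0 mulrnDr addrAC subrr add0r.
by move=> s' hs; apply: a3; move: hs; lia.
Qed.

End Step.

(** The data of the section [Step] for c = x_j^h. *)
Definition splitting (j : 'I_m) h (sg : 'I_m -> nat -> P) (ta : 'I_m -> P) :=
  [/\ forall b a, sg b a \is xh 0%N, forall b, ta b \is xh 0%N,
      forall b b', ip n (sg b') (w b) + ta b * u b'
                   = ('X_(lshift m j) ^+ h : P) *+ (b == b')
    & \sum_b ta b * u b = 'X_(lshift m j) ^+ h].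

Lemma Xl_homog (j : 'I_m) h : ('X_(lshift m j) ^+ h : P) \is xh 0%N.
Proof.
rewrite mpolyXn dhomogX; apply/eqP; rewrite /= /xdeg big1 // => b _.
by rewrite mulmnE mnm1E eq_lrshift /= ?muln0 ?mul0n.
Qed.

(** Descending induction on i from i = r + 2, where the tensor degrees are negative; each step uses
    one more variable x_t. Modulo J_t, x_t^(e t) z = D z'. Then D z' lies in J_(t+1), so by
    induction z' - D z2 = x_t^(e t) q modulo J_t for some z2 and q, and z = D q modulo J_t because
    x_t is regular there. The bound t <= i + 1 is preserved and gives t < m. *)
Lemma exact_mod (e : nat -> nat) h t0 :
  (2%:R : k) != 0 -> (forall a, \sum_b u b * w b a = 0) ->
  (forall j : 'I_m, (t0 <= j)%N -> e j = (h * r)%N /\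
     exists sg, exists ta, splitting j h sg ta) ->
  (forall l, (0 < l <= r)%N -> (l%:R : k) != 0) -> (r + 2 < m)%N ->
  forall d i t z, (r + 2 <= i + d)%N -> (0 < i)%N -> (t0 <= t <= i.+1)%N ->
  graded_pair i z -> (forall e' s, inJ e t (koszulD w u z e' s)) ->
  exists2 z', graded_pair i.+1 z' & forall e' s, inJ e t (z e' s - koszulD w u z' e' s).
Proof.
move=> two uw0 hsp hl hrm; elim=> [|d IH] i t z hid i0 ht hz hD.
  exists (fun _ _ => 0).
    split=> //.
    - by move=> e' s1 a b s2; rewrite oppr0.
    - by move=> e' s; rewrite rpred0.
  move=> e' s; have -> : koszulD w u (fun _ _ => 0) e' s = 0.
    by case: e' => /=; rewrite ?mulr0 ?addr0 Wop0 ?oppr0.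
  have [a1 a2 a3 a4 a5] := hz.
  by rewrite a3 ?subr0; [apply: inJ0 | lia].
have [l|l] := leqP (r + 2)%N i; first by apply: (IH i) => //; lia.
have tm : (t < m)%N by lia.
pose j := Ordinal tm.
have [|ej [sg [ta [s1 s2 s3 s4]]]] := hsp j; first by rewrite /=; lia.
have cn0 : ('X_(lshift m j) ^+ h : P) != 0 by rewrite mpolyXn -msupp_eq0 msuppX.
have [z' hz' hz'D] := homotopy_pow two uw0 (Xl_homog j h) cn0 s1 s2 s3 s4 i0 hz hD hl.
have [||||z2 hz2 hz2D] := IH i.+1 t.+1 z' _ _ _ hz'; try lia.
  move=> e' s; rewrite (_ : koszulD w u z' e' s = ('X_(lshift m j)) ^+ e j * z e' s
     - (('X_(lshift m j) ^+ h) ^+ r * z e' s - koszulD w u z' e' s)); last first.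
    by rewrite ej exprM; ring.
  by apply: inJB; [apply: inJ_var; rewrite /= | apply: inJS].
pose y e s := z' e s + - koszulD w u z2 e s.
have hy : graded_pair i.+1 y by apply: ClsD => //; apply: ClsN; apply: Cls_D.
exists (fun e' s => quov (lshift m j) (e j) (y e' s)).
  by apply: Cls_quo => // b; rewrite eq_lrshift.
move=> e' s; apply: (@inJ_cancel _ _ _ j (e j)).
set q := fun (e' : bool) s => quov _ _ _.
have hq : 'X_(lshift m j) ^+ e j * koszulD w u q e' s
   = koszulD w u (fun e s => 'X_(lshift m j) ^+ h ^+ r * q e s) e' s.
  by rewrite koszulDZ -?exprM ?ej //; apply: Xl_homog.
rewrite mulrBr hq.
have hDy : koszulD w u z' e' s = koszulD w u y e' s.
  rewrite koszulDD koszulDN koszulDK // ?oppr0 ?addr0 //.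
  - by move=> b a; apply: homog0_xc.
  - by move=> b; apply: homog0_xc.
rewrite (_ : _ - _ = ('X_(lshift m j) ^+ h ^+ r * z e' s - koszulD w u z' e' s)
  + koszulD w u (fun e s => y e s + - ('X_(lshift m j) ^+ h ^+ r * q e s)) e' s); last first.
  rewrite koszulDD koszulDN -hDy ej exprM; ring.
apply: inJD; first exact: hz'D.
apply: inJ_D => e1 s1'; rewrite -exprM -ej.
by apply: (@inJ_quo _ _ _ j); apply: hz2D.
Qed.

End Class.

(** * Wronskian relations *)

Section Wronskian.
Variable R : idomainType.
Implicit Types (u x y f : {poly R}) (c : R).

Definition Wr u y := u * y^`() - u^`() * y.

Lemma WrBr u x y : Wr u (x - y) = Wr u x - Wr u y.
Proof. by rewrite /Wr derivB; ring. Qed.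

Lemma WrZr u c y : Wr u (c *: y) = c *: Wr u y.
Proof. by rewrite /Wr derivZ -!mul_polyC; ring. Qed.

Lemma Wr_sum u (I : Type) (s : seq I) (F : I -> {poly R}) :
  Wr u (\sum_(i <- s) F i) = \sum_(i <- s) Wr u (F i).
Proof. by rewrite /Wr raddf_sum mulr_sumr mulr_sumr -sumrB. Qed.

Lemma Wrr u : Wr u u = 0.
Proof. by rewrite /Wr mulrC subrr. Qed.

Lemma Wr_comp u y q : q^`() = 1 -> Wr (u \Po q) (y \Po q) = Wr u y \Po q.
Proof. by move=> h; rewrite /Wr !deriv_comp h !mulr1 comp_polyB !comp_polyM. Qed.

Lemma Wr_mul f u y : Wr (f * u) (f * y) = f ^+ 2 * Wr u y.
Proof. by rewrite /Wr !derivM; ring. Qed.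

Lemma coef_WrXn u b e : (e < b)%N -> (Wr u 'X^b)`_e = (u`_0 *+ b) *+ (b == e.+1).
Proof.
move=> h; rewrite /Wr derivXn coefB mulrnAr coefMn !coefMXn h subr0.
case: ltnP => h2; first by rewrite mul0rn; case: eqP => //; lia.
by have -> : b = e.+1 by [lia]; rewrite /= subnn eqxx.
Qed.

Lemma coef_Wr u y e : (Wr u y)`_e = \sum_(b < e.+2) y`_b * (Wr u 'X^b)`_e.
Proof.
set n := maxn (size y) e.+2.
have -> : y = \sum_(b < n) y`_b *: 'X^b.
  rewrite -{1}[y]coefK poly_def (big_ord_widen n (fun b => y`_b *: 'X^b)) ?leq_maxl //.
  rewrite big_mkcond; apply: eq_bigr => b _; case: ltnP => // h.
  by rewrite nth_default ?scale0r.
rewrite Wr_sum coef_sum.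
have E (b : nat) : (b < n)%N -> (\sum_(b < n) y`_b *: 'X^b)`_b = y`_b.
  by move=> hb; rewrite -poly_def coef_poly hb.
rewrite [RHS](eq_bigr (fun b : 'I_e.+2 => y`_b * (Wr u 'X^b)`_e)); last first.
  by move=> b _; rewrite E // (leq_trans (ltn_ord b)) ?leq_maxr.
rewrite (big_ord_widen n (fun b => y`_b * (Wr u 'X^b)`_e)) ?leq_maxr //.
rewrite [RHS]big_mkcond; apply: eq_bigr => b _; rewrite WrZr coefZ; case: ltnP => // h.
by rewrite coef_WrXn ?(leq_trans _ h) // gtn_eqF // mulr0n mulr0.
Qed.

(** The coefficient of degree 2 N - 1 is u_N y_N (N - N) = 0. *)
Lemma size_Wr N u y : (size u <= N.+1)%N -> (size y <= N.+1)%N ->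
  (size (Wr u y) <= N.*2.-1)%N.
Proof.
move=> hu hy; apply/leq_sizeP => e he.
rewrite coef_Wr big1 // => b _.
have [h|h] := leqP (N.+1) b; first by rewrite nth_default ?mul0r // (leq_trans hy).
case: (ltnP e b) => h2; first by lia.
case: (posnP b) => [b0|b0].
  have ue : u`_e.+1 = 0 by rewrite nth_default // (leq_trans hu) //; lia.
  by rewrite b0 expr0 /Wr derivC mulr0 sub0r mulr1 coefN coef_deriv ue mul0rn oppr0 mulr0.
rewrite /Wr derivXn coefB mulrnAr coefMn !coefMXn coef_deriv.
rewrite !ifF; [|lia|lia].
have -> : (e - b.-1 = (e - b).+1)%N by lia.
have [l|l] := ltnP N (e - b).+1.
  have ue : u`_(e - b).+1 = 0 by rewrite nth_default // (leq_trans hu).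
  by rewrite ue !mul0rn subrr mulr0.
by have [-> ->] : (e - b).+1 = N /\ b = N :> nat by [lia]; rewrite subrr mulr0.
Qed.

Definition cf f : nat -> R := fun i => f`_i.

Section Local.
Variables (N n : nat) (inv : nat -> R).
Hypothesis Nn : (N <= n)%N.
Hypothesis invP : forall l, (0 < l <= N)%N -> inv l * l%:R = 1.

(** W(u, x^b) starts with b u_0 x^(b-1), so W(u, x) = u_0 f is a triangular system for the
    coefficients of x. Solving it divides by 1, ..., d and costs one power of u_0 per step. *)
Lemma taylor_split u d : u`_0 != 0 -> (d <= N)%N -> exists xi : nat -> nat -> R,
  forall e x f, (0 < e <= d)%N -> x`_0 = 0 -> Wr u x = u`_0 *: f ->
  ip n (xi e) (cf f) = u`_0 ^+ e.-1 * x`_e.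
Proof.
move=> u0; elim: d => [|d IH] hd; first by exists (fun _ _ => 0) => e x f; lia.
have [|xi hxi] := IH; first by lia.
pose new (a : nat) := inv d.+1 * (u`_0 ^+ d * (a == d)%:R
   - \sum_(b < d) u`_0 ^+ (d - b.+1) * xi b.+1 a * (Wr u 'X^(b.+1))`_d).
exists (fun e => if e == d.+1 then new else xi e) => e x f he x0 hf.
have [->|ne] := eqVneq e d.+1; last by apply: hxi => //; lia.
have E : ip n new (cf f) = inv d.+1 * (u`_0 ^+ d * f`_d
   - \sum_(b < d) u`_0 ^+ (d - b.+1) * ip n (xi b.+1) (cf f) * (Wr u 'X^(b.+1))`_d).
  rewrite /ip /new /cf; under eq_bigr do rewrite -mulrA.
  rewrite -mulr_sumr; congr (_ * _).
  have hdn : (d < n)%N by lia.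
  rewrite (eq_bigr (fun a : 'I_n => u`_0 ^+ d * (f`_a *+ (a == Ordinal hdn))
     - \sum_(b < d) (u`_0 ^+ (d - b.+1) * (Wr u 'X^(b.+1))`_d) * (xi b.+1 a * f`_a))); last first.
    move=> a _; rewrite mulrBl -val_eqE /= -mulrA [_%:R * _]mulrC mulr_natr; congr (_ - _).
    by rewrite mulr_suml; apply: eq_bigr => b _; ring.
  rewrite sumrB -mulr_sumr (bigD1 (Ordinal hdn)) //= eqxx mulr1n big1 ?addr0; last first.
    by move=> a /negbTE ->.
  congr (_ - _); rewrite exchange_big; apply: eq_bigr => b _.
  by rewrite mulr_sumr mulr_suml; apply: eq_bigr => a _; ring.
have := coef_Wr u x d; rewrite hf coefZ big_ord_recl x0 mul0r add0r big_ord_recr /=.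
rewrite [X in _ + _ * X]coef_WrXn // eqxx mulr1n /bump /= !add1n.
rewrite (eq_bigr (fun b : 'I_d => x`_b.+1 * (Wr u 'X^(b.+1))`_d)); last by [].
move=> hc; rewrite E.
apply: (mulfI u0); rewrite mulrCA mulrBr mulr_sumr.
rewrite (eq_bigr (fun b : 'I_d => u`_0 ^+ d * (x`_b.+1 * (Wr u 'X^(b.+1))`_d))); last first.
  move=> b _; rewrite (hxi b.+1 x f) // ?ltn_ord // !mulrA -exprS -exprD.
  by congr (_ ^+ _ * _ * _); have := ltn_ord b; rewrite /=; lia.
rewrite -mulr_sumr mulrCA -mulrBr.
have -> : u`_0 * f`_d - \sum_(b < d) x`_b.+1 * (Wr u 'X^(b.+1))`_d = x`_d.+1 * (u`_0 *+ d.+1).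
  by rewrite hc addrAC subrr add0r.
rewrite -mulr_natr /=.
have <- : inv d.+1 * d.+1%:R * (u`_0 * (u`_0 ^+ d * x`_d.+1)) = u`_0 * (u`_0 ^+ d * x`_d.+1).
  by rewrite invP ?mul1r //; lia.
ring.
Qed.

Lemma ip_lin (I : Type) (s : seq I) (c : I -> R) (xi : I -> nat -> R) (f : nat -> R) :
  ip n (fun a => \sum_(i <- s) c i * xi i a) f = \sum_(i <- s) c i * ip n (xi i) f.
Proof.
rewrite /ip; under eq_bigr do rewrite mulr_suml.
rewrite exchange_big; apply: eq_bigr => i _; rewrite mulr_sumr.
by apply: eq_bigr => a _; rewrite mulrA.
Qed.

Lemma comp_polyXD_coef (a : R) f e : (size f <= n)%N ->
  (f \Po ('X + a%:P))`_e = \sum_(b < n) f`_b * (('X + a%:P) ^+ b)`_e.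
Proof.
move=> hf; rewrite comp_polyE coef_sum.
rewrite (big_ord_widen n (fun b => (f`_b *: ('X + a%:P) ^+ b)`_e)) // big_mkcond.
apply: eq_bigr => b _; rewrite coefZ; case: ltnP => // h.
by rewrite nth_default // mul0r.
Qed.

(* At a point a with u(a) <> 0 the kernel u of y |-> Wr u y splits off: y is
   recovered from Wr u y modulo u, by Taylor expansion at a. *)
Lemma local_splitting u (a : R) : u.[a] != 0 -> (size u <= N.+1)%N -> (0 < N)%N ->
  exists rho : nat -> nat -> R, forall y, (size y <= N.+1)%N ->
    (size (Wr u y) <= n)%N ->
    ('X - a%:P) * \poly_(b < N) ip n (rho b) (cf (Wr u y))
    = u.[a] ^+ N.-1 *: (u.[a] *: y - y.[a] *: u).
Proof.
move=> ua su N0; pose q := 'X + a%:P; pose q' := 'X - a%:P.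
have qq' : q \Po q' = 'X by rewrite comp_polyD comp_polyX comp_polyC /q' subrK.
have hq : q^`() = 1 by rewrite /q derivD derivX derivC addr0.
pose ut := u \Po q.
have coef0 f : (f \Po q)`_0 = f.[a].
  by rewrite -horner_coef0 horner_comp /q !hornerE.
have ut0 : ut`_0 != 0 by rewrite coef0.
have [xi hxi] := taylor_split ut0 (leqnn N).
(* Translate a to 0, apply [taylor_split] there, and translate back; the factors u(a)^(N - 1 - e)
   bring all terms to the common power u(a)^(N - 1). *)
pose rho (b a' : nat) := \sum_(e < N) (u.[a] ^+ (N.-1 - e) * (q' ^+ e)`_b)
  * \sum_(c < n) (q ^+ a')`_c * xi e.+1 c.
exists rho => y sy sW.
pose x := u.[a] *: y - y.[a] *: u.
have sx : (size x <= N.+1)%N.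
  rewrite (leq_trans (size_polyD _ _)) // geq_max size_polyN.
  by rewrite !(leq_trans (size_scale_leq _ _)).
have Wx : Wr ut (x \Po q) = ut`_0 *: (Wr u y \Po q).
  by rewrite Wr_comp // /x WrBr !WrZr Wrr scaler0 subr0 comp_polyZ coef0.
have x0 : (x \Po q)`_0 = 0 by rewrite coef0 /x !hornerE mulrC subrr.
have E b : ip n (rho b) (cf (Wr u y)) = \sum_(e < N)
    (u.[a] ^+ (N.-1 - e) * (q' ^+ e)`_b) * (u.[a] ^+ e * (x \Po q)`_e.+1).
  rewrite /rho ip_lin; apply: eq_bigr => e _; congr (_ * _).
  have := hxi e.+1 _ _ _ x0 Wx; rewrite ltn_ord /= coef0 => <- //.
  rewrite /ip /cf.
  transitivity (\sum_(c < n) xi e.+1 c * (\sum_(b' < n) (Wr u y)`_b' * (q ^+ b')`_c)).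
    under eq_bigr do rewrite mulr_suml.
    rewrite exchange_big; apply: eq_bigr => c _; rewrite mulr_sumr.
    by apply: eq_bigr => b' _; ring.
  by apply: eq_bigr => c _; rewrite -comp_polyXD_coef.
have sq' e : size (q' ^+ e) = e.+1 by rewrite /q' size_exp_XsubC.
have -> : \poly_(b < N) ip n (rho b) (cf (Wr u y)) =
    u.[a] ^+ N.-1 *: \sum_(e < N) (x \Po q)`_e.+1 *: q' ^+ e.
  apply/polyP => b; rewrite coef_poly coefZ coef_sum mulr_sumr.
  case: ltnP => hb.
    rewrite E; apply: eq_bigr => e _; rewrite coefZ.
    rewrite (_ : u.[a] ^+ N.-1 = u.[a] ^+ (N.-1 - e) * u.[a] ^+ e); first by ring.
    by rewrite -exprD; congr (_ ^+ _); have := ltn_ord e; lia.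
  rewrite big1 // => e _; rewrite coefZ.
  have -> : (q' ^+ e)`_b = 0 by rewrite nth_default // sq' (leq_trans _ hb).
  by rewrite !mulr0.
rewrite -scalerAr mulr_sumr; congr (_ *: _).
transitivity ((x \Po q) \Po q'); last by rewrite -comp_polyA qq' comp_polyXr.
have sxq : (size (x \Po q) <= N.+1)%N.
  by rewrite size_comp_poly2 // /q size_XaddC.
have -> : (x \Po q) \Po q' = \sum_(e < N.+1) (x \Po q)`_e *: q' ^+ e.
  rewrite [LHS]comp_polyE (big_ord_widen N.+1 (fun i => (x \Po q)`_i *: q' ^+ i)) //.
  rewrite big_mkcond; apply: eq_bigr => e _.
  by case: ltnP => // h; rewrite nth_default // scale0r.
rewrite big_ord_recl x0 scale0r add0r.
by apply: eq_bigr => e _; rewrite -scalerAr -exprS.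
Qed.

End Local.
End Wronskian.

(** * Points, interpolation and vanishing of polynomials *)

Lemma closed_points (k : closedFieldType) n :
  exists2 s : seq k, uniq s & size s = n.
Proof.
elim: n => [|n [s us <-]]; first by exists [::].
pose p := \prod_(a <- s) ('X - a%:P) : {poly k}.
have [s0|s0] := eqVneq s [::]; first by exists [:: 0]; rewrite ?s0.
have sp : size (p + 1) = (size s).+1.
  rewrite size_polyDl size_prod_XsubC // size_poly1 ltnS lt0n size_eq0 //.
(* A root of p + 1 is new, since the elements of s are roots of p. *)
have /closed_rootP[x] : size (p + 1) != 1 by rewrite sp eqSS size_eq0.
rewrite rootE !hornerE => /eqP hx.
exists (x :: s) => //=; rewrite us andbT; apply/negP => xs.
have : root p x by rewrite root_prod_XsubC.
rewrite rootE => /eqP px; move: hx; rewrite px add0r => /eqP.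
by rewrite oner_eq0.
Qed.

Lemma digits_inj B n (f g : nat -> nat) :
  (forall i, (i < n)%N -> (f i < B)%N) -> (forall i, (i < n)%N -> (g i < B)%N) ->
  (\sum_(i < n) f i * B ^ i = \sum_(i < n) g i * B ^ i)%N ->
  forall i, (i < n)%N -> f i = g i.
Proof.
elim: n f g => [|n IH] f g hf hg // e.
have E (h : nat -> nat) : (\sum_(i < n.+1) h i * B ^ i
    = h 0 + (\sum_(i < n) h i.+1 * B ^ i) * B)%N.
  rewrite big_ord_recl expn0 muln1; congr (_ + _)%N.
  by rewrite big_distrl /=; apply: eq_bigr => i _; rewrite -mulnA -expnSr.
move: e; rewrite !E => e.
have B0 : (0 < B)%N by apply: leq_trans (hf 0%N _).
have e0 : f 0%N = g 0%N.
  have := congr1 (modn^~ B) e.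
  by rewrite ![(_ 0%N + _)%N]addnC !modnMDl !modn_small ?hf ?hg.
move=> [|i] // hi; apply: (IH (fun i => f i.+1) (fun i => g i.+1)) => //.
- by move=> j hj; apply: hf.
- by move=> j hj; apply: hg.
by move/eqP: e; rewrite e0 eqn_add2l eqn_pmul2r // => /eqP.
Qed.

Section Vanishing.
Variable k : closedFieldType.

(** Kronecker substitution x_i -> x^(B^i): with B above the total degree, distinct monomials stay
    distinct, which leaves a polynomial in one variable. *)
Lemma mpoly_vanish n (p : {mpoly k[n]}) : (forall x, p.@[x] = 0) -> p = 0.
Proof.
move=> h; set B := msize p.
pose wt (m : 'X_{1..n}) := (\sum_(i < n) m i * B ^ i)%N.
pose q := \sum_(m <- msupp p) p@_m *: 'X^(wt m) : {poly k}.
have wtI m m' : m \in msupp p -> m' \in msupp p -> wt m = wt m' -> m = m'.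
  move=> hm hm' e.
  pose F (mm : 'X_{1..n}) i := if insub i is Some j then mm (j : 'I_n) else 0%N.
  have FE mm (i : 'I_n) : F mm i = mm i by rewrite /F valK.
  have Fb mm : mm \in msupp p -> forall i, (i < n)%N -> (F mm i < B)%N.
    move=> hmm i hi; rewrite -[i]/(val (Ordinal hi)) FE.
    apply: leq_ltn_trans (msize_mdeg_lt hmm).
    by rewrite mdegE (bigD1 (Ordinal hi)) //= leq_addr.
  apply/mnmP => i; rewrite -!FE.
  apply: (@digits_inj B n (F m) (F m')) => //; [exact: Fb | exact: Fb |].
  by rewrite (eq_bigr (fun i : 'I_n => m i * B ^ i)%N) => [|j _]; rewrite ?FE //
    -/(wt m) e; apply: eq_bigr => j _; rewrite FE.
have q0 : q = 0.
  have [s us ss] := closed_points k (size q).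
  apply/eqP; apply: contraT => nq; have := max_poly_roots nq _ us.
  rewrite ss ltnn => -> //; apply/allP => x _; rewrite rootE.
  rewrite -[X in _ == X](h (fun i => x ^+ (B ^ i))) /q mevalE.
  rewrite horner_sum; apply/eqP; apply: eq_bigr => m _.
  rewrite hornerZ hornerXn; congr (_ * _); rewrite /wt.
  rewrite (big_morph (fun e => x ^+ e) (exprD x) (expr0 x)).
  by apply: eq_bigr => i _; rewrite -exprM mulnC.
apply/mpolyP => m; rewrite mcoeff0.
have [hm|/memN_msupp_eq0 //] := boolP (m \in msupp p).
have := congr1 (fun f : {poly k} => f`_(wt m)) q0.
rewrite coef0 /q coef_sum (bigD1_seq m) //= coefZ coefXn eqxx mulr1.
rewrite big1_seq ?addr0 // => m' /andP[ne hm'].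
rewrite coefZ coefXn; case: eqP => [/(wtI _ _ hm hm') e|]; last by rewrite mulr0.
by rewrite e eqxx in ne.
Qed.

Section Lagrange.
Variables (N : nat) (a : 'I_N.+1 -> k).
Hypothesis a_inj : injective a.

Definition lag j : {poly k} := \prod_(l | l != j) ('X - (a l)%:P).

Lemma lag_at j l : (lag j).[a l] = (lag j).[a j] *+ (l == j).
Proof.
have [->|ne] := eqVneq l j; first by rewrite mulr1n.
by rewrite mulr0n horner_prod (bigD1 l) //= !hornerE subrr mul0r.
Qed.

Lemma lag_neq0 j : (lag j).[a j] != 0.
Proof.
rewrite horner_prod; apply/prodf_neq0 => l ne.
by rewrite !hornerE subr_eq0 (inj_eq a_inj) eq_sym.
Qed.

Lemma size_lag j : size (lag j) = N.+1.
Proof.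
rewrite /lag size_prod; last by move=> l _; rewrite polyXsubC_eq0.
rewrite (eq_bigr (fun=> 2%N)) => [|l _]; last by rewrite size_XsubC.
rewrite sum_nat_const /= (_ : #|_| = N); first by lia.
have := cardC1 j; rewrite card_ord => h; rewrite -[RHS]h; apply: eq_card => l.
by rewrite !inE.
Qed.

Lemma lagrangeE (x : {poly k}) : (size x <= N.+1)%N ->
  x = \sum_j (x.[a j] / (lag j).[a j]) *: lag j.
Proof.
move=> sx; apply/eqP; rewrite -subr_eq0; apply: contraT => ne.
have := max_poly_roots ne (rs := [seq a j | j <- enum 'I_N.+1]).
rewrite map_inj_uniq // enum_uniq size_map size_enum_ord => h.
have : (N.+1 < N.+1)%N; last by rewrite ltnn.
apply: leq_trans (h _ isT) _.
  apply/allP => _ /mapP[j _ ->]; rewrite rootE hornerD hornerN horner_sum.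
  rewrite (bigD1 j) //= hornerZ divfK ?lag_neq0 // big1 ?addr0 ?subrr // => l ne'.
  by rewrite hornerZ (lag_at l j) eq_sym (negbTE ne') mulr0n mulr0.
rewrite (leq_trans (size_polyD _ _)) // geq_max sx size_polyN.
rewrite (leq_trans (size_sum _ _ _)) //; apply/bigmax_leqP => j _.
by rewrite (leq_trans (size_scale_leq _ _)) // size_lag.
Qed.

Definition lagT : N.+1.-tuple {mpoly k[N.+1]} :=
  [tuple \sum_j (lag j)`_i *: 'X_j | i < N.+1].

(** By interpolation every coefficient vector is an image under the linear map [lagT], so p vanishes
    at every point. *)
Lemma lagT_eq0 (p : {mpoly k[N.+1]}) : p \mPo lagT = 0 -> p = 0.
Proof.
move=> h; apply: mpoly_vanish => x.
pose f := \poly_(i < N.+1) (if insub i is Some j then x j else 0).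
have fE (i : 'I_N.+1) : f`_i = x i by rewrite coef_poly ltn_ord valK.
pose y j := f.[a j] / (lag j).[a j].
rewrite -[RHS](meval0 y) -h comp_mpoly_meval; apply: meval_eq => i.
rewrite tnth_mktuple raddf_sum /= -fE {1}[f]lagrangeE ?size_poly // coef_sum.
by apply: eq_bigr => j _; rewrite mevalZ mevalXU coefZ mulrC.
Qed.

End Lagrange.
End Vanishing.

(** * Iterated wedge products and top forms *)

Section Wedges.
Variable P : comNzRingType.
Hypothesis two_reg : forall x : P, x + x = 0 -> x = 0.
Implicit Types (g h : nat -> P) (al be : seq nat -> P).

Definition wedges (I : Type) (F : I -> nat -> P) (bs : seq I) al :=
  foldr (fun b => wedge (F b)) al bs.

Lemma wedge0r g s : wedge g (fun=> 0) s = 0.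
Proof. by elim: s => [|a s IH] //=; rewrite IH mulr0 subrr. Qed.

Lemma wedge_r0 g al s : (forall s, al s = 0) -> wedge g al s = 0.
Proof. by move=> h; rewrite -(wedge0r g s); apply: wedge_eq. Qed.

Lemma wedgegg g al s : wedge g (wedge g al) s = 0.
Proof. by apply: two_reg; rewrite {1}wedgeC addNr. Qed.

Lemma wedges_eq (I : Type) (F : I -> nat -> P) bs al be :
  al =1 be -> wedges F bs al =1 wedges F bs be.
Proof. by move=> /functional_extensionality ->. Qed.

Lemma wedges_comm (I : Type) (F : I -> nat -> P) bs g al s :
  wedges F bs (wedge g al) s = (-1) ^+ size bs * wedge g (wedges F bs al) s.
Proof.
elim: bs s => [|b bs IH] s /=; first by rewrite mul1r.
rewrite (wedge_eq _ IH) wedgeZ wedgeC exprS; ring.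
Qed.

Lemma wedges_dup (I : eqType) (F : I -> nat -> P) bs b al s : b \in bs ->
  wedge (F b) (wedges F bs al) s = 0.
Proof.
elim: bs s => [|c bs IH] s //=; rewrite inE => /predU1P[->|h]; first exact: wedgegg.
by rewrite wedgeC wedge_r0 ?oppr0 // => t; apply: IH.
Qed.

Lemma alt_wedges (I : Type) (F : I -> nat -> P) bs al : alt al -> alt (wedges F bs al).
Proof. by move=> h; elim: bs => //= b bs IH; apply: alt_wedge. Qed.

Lemma tdeg_wedges j (I : Type) (F : I -> nat -> P) bs al :
  tdeg j al -> tdeg (size bs + j)%N (wedges F bs al).
Proof. by move=> h; elim: bs => [|b bs IH] //=; apply: tdeg_wedge. Qed.

Definition ev1 (a i : nat) : P := (i == a)%:R.

Definition one (s : seq nat) : P := (s == [::])%:R.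

Lemma alt_one : alt one.
Proof. by move=> [|x s1] a b s2; rewrite /one /= oppr0. Qed.

Lemma supp_one n : supp n one.
Proof. by case. Qed.

Lemma tdeg_one : tdeg 0 one.
Proof. by case. Qed.

Variable n : nat.

(** The form e_i /\ ... /\ e_(n - 1), with [top 0] the volume form. *)
Definition top i := wedges ev1 (iota i (n - i)) one.

Lemma topS i : (i < n)%N -> top i = wedge (ev1 i) (top i.+1).
Proof. by move=> h; rewrite /top (_ : n - i = (n - i.+1).+1)%N //; lia. Qed.

Lemma alt_top i : alt (top i).
Proof. exact/alt_wedges/alt_one. Qed.

Lemma supp_top i : (i <= n)%N -> supp n (top i).
Proof.
move=> hi; rewrite /top; have : all (ltn^~ n) (iota i (n - i)).
  by apply/allP => a; rewrite mem_iota /=; lia.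
elim: (iota _ _) => [|b bs IH] /=; first by move=> _; apply: supp_one.
case/andP=> hb /IH h; apply: supp_wedge => // a ha.
by rewrite /ev1 gtn_eqF //; apply: leq_trans ha.
Qed.

Lemma tdeg_top i : tdeg (n - i)%N (top i).
Proof. by have := @tdeg_wedges 0 nat ev1 (iota i (n - i)) one tdeg_one; rewrite size_iota addn0. Qed.

Lemma wedge_ev1 g al s : (forall a, (n <= a)%N -> g a = 0) ->
  wedge g al s = \sum_(a < n) g a * wedge (ev1 a) al s.
Proof.
move=> hg; rewrite -wedge_linl; congr wedge.
apply: functional_extensionality => a.
have [ha|ha] := ltnP a n.
  rewrite (bigD1 (Ordinal ha)) //= /ev1 eqxx mulr1 big1 ?addr0 // => b hb.
  by rewrite -val_eqE /= eq_sym in hb; rewrite (negbTE hb) mulr0.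
rewrite hg // big1 // => b _.
by rewrite /ev1 gtn_eqF ?mulr0 //; apply: leq_trans ha.
Qed.

Lemma wedge_top g i s : (i < n)%N -> (forall a, (a < i)%N -> g a = 0) ->
  (forall a, (n <= a)%N -> g a = 0) ->
  wedge g (top i.+1) s = g i * top i s.
Proof.
move=> hi h0 hn; rewrite wedge_ev1 // (bigD1 (Ordinal hi)) //= -topS // big1 ?addr0 // => a ha.
have [l|l] := ltnP a i; first by rewrite h0 ?mul0r.
rewrite /top wedges_dup ?mulr0 // mem_iota.
by move: ha; rewrite -val_eqE /=; have := ltn_ord a; lia.
Qed.

Lemma wedge_top0 g s : (forall a, (n <= a)%N -> g a = 0) -> wedge g (top 0) s = 0.
Proof.
move=> hn; rewrite wedge_ev1 // big1 // => a _.
by rewrite /top wedges_dup ?mulr0 // mem_iota subn0 ltn_ord.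
Qed.

Lemma wedges_zero (I : Type) (F : I -> nat -> P) bs s (i : nat) :
  all (fun a => i < a)%N bs -> wedges ev1 bs one (i :: s) = 0 :> P.
Proof.
elim: bs s i => [|b bs IH] s i //= /andP[h1 h2].
have -> : ev1 b i = 0 by rewrite /ev1 ltn_eqF.
rewrite mul0r sub0r; apply/eqP; rewrite oppr_eq0; apply/eqP.
rewrite wedge_r0 // => t; exact: IH.
Qed.

Lemma top_iota i : (i <= n)%N -> top i (iota i (n - i)) = 1.
Proof.
move=> hi; have [d e] : exists d, d = (n - i)%N by exists (n - i)%N.
elim: d i hi e => [|d IH] i hi e; first by rewrite /top -e.
rewrite topS; last by lia.
rewrite -e /= /ev1 eqxx mul1r (_ : d = n - i.+1)%N ?IH; [|lia..].
rewrite wedge_r0 ?subr0 // => t.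
by apply: (@wedges_zero nat ev1); apply/allP => a; rewrite mem_iota; lia.
Qed.

(** As e_a /\ top 0 = 0, contracting it with F gives F_a top 0 = e_a /\ (contraction of top 0), and
    the right side is 0 by hypothesis. *)
Lemma contr_top_eq0 (F : nat -> P) : (forall s, contr n F (top 0) s = 0) ->
  forall a, (a < n)%N -> F a = 0.
Proof.
move=> h a ha.
have := contr_wedge n F (ev1 a) (top 0) (iota 0 n).
rewrite [wedge (ev1 a) (contr _ _ _) _]wedge_r0 // subr0 /contr big1; last first.
  move=> b _; rewrite wedge_top0 ?mulr0 // => c hc.
  by rewrite /ev1 gtn_eqF //; apply: leq_trans hc.
have := top_iota (leq0n n); rewrite subn0 => ->; rewrite mulr1 => ->.
rewrite /ip (bigD1 (Ordinal ha)) //= /ev1 eqxx mulr1 big1 ?addr0 // => b hb.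
by rewrite -val_eqE /= in hb; rewrite (negbTE hb) mulr0.
Qed.

(** F b has no coordinate before position b, and later ones are absorbed by the top form, so each
    factor contributes its diagonal entry by [wedge_top]. *)
Lemma wedges_tri (F : nat -> nat -> P) (c : nat -> P) i d :
  (forall b a, (n <= a)%N -> F b a = 0) ->
  (forall b a, (i <= b < i + d)%N -> (a < b)%N -> F b a = 0) ->
  (forall b, (i <= b < i + d)%N -> F b b = c b) -> (i + d <= n)%N ->
  forall s, wedges F (iota i d) (top (i + d)) s = (\prod_(b <- iota i d) c b) * top i s.
Proof.
elim: d i => [|d IH] i hn h0 h1 hd s /=; first by rewrite big_nil mul1r addn0.
rewrite -addSnnS big_cons.
rewrite (@wedge_eq _ _ _ (fun s => (\prod_(b <- iota i.+1 d) c b) * top i.+1 s)).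
  rewrite wedgeZ wedge_top ?h1; [|lia|lia| |by move=> a; apply: hn].
    by rewrite mulrCA mulrA.
  by move=> a ha; apply: h0 => //; lia.
move=> t; apply: IH => //.
- by move=> b a hb; apply: h0; lia.
- by move=> b hb; apply: h1; lia.
- lia.
Qed.

End Wedges.

(** * The case i = N - 2, in Lagrange coordinates *)

Section CoreTop.
Variables (k : closedFieldType) (N : nat).
Hypothesis N2 : (2 <= N)%N.
Hypothesis charN : forall l, (0 < l <= N)%N -> (l%:R : k) != 0.
Local Notation Q := {mpoly k[N.+1]}.
Local Notation n := (N.*2.-1).
Local Notation MP := (@mpolyC N.+1 k).

Implicit Types (y : {poly Q}).

(** The points 0, ..., N are distinct because 1, ..., N are invertible in k. *)
Definition pt (j : 'I_N.+1) : k := (val j)%:R.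

Lemma pt_inj : injective pt.
Proof.
move=> i j; rewrite /pt => e; apply/val_inj/eqP; apply: contraT => ne.
wlog l : i j e ne / (i < j)%N => [H|].
  have [l|l] := ltnP i j; first exact: (H i j).
  by apply: (H j i) => //; [rewrite eq_sym | rewrite ltn_neqAle eq_sym ne].
have : ((j - i)%:R : k) != 0 by apply: charN; have := ltn_ord j; move: l; rewrite /=; lia.
by rewrite natrB ?(ltnW l) // -e subrr eqxx.
Qed.

Definition lagQ j : {poly Q} := map_poly MP (lag pt j).
(** The generic polynomial of degree N whose values at the points [pt j] are the variables up to the
    constants [kap j]; splitting at such a point costs a power of one variable. *)
Definition ug : {poly Q} := \sum_j 'X_j *: lagQ j.

Lemma ug_coef b : ug`_b = \sum_j (lag pt j)`_b *: 'X_j.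
Proof.
rewrite /ug coef_sum; apply: eq_bigr => j _.
by rewrite coefZ coef_map /= mulrC mul_mpolyC.
Qed.

Lemma ug_homog b : ug`_b \is 1.-homog.
Proof.
rewrite ug_coef; apply: rpred_sum => j _; apply: rpredZ.
by rewrite dhomogX; apply/eqP; apply: mdeg1.
Qed.

Lemma size_ug : (size ug <= N.+1)%N.
Proof.
rewrite (leq_trans (size_sum _ _ _)) //; apply/bigmax_leqP => j _.
rewrite (leq_trans (size_scale_leq _ _)) // (leq_trans (size_poly _ _)) //.
by rewrite size_lag.
Qed.

Definition kap j : k := (lag pt j).[pt j].

Lemma kap_neq0 j : kap j != 0.
Proof. exact: lag_neq0 pt_inj j. Qed.

Lemma ug_at j : ug.[(pt j)%:MP] = kap j *: 'X_j.
Proof.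
rewrite /ug horner_sum (bigD1 j) //= big1 ?addr0 => [|l ne].
  by rewrite hornerZ horner_map /= mulrC mul_mpolyC.
by rewrite hornerZ horner_map /= lag_at eq_sym (negbTE ne) mulr0n mpolyC0 mulr0.
Qed.

Lemma ug_at_neq0 j : ug.[(pt j)%:MP] != 0.
Proof. by rewrite ug_at scaler_eq0 negb_or kap_neq0 -msupp_eq0 msuppX. Qed.

Definition wv (b : nat) : nat -> Q := cf (Wr ug 'X^b).

Lemma Wr_size y : (size y <= N.+1)%N -> (size (Wr ug y) <= n)%N.
Proof. by move=> sy; apply: size_Wr sy; apply: size_ug. Qed.

Lemma cf_supp y : (size y <= N.+1)%N -> forall a, (n <= a)%N -> cf (Wr ug y) a = 0.
Proof. by move=> sy a ha; rewrite /cf nth_default // (leq_trans (Wr_size sy)). Qed.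

Lemma wv_supp b a : (b <= N)%N -> (n <= a)%N -> wv b a = 0.
Proof. by move=> hb; apply: cf_supp; rewrite size_polyXn. Qed.

Lemma Wr_lin y : (size y <= N.+1)%N ->
  Wr ug y = \sum_(b < N.+1) y`_b *: Wr ug 'X^b.
Proof.
move=> sy; rewrite -{1}[y]coefK poly_def Wr_sum.
rewrite (big_ord_widen N.+1 (fun b => Wr ug (y`_b *: 'X^b))) // big_mkcond.
apply: eq_bigr => b _; rewrite WrZr; case: ltnP => // h.
by rewrite nth_default // scale0r.
Qed.

Lemma cf_Wr_lin y : (size y <= N.+1)%N ->
  cf (Wr ug y) = fun a => \sum_(b < N.+1) y`_b * wv b a.
Proof.
move=> sy; apply: functional_extensionality => a.
by rewrite /cf Wr_lin // coef_sum; apply: eq_bigr => b _; rewrite coefZ.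
Qed.

Lemma uw_rel a : \sum_(b < N.+1) ug`_b * wv b a = 0.
Proof.
have := congr1 (fun f => f a) (cf_Wr_lin size_ug).
by rewrite /cf Wrr coef0 => <-.
Qed.

Definition inv (l : nat) : Q := (l%:R^-1)%:MP.

Lemma invP l : (0 < l <= N)%N -> inv l * l%:R = 1.
Proof.
move=> h; have -> : (l%:R : Q) = (l%:R : k)%:MP by rewrite mpolyC_nat.
by rewrite /inv -mpolyCM mulVf ?charN.
Qed.

Lemma Nn : (N <= n)%N. Proof. lia. Qed.

(** [local_splitting] for y = x^b, read at the coefficient of x^b'. Its term y(a) u becomes [ta],
    and [kp] normalises the constant. *)
Lemma split_sg j : exists (sg : 'I_N.+1 -> nat -> Q) (ta : 'I_N.+1 -> Q),
  (forall b b' : 'I_N.+1,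
     ip n (sg b') (wv b) + ta b * ug`_b' = ('X_j ^+ N : Q) *+ (b == b'))
  /\ \sum_b ta b * ug`_b = 'X_j ^+ N.
Proof.
have [|rho hrho] := local_splitting Nn invP (ug_at_neq0 j) size_ug; first by lia.
set a : Q := (pt j)%:MP in hrho; set U := ug.[a] in hrho.
have UE : U = kap j *: 'X_j by rewrite /U ug_at.
pose kp : Q := ((kap j)^-1 ^+ N)%:MP.
have kU : kp * U ^+ N = 'X_j ^+ N.
  rewrite UE -mul_mpolyC exprMn mulrA -rmorphXn -mpolyCM -exprMn mulVf ?kap_neq0 //.
  by rewrite expr1n mpolyC1 mul1r.
have US : U ^+ N = U ^+ N.-1 * U by rewrite -exprSr prednK //; lia.
pose sg0 b c := (('X - a%:P) * \poly_(b < N) rho b c)`_b.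
exists (fun b c => kp * sg0 b c), (fun b => kp * (U ^+ N.-1 * a ^+ b)); split.
  move=> b b'.
  have ipk : ip n (fun c => kp * sg0 b' c) (wv b) = kp * ip n (sg0 b') (wv b).
    by rewrite /ip mulr_sumr; apply: eq_bigr => c _; rewrite mulrA.
  have -> : ip n (fun c => kp * sg0 b' c) (wv b)
    = kp * (('X - a%:P) * \poly_(i < N) ip n (rho i) (wv b))`_b'.
    rewrite ipk; congr (_ * _); rewrite /ip /sg0.
    transitivity ((('X - a%:P) * \sum_(c < n) wv b c *: \poly_(i < N) rho i c)`_b').
      rewrite mulr_sumr coef_sum; apply: eq_bigr => c _.
      by rewrite -scalerAr coefZ mulrC.
    apply: (congr1 (fun q : {poly Q} => (('X - a%:P) * q)`_b')); apply/polyP => i; rewrite coef_sum coef_poly.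
    case: ltnP => hi; last by rewrite big1 // => c _; rewrite coefZ coef_poly ltnNge hi mulr0.
    by rewrite /ip; apply: eq_bigr => c _; rewrite coefZ coef_poly hi mulrC.
  rewrite hrho ?size_polyXn ?Wr_size ?size_polyXn //.
  rewrite hornerXn !(coefZ, coefB) coefXn -kU US (eq_sym b) -val_eqE /=.
  by case: eqP => _ /=; rewrite ?mulr1n ?mulr0n ?mulr1 ?mulr0; ring.
transitivity (kp * (U ^+ N.-1 * U)); last by rewrite -US.
rewrite {3}/U (horner_coef_wide _ size_ug) !mulr_sumr; apply: eq_bigr => b _; ring.
Qed.

Lemma one_lt : (1 < N.+1)%N. Proof. by rewrite ltnS ltnW. Qed.
Definition j1 : 'I_N.+1 := Ordinal one_lt.

(** A basis of the polynomials of degree at most N vanishing at 1. It spans a complement of u on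
    which [local_splitting] has no term y(a) u. *)
Definition yb (b : nat) : {poly Q} := ('X - 1%:P) * 'X^b.

Lemma size_yb b : (b < N)%N -> (size (yb b) <= N.+1)%N.
Proof.
by move=> hb; rewrite (leq_trans (size_polyMleq _ _)) // size_XsubC size_polyXn; lia.
Qed.

Definition yw b := cf (Wr ug (yb b)).
Local Notation U := (ug.[1]).

Lemma U_at : U = kap j1 *: 'X_j1.
Proof. by rewrite -ug_at /pt mpolyC1. Qed.

Lemma U_neq0 : U != 0.
Proof. by have := ug_at_neq0 j1; rewrite /pt mpolyC1. Qed.

Lemma ug0_at : ug`_0 = kap ord0 *: 'X_ord0.
Proof. by rewrite -horner_coef0 -ug_at /pt mpolyC0. Qed.

Lemma ug0_neq0 : ug`_0 != 0.
Proof. by rewrite ug0_at scaler_eq0 negb_or kap_neq0 -msupp_eq0 msuppX. Qed.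

Lemma split_rho : exists rho : nat -> nat -> Q, forall b b', (b < N)%N -> (b' < N)%N ->
  ip n (rho b') (yw b) = (U ^+ N) *+ (b == b').
Proof.
have [||rho hrho] := local_splitting Nn invP _ size_ug (a := 1); [exact: U_neq0 | lia |].
exists rho => b b' hb hb'.
have := hrho (yb b); rewrite size_yb // Wr_size ?size_yb // => /(_ isT isT).
have -> : (yb b).[1] = 0 by rewrite /yb hornerM hornerXsubC subrr mul0r.
rewrite scale0r subr0 scalerA -exprSr prednK; last by lia.
rewrite {2}/yb scalerAr => e.
have nz : 'X - (1 : Q)%:P != 0 by rewrite polyXsubC_eq0.
have /(congr1 (fun q : {poly Q} => q`_b')) := mulfI nz e.
rewrite coef_poly hb' coefZ coefXn => ->.
by rewrite mulr_natr eq_sym.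
Qed.

Lemma two_neq0 : (2%:R : k) != 0.
Proof. by apply: charN. Qed.

Lemma two_regQ (x : Q) : x + x = 0 -> x = 0.
Proof.
rewrite -mulr2n -mulr_natl => /eqP; rewrite mulf_eq0 => /orP[|/eqP //].
by rewrite -mpolyC_nat mpolyC_eq0 (negbTE two_neq0).
Qed.

Implicit Types (al be : seq nat -> Q).

(** The image of (phi_b) -> sum_b w_b /\ phi_b on tensors phi_b of degree N - d. *)
Definition imageW d al := exists2 phi : 'I_N.+1 -> seq nat -> Q,
  forall b, [/\ alt (phi b), supp n (phi b) & forall s, (size s + d != N)%N -> phi b s = 0]
  & forall s, al s = \sum_(b < N.+1) wedge (wv b) (phi b) s.

Lemma imageW_D d al be : imageW d al -> imageW d be -> imageW d (fun s => al s + be s).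
Proof.
move=> [f hf ef] [g hg eg]; exists (fun b s => f b s + g b s).
  move=> b; have [a1 a2 a3] := hf b; have [b1 b2 b3] := hg b; split.
  - by move=> s1 x y s2; rewrite a1 b1 opprD.
  - by move=> s hs; rewrite a2 // b2 // addr0.
  - by move=> s hs; rewrite a3 // b3 // addr0.
by move=> s; rewrite ef eg -big_split; apply: eq_bigr => b _ /=; rewrite wedgeD.
Qed.

Lemma imageW_Z d c al : imageW d al -> imageW d (fun s => c * al s).
Proof.
move=> [f hf ef]; exists (fun b s => c * f b s).
  move=> b; have [a1 a2 a3] := hf b; split.
  - by move=> s1 x y s2; rewrite a1 mulrN.
  - by move=> s hs; rewrite a2 // mulr0.
  - by move=> s hs; rewrite a3 // mulr0.
by move=> s; rewrite ef mulr_sumr; apply: eq_bigr => b _ /=; rewrite wedgeZ.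
Qed.

Lemma imageW_eq d al be : al =1 be -> imageW d al -> imageW d be.
Proof. by move=> e [f hf ef]; exists f => // s; rewrite -e. Qed.

Lemma imageW_wedge d y al : (size y <= N.+1)%N -> alt al -> supp n al ->
  (forall s, (size s + d != N)%N -> al s = 0) -> imageW d (wedge (cf (Wr ug y)) al).
Proof.
move=> sy h1 h2 h3; exists (fun b s => y`_b * al s).
  move=> b; split.
  - by move=> s1 x z s2; rewrite h1 mulrN.
  - by move=> s hs; rewrite h2 // mulr0.
  - by move=> s hs; rewrite h3 // mulr0.
move=> s; rewrite cf_Wr_lin // wedge_linl; apply: eq_bigr => b _.
by rewrite wedgeZ.
Qed.

Section Rho.
Variable rho : nat -> nat -> Q.
Hypothesis rhoP : forall b b', (b < N)%N -> (b' < N)%N ->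
  ip n (rho b') (yw b) = (U ^+ N) *+ (b == b').

Fixpoint contr_seq bs al := if bs is b :: bs' then contr_seq bs' (contr n (rho b) al) else al.

Lemma contr_seqD bs al be s : contr_seq bs (fun s => al s + be s) s = contr_seq bs al s + contr_seq bs be s.
Proof.
elim: bs al be => [|b bs IH] al be //=; rewrite -IH.
by congr (contr_seq bs _ s); apply: functional_extensionality => t; rewrite contrD.
Qed.

Lemma contr_seqZ bs c al s : contr_seq bs (fun s => c * al s) s = c * contr_seq bs al s.
Proof.
elim: bs al => [|b bs IH] al //=; rewrite -IH.
by congr (contr_seq bs _ s); apply: functional_extensionality => t; rewrite contrZ.
Qed.

Lemma contr_seq_wedge bs b al s : (b < N)%N -> all (ltn^~ N) bs -> b \notin bs ->
  contr_seq bs (wedge (yw b) al) s = (-1) ^+ size bs * wedge (yw b) (contr_seq bs al) s.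
Proof.
move=> hb; elim: bs al => [|c bs IH] al /=; first by rewrite mul1r.
case/andP=> hc hbs; rewrite inE negb_or => /andP[bc bbs].
rewrite (_ : contr n (rho c) (wedge (yw b) al)
    = fun s => (-1) * wedge (yw b) (contr n (rho c) al) s); last first.
  apply: functional_extensionality => t.
  by rewrite contr_wedge rhoP // (negbTE bc) mulr0n mul0r sub0r mulN1r.
by rewrite contr_seqZ IH // exprS mulrA.
Qed.

Lemma contr_seq_inv bs j al : alt al -> supp n al -> tdeg (size bs + j)%N al ->
  [/\ alt (contr_seq bs al), supp n (contr_seq bs al) & tdeg j (contr_seq bs al)].
Proof.
elim: bs al => [|b bs IH] al //= h1 h2 h3.
by apply: IH; [apply: alt_contr | apply: supp_contr | apply: tdeg_contr].
Qed.

(** The form e_N /\ ... /\ e_(2N-2): its degree N - 1 is such that wedging with N Wronskian vectors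
    reaches the top degree 2 N - 1. *)
Definition x0 : seq nat -> Q := top Q n N.

Lemma yw_supp b a : (b < N)%N -> (n <= a)%N -> yw b a = 0.
Proof. by move=> hb; apply/cf_supp/size_yb. Qed.

Lemma supp_wedges_yw bs : all (ltn^~ N) bs -> supp n (wedges yw bs x0).
Proof.
elim: bs => [|b bs IH] /=; first by move=> _; apply: supp_top; apply: Nn.
by case/andP=> hb /IH h; apply: supp_wedge => // a; apply: yw_supp.
Qed.

(** With i_b the contraction with rho_b, the antiderivation rule reads U^N al = i_b (yw_b /\ al) +
    yw_b /\ i_b al. The last term lies in the image and stays there under the other contractions,
    which anticommute with the wedge by yw_b. *)
Lemma telescope bs : uniq bs -> all (ltn^~ N) bs ->
  imageW 2 (fun s => (U ^+ N) ^+ size bs * x0 s - contr_seq bs (wedges yw bs x0) s).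
Proof.
elim: bs => [|b bs IH] /=.
  move=> _ _; exists (fun _ _ => 0).
    by move=> b; split=> // s1 x y s2; rewrite oppr0.
  move=> s; rewrite mul1r subrr big1 // => b _.
  exact: wedge0r.
case/andP=> bbs us /andP[hb hbs].
set Y := wedges yw bs x0.
have altY : alt Y by apply/alt_wedges/alt_top.
have suppY : supp n Y by apply: supp_wedges_yw.
have degY : tdeg (size bs + N.-1)%N Y.
  by apply: tdeg_wedges; have := @tdeg_top Q n N; rewrite (_ : n - N = N.-1)%N //; lia.
have degc : tdeg (size bs + (N - 2))%N (contr n (rho b) Y).
  by apply: tdeg_contr; move: degY; rewrite (_ : N.-1 = (N - 2).+1) ?addnS //; lia.
have [c1 c2 c3] := contr_seq_inv (alt_contr n (rho b) altY) (@supp_contr _ n n (rho b) _ suppY) degc.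
have h := IH us hbs; rewrite -/Y in h.
have h2 : imageW 2 (wedge (yw b) (contr_seq bs (contr n (rho b) Y))).
  apply: imageW_wedge => //; first exact: size_yb.
  by move=> s hs; apply: c3; move: hs; lia.
apply: imageW_eq (imageW_D (imageW_Z (U ^+ N) h) (imageW_Z ((-1) ^+ size bs) h2)) => s.
have e : U ^+ N * contr_seq bs Y s = contr_seq bs (contr n (rho b) (wedge (yw b) Y)) s
    + (-1) ^+ size bs * wedge (yw b) (contr_seq bs (contr n (rho b) Y)) s.
  rewrite -contr_seqZ -contr_seq_wedge // -contr_seqD; congr (contr_seq bs _ s).
  apply: functional_extensionality => t.
  by rewrite contr_wedge rhoP // eqxx mulr1n subrK.
by rewrite mulrBr e exprS; ring.
Qed.

Lemma wedges_map (I J : Type) (f : I -> J) (F : J -> nat -> Q) bs al :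
  wedges F (map f bs) al = wedges (fun i => F (f i)) bs al.
Proof. by rewrite /wedges foldr_map. Qed.

Lemma yw_coef b c : (c <= b)%N -> yw b.+1 c = - (ug`_0 *+ b.+1 *+ (b == c)).
Proof.
move=> h; have h2 : (c < b.+1)%N by lia.
rewrite /yw /cf /yb mulrBl -exprS mul1r WrBr coefB.
rewrite (coef_WrXn _ h2) (@coef_WrXn _ _ b.+2 c); last by lia.
rewrite eqSS (@gtn_eqF c b.+1) // mulr0n sub0r.
by rewrite eqSS.
Qed.

(** U x^N - u vanishes at 1, which allows u_0 yw_0 to be replaced by U w_N in the product. Then w_N
    /\ x0 contributes N u_0, and each of the other N - 1 vectors yw_b contributes u_0 by
    triangularity. Of these N factors u_0 one pays for the replacement. *)
Lemma wedges_yw_x0_div : exists om : seq nat -> Q, forall s,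
  wedges yw (iota 0 N) x0 s = ug`_0 ^+ N.-1 * om s.
Proof.
have eN : iota 0 N = 0%N :: iota 1 N.-1 by rewrite -{1}(prednK (ltnW N2)).
set T := wedges yw (iota 1 N.-1) x0.
pose p := U *: 'X^N - ug.
have /factor_theorem[q hq] : root p 1.
  by rewrite rootE /p hornerD hornerN hornerZ hornerXn expr1n mulr1 subrr.
have sp : (size p <= N.+1)%N.
  rewrite (leq_trans (size_polyD _ _)) // geq_max size_polyN size_ug andbT.
  by rewrite (leq_trans (size_scale_leq _ _)) // size_polyXn.
have sq : (size q <= N)%N.
  have [->|q0] := eqVneq q 0; first by rewrite size_poly0.
  by move: sp; rewrite hq size_Mmonic ?monicXsubC // size_XsubC addn2.
have q0 : q`_0 = ug`_0.
  have := congr1 (fun f : {poly Q} => f.[0]) hq.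
  rewrite /p hornerM !hornerE !horner_coef0 expr0n.
  rewrite (_ : (N == 0)%N = false); last by lia.
  by rewrite mulr0 !sub0r mulrN1 => /oppr_inj.
have hW : (fun a => U * wv N a) = fun a => \sum_(b < N) q`_b * yw b a.
  apply: functional_extensionality => a.
  have -> : U * wv N a = (Wr ug p)`_a by rewrite /p WrBr Wrr subr0 WrZr coefZ.
  have -> : p = \sum_(b < N) q`_b *: yb b.
    rewrite hq -{1}(coefK q) poly_def (big_ord_widen N (fun b => q`_b *: 'X^b)) // big_mkcond.
    rewrite mulr_suml; apply: eq_bigr => b _; rewrite /yb.
    case: ltnP => h; first by rewrite mulrC -scalerAr.
    by rewrite mul0r nth_default // scale0r.
  by rewrite Wr_sum coef_sum; apply: eq_bigr => b _; rewrite WrZr coefZ.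
have E1 s : U * wedge (wv N) T s = ug`_0 * wedges yw (iota 0 N) x0 s.
  rewrite -wedgeZl hW wedge_linl eN /= -/T.
  have N0 : (0 < N)%N by lia.
  rewrite (bigD1 (Ordinal N0)) //= q0 big1 ?addr0 // => b hb.
  rewrite /T (wedges_dup two_regQ) ?mulr0 // mem_iota.
  by move: hb; rewrite -val_eqE /=; have := ltn_ord b; lia.
pose c : Q := \prod_(b <- iota 0 N.-1) - b.+1%:R.
have E2 s : wedges yw (iota 1 N.-1) (top Q n N.-1) s = c * ug`_0 ^+ N.-1 * top Q n 0 s.
  rewrite (iotaDl 1 0) wedges_map.
  have /= h := @wedges_tri _ two_regQ n (fun b => if (b < N.-1)%N then yw b.+1 else fun=> 0)
    (fun b => - b.+1%:R * ug`_0) 0 N.-1.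
  transitivity (wedges (fun b => if (b < N.-1)%N then yw b.+1 else fun=> 0) (iota 0 N.-1)
     (top Q n N.-1) s).
    have : all (ltn^~ N.-1) (iota 0 N.-1) by apply/allP => b; rewrite mem_iota.
    elim: (iota 0 N.-1) s => [|b bs IH] s //= /andP[-> hbs].
    by apply: wedge_eq => t; apply: IH.
  rewrite h.
  - rewrite big_split /= -/c; congr (_ * _ * _).
    by rewrite big_const_seq count_predT size_iota -Monoid.iteropE.
  - by move=> b a ha; case: ifP => // hb; apply: yw_supp => //; lia.
  - move=> b a hb ab; case: ifP => // hb'.
    by rewrite yw_coef; [rewrite gtn_eqF ?mulr0n ?oppr0 // | lia].
  - move=> b hb; rewrite ifT; last by lia.
    by rewrite yw_coef // eqxx mulr1n mulNr mulr_natl.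
  - lia.
have E3 s : wedge (wv N) x0 s = N%:R * ug`_0 * top Q n N.-1 s.
  have -> : x0 = top Q n N.-1.+1 by rewrite prednK //; lia.
  rewrite (wedge_top two_regQ).
  - rewrite /wv /cf coef_WrXn; last by lia.
    by rewrite prednK ?eqxx ?mulr1n; [rewrite mulr_natl | lia].
  - lia.
  - move=> a ha; rewrite /wv /cf coef_WrXn; last by lia.
    by have -> : (N == a.+1)%N = false by [lia].
  - by move=> a ha; apply: wv_supp.
exists (fun s => U * (-1) ^+ N.-1 * (N%:R * c * top Q n 0 s)) => s.
apply: (mulfI ug0_neq0); rewrite -E1.
have -> : wedge (wv N) T s = (-1) ^+ N.-1 * wedges yw (iota 1 N.-1) (wedge (wv N) x0) s.
  by rewrite wedges_comm size_iota mulrA -exprMn mulrNN mulr1 expr1n mul1r.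
rewrite (wedges_eq _ _ E3).
have WZ bs cc al t : wedges yw bs (fun s => cc * al s) t = cc * wedges yw bs al t.
  elim: bs t => [|b bs IH] t //=; rewrite -wedgeZ; exact: wedge_eq.
rewrite WZ E2; ring.
Qed.

End Rho.

(** N contractions cost U^N each. The exponent N - 1 of u_0 is one more than the degree N - 2 of the
    forms F, which is what finally makes this term disappear. *)
Lemma x0_mod_imageW : exists q, imageW 2 (fun s => U ^+ (N * N) * x0 s - ug`_0 ^+ N.-1 * q s).
Proof.
have [rho hrho] := split_rho.
have [om hom] := wedges_yw_x0_div.
exists (contr_seq rho (iota 0 N) om).
have hall : all (ltn^~ N) (iota 0 N) by apply/allP => b; rewrite mem_iota.
apply: imageW_eq (telescope hrho (iota_uniq 0 N) hall) => s.
rewrite size_iota -exprM -contr_seqZ; congr (_ - contr_seq _ _ _ _).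
exact: functional_extensionality.
Qed.

End CoreTop.

Section Homog.
Variables (k : fieldType) (n n' : nat).

Lemma comp_homog (mf : measure n') c d (p : {mpoly k[n]}) (lq : n.-tuple {mpoly k[n']}) :
  p \is d.-homog -> (forall i, tnth lq i \is c.-homog for mf) ->
  p \mPo lq \is (c * d)%N.-homog for mf.
Proof.
move=> /dhomogP hp hq; rewrite comp_mpolyE big_seq; apply: rpred_sum => m hm.
apply: rpredZ; rewrite -(hp _ hm) /= mdegE big_distrr /=.
elim/big_rec2: _ => [|i y1 y2 _ IH]; first exact: dhomog1.
by apply: dhomogM => //; apply: dhomogMn.
Qed.

Lemma comp_homog0 (mf : measure n') (p : {mpoly k[n]}) (lq : n.-tuple {mpoly k[n']}) :
  (forall i, tnth lq i \is 0.-homog for mf) -> p \mPo lq \is 0.-homog for mf.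
Proof.
move=> hq; rewrite comp_mpolyE; apply: rpred_sum => m _; apply: rpredZ.
elim/big_ind: _ => [|x y hx hy|i _]; first exact: dhomog1.
  by have := dhomogM hx hy; rewrite addn0.
by have := dhomogMn (m i) (hq i); rewrite mul0n.
Qed.

Definition mdeg0 d (p : {mpoly k[n]}) := forall m : 'X_{1..n}, mdeg m = d -> p@_m = 0.

Lemma mdeg0M d e (p q : {mpoly k[n]}) : p \is e.-homog -> mdeg0 d q -> mdeg0 (e + d) (p * q).
Proof.
move=> hp hq mm hmm; rewrite mcoeffM big1 // => -[m1 m2] /= /eqP e1.
have [h|h] := eqVneq (mdeg (m1 : 'X_{1..n})) e; last first.
  by rewrite (dhomog_nemf_coeff hp) ?mul0r.
have e2 : mdeg mm = (mdeg (m1 : 'X_{1..n}) + mdeg (m2 : 'X_{1..n}))%N.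
  by rewrite -mdegD; exact: congr1 e1.
have sub (x y z t : nat) : x = (y + t)%N -> z = y -> x = (z + d)%N -> t = d by lia.
by rewrite hq ?mulr0 //; apply: (sub _ _ _ _ e2 _ (etrans hmm _)) => //; rewrite h.
Qed.

Lemma mdeg0B d (p q : {mpoly k[n]}) : mdeg0 d p -> mdeg0 d q -> mdeg0 d (p - q).
Proof. by move=> hp hq m hm; rewrite mcoeffB hp // hq // subrr. Qed.

Lemma mdeg0_wedge d g al s : (forall a, g a \is 1.-homog) ->
  (forall s, mdeg0 d (al s)) -> mdeg0 d.+1 (wedge g al s).
Proof.
move=> hg; elim: s al => [|a s IH] al h /=; first by move=> m _; rewrite mcoeff0.
by apply: mdeg0B; [rewrite -add1n; apply: mdeg0M | apply: IH].
Qed.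

Lemma mdeg0_homog d (p : {mpoly k[n]}) : p \is d.-homog -> mdeg0 d p -> p = 0.
Proof.
move=> hp h; apply/mpolyP => m; rewrite mcoeff0.
have [e|e] := eqVneq (mdeg m) d; first exact: h.
by rewrite (dhomog_nemf_coeff hp).
Qed.

End Homog.

Section CoreTop2.
Variables (k : closedFieldType) (N : nat).
Hypothesis N2 : (2 <= N)%N.
Hypothesis charN : forall l, (0 < l <= N)%N -> (l%:R : k) != 0.
Local Notation Q := {mpoly k[N.+1]}.
Local Notation P := {mpoly k[N.+1 + N.+1]}.
Local Notation n := (N.*2.-1).
Local Notation ug := (@ug k N).
Local Notation wv := (@wv k N).
Variable F : nat -> Q.
Hypothesis hF : forall b, (b <= N)%N -> ip n F (wv b) = 0.
Hypothesis hFh : forall e, (e < n)%N -> F e \is (N - 2)%N.-homog.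

Definition y0 := contr n F (@x0 k N).

(** Since F is orthogonal to all w_b, contraction with F passes through the wedges with w_b up to
    sign. *)
Lemma y0_mod_imageW : exists (q : seq nat -> Q) (phi : 'I_N.+1 -> seq nat -> Q),
  (forall b, [/\ alt (phi b), supp n (phi b) & forall s, (size s + 3 != N)%N -> phi b s = 0])
  /\ forall s, ug.[1] ^+ (N * N) * y0 s
     = ug`_0 ^+ N.-1 * q s + \sum_(b < N.+1) wedge (wv b) (phi b) s.
Proof.
have [q [phi hphi e]] := x0_mod_imageW N2 charN.
exists (contr n F q), (fun b s => - contr n F (phi b) s); split.
  move=> b; have [a1 a2 a3] := hphi b; split.
  - by move=> s1 x y s2; rewrite (alt_contr n F a1).
  - by move=> s hs; rewrite (@supp_contr _ n n F _ a2) // oppr0.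
  - move=> s hs; rewrite /contr big1 ?oppr0 // => a _.
    by rewrite a3 ?mulr0 //=; move: hs; lia.
move=> s; rewrite -!contrZ.
have -> : (fun s => ug.[1] ^+ (N * N) * x0 k N s)
  = fun s => ug`_0 ^+ N.-1 * q s + \sum_(b < N.+1) 1 * wedge (wv b) (phi b) s.
  apply: functional_extensionality => t.
  by rewrite (eq_bigr _ (fun b _ => mul1r _)) -e addrCA subrr addr0.
rewrite contrD; congr (_ + _); rewrite contr_lin; apply: eq_bigr => b _.
by rewrite mul1r contr_wedge hF ?mul0r ?sub0r ?wedgeN // -ltnS.
Qed.

Definition iT : N.+1.-tuple P := [tuple 'X_(lshift N.+1 j) | j < N.+1].
Definition io (p : Q) : P := p \mPo iT.
HB.instance Definition _ := GRing.RMorphism.copy io (comp_mpoly iT).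

Lemma ioM p q : io (p * q) = io p * io q.
Proof. exact: rmorphM. Qed.

Lemma io_X j : io 'X_j = 'X_(lshift N.+1 j).
Proof. by rewrite /io comp_mpolyXU -tnth_nth tnth_mktuple. Qed.

Lemma io_Z c p : io (c *: p) = c *: io p.
Proof. exact: comp_mpolyZ. Qed.

Lemma io_xh p : io p \is 0.-homog for (@xdeg N.+1).
Proof.
by apply: comp_homog0 => i; rewrite tnth_mktuple; have := @Xl_homog k N.+1 i 1; rewrite expr1.
Qed.

Lemma io_homog d p : p \is d.-homog -> io p \is d.-homog.
Proof.
move=> hp; rewrite -[d]mul1n; apply: comp_homog => // i.
by rewrite tnth_mktuple dhomogX; apply/eqP; apply: mdeg1.
Qed.

Lemma io_inj : injective io.
Proof.
pose lq : (N.+1 + N.+1).-tuple Q := [tuple if split i is inl j then 'X_j else 0 | i < N.+1 + N.+1].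
suff h : cancel io (comp_mpoly lq) by apply: can_inj h.
move=> p; rewrite [RHS]mpolyE /io (comp_mpolyE p) raddf_sum /=; apply: eq_bigr => m _.
rewrite comp_mpolyZ rmorph_prod /=; congr (_ *: _).
rewrite mpolyXE_id; apply: eq_bigr => i _.
rewrite rmorphXn /= tnth_mktuple comp_mpolyXU -tnth_nth tnth_mktuple.
by have := unsplitK (inl i : 'I_N.+1 + 'I_N.+1); rewrite /= => ->.
Qed.

Definition wP (b : 'I_N.+1) a : P := io (wv b a).
Definition uP (b : 'I_N.+1) : P := io ug`_b.

Lemma wP_wedge (b : 'I_N.+1) (al : seq nat -> Q) s :
  wedge (wP b) (io \o al) s = io (wedge (wv b) al s).
Proof. by rewrite (@wedge_map _ _ io _ (wP b)) // => a x; apply: ioM. Qed.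

Lemma wP0 b a : wP b a \is 0.-homog for (@xdeg N.+1). Proof. exact: io_xh. Qed.
Lemma uP0 b : uP b \is 0.-homog for (@xdeg N.+1). Proof. exact: io_xh. Qed.
Lemma wP_supp b a : (n <= a)%N -> wP b a = 0.
Proof. by move=> ha; rewrite /wP wv_supp ?rmorph0 //; have := ltn_ord b. Qed.
Lemma uwP a : \sum_b uP b * wP b a = 0.
Proof.
transitivity (io (\sum_(b < N.+1) ug`_b * wv b a)); last by rewrite uw_rel rmorph0.
by rewrite rmorph_sum; apply: eq_bigr => b _; rewrite rmorphM.
Qed.

Lemma splitP_P (j : 'I_N.+1) : exists sg ta, splitting n wP uP j N sg ta.
Proof.
have [sg [ta [h1 h2]]] := split_sg N2 charN j.
exists (fun b a => io (sg b a)), (fun b => io (ta b)); split.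
- by move=> b a; apply: io_xh.
- by move=> b; apply: io_xh.
- move=> b b'; rewrite -io_X -rmorphXn -rmorphMn -h1 rmorphD rmorphM rmorph_sum /=.
  by congr (_ + _); apply: eq_bigr => a _; rewrite rmorphM.
- by rewrite -io_X -rmorphXn -h2 rmorph_sum; apply: eq_bigr => b _; rewrite rmorphM.
Qed.

(** By [y0_mod_imageW], z = sum_b X_b phi_b is a cycle of degree 1 modulo powers of x_0 and x_1. By
    exactness it is a boundary modulo the same powers, so the power of x_1 can be divided out. What
    remains is an identity modulo x_0^(N-1), exact in degree N - 2. *)
Lemma y0_exact : exists psi : 'I_N.+1 -> seq nat -> P, forall s,
  mdeg0 (N - 2) (io (y0 s) - \sum_b wedge (wP b) (psi b) s).
Proof.
have [q [phi [hphi e0]]] := y0_mod_imageW.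
pose k1 : k := @kap k N (j1 N2) ^+ (N * N).
pose k0 : k := @kap k N ord0 ^+ N.-1.
have k1n0 : k1 != 0 by rewrite expf_neq0 // (kap_neq0 N2 charN).
pose j0 : 'I_N.+1 := ord0.
pose v1 : P := 'X_(lshift N.+1 (j1 N2)).
pose v0 : P := 'X_(lshift N.+1 j0).
pose y s := k1%:MP * io (y0 s).
pose q' s := k0%:MP * io (q s).
have e1 s : v1 ^+ (N * N) * y s = v0 ^+ N.-1 * q' s
    + \sum_(b < N.+1) wedge (wP b) (io \o phi b) s.
  rewrite /y /q'; have := congr1 io (e0 s); move: (y0 s) (q s) => Y q1.
  rewrite rmorphD !rmorphM !rmorphXn rmorph_sum /=.
  rewrite (U_at k N2) (ug0_at k N) !io_Z !io_X -/v1 -/v0 -!mul_mpolyC !exprMn -!rmorphXn /=.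
  rewrite -/k1 -/k0 mulrAC mulrC mulrA => ->.
  rewrite [_ * v0 ^+ _]mulrC -mulrA; congr (_ + _).
  by apply: eq_bigr => b _; rewrite wP_wedge.
(* The exponents at 0 and 1 come from [y0_mod_imageW]. The others are h r, with h = N the cost of a
   splitting and r = N - 2. *)
pose e (j : nat) := if j == 0%N then N.-1 else if j == 1%N then (N * N)%N else (N * (N - 2))%N.
pose z (b : bool) s : P := if b then 0 else \sum_(i < N.+1) xX k i * io (phi i s).
have hz : graded_pair n (N - 2) 1 z.
  split.
  - case=> s1 a b s2; rewrite /z ?oppr0 // -sumrN; apply: eq_bigr => i _.
    by have [a1 _ _] := hphi i; rewrite a1 rmorphN mulrN.
  - case=> s hs; rewrite /z // big1 // => i _.
    by have [_ a2 _] := hphi i; rewrite a2 // rmorph0 mulr0.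
  - case=> s hs; rewrite /z // big1 // => i _.
    have [_ _ a3] := hphi i; rewrite a3 ?rmorph0 ?mulr0 //.
    by move: hs; rewrite /=; lia.
  - case=> s; rewrite /z; first exact: rpred0.
    apply: rpred_sum => i _; rewrite mulrC; apply: homogM0; first exact: io_xh.
    exact: xX_homog.
  - by [].
have xcio p : xc (io p) by apply: homog0_xc; apply: io_xh.
have Dzf s : koszulD wP uP z false s = v1 ^+ (N * N) * y s - v0 ^+ N.-1 * q' s.
  rewrite e1 addrAC subrr add0r /koszulD mulr0 addr0 /Wop; apply: eq_bigr => b _.
  apply: wedge_eq => t; rewrite /z raddf_sum /= (bigD1 b) //= big1 ?addr0; last first.
    by move=> i hi; rewrite dXXM eq_sym (negbTE hi) mulr0n add0r xcio mulr0.
  by rewrite dXXM eqxx mulr1n xcio mulr0 addr0.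
have Dzt s : koszulD wP uP z true s = 0.
  rewrite /koszulD /Wop big1 ?oppr0 // => b _; apply: wedge_r0 => t.
  by rewrite /z raddf0.
have DzJ : forall (b : bool) s, inJ e 2 (koszulD wP uP z b s).
  case=> s; first by rewrite Dzt; apply: inJ0.
  rewrite Dzf; apply: inJB; first by have := @inJ_var k N.+1 e (j1 N2) 2 (y s); apply.
  by have := @inJ_var k N.+1 e j0 2 (q' s); apply.
have hspl (j : 'I_N.+1) : (2 <= j)%N -> e j = (N * (N - 2))%N /\
     exists sg, exists ta, splitting n wP uP j N sg ta.
  move=> hj; split; last exact: splitP_P.
  by rewrite /e !ifF //; lia.
have [|||z2 hz2 hz2J] := @exact_mod k N.+1 n (N - 2) wP uP wP0 uP0 wP_supp e N 2
  (two_neq0 N2 charN) uwP hspl _ _ (N - 2).+1 1 2 z _ isT isT hz DzJ; try lia.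
  by move=> l hl; apply: charN; move: hl; lia.
(* r has the same false component of D as z and lies in J_2, hence equals x_1^(N N) h modulo J_1. *)
pose r (b : bool) s := z b s + - koszulD wP uP z2 b s.
have hr : graded_pair n (N - 2) 1 r by apply: ClsD => //; apply: ClsN; apply: (Cls_D wP0 uP0 wP_supp).
pose h (b : bool) s := quov (lshift N.+1 (j1 N2)) (N * N) (r b s).
have hh : graded_pair n (N - 2) 1 h by apply: Cls_quo => // b; rewrite eq_lrshift.
have Dr s : koszulD wP uP r false s = koszulD wP uP z false s.
  rewrite koszulDD koszulDN koszulDK ?oppr0 ?addr0 //.
  - exact: (two_neq0 N2 charN).
  - by move=> b a; apply: homog0_xc; apply: wP0.
  - by move=> b; apply: homog0_xc; apply: uP0.
  - exact: uwP.
have hJ1 s : inJ e 1 (y s - koszulD wP uP h false s).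
  apply: (@inJ_cancel _ _ e (j1 N2) (N * N)); rewrite -/v1.
  have -> : v1 ^+ (N * N) * (y s - koszulD wP uP h false s) = v0 ^+ N.-1 * q' s
     + koszulD wP uP (fun b s => r b s + - (v1 ^+ (N * N) * h b s)) false s.
    rewrite koszulDD koszulDN koszulDZ ?Dr ?Dzf; first by ring.
    by rewrite /v1; apply: Xl_homog.
  apply: inJD; first by have := @inJ_var k N.+1 e j0 1 (q' s); apply.
  apply: inJ_D => b t.
  by have := @inJ_quo k N.+1 e (j1 N2) (r b t); apply; apply: hz2J.
exists (fun b s => (k1^-1)%:MP * dX b (h false s)) => s mm hmm.
have -> : io (y0 s) - \sum_(b < N.+1) wedge (wP b) (fun s => (k1^-1)%:MP * dX b (h false s)) s
  = (k1^-1)%:MP * (y s - koszulD wP uP h false s).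
  have -> : koszulD wP uP h false s = \sum_(b < N.+1) wedge (wP b) (fun s => dX b (h false s)) s.
    have [_ _ _ _ a5] := hh; by rewrite /koszulD a5 // mulr0 addr0.
  rewrite mulrBr /y mulrA -mpolyCM mulVf // mpolyC1 mul1r mulr_sumr.
  by congr (_ - _); apply: eq_bigr => b _; rewrite wedgeZ.
rewrite mul_mpolyC mcoeffZ hJ1 ?mulr0 // => j hj.
rewrite /e ifT; last by lia.
have : (mm (lshift N.+1 j) <= mdeg mm)%N by rewrite mdegE (bigD1 (lshift N.+1 j)) //= leq_addr.
by rewrite hmm; lia.
Qed.

End CoreTop2.

Section CoreTop3.
Variables (k : closedFieldType) (N : nat).
Hypothesis N2 : (2 <= N)%N.
Hypothesis charN : forall l, (0 < l <= N)%N -> (l%:R : k) != 0.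
Local Notation Q := {mpoly k[N.+1]}.
Local Notation P := {mpoly k[N.+1 + N.+1]}.
Local Notation n := (N.*2.-1).
Local Notation ug := (@ug k N).
Local Notation wv := (@wv k N).
Variable F : nat -> Q.
Hypothesis hF : forall b, (b <= N)%N -> ip n F (wv b) = 0.
Hypothesis hFh : forall e, (e < n)%N -> F e \is (N - 2)%N.-homog.

Lemma wedges_sub (R : comNzRingType) (I : Type) (G : I -> nat -> R) bs al be s :
  wedges G bs (fun s => al s - be s) s = wedges G bs al s - wedges G bs be s.
Proof.
elim: bs s => [|b bs IH] s //=; rewrite (wedge_eq _ IH).
by rewrite wedgeD wedgeN.
Qed.

Lemma wedges_sum (R : comNzRingType) (I J : Type) (t : seq J) (G : I -> nat -> R) bs
  (al : J -> seq nat -> R) s :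
  wedges G bs (fun s => \sum_(j <- t) al j s) s = \sum_(j <- t) wedges G bs (al j) s.
Proof.
elim: bs s => [|b bs IH] s //=; rewrite (wedge_eq _ IH).
rewrite [X in wedge _ X](_ : _ = fun s => \sum_(j <- t) 1 * wedges G bs (al j) s).
  by rewrite wedge_lin; apply: eq_bigr => j _; rewrite mul1r.
by apply: functional_extensionality => r; apply: eq_bigr => j _; rewrite mul1r.
Qed.

Lemma wedgesZ (R : comNzRingType) (I : Type) (G : I -> nat -> R) bs c al s :
  wedges G bs (fun s => c * al s) s = c * wedges G bs al s.
Proof.
elim: bs s => [|b bs IH] s //=; rewrite (wedge_eq _ IH).
by rewrite wedgeZ.
Qed.

Lemma contr_wedges (R : comNzRingType) (I : Type) (G : I -> nat -> R) nn f bs al s :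
  (forall b, ip nn f (G b) = 0) ->
  contr nn f (wedges G bs al) s = (-1) ^+ size bs * wedges G bs (contr nn f al) s.
Proof.
move=> h; elim: bs s => [|b bs IH] s /=; first by rewrite mul1r.
by rewrite contr_wedge h mul0r sub0r (wedge_eq _ IH) wedgeZ exprS; ring.
Qed.

Lemma wedges_homog bs s : wedges (ev1 Q) bs (one Q) s \is 0.-homog.
Proof.
elim: bs s => [|b bs IH] s /=.
  by rewrite /one; case: (s == _); [apply: dhomog1 | apply: rpred0].
have W al t : (forall t, al t \is 0.-homog) -> wedge (ev1 Q b) al t \is 0.-homog.
  elim: t al => [|a t IHt] al h /=; first exact: rpred0.
  apply: rpredB; last exact: IHt.
  by rewrite /ev1; case: (a == b); rewrite ?mul1r ?mul0r //; apply: rpred0.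
exact: W.
Qed.

Definition wn (b : nat) : nat -> Q := if (b <= N)%N then wv b else fun=> 0.

Lemma wedges_wn_x0 s : wedges wn (iota 1 N) (@x0 k N) s
  = (\prod_(b <- iota 0 N) b.+1%:R) * ug`_0 ^+ N * top Q n 0 s.
Proof.
rewrite (iotaDl 1 0) wedges_map /x0 -[N in top _ _ N]add0n.
rewrite (wedges_tri (two_regQ N2 charN) (c := fun b => b.+1%:R * ug`_0)).
- rewrite big_split /=; congr (_ * _ * _).
  by rewrite big_const_seq count_predT size_iota -Monoid.iteropE.
- move=> b a ha; rewrite /wn; case: ifP => // hb; apply: wv_supp => //.
- move=> b a hb ab; rewrite /wn; case: ifP => // hb'.
  rewrite /wv /cf coef_WrXn; last by rewrite /=; lia.
  by rewrite eqSS gtn_eqF // mulr0n.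
- move=> b hb; rewrite /wn ifT; last by move: hb; rewrite /=; lia.
  by rewrite /wv /cf coef_WrXn // eqxx mulr1n mulr_natl.
- by rewrite add0n; apply: Nn N2.
Qed.

(** The product w_1 /\ ... /\ w_N kills w_1, ..., w_N, and also u_0 w_0 by sum_b u_b w_b = 0; so u_0
    times it kills y0 in the relevant degree. Up to sign it also carries y0 to the contraction of F
    with w_1 /\ ... /\ w_N /\ x0 = N! u_0^N top 0, which determines F. *)
Lemma wronskian_annihilator_eq0 e : (e < n)%N -> F e = 0.
Proof.
move: e; apply: (contr_top_eq0 (two_regQ N2 charN)) => s.
have [psi hpsi] := y0_exact N2 charN hF.
pose wp b a : P := io (wn b a).
pose bs := iota 1 N.
pose Y := @io k N \o y0 F.
pose E s := io (y0 F s) - \sum_b wedge (wP k b) (psi b) s.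
have wpE (b : 'I_N.+1) : wp b = wP k b by rewrite /wp /wn -ltnS ltn_ord.
have hEbs cs t : mdeg0 (size cs + (N - 2)) (wedges wp cs E t).
  elim: cs t => [|c cs IH] t /=; first exact: hpsi.
  apply: mdeg0_wedge => // a; rewrite /wp /wn; case: ifP => hc; last by rewrite rmorph0 rpred0.
  apply: io_homog; rewrite /wv /cf /Wr coefB !coefM.
  apply: rpredB; apply: rpred_sum => i _; rewrite -[1%N]addn0.
    apply: dhomogM; first exact: ug_homog.
    rewrite coef_deriv coefXn; apply: rpredMn; case: eqP => _; [exact: dhomog1 | exact: rpred0].
  apply: dhomogM; first by rewrite coef_deriv; apply: rpredMn; apply: ug_homog.
  by rewrite coefXn; case: eqP => _; [exact: dhomog1 | exact: rpred0].
have two : forall x : P, x + x = 0 -> x = 0.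
  by apply: two_reg; apply: (two_neq0 N2 charN).
have h1 t : io ug`_0 * wedges wp bs E t = io ug`_0 * wedges wp bs Y t.
  rewrite /E wedges_sub mulrBr -[RHS]subr0; congr (_ - _).
  rewrite wedges_sum mulr_sumr big_ord_recl big1 => [|b _]; last first.
    rewrite (wedges_comm wp) -wpE (wedges_dup two) ?mulr0 // mem_iota /bump /=.
    by rewrite /bump /=; have := ltn_ord b; lia.
  rewrite addr0 (wedges_comm wp) mulrCA -wedgeZl -wpE.
  rewrite [X in wedge X _](_ : _ = fun a => \sum_(b < N) (- io ug`_b.+1) * wp b.+1 a).
    rewrite wedge_linl big1 ?mulr0 // => b _; rewrite (wedges_dup two) ?mulr0 // mem_iota.
    by have := ltn_ord b; lia.
  apply: functional_extensionality => a.
  have := uwP k N a; rewrite big_ord_recl => /eqP; rewrite addr_eq0 => /eqP.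
  rewrite -wpE => ->; rewrite -sumrN; apply: eq_bigr => b _.
  by rewrite -wpE mulNr.
have h2 t : wedges wp bs Y t = io ((-1) ^+ N * contr n F (wedges wn bs (@x0 k N)) t).
  rewrite contr_wedges; last first.
    move=> b; rewrite /wn; case: ifP => hb; first exact: hF.
    by rewrite /ip big1 // => a _; rewrite mulr0.
  rewrite size_iota mulrA -exprMn mulrNN mulr1 expr1n mul1r.
  rewrite /Y; elim: (bs) t => [|b cs IH] t //=.
  rewrite (wedge_eq _ IH) -(@wedge_map _ _ (@io k N) (wn b)) // => a x; exact: ioM.
pose c : Q := \prod_(b <- iota 0 N) b.+1%:R.
have c0 : c != 0.
  rewrite /c prodf_seq_neq0; apply/allP => b; rewrite mem_iota => hb /=.
  by rewrite -mpolyC_nat mpolyC_eq0 charN //; lia.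
have h3 : ug`_0 * ((-1) ^+ N * (c * ug`_0 ^+ N * contr n F (top Q n 0) s)) = 0.
  have e3 : ug`_0 * ((-1) ^+ N * (c * ug`_0 ^+ N * contr n F (top Q n 0) s))
     = ug`_0 * ((-1) ^+ N * contr n F (wedges wn bs (@x0 k N)) s).
    rewrite -contrZ.
    have -> : (fun t => c * ug`_0 ^+ N * top Q n 0 t) = wedges wn bs (@x0 k N).
      by apply: functional_extensionality => t; rewrite wedges_wn_x0.
    by [].
  apply: (@io_inj k N); rewrite rmorph0.
  (* The degrees of u_0, of the N vectors w_b, and of y0. *)
  apply: (@mdeg0_homog _ _ (1 + (N + (N - 2)))).
    apply: io_homog; apply: dhomogM; first exact: ug_homog.
    rewrite -[(N + _)%N]add0n; apply: dhomogM.
      by rewrite -signr_odd; case: odd; rewrite ?expr1 ?rpredN; apply: dhomog1.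
    apply: dhomogM.
      rewrite -[X in X.-homog](add0n N); apply: dhomogM; last first.
        by rewrite -[X in X.-homog]mul1n; apply: dhomogMn; apply: ug_homog.
      rewrite /c; elim/big_ind: _ => [|x y hx hy|b _]; first exact: dhomog1.
        by have := dhomogM hx hy; rewrite addn0.
      by apply: rpredMn; apply: dhomog1.
    apply: rpred_sum => a _; rewrite -[(N - 2)%N]addn0; apply: dhomogM; first exact: hFh.
    exact: wedges_homog.
  rewrite e3 ioM -h2 -h1; apply: mdeg0M; first by apply: io_homog; apply: ug_homog.
  by have := hEbs bs s; rewrite size_iota.
have u0 := negbTE (ug0_neq0 N2 charN).
move/eqP: h3; rewrite mulf_eq0 u0 /= mulf_eq0 signr_eq0 /= 2!mulf_eq0 (negbTE c0) /=.
by rewrite expf_eq0 u0 andbF => /eqP.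
Qed.

End CoreTop3.

(** * Reduction of general N to N = i + 2 *)

Section General.
Variable k : closedFieldType.

Definition gen_poly N : {poly {mpoly k[N.+1]}} := \poly_(c < N.+1) 'X_(inord c).

Lemma gen_poly_coef N (c : 'I_N.+1) : (gen_poly N)`_c = 'X_c.
Proof. by rewrite coef_poly ltn_ord inord_val. Qed.

Lemma size_gen_poly N : (size (gen_poly N) <= N.+1)%N. Proof. exact: size_poly. Qed.

Lemma Wr_map (R S : idomainType) (f : {rmorphism R -> S}) (u y : {poly R}) :
  Wr (map_poly f u) (map_poly f y) = map_poly f (Wr u y).
Proof. by rewrite /Wr !deriv_map -!rmorphM -rmorphB. Qed.

(* Spelled out, [\sum_c (c - b) u_c F_(b + c - 1) = 0] for [b <= N], where the
   [u_c] are the variables. *)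
Definition wronskian_rel N (F : nat -> {mpoly k[N.+1]}) :=
  forall b, (b <= N)%N -> ip N.*2.-1 F (cf (Wr (gen_poly N) 'X^b)) = 0.

Lemma wronskian_rel_lin N F (y : {poly {mpoly k[N.+1]}}) : wronskian_rel F -> (size y <= N.+1)%N ->
  ip N.*2.-1 F (cf (Wr (gen_poly N) y)) = 0.
Proof.
move=> hF sy; have -> : y = \sum_(b < N.+1) y`_b *: 'X^b.
  rewrite -{1}[y]coefK poly_def (big_ord_widen N.+1 (fun b => y`_b *: 'X^b)) // big_mkcond.
  apply: eq_bigr => b _; case: ltnP => // h.
  by rewrite nth_default // scale0r.
transitivity (\sum_(b < N.+1) y`_b * ip N.*2.-1 F (cf (Wr (gen_poly N) 'X^b))).
  rewrite /ip; under [RHS]eq_bigr do rewrite mulr_sumr.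
  rewrite exchange_big; apply: eq_bigr => a _ /=.
  rewrite /cf Wr_sum coef_sum mulr_sumr; apply: eq_bigr => b _.
  by rewrite WrZr coefZ mulrCA.
by rewrite big1 // => b _; rewrite hF ?mulr0 // -ltnS.
Qed.

Lemma ip_map (R S : comNzRingType) (f : {rmorphism R -> S}) n (F : nat -> R) (y : {poly R}) :
  ip n (f \o F) (fun a => (map_poly f y)`_a) = f (ip n F (fun a => y`_a)).
Proof.
by rewrite /ip rmorph_sum; apply: eq_bigr => a _; rewrite coef_map rmorphM.
Qed.

(** The injective substitution [lagT] carries [gen_poly] to [ug]. *)
Lemma wronskian_rel_eq0_top N (F : nat -> {mpoly k[N.+1]}) : (2 <= N)%N ->
  (forall l, (0 < l <= N)%N -> (l%:R : k) != 0) -> wronskian_rel F ->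
  (forall e, (e < N.*2.-1)%N -> F e \is (N - 2)%N.-homog) ->
  forall e, (e < N.*2.-1)%N -> F e = 0.
Proof.
move=> N2 charN hF hFh e he.
pose f : {rmorphism {mpoly k[N.+1]} -> {mpoly k[N.+1]}} :=
  GRing.RMorphism.clone _ _ (comp_mpoly (lagT (@pt k N))) _.
apply: (lagT_eq0 (pt_inj N2 charN)); rewrite -/(f (F e)).
have hu : map_poly f (gen_poly N) = ug k N.
  apply/polyP => c; rewrite coef_map /=; have [hc|hc] := ltnP c N.+1.
    rewrite -[c]/(val (Ordinal hc)) gen_poly_coef comp_mpolyXU -tnth_nth tnth_mktuple.
    by rewrite ug_coef.
  rewrite nth_default ?(leq_trans (size_gen_poly N)) // raddf0 nth_default //.
  by rewrite (leq_trans (size_ug k N)).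
apply: (@wronskian_annihilator_eq0 k N N2 charN (f \o F)) => //.
- move=> b hb; have := ip_map f N.*2.-1 F (Wr (gen_poly N) 'X^b).
  rewrite -Wr_map hu map_polyXn /wv /cf => ->.
  by have := hF b hb; rewrite /cf => ->; rewrite rmorph0.
- move=> c hc; rewrite -[(N - 2)%N]mul1n /=; apply: comp_homog; first exact: hFh.
  move=> i; rewrite tnth_mktuple; apply: rpred_sum => j _; apply: rpredZ.
  by rewrite dhomogX; apply/eqP; apply: mdeg1.
Qed.

End General.

(** Multiplication by (x - A)^2 is adjoint to the second-order recurrence with double root A. *)
Lemma ip_shift2 (R : comNzRingType) n (F : nat -> R) (A : R) (W : {poly R}) :
  (size W <= n)%N ->
  ip n.+2 F (fun i => (('X - A%:P) ^+ 2 * W)`_i)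
  = ip n (fun e => F e.+2 - A *+ 2 * F e.+1 + A ^+ 2 * F e) (fun i => W`_i).
Proof.
move=> sW.
have W0 i : (n <= i)%N -> W`_i = 0 by move=> h; rewrite nth_default // (leq_trans sW).
have -> : ('X - A%:P) ^+ 2 * W = W * 'X * 'X - (A *+ 2) *: (W * 'X) + (A ^+ 2) *: W.
  by rewrite -!mul_polyC rmorphMn rmorphXn /=; ring.
transitivity (ip n.+2 F (fun i => (W * 'X * 'X)`_i) - A *+ 2 * ip n.+2 F (fun i => (W * 'X)`_i)
   + A ^+ 2 * ip n.+2 F (fun i => W`_i)).
  rewrite /ip !mulr_sumr -sumrN -!big_split; apply: eq_bigr => i _ /=.
  by rewrite coefD coefB !coefZ; ring.
have -> : ip n.+2 F (fun i => (W * 'X * 'X)`_i) = \sum_(a < n) F a.+2 * W`_a.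
  by rewrite /ip !big_ord_recl !coefMX /= !mulr0 !add0r; apply: eq_bigr => i _; rewrite !coefMX.
have -> : ip n.+2 F (fun i => (W * 'X)`_i) = \sum_(a < n) F a.+1 * W`_a.
  rewrite /ip big_ord_recl coefMX /= mulr0 add0r big_ord_recr /= coefMX /= W0 // mulr0 addr0.
  by apply: eq_bigr => i _; rewrite coefMX.
have -> : ip n.+2 F (fun i => W`_i) = \sum_(a < n) F a * W`_a.
  by rewrite /ip !big_ord_recr /= !W0 // !mulr0 !addr0.
rewrite /ip !mulr_sumr -sumrN -!big_split; apply: eq_bigr => i _ /=; ring.
Qed.

Section Core.
Variable k : closedFieldType.

Definition vpoly N (x : 'I_N.+1 -> k) : {poly k} := \poly_(c < N.+1) x (inord c).

Lemma vpoly_coef N (x : 'I_N.+1 -> k) (c : 'I_N.+1) : (vpoly x)`_c = x c.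
Proof. by rewrite coef_poly ltn_ord inord_val. Qed.

Section RootStep.
Variables (M : nat) (a : k).

Definition rootT : M.+2.-tuple {mpoly k[M.+1]} :=
  [tuple (('X - (a%:MP)%:P) * gen_poly k M)`_c | c < M.+2].

Lemma size_root_gen : (size (('X - (a%:MP : {mpoly k[M.+1]})%:P) * gen_poly k M)%R <= M.+2)%N.
Proof.
rewrite (leq_trans (size_polyMleq _ _)) // size_XsubC /=.
by rewrite -[M.+2]add1n leq_add2l size_gen_poly.
Qed.

Lemma map_root_gen :
  map_poly (comp_mpoly rootT) (gen_poly k M.+1) = ('X - (a%:MP)%:P) * gen_poly k M.
Proof.
apply/polyP => c; rewrite coef_map /=; have [hc|hc] := ltnP c M.+2.
  by rewrite -[c]/(val (Ordinal hc)) gen_poly_coef comp_mpolyXU -tnth_nth tnth_mktuple.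
rewrite nth_default ?(leq_trans (size_gen_poly k M.+1)) // raddf0 nth_default //.
by rewrite (leq_trans size_root_gen).
Qed.

Lemma rootT_homog i : tnth rootT i \is 1.-homog.
Proof.
have gh c : (gen_poly k M)`_c \is 1.-homog.
  rewrite coef_poly; case: ifP => _; last exact: rpred0.
  by rewrite dhomogX; apply/eqP; apply: mdeg1.
rewrite tnth_mktuple mulrBl coefB mulrC coefMX coefCM; apply: rpredB.
  by case: ifP => _; rewrite ?rpred0.
by rewrite mul_mpolyC; apply: rpredZ.
Qed.

(** What F becomes under u = (x - a) v. Because W((x - a) v, (x - a) y) = (x - a)^2 W(v, y), these
    forms in the coefficients of v satisfy the relations for one degree less. *)
Definition rootG (F : nat -> {mpoly k[M.+2]}) e : {mpoly k[M.+1]} :=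
  let f := comp_mpoly rootT in
  f (F e.+2) - a%:MP *+ 2 * f (F e.+1) + a%:MP ^+ 2 * f (F e).

Lemma wronskian_rel_root F : (0 < M)%N -> wronskian_rel F -> wronskian_rel (rootG F).
Proof.
move=> M0 hF b hb.
have sW : (size (Wr (gen_poly k M) 'X^b) <= M.*2.-1)%N.
  by apply: size_Wr; rewrite ?size_gen_poly // size_polyXn.
rewrite /rootG /cf -(ip_shift2 (fun e => comp_mpoly rootT (F e))) //.
have -> : M.*2.-1.+2 = M.+1.*2.-1 by lia.
rewrite -Wr_mul -map_root_gen.
have -> : ('X - a%:MP%:P) * 'X^b = map_poly (comp_mpoly rootT) (('X - a%:MP%:P) * 'X^b).
  by rewrite rmorphM /= map_polyXn rmorphB /= map_polyX map_polyC /= comp_mpolyC.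
rewrite Wr_map (ip_map (comp_mpoly rootT) _ F).
rewrite (wronskian_rel_lin hF) ?rmorph0 // (leq_trans (size_polyMleq _ _)) //.
by rewrite size_XsubC size_polyXn; lia.
Qed.

Lemma rootT_eval (x : 'I_M.+2 -> k) : (vpoly x).[a] = 0 ->
  exists y, forall p : {mpoly k[M.+2]}, (p \mPo rootT).@[y] = p.@[x].
Proof.
move=> /eqP /factor_theorem[v hv].
exists (fun c => v`_c) => p; rewrite comp_mpoly_meval; apply: meval_eq => c.
rewrite tnth_mktuple -(coef_map (meval _)) rmorphM /= rmorphB /= map_polyX map_polyC /= mevalC.
have -> : map_poly (meval (fun c : 'I_M.+1 => v`_c)) (gen_poly k M) = v.
  apply/polyP => i; rewrite coef_map /=; have [hi|hi] := ltnP i M.+1.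
    by rewrite -[i]/(val (Ordinal hi)) gen_poly_coef mevalXU.
  rewrite nth_default ?(leq_trans (size_gen_poly k M)) // meval0 nth_default //.
  apply: leq_trans hi; have [->|v0] := eqVneq v 0; first by rewrite size_poly0.
  have : (size (vpoly x) <= M.+2)%N by apply: size_poly.
  by rewrite hv size_Mmonic ?monicXsubC // size_XsubC addn2.
by rewrite mulrC -hv vpoly_coef.
Qed.

End RootStep.

(** The difference of the two recurrences is the first-order relation 2 L_(e+1) = (a + b) L_e, and
    substituting it back leaves (a - b)^2 L_e = 0. The entries n - 1, n and n + 1 at the end follow
    from the preceding ones. *)
Lemma two_roots_rec (n : nat) (L : nat -> k) (a b : k) : (2%:R : k) != 0 -> a != b ->
  (forall e, (e < n)%N -> L e.+2 - a *+ 2 * L e.+1 + a ^+ 2 * L e = 0) ->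
  (forall e, (e < n)%N -> L e.+2 - b *+ 2 * L e.+1 + b ^+ 2 * L e = 0) ->
  (1 < n)%N -> forall e, (e < n.+2)%N -> L e = 0.
Proof.
move=> two ab ha hb n0.
have ab0 : a - b != 0 by rewrite subr_eq0.
have h1 e : (e < n)%N -> L e.+1 *+ 2 = (a + b) * L e.
  move=> he; apply: (mulfI ab0); apply/eqP; rewrite -subr_eq0; apply/eqP.
  by rewrite -[RHS](subrr 0) -[X in _ = X - _](hb e he) -[X in _ = _ - X](ha e he); ring.
have halve (x : k) : x *+ 2 = 0 -> x = 0.
  by rewrite -mulr_natl => /eqP; rewrite mulf_eq0 (negbTE two) => /eqP.
have L0 e : (e.+1 < n)%N -> L e = 0.
  move=> he; apply/eqP; have : (a - b) ^+ 2 * L e == 0; last first.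
    by rewrite mulf_eq0 expf_eq0 (negbTE ab0).
  have ha' := ha e (ltnW he); have h1' := h1 e (ltnW he); have h2' := h1 e.+1 he.
  have -> : (a - b) ^+ 2 * L e = (L e.+2 - a *+ 2 * L e.+1 + a ^+ 2 * L e) *+ 4
      - (L e.+2 *+ 2 - (a + b) * L e.+1) *+ 2
      + (L e.+1 *+ 2 - (a + b) * L e) * (a *+ 3 - b) by ring.
  by rewrite ha' h1' h2' !subrr !mul0rn mul0r oppr0 !addr0.
have L1 : L n.-1 = 0.
  have e1 : n.-2.+1 = n.-1 by lia.
  by rewrite -e1; apply: halve; rewrite h1 ?L0 ?mulr0 //; lia.
have L2 : L n = 0.
  have e1 : n.-1.+1 = n by lia.
  by rewrite -e1; apply: halve; rewrite h1 ?L1 ?mulr0 //; lia.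
have L3 : L n.+1 = 0.
  have e1 : n.-1.+2 = n.+1 by lia.
  have e2 : n.-1.+1 = n by lia.
  have h : (n.-1 < n)%N by lia.
  by have := ha _ h; rewrite e1 e2 L1 L2 !mulr0 subr0 addr0.
move=> e he; have [h|h] := ltnP e.+1 n; first exact: L0.
have [->|ne1] := eqVneq e n.+1; first by [].
have [->|ne2] := eqVneq e n; first by [].
by have -> : e = n.-1 by lia.
Qed.

(** A monomial of degree q in at least q + 2 variables misses two of them, and its coefficient
    survives when those two are set to 0. *)
Lemma meval0_homog n q (p : {mpoly k[n]}) : p \is q.-homog -> (q.+2 <= n)%N ->
  (forall x (i j : 'I_n), i != j -> x i = 0 -> x j = 0 -> p.@[x] = 0) -> p = 0.
Proof.
move=> hp hq hx; apply/mpolyP => m; rewrite mcoeff0.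
have [hm|hm] := eqVneq (mdeg m) q; last by rewrite (dhomog_nemf_coeff hp).
have [i [j [ij mi mj]]] : exists i j : 'I_n, [/\ i != j, m i = 0%N & m j = 0%N].
  pose A := [set i : 'I_n | m i == 0%N].
  have cA : (1 < #|A|)%N.
    have := cardsC A; rewrite card_ord => e.
    have hC : (#|~: A| <= mdeg m)%N.
      rewrite mdegE -sum1_card big_mkcond /=; apply: leq_sum => i _.
      by rewrite !inE; case: posnP.
    by move: hC; rewrite hm; lia.
  have [i hi] : exists i, i \in A by apply/set0Pn; rewrite -card_gt0; lia.
  have [j] : exists j, j \in A :\ i.
    by apply/set0Pn; rewrite -card_gt0; move: cA; rewrite (cardsD1 i) hi; lia.
  rewrite !inE => /andP[ji /eqP mj].
  by exists i, j; split=> //; [rewrite eq_sym | move: hi; rewrite inE => /eqP].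
pose T : n.-tuple {mpoly k[n]} := [tuple if (l == i) || (l == j) then 0 else 'X_l | l < n].
have p0 : p \mPo T = 0.
  apply: mpoly_vanish => x; rewrite comp_mpoly_meval.
  by apply: (hx _ i j ij); rewrite tnth_mktuple eqxx ?orbT /= meval0.
have := congr1 (mcoeff m) p0; rewrite mcoeff0 comp_mpolyEX raddf_sum /=.
have E (m' : 'X_{1..n}) : ('X_[m'] \mPo T)@_m = (m' == m)%:R.
  have [->|ne] := eqVneq m' m.
    rewrite comp_mpolyX (eq_bigr (fun l => 'X_l ^+ m l)) => [|l _].
      by rewrite -mpolyXE_id mcoeffX eqxx.
    rewrite tnth_mktuple; case: eqP => [->|_] /=; first by rewrite mi !expr0.
    by case: eqP => [->|_] //=; rewrite mj !expr0.
  have [/andP[/eqP h1 /eqP h2]|h] := boolP ((m' i == 0%N) && (m' j == 0%N)).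
    rewrite comp_mpolyX (eq_bigr (fun l => 'X_l ^+ m' l)) => [|l _].
      by rewrite -mpolyXE_id mcoeffX (negbTE ne).
    rewrite tnth_mktuple; case: eqP => [->|_] /=; first by rewrite h1 !expr0.
    by case: eqP => [->|_] //=; rewrite h2 !expr0.
  rewrite comp_mpolyX; move: h; rewrite negb_and => /orP[] h.
    by rewrite (bigD1 i) //= tnth_mktuple eqxx /= expr0n (negbTE h) mul0r mcoeff0.
  by rewrite (bigD1 j) //= tnth_mktuple eqxx orbT /= expr0n (negbTE h) mul0r mcoeff0.
under eq_bigr => m' _ do rewrite mcoeffZ E.
have [hin|/memN_msupp_eq0 ->//] := boolP (m \in msupp p).
rewrite (bigD1_seq m) //= eqxx mulr1 big1 ?addr0 // => m' /negbTE ->.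
by rewrite mulr0.
Qed.

(** By induction a root a of u imposes on the values F_e(u) the recurrence with double root a, so F
    vanishes at every u with two distinct roots among the nodes. In Lagrange coordinates these are
    the points with two zero coordinates, and [meval0_homog] applies. At the base N = q + 2 the
    bound 2 l < N + q + 3 means l <= N. *)
Theorem wronskian_rel_eq0 N q : (q.+2 <= N)%N ->
  (forall l, (0 < l)%N -> (2 * l < N + q + 3)%N -> (l%:R : k) != 0) ->
  forall F : nat -> {mpoly k[N.+1]}, wronskian_rel F ->
  (forall e, (e < N.*2.-1)%N -> F e \is q.-homog) ->
  forall e, (e < N.*2.-1)%N -> F e = 0.
Proof.
have [d hd] : exists d, (N - q.+2 = d)%N by exists (N - q.+2)%N.
elim: d N hd => [|d IH] N hd hN charP F hF hFh.
  apply: wronskian_rel_eq0_top => //; first by lia.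
    by move=> l hl; apply: charP; lia.
  by rewrite (_ : N - 2 = q)%N //; lia.
case: N hd hN charP F hF hFh => // M hd hN charP F hF hFh e he.
have hG a e' : (e' < M.*2.-1)%N -> rootG a F e' = 0.
  move=> he'; apply: IH he' => //; try lia.
  - by move=> l l0 hl; apply: charP => //; lia.
  - by apply: wronskian_rel_root => //; lia.
  move=> c hc.
  have hh c' : (c' < M.+1.*2.-1)%N -> F c' \mPo rootT M a \is q.-homog.
    move=> hc'; rewrite -[q]mul1n; apply: comp_homog; first exact: hFh.
    exact: rootT_homog.
  rewrite /rootG -mpolyCMn -rmorphXn !mul_mpolyC; apply: rpredD; [apply: rpredB|].
  - by apply: hh; lia.
  - by apply: rpredZ; apply: hh; lia.
  - by apply: rpredZ; apply: hh; lia.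
have two : (2%:R : k) != 0 by apply: charP; lia.
have hroot a (x : 'I_M.+2 -> k) : (vpoly x).[a] = 0 ->
    forall e, (e < M.*2.-1)%N ->
    (F e.+2).@[x] - a *+ 2 * (F e.+1).@[x] + a ^+ 2 * (F e).@[x] = 0.
  move=> ha e' he'; have [y hy] := rootT_eval ha.
  have := congr1 (meval y) (hG a e' he'); rewrite meval0 /rootG.
  rewrite -mpolyCMn -rmorphXn !mul_mpolyC /=.
  by rewrite mevalD mevalB !mevalZ !hy.
have hroots a b (x : 'I_M.+2 -> k) : a != b -> (vpoly x).[a] = 0 -> (vpoly x).[b] = 0 ->
    (F e).@[x] = 0.
  move=> ab ha hb.
  apply: (@two_roots_rec M.*2.-1 (fun e => (F e).@[x]) a b two ab (hroot a x ha) (hroot b x hb)); lia.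
have [s us ss] := closed_points k M.+2.
pose a (j : 'I_M.+2) := s`_j.
have ainj : injective a.
  move=> i j /eqP; rewrite /a nth_uniq ?ss ?ltn_ord // => /eqP.
  exact: val_inj.
apply: (lagT_eq0 ainj); apply: (@meval0_homog _ q).
- rewrite -[q]mul1n; apply: comp_homog; first exact: hFh.
  move=> i; rewrite tnth_mktuple; apply: rpred_sum => j _; apply: rpredZ.
  by rewrite dhomogX; apply/eqP; apply: mdeg1.
- lia.
move=> y i j ij yi yj; rewrite comp_mpoly_meval.
set x := fun _ => _.
have hx : vpoly x = \sum_j y j *: lag a j.
  apply/polyP => c; rewrite coef_sum; have [hc|hc] := ltnP c M.+2.
    rewrite -[c]/(val (Ordinal hc)) vpoly_coef /x tnth_mktuple raddf_sum /=.
    by apply: eq_bigr => l _; rewrite mevalZ mevalXU coefZ mulrC.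
  rewrite coef_poly ltnNge hc /= big1 // => l _.
  by rewrite coefZ nth_default ?mulr0 // size_lag.
have hxa l : y l = 0 -> (vpoly x).[a l] = 0.
  move=> yl; rewrite hx horner_sum big1 // => l' _; rewrite hornerZ (lag_at a l').
  by case: eqP => [<-|_]; rewrite ?yl ?mul0r // mulr0n mulr0.
by apply: (hroots (a i) (a j)); rewrite ?(inj_eq ainj) // hxa.
Qed.

End Core.

(** * Contraction with the curve and division by x - t *)

Section AltExt.
Variable R : comNzRingType.
Implicit Types (al be : seq nat -> R).

Lemma alt_front al s1 a s2 : alt al ->
  al (s1 ++ a :: s2) = (-1) ^+ size s1 * al (a :: s1 ++ s2).
Proof.
elim: s1 al => [|b s1 IH] al h /=; first by rewrite mul1r.
rewrite (IH (fun r => al (b :: r)) (alt_cons b h)) (h [::] b a) /= exprS.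
by rewrite mulN1r mulrN mulNr.
Qed.

Lemma alt_perm al s s' : alt al -> perm_eq s s' -> al s = 0 -> al s' = 0.
Proof.
elim: s s' al => [|a s IH] s' al h hs h0.
  by rewrite perm_sym in hs; rewrite (perm_nilP hs).
have as' : a \in s' by rewrite -(perm_mem hs) mem_head.
case/path.splitPr: as' hs => s1 s2 hs.
have hs2 : perm_eq s (s1 ++ s2).
  by rewrite -(perm_cons a) (permPl hs) -cat1s perm_catCA.
by rewrite alt_front // (IH _ _ (alt_cons a h) hs2 h0) mulr0.
Qed.

Hypothesis two_reg : forall x : R, x + x = 0 -> x = 0.
Variable n : nat.
Implicit Types (A : {set 'I_n}).

Definition enl A : seq nat := [seq val a | a <- enum A].

Lemma size_enl A : size (enl A) = #|A|.
Proof. by rewrite size_map -cardE. Qed.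

Lemma uniq_enl A : uniq (enl A).
Proof. by rewrite map_inj_uniq ?enum_uniq //; apply: val_inj. Qed.

Lemma mem_enl A (a : 'I_n) : (val a \in enl A) = (a \in A).
Proof. by rewrite mem_map ?mem_enum //; apply: val_inj. Qed.

Lemma enl_lt A : all (ltn^~ n) (enl A).
Proof. by apply/allP => _ /mapP[a _ ->]; apply: ltn_ord. Qed.

Lemma sorted_enl A : path.sorted ltn (enl A).
Proof.
rewrite /enl path.sorted_map; apply: path.sorted_filter.
  by move=> b a c /=; apply: ltn_trans.
by have := path.iota_ltn_sorted 0 n; rewrite -val_enum_ord path.sorted_map enumT.
Qed.

Definition sos (s : seq nat) : {set 'I_n} := [set a | val a \in s].

Lemma sos_enl A : sos (enl A) = A.
Proof. by apply/setP => a; rewrite inE mem_enl. Qed.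

Lemma perm_sos s : uniq s -> all (ltn^~ n) s -> perm_eq s (enl (sos s)).
Proof.
move=> us hs; apply: uniq_perm => //; first exact: uniq_enl.
move=> a; have [ha|ha] := ltnP a n.
  by rewrite -[a]/(val (Ordinal ha)) mem_enl inE.
have -> : (a \in s) = false by apply: contraTF ha => /(allP hs); rewrite -ltnNge.
by symmetry; apply: contraTF ha => /(allP (enl_lt _)); rewrite -ltnNge.
Qed.

Lemma alt_ext al be : alt al -> alt be -> supp n al -> supp n be ->
  (forall A, al (enl A) = be (enl A)) -> al =1 be.
Proof.
move=> h1 h2 h3 h4 h s.
have [hs|hs] := boolP (all (ltn^~ n) s); last by rewrite h3 // h4.
have [us|us] := boolP (uniq s); last by rewrite !(alt_uniq two_reg).
apply/eqP; rewrite -subr_eq0; apply/eqP.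
apply: (@alt_perm (fun s => al s - be s) (enl (sos s))).
- by move=> s1 a b s2; rewrite h1 h2 opprD.
- by rewrite perm_sym perm_sos.
- by rewrite h subrr.
Qed.

Fixpoint sgn (s : seq nat) : R :=
  if s is a :: s' then (-1) ^+ count (ltn^~ a) s' * sgn s' else 1.

(** The alternating tensor with prescribed values on increasing lists; the exponent in [sgn] is the
    number of inversions. *)
Definition lst (x : {set 'I_n} -> R) s : R :=
  if uniq s && all (ltn^~ n) s then sgn s * x (sos s) else 0.

Lemma sgn_swap s1 a b s2 : a != b -> sgn (s1 ++ a :: b :: s2) = - sgn (s1 ++ b :: a :: s2).
Proof.
move=> ab; elim: s1 => [|c s1 IH] /=.
  rewrite !exprD; case: (ltngtP a b) ab => // l _ /=; rewrite ?expr1 ?expr0; ring.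
by rewrite IH mulrN; congr (- ((-1) ^+ _ * _)); rewrite !count_cat /=; lia.
Qed.

Lemma sos_perm s s' : s =i s' -> sos s = sos s'.
Proof. by move=> h; apply/setP => a; rewrite !inE h. Qed.

Lemma alt_lst x : alt (lst x).
Proof.
move=> s1 a b s2; rewrite /lst.
have hp : perm_eq (s1 ++ a :: b :: s2) (s1 ++ b :: a :: s2).
  by rewrite perm_cat2l -[a :: b :: _]/([:: a] ++ [:: b] ++ s2) perm_catCA.
rewrite (perm_uniq hp) (perm_all _ hp); case: ifP => [/andP[us _]|_]; last by rewrite oppr0.
rewrite sgn_swap ?mulNr; last first.
  apply: contraTneq us => ->; rewrite cat_uniq /= inE eqxx /= !andbF //.
by congr (- (_ * x _)); apply: sos_perm => c; rewrite (perm_mem hp).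
Qed.

Lemma supp_lst x : supp n (lst x).
Proof. by move=> s hs; rewrite /lst (negbTE hs) andbF. Qed.

Lemma tdeg_lst j x : (forall A, #|A| != j -> x A = 0) -> tdeg j (lst x).
Proof.
move=> h s hs; rewrite /lst; case: ifP => // /andP[us hl].
rewrite h ?mulr0 //; apply: contraNneq hs => <-.
by rewrite (perm_size (perm_sos us hl)) size_enl.
Qed.

Lemma count_enl A a : count (ltn^~ a) (enl A) = #|[set b in A | (b < a)%N]|.
Proof.
rewrite count_map -sum1_count big_enum_cond sum1dep_card.
by apply: eq_card => b; rewrite !inE.
Qed.

Lemma sgn_sorted s : path.sorted ltn s -> sgn s = 1.
Proof.
elim: s => //= a s IH; rewrite path.path_sortedE; last exact: ltn_trans.
case/andP=> /allP ha /IH ->; rewrite mulr1 (_ : count _ _ = 0%N) ?expr0 //.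
apply/eqP; rewrite -leqn0 leqNgt -has_count; apply/hasPn => b /ha /=.
by rewrite -leqNgt => /ltnW.
Qed.

Lemma lst_enl x A : lst x (enl A) = x A.
Proof. by rewrite /lst uniq_enl enl_lt /= sgn_sorted ?sorted_enl // mul1r sos_enl. Qed.

Lemma lst_id al : alt al -> supp n al -> lst (fun A => al (enl A)) =1 al.
Proof.
move=> h1 h2; apply: alt_ext => //; [exact: alt_lst | exact: supp_lst |].
by move=> A; rewrite lst_enl.
Qed.

(** The signs are those of [koszul_sign]; this identifies the Koszul differential with a
    contraction. *)
Lemma contr_lst f x A : contr n f (lst x) (enl A)
  = \sum_(a | a \notin A) f a * ((-1) ^+ #|[set b in A | (b < a)%N]| * x (a |: A)).
Proof.
rewrite /contr [RHS]big_mkcond; apply: eq_bigr => a _.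
rewrite /lst /= mem_enl uniq_enl enl_lt ltn_ord /= !andbT.
case: ifP => _; last by rewrite mulr0.
rewrite count_enl sgn_sorted ?sorted_enl // mulr1; congr (_ * (_ * x _)).
apply/setP => b; rewrite !inE mem_enl; congr (_ || _).
Qed.

End AltExt.

Section Slot.
Variable P : comNzRingType.
Implicit Types (l h : nat -> nat -> P) (al be : seq nat -> P) (n : nat).

(* The exterior power of the matrix [l]. *)
Fixpoint sl n l al (s : seq nat) : P :=
  if s is a :: s' then \sum_(m < n) l a m * sl n l (fun r => al (val m :: r)) s'
  else al [::].

Lemma sl_eq n l al be : al =1 be -> sl n l al =1 sl n l be.
Proof. by move=> /functional_extensionality ->. Qed.

Lemma sl_lin n l (I : Type) (t : seq I) (c : I -> P) (F : I -> seq nat -> P) s :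
  sl n l (fun s => \sum_(i <- t) c i * F i s) s = \sum_(i <- t) c i * sl n l (F i) s.
Proof.
elim: s F => [|a s IH] F //=.
under [RHS]eq_bigr do rewrite mulr_sumr.
rewrite [RHS]exchange_big; apply: eq_bigr => m _ /=.
rewrite (IH (fun i r => F i (val m :: r))) mulr_sumr.
by apply: eq_bigr => i _; ring.
Qed.

Lemma slZ n l c al s : sl n l (fun s => c * al s) s = c * sl n l al s.
Proof.
have := @sl_lin n l bool [:: true] (fun=> c) (fun=> al) s.
by rewrite big_seq1 => <-; apply: sl_eq => r; rewrite big_seq1.
Qed.

Lemma slB n l al be s : sl n l (fun s => al s - be s) s = sl n l al s - sl n l be s.
Proof.
elim: s al be => [|a s IH] al be //=; rewrite -sumrB; apply: eq_bigr => m _.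
by rewrite (IH (fun r => al (val m :: r)) (fun r => be (val m :: r))) mulrBr.
Qed.

Lemma sl0 n l s : sl n l (fun=> 0) s = 0.
Proof.
elim: s => [|a s IH] //=; rewrite big1 // => m _.
by rewrite IH mulr0.
Qed.

Lemma sl_r0 n l al s : (forall s, al s = 0) -> sl n l al s = 0.
Proof. by move=> h; rewrite -(sl0 n l s); apply: sl_eq. Qed.

Lemma alt_sl n l al : alt al -> alt (sl n l al).
Proof.
move=> h s1; elim: s1 al h => [|c s1 IH] al h a b s2 /=.
  under eq_bigr do rewrite mulr_sumr.
  rewrite exchange_big -sumrN; apply: eq_bigr => m' _ /=.
  rewrite mulr_sumr -sumrN; apply: eq_bigr => m _.
  rewrite (@sl_eq n l _ (fun r => (-1) * al (val m' :: val m :: r))); last first.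
    by move=> r; rewrite mulN1r (h [::]).
  by rewrite slZ; ring.
rewrite -sumrN; apply: eq_bigr => m _.
by rewrite (IH _ (alt_cons _ h)) mulrN.
Qed.

Lemma contr_sl n n' f l al s :
  contr n' f (sl n l al) s = sl n l (contr n (fun m => \sum_(a < n') f a * l a m) al) s.
Proof.
rewrite /contr sl_lin /=.
under eq_bigr do rewrite mulr_sumr.
rewrite exchange_big; apply: eq_bigr => m _ /=; rewrite mulr_suml.
by apply: eq_bigr => a _; rewrite mulrA.
Qed.

Lemma sl_wedge n l g al s :
  sl n l (wedge g al) s = wedge (fun a => \sum_(m < n) l a m * g m) (sl n l al) s.
Proof.
elim: s al => [|a s IH] al //=.
rewrite wedge_lin mulr_suml -sumrB; apply: eq_bigr => m _.
rewrite (slB n l (fun r => g m * al r)) slZ (IH (fun r => al (val m :: r))).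
by ring.
Qed.

Lemma sl_one n l s : sl n l (one P) s = one P s.
Proof.
by case: s => [|a s] //=; rewrite big1 // => m _; rewrite sl_r0 ?mulr0.
Qed.

Lemma sl_wedges n l (I : Type) (F : I -> nat -> P) bs s :
  sl n l (wedges F bs (one P)) s
  = wedges (fun b a => \sum_(m < n) l a m * F b m) bs (one P) s.
Proof.
elim: bs s => [|b bs IH] s /=; first exact: sl_one.
by rewrite sl_wedge (wedge_eq _ IH).
Qed.

Lemma sl_sl n n' l h al s :
  sl n l (sl n' h al) s = sl n' (fun a b => \sum_(m < n) l a m * h m b) al s.
Proof.
elim: s al => [|a s IH] al //=.
transitivity (\sum_(m < n) \sum_(b < n') (l a m * h m b) *
    sl n' (fun a b => \sum_(m < n) l a m * h m b) (fun r => al (val b :: r)) s).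
  apply: eq_bigr => m _; rewrite sl_lin mulr_sumr; apply: eq_bigr => b _.
  by rewrite IH mulrA.
by rewrite exchange_big; apply: eq_bigr => b _; rewrite mulr_suml.
Qed.

(** Alternation carries the hypothesis on the first slot to all others. *)
Lemma sl_fix n n' (q : nat -> nat -> P) al s : alt al ->
  (forall a r, (a < n')%N -> \sum_(m < n) q a m * al (val m :: r) = al (a :: r)) ->
  all (ltn^~ n') s -> sl n q al s = al s.
Proof.
elim: s al => [|a s IH] al h hq //= /andP[ha hs].
rewrite -hq //; apply: eq_bigr => m _; congr (_ * _); apply: IH => //.
  exact: alt_cons.
move=> b r hb; rewrite (h [::]) /= -hq // -sumrN; apply: eq_bigr => m' _.
by rewrite (h [::]) mulrN.
Qed.

Lemma supp_sl n n' l al : (forall a m, (n' <= a)%N -> (m < n)%N -> l a m = 0) ->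
  supp n' (sl n l al).
Proof.
move=> h s; elim: s al => [|a s IH] al //=; rewrite negb_and => hs.
rewrite big1 // => m _; case/orP: hs => hs; last by rewrite IH ?mulr0.
by rewrite h ?mul0r // leqNgt.
Qed.

Lemma tdeg_sl j n l al : tdeg j al -> tdeg j (sl n l al).
Proof.
move=> h s; elim: s j al h => [|a s IH] j al h hs /=; first exact: h.
rewrite big1 // => m _; case: j h hs => [|j] h hs.
  by rewrite sl_r0 ?mulr0 // => r; apply: h.
by rewrite (IH j) ?mulr0 // => r hr; apply: h.
Qed.

End Slot.

Section SlotMap.
Variables (P Q : comNzRingType) (F : {additive P -> Q}).

Lemma sl_map n (l : nat -> nat -> P) (l' : nat -> nat -> Q) al s :
  (forall a m x, (m < n)%N -> F (l a m * x) = l' a m * F x) ->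
  F (sl n l al s) = sl n l' (F \o al) s.
Proof.
move=> h; elim: s al => [|a s IH] al //=; rewrite raddf_sum; apply: eq_bigr => m _.
by rewrite h // IH.
Qed.

End SlotMap.

Section Division.
Variable R : idomainType.
Local Notation P := {poly R}.
Implicit Types (al be : seq nat -> P).

(* [lx] is the matrix of multiplication by x - t on polynomials in x, and [hx]
   that of the quotient in the division by x - t. *)
Definition curve (m : nat) : P := 'X^m.
Definition curve' (m : nat) : P := 'X^m^`().
Definition lx (a m : nat) : P := (m.+1 == a)%:R - 'X *+ (m == a).
Definition hx (a m : nat) : P := if (a < m)%N then 'X^(m - a.+1) else 0.

Lemma sum_lx_l n (f : nat -> P) m : (m < n)%N ->
  \sum_(a < n.+1) f a * lx a m = f m.+1 - f m * 'X.
Proof.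
move=> hm; rewrite /lx; under eq_bigr do rewrite mulrBr.
rewrite sumrB; congr (_ - _).
  have h1 : (m.+1 < n.+1)%N by [].
  rewrite (bigD1 (Ordinal h1)) //= eqxx mulr1 big1 ?addr0 // => a.
  by rewrite -val_eqE /= eq_sym => /negbTE ->; rewrite mulr0.
have h1 : (m < n.+1)%N by apply: ltnW.
rewrite (bigD1 (Ordinal h1)) //= eqxx mulr1n big1 ?addr0 // => a.
by rewrite -val_eqE /= eq_sym => /negbTE ->; rewrite mulr0n mulr0.
Qed.

Lemma sum_lx_r n (f : nat -> P) a : (a <= n)%N -> (forall m, (n <= m)%N -> f m = 0) ->
  \sum_(m < n) lx a m * f m = (if a is a'.+1 then f a' else 0) - 'X * f a.
Proof.
move=> ha hf; rewrite /lx; under eq_bigr do rewrite mulrBl.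
rewrite sumrB; congr (_ - _).
  case: a ha => [|a] ha; first by rewrite big1 // => m _; rewrite mul0r.
  rewrite (bigD1 (Ordinal ha)) //= eqxx mul1r big1 ?addr0 // => m.
  by rewrite -val_eqE /= eqSS => /negbTE ->; rewrite mul0r.
have [l|l] := ltnP a n; last first.
  rewrite hf // mulr0 big1 // => m _.
  by rewrite ltn_eqF ?mulr0n ?mul0r //; apply: leq_trans l.
rewrite (bigD1 (Ordinal l)) //= eqxx mulr1n big1 ?addr0 // => m.
by rewrite -val_eqE /= => /negbTE ->; rewrite mulr0n mul0r.
Qed.

Lemma curve_lx n m : (m < n)%N -> \sum_(a < n.+1) curve a * lx a m = 0.
Proof. by move=> h; rewrite sum_lx_l // /curve exprSr subrr. Qed.

Lemma curve'_lx n m : (m < n)%N -> \sum_(a < n.+1) curve' a * lx a m = curve m.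
Proof.
move=> h; rewrite sum_lx_l // /curve' /curve exprSr derivM derivX mulr1.
by rewrite addrAC subrr add0r.
Qed.

(** Division with remainder of x^b by x - t: the remainder t^b sits in coordinate 0. *)
Lemma lx_hx n a b : (a <= n)%N -> (b <= n)%N ->
  \sum_(m < n) lx a m * hx m b = (a == b)%:R - (a == 0)%:R * 'X^b.
Proof.
move=> ha hb; rewrite (sum_lx_r (f := hx^~ b)) //; last first.
  by move=> m hm; rewrite /hx ltnNge (leq_trans hb hm).
case: a ha => [|a] ha; rewrite /hx /= ?mul0r ?mul1r ?subr0.
  case: b hb => [|b] hb /=; first by rewrite mulr0 subrr expr0 subrr.
  by rewrite subSS subn0 -exprS.
case: (ltngtP a.+1 b) => h.
- by rewrite -exprS (_ : (b - a.+2).+1 = b - a.+1)%N ?subrr //; lia.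
- by rewrite mulr0 subrr.
- by rewrite -h subnn mulr0 subr0.
Qed.

Lemma hx_lx n a b : (a < n)%N -> (b < n)%N ->
  \sum_(m < n.+1) hx a m * lx m b = (a == b)%:R.
Proof.
move=> ha hb; rewrite sum_lx_l // /hx ltnS.
case: (ltngtP a b) => h.
- by rewrite -exprSr (_ : (b - a.+1).+1 = b.+1 - a.+1)%N ?subrr //; lia.
- by rewrite mul0r subrr.
- by rewrite h subSS subnn mul0r subr0.
Qed.

Lemma lx_out n a m : (n < a)%N -> (m < n)%N -> lx a m = 0.
Proof.
move=> ha hm; rewrite /lx !ltn_eqF ?mulr0n ?subr0 //; first exact: ltn_trans ha.
exact: leq_ltn_trans ha.
Qed.

Lemma supp_lx n al : supp n.+1 (sl n lx al).
Proof. by apply: supp_sl => a m ha hm; apply: lx_out hm. Qed.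

Lemma supp_hx n al : supp n (sl n.+1 hx al).
Proof. by apply: supp_sl => a m ha hm; rewrite /hx ifF //; lia. Qed.

(** In each slot the remainder of the division is the contraction with the curve, that is, the value
    at x = t. *)
Lemma divide n al : alt al -> supp n.+1 al -> (forall s, contr n.+1 curve al s = 0) ->
  forall s, sl n lx (sl n.+1 hx al) s = al s.
Proof.
move=> h1 h2 h3 s.
have [hs|hs] := boolP (all (ltn^~ n.+1) s); last by rewrite h2 // supp_lx.
rewrite sl_sl; apply: sl_fix hs => // a r ha.
transitivity (\sum_(m < n.+1) ((a == m)%:R - (a == 0)%:R * 'X^m) * al (val m :: r)).
  by apply: eq_bigr => m _; rewrite lx_hx // -ltnS.
under eq_bigr do rewrite mulrBl -mulrA.
rewrite sumrB -mulr_sumr [X in _ - _ * X](_ : _ = contr n.+1 curve al r) // h3 mulr0 subr0.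
rewrite (bigD1 (Ordinal ha)) //= eqxx mul1r big1 ?addr0 // => m.
by rewrite -val_eqE /= eq_sym => /negbTE ->; rewrite mul0r.
Qed.

Lemma undivide n be : alt be -> supp n be ->
  forall s, sl n.+1 hx (sl n lx be) s = be s.
Proof.
move=> h1 h2 s.
have [hs|hs] := boolP (all (ltn^~ n) s); last by rewrite h2 // supp_hx.
rewrite sl_sl; apply: sl_fix hs => // a r ha.
rewrite (bigD1 (Ordinal ha)) //= hx_lx // eqxx mul1r big1 ?addr0 // => m.
by rewrite -val_eqE /= eq_sym hx_lx // => /negbTE ->; rewrite mul0r.
Qed.

(* Dividing by x - t lowers the degree in t, because the remainder
   \sum_m t^m be_m vanishes. *)
Lemma size_hx n (be : nat -> P) a d : (a < n)%N ->
  (forall m, (m < n)%N -> (size (be m) <= d)%N) ->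
  \sum_(m < n) 'X^m * be m = 0 ->
  (size (\sum_(m < n) hx a m * be m)%R <= d.-1)%N.
Proof.
move=> ha hb h0.
set q := \sum_(m < n) _.
have e : 'X^(a.+1) * q = - \sum_(m < n | (m <= a)%N) 'X^m * be m.
  apply/eqP; rewrite -addr_eq0; apply/eqP; rewrite -[RHS]h0.
  rewrite [RHS](bigID (fun m : 'I_n => (m <= a)%N)) /= addrC; congr (_ + _).
  rewrite /q mulr_sumr [RHS]big_mkcond; apply: eq_bigr => m _.
  rewrite /hx -ltnNge; case: ifP => h; last by rewrite mul0r mulr0.
  by rewrite mulrA -exprD subnKC.
have [q0|q0] := eqVneq q 0; first by rewrite q0 size_poly0.
have : (size ('X^(a.+1) * q)%R <= a + d)%N.
  rewrite e size_polyN (leq_trans (size_sum _ _ _)) //; apply/bigmax_leqP => m hm.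
  rewrite (leq_trans (size_polyMleq _ _)) // size_polyXn /=.
  by apply: leq_add => //; apply: hb.
by rewrite size_monicM ?monicXn // size_polyXn; lia.
Qed.

Lemma size_divide n al d : alt al -> (forall s, (size (al s) <= d)%N) ->
  (forall s, contr n.+1 curve al s = 0) ->
  forall s, (size (sl n.+1 hx al s) <= d - size s)%N.
Proof.
move=> h1 h2 h3 s; elim: s al d h1 h2 h3 => [|a s IH] al d h1 h2 h3.
  by rewrite subn0; apply: h2.
have [ha|ha] := leqP n.+1 a.
  by rewrite (supp_hx (n := n)) ?size_poly0 //= ltnNge ltnW.
rewrite [sl _ _ _ _]/= [size (a :: s)]/= subnS.
apply: (@size_hx n.+1 (fun m => sl n.+1 hx (fun r => al (m :: r)) s)) => //.
  move=> m hm; apply: IH => //; first exact: alt_cons.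
  move=> r; transitivity (- contr n.+1 curve al (m :: r)); last by rewrite h3 oppr0.
  rewrite /contr -sumrN; apply: eq_bigr => b _.
  by rewrite (h1 [::]) mulrN.
rewrite -(sl_lin n.+1 hx (index_enum 'I_n.+1) curve (fun m r => al (val m :: r)) s).
by apply: sl_r0 => r; apply: h3.
Qed.

End Division.

Section Chain.
Variable R : comNzRingType.
Hypothesis two_reg : forall x : R, x + x = 0 -> x = 0.
Implicit Types (G : nat -> nat -> R).

Definition chain G i : seq nat -> R := wedges G (rev (iota 0 i)) (one R).

Lemma chainS G i : chain G i.+1 = wedge (G i) (chain G i).
Proof. by rewrite /chain -addn1 iotaD rev_cat. Qed.

Lemma alt_chain G i : alt (chain G i).
Proof. exact/alt_wedges/alt_one. Qed.

Lemma tdeg_chain G i : tdeg i (chain G i).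
Proof.
have := @tdeg_wedges R 0 nat G (rev (iota 0 i)) (one R) (@tdeg_one R).
by rewrite size_rev size_iota addn0.
Qed.

Lemma supp_chain n G i : (forall b a, (b < i)%N -> (n <= a)%N -> G b a = 0) -> supp n (chain G i).
Proof.
elim: i => [|i IH] h; first exact: supp_one.
rewrite chainS; apply: supp_wedge; first by move=> a; apply: h.
by apply: IH => b a hb; apply: h; apply: ltnW.
Qed.

Lemma eq_chain G G' i : (forall b, (b < i)%N -> G b =1 G' b) -> chain G i =1 chain G' i.
Proof.
elim: i => [|i IH] h //.
rewrite !chainS; have /functional_extensionality -> : G i =1 G' i by apply: h.
by move=> s; apply: wedge_eq; apply: IH => b hb; apply: h; apply: ltnW.
Qed.

(** The corrections are multiples of vectors already present in the wedge product. *)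
Lemma chain_unip G G' i :
  (forall b, (b < i)%N -> exists c : nat -> R, forall a, G' b a = G b a + \sum_(q < b) c q * G q a) ->
  chain G' i =1 chain G i.
Proof.
elim: i => [|i IH] h //; rewrite !chainS => s.
have [c hc] := h i (ltnSn i).
rewrite (functional_extensionality _ _ hc).
rewrite (@wedge_eq _ _ _ (chain G i)); last by apply: IH => b hb; apply: h; apply: ltnW.
rewrite wedgeDl wedge_linl big1 ?addr0 // => q _.
by rewrite /chain wedges_dup ?mulr0 // mem_rev mem_iota /= ltn_ord.
Qed.

Lemma wedge_tail0 (g : nat -> R) al a s : all (fun b => g b == 0) s ->
  wedge g al (a :: s) = g a * al s.
Proof.
move=> h /=; rewrite (_ : wedge g _ s = 0) ?subr0 //.
elim: s (fun r => al (a :: r)) h => [|b s IH] be //= /andP[/eqP -> h].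
by rewrite mul0r IH ?subr0.
Qed.

Lemma chain_vanish G i b s : (forall q, (q < i)%N -> G q b = 0) -> b \in s -> chain G i s = 0.
Proof.
elim: i s => [|i IH] s h hb.
  by case: s hb.
have key al : (forall t, b \in t -> al t = 0) -> forall t, b \in t -> wedge (G i) al t = 0.
  move=> hal t; elim: t al hal => [|c t IHt] al hal //=.
  rewrite inE => /predU1P[<-|ht].
    rewrite h // mul0r sub0r wedge_r0 ?oppr0 // => r; apply: hal; exact: mem_head.
  rewrite hal // mulr0 sub0r (IHt (fun r => al (c :: r))) ?oppr0 // => r hr.
  by apply: hal; rewrite inE hr orbT.
rewrite chainS; apply: key hb => t; apply: IH => q hq; apply: h; exact: ltnW.
Qed.

Lemma monic_split (p : {poly R}) r : p \is monic -> size p = r.+1 ->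
  p = 'X^r + \sum_(q < r) p`_q *: 'X^q.
Proof.
move=> hp sp; rewrite -[LHS]coefK poly_def sp big_ord_recr /= addrC.
by move/eqP: hp; rewrite /lead_coef sp /= => ->; rewrite scale1r.
Qed.

End Chain.

Section Newton.
Variable R : idomainType.
Hypothesis two_reg : forall x : R, x + x = 0 -> x = 0.

(** The last vector may be replaced by the values of the monic polynomial whose roots are the y b
    for b in the tail. It vanishes on the tail, so expansion along the first index leaves one
    nonzero term. *)
Lemma chain_vandermonde (y c : nat -> R) s : uniq (map y s) -> all (fun a => c a != 0) s ->
  chain (fun r a => y a ^+ r * c a) (size s) s != 0.
Proof.
elim: s => [|a s IH] /=; first by rewrite /chain /= /one eqxx oner_neq0.
case/andP=> ha us /andP[ca hc].
pose p : {poly R} := \prod_(b <- s) ('X - (y b)%:P).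
have sp : size p = (size s).+1.
  by rewrite /p -(big_map y xpredT (fun z => 'X - z%:P)) size_prod_XsubC size_map.
have mp : p \is monic by apply: monic_prod => b _; apply: monicXsubC.
have rp b : root p (y b) = (y b \in map y s).
  by rewrite /p -(big_map y xpredT (fun z => 'X - z%:P)) root_prod_XsubC.
pose G r a := y a ^+ r * c a.
have -> : chain G (size s).+1 (a :: s) =
    wedge (fun b => p.[y b] * c b) (chain G (size s)) (a :: s).
  pose G' r b := if r == size s then p.[y b] * c b else G r b.
  rewrite -(@chain_unip R two_reg G G' (size s).+1).
    rewrite chainS {1}/G' eqxx; apply: wedge_eq; apply: eq_chain => b hb t.
    by rewrite /G' ltn_eqF.
  move=> r hr; rewrite /G'; case: eqP => [->|_]; last first.
    by exists (fun=> 0) => b; rewrite big1 ?addr0 // => q _; rewrite mul0r.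
  exists (fun q => p`_q) => b; rewrite {1}(monic_split mp sp) hornerD hornerXn horner_sum.
  rewrite mulrDl mulr_suml; congr (_ + _); apply: eq_bigr => q _.
  by rewrite hornerZ hornerXn /G mulrA.
rewrite wedge_tail0.
  rewrite !mulf_neq0 ?IH //; have := rp a; rewrite rootE (negbTE ha) => ->.
  by [].
apply/allP => b hb; have := rp b; rewrite map_f // rootE => /eqP ->.
by rewrite mul0r.
Qed.

End Newton.

(** * Spanning the alternating tensors by u /\ x u /\ ... /\ x^(i-1) u *)

Section Span.
Variables (k : closedFieldType) (N i : nat).
Hypothesis two : (2%:R : k) != 0.
Hypothesis N0 : (0 < N)%N.
Local Notation D := (N + i)%N.

Lemma two_regk (x : k) : x + x = 0 -> x = 0.
Proof. by rewrite -mulr2n -mulr_natl => /eqP; rewrite mulf_eq0 (negbTE two) => /eqP. Qed.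

(* The coordinates of x^r u, so [chain (om u) i] is u /\ x u /\ .. /\ x^(i-1) u. *)
Definition om (R : nzRingType) (u : {poly R}) (r a : nat) : R := ('X^r * u)`_a.

Lemma sl_vandermonde_inj (R : comNzRingType) (E : nat -> nat -> R) n :
  (forall f : {poly R}, (size f <= n)%N ->
     (forall l, (l < n)%N -> \sum_(m < n) E l m * f`_m = 0) -> f = 0) ->
  forall al, supp n al -> (forall s, sl n E al s = 0) -> forall s, al s = 0.
Proof.
move=> hE al h0 h1 s; elim: s al h0 h1 => [|a s IH] al h0 h1.
  exact: (h1 [::]).
have [ha|ha] := ltnP a n; last by rewrite h0 //= ltnNge ha.
apply: (IH (fun r => al (a :: r))).
  by move=> r hr; apply: h0; rewrite /= negb_and hr orbT.
move=> r; pose f := \poly_(m < n) sl n E (fun t => al (m :: t)) r.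
have /(congr1 (fun q : {poly R} => q`_a)) : f = 0.
  apply: hE; first exact: size_poly.
  move=> l hl; rewrite -[RHS](h1 (l :: r)) /=; apply: eq_bigr => m _.
  by rewrite coef_poly ltn_ord.
by rewrite coef_poly ha coef0.
Qed.

(* Already the products u x^r with u a product of N linear factors with roots
   among fixed N + i points suffice: in terms of the values at these points the
   wedge product of u, x u, ..., x^(i-1) u is supported on the complement of
   the zeros of u. *)
Lemma chain_span (ga : seq nat -> k) : alt ga -> supp D ga -> tdeg i ga ->
  exists (c : {set 'I_D} -> k) (u : {set 'I_D} -> {poly k}),
    (forall A, (size (u A) <= N.+1)%N) /\
    forall s, ga s = \sum_A c A * chain (om (u A)) i s.
Proof.
move=> h1 h2 h3.
have [pts upts spts] := closed_points k D.
pose y (l : nat) : k := pts`_l.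
have yinj l l' : (l < D)%N -> (l' < D)%N -> (y l == y l') = (l == l').
  by move=> hl hl'; rewrite /y nth_uniq ?spts.
(* Evaluation at the D points. The passage to values is injective on tensors by
   [sl_vandermonde_inj], and it makes the supports of the products visible. *)
pose E l m := if (l < D)%N then y l ^+ m else 0.
pose uu (A : {set 'I_D}) : {poly k} := \prod_(l in ~: A) ('X - (y l)%:P).
pose u (A : {set 'I_D}) := if #|A| == i then uu A else 0.
have su (A : {set 'I_D}) : (size (u A) <= N.+1)%N.
  rewrite /u; case: eqP => hA; last by rewrite size_poly0.
  rewrite /uu size_prod; last by move=> l _; rewrite polyXsubC_eq0.
  rewrite (eq_bigr (fun=> 2%N)) => [|l _]; last by rewrite size_XsubC.
  rewrite sum_nat_const (_ : #|in_mem^~ _| = #|~: A|); last by apply: eq_card.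
  by have := cardsC A; rewrite card_ord hA; lia.
have uA0 (A : {set 'I_D}) (l : 'I_D) : l \notin A -> (uu A).[y l] = 0.
  by move=> hl; rewrite horner_prod (bigD1 l) ?inE //= !hornerE subrr mul0r.
have uA1 (A : {set 'I_D}) (l : 'I_D) : l \in A -> (uu A).[y l] != 0.
  move=> hl; rewrite horner_prod; apply/prodf_neq0 => l'; rewrite inE => hl'.
  rewrite !hornerE subr_eq0 yinj ?ltn_ord //.
  by apply: contraNneq hl' => /val_inj <-.
pose H A r a := if (a < D)%N then y a ^+ r * (u A).[y a] else 0.
have hat A s : sl D E (chain (om (u A)) i) s = chain (H A) i s.
  rewrite /chain sl_wedges; apply: eq_chain => r hr a.
  rewrite /H /E; case: ltnP => ha; last by rewrite big1 // => m _; rewrite mul0r.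
  have sr : (size ('X^r * u A)%R <= D)%N.
    rewrite (leq_trans (size_polyMleq _ _)) // size_polyXn /=.
    by apply: leq_trans (leq_add (leqnn r) (su A)) _; move: hr; clear; lia.
  transitivity (('X^r * u A).[y a]); last by rewrite hornerM hornerXn.
  by rewrite (horner_coef_wide _ sr); apply: eq_bigr => m _; rewrite mulrC.
pose gh := sl D E ga.
pose c A := gh (enl A) / chain (H A) i (enl A).
have supp_H A : supp D (chain (H A) i).
  by apply: supp_chain => b a _ ha; rewrite /H ltnNge ha.
have gE : gh =1 fun s => \sum_A c A * chain (H A) i s.
  apply: (alt_ext two_regk (n := D)).
  - exact: alt_sl.
  - by move=> s1 a b s2; rewrite -sumrN; apply: eq_bigr => A _; rewrite alt_chain mulrN.
  - by apply: supp_sl => a m ha _; rewrite /E ltnNge ha.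
  - by move=> s hs; rewrite big1 // => A _; rewrite supp_H // mulr0.
  move=> A; have [hA|hA] := eqVneq #|A| i; last first.
    rewrite [LHS](@tdeg_sl _ i D E ga h3) ?size_enl // big1 // => B _.
    by rewrite (@tdeg_chain _ _ i) ?mulr0 // size_enl.
  rewrite (bigD1 A) //= big1 ?addr0 => [|B hB].
    rewrite divfK //.
    have := @chain_vandermonde k two_regk y (fun a => if (a < D)%N then (u A).[y a] else 0) (enl A).
    rewrite size_enl hA (@eq_chain _ _ (H A) i); first apply.
    - rewrite map_inj_in_uniq ?uniq_enl // => a b ha hb /eqP.
      by rewrite yinj => [/eqP //||]; apply: (allP (enl_lt A)).
    - apply/allP => _ /mapP[a ha ->]; rewrite ltn_ord /u hA eqxx.
      by apply: uA1; rewrite -mem_enum.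
    - by move=> b hb a; rewrite /H; case: ifP => // _; rewrite mulr0.
  have [hcB|hcB] := eqVneq #|B| i; last first.
    by rewrite /c /gh (@tdeg_sl _ i D E ga h3) ?size_enl // !mul0r.
  have [l lA lB] : exists2 l, l \in A & l \notin B.
    apply/subsetPn; apply: contra hB => sAB.
    by rewrite eq_sym eqEcard sAB hA hcB leqnn.
  rewrite (@chain_vanish _ (H B) i l) ?mulr0 ?mem_enl // => q _.
  by rewrite /H ltn_ord /u hcB eqxx uA0 ?mulr0.
exists c, u; split=> // s; apply/eqP; rewrite -subr_eq0; apply/eqP; move: s.
apply: (@sl_vandermonde_inj _ E D).
- move=> f hf hE; apply/eqP; apply: contraT => f0.
  suff hr : all (root f) pts by have := max_poly_roots f0 hr upts; rewrite spts ltnNge hf.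
  apply/allP => _ /(nthP 0)[l hl <-]; rewrite spts in hl; rewrite rootE.
  rewrite (horner_coef_wide _ hf); apply/eqP; apply: etrans (hE l hl).
  by apply: eq_bigr => m _; rewrite /E hl mulrC.
- move=> s hs; rewrite h2 // sub0r big1 ?oppr0 // => A _.
  rewrite (@supp_chain _ D) ?mulr0 // => b a hb ha.
  rewrite /om coefXnM ltnNge; case: leqP => //= hba.
  by rewrite nth_default // (leq_trans (su A)); lia.
move=> s; rewrite slB sl_lin -/(gh) gE -sumrB big1 // => A _.
by rewrite hat subrr.
Qed.

End Span.

Lemma size_sl_lx (R : idomainType) n (al : seq nat -> {poly R}) d s : (forall s, (size (al s) <= d)%N) ->
  (size (sl n (lx R) al s) <= d + size s)%N.
Proof.
move=> h; elim: s al d h => [|a s IH] al d h /=; first by rewrite addn0; apply: h.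
rewrite (leq_trans (size_sum _ _ _)) //; apply/bigmax_leqP => m _.
rewrite (leq_trans (size_polyMleq _ _)) //.
have s2 : (size (lx R a m) <= 2)%N.
  rewrite /lx (leq_trans (size_polyD _ _)) // geq_max size_polyN.
  case: (_ == a); case: (_ == a); rewrite ?mulr1n ?mulr0n ?size_poly0 ?size_polyX ?size_poly1 //.
have ar (x y z : nat) : (x <= 2)%N -> (y <= z)%N -> ((x + y).-1 <= z.+1)%N by lia.
by rewrite addnS; apply: ar => //; apply: IH.
Qed.

(** * Boundaries built from powers of x - t *)

Section Family.
Variable R : idomainType.
Hypothesis two_reg : forall x : {poly R}, x + x = 0 -> x = 0.
Variables (N i : nat) (u : {poly R}).
Hypothesis su : (size u <= N.+1)%N.
Local Notation D := (N + i)%N.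
Local Notation P := {poly R}.

Definition ux : {poly P} := map_poly polyC u.
Definition xt : {poly P} := 'X - ('X)%:P.
Definition wr (r : nat) : nat -> P := cf (xt ^+ r * ux).

Lemma size_xtu r : (size (xt ^+ r * ux)%R <= N.+1 + r)%N.
Proof.
rewrite (leq_trans (size_polyMleq _ _)) // size_exp_XsubC addSn /= addnC leq_add2r.
by rewrite (leq_trans (size_poly _ _)).
Qed.

(** The powers (x - t)^r are monic of degree r in x, so the change from x^r is unitriangular. *)
Lemma chain_wr q : chain wr q =1 chain (om ux) q.
Proof.
apply: chain_unip => // r _; exists (fun m => (xt ^+ r)`_m) => a.
have mr : xt ^+ r \is monic by apply: monic_exp; apply: monicXsubC.
have sr : size (xt ^+ r) = r.+1 by rewrite size_exp_XsubC.
rewrite /wr /cf {1}(monic_split mr sr) mulrDl mulr_suml coefD coef_sum.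
by congr (_ + _); apply: eq_bigr => m _; rewrite -scalerAl coefZ.
Qed.

Lemma wedges_polyC (G : nat -> nat -> R) bs s :
  wedges (fun r a => (G r a)%:P) bs (one P) s = (wedges G bs (one R) s)%:P.
Proof.
elim: bs s => [|b bs IH] s /=; first by rewrite /one; case: (s == _); rewrite ?polyC1 ?polyC0.
rewrite (wedge_eq _ IH); symmetry.
by apply: (@wedge_map _ _ (polyC : {rmorphism R -> P})) => a x; apply: polyCM.
Qed.

Lemma chain_omC q s : chain (om ux) q s = (chain (om u) q s)%:P.
Proof.
rewrite /chain -wedges_polyC; congr (wedges _ _ _ s).
apply: functional_extensionality => r; apply: functional_extensionality => a.
by rewrite /om !coefXnM; case: ifP => _; rewrite ?polyC0 // coef_map.
Qed.

Lemma lx_wr n r a : (N + r < n)%N -> \sum_(m < n) lx R a m * wr r m = wr r.+1 a.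
Proof.
move=> hn; have sr := size_xtu r.
have w0 m : (n <= m)%N -> wr r m = 0.
  by move=> hm; rewrite /wr /cf nth_default // (leq_trans sr) //; lia.
have [ha|ha] := leqP a n.
  rewrite sum_lx_r // /wr /cf exprS -mulrA mulrBl coefB coefXM coefCM.
  by case: a ha.
rewrite big1 => [|m _]; last by rewrite (lx_out R ha) ?mul0r.
rewrite /wr /cf nth_default // (leq_trans (size_xtu _)) //; lia.
Qed.

Lemma chain_wrS q b n : (N + q + b < n.+1)%N ->
  chain (fun r => wr (r + b).+1) q =1 sl n (lx R) (chain (fun r => wr (r + b)) q).
Proof.
move=> hn s; rewrite [in RHS]/chain sl_wedges; symmetry; apply: eq_chain => r hr a.
by rewrite lx_wr //; lia.
Qed.

Definition Bt : seq nat -> P := chain (fun r => wr r.+1) i.+1.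
Definition Cs s : P := (chain (om u) i s)%:P.

(** Taking one factor x - t out of every slot leaves a product that is constant in t by [chain_wr];
    this bounds the degree of [Bt] in t by i + 1. *)
Lemma BtE : Bt =1 sl D.+1 (lx R) (fun s => (chain (om u) i.+1 s)%:P).
Proof.
move=> s; rewrite /Bt -(@eq_chain _ (fun r => wr (r + 0).+1)); last by move=> r _ a; rewrite addn0.
rewrite (@chain_wrS i.+1 0 D.+1); last by lia.
apply: sl_eq => t; rewrite -chain_omC -chain_wr; apply: eq_chain => r _ a.
by rewrite addn0.
Qed.

Lemma size_Bt s : (size (Bt s) <= i.+2)%N.
Proof.
have [hs|hs] := eqVneq (size s) i.+1; last by rewrite /Bt (@tdeg_chain P _ i.+1) ?size_poly0.
rewrite BtE; apply: leq_trans (@size_sl_lx _ _ _ 1 s _) _; last by rewrite hs.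
by move=> t; apply: size_polyC_leq1.
Qed.

Lemma supp_Bt : supp D.+2 Bt.
Proof.
apply: supp_chain => b a hb ha; rewrite /wr /cf nth_default //.
by rewrite (leq_trans (size_xtu _)) //; lia.
Qed.

Lemma ip_curve n (f : {poly P}) : (size f <= n)%N -> ip n (curve R) (cf f) = f.['X].
Proof.
move=> sf; rewrite (horner_coef_wide _ sf) /ip; apply: eq_bigr => a _.
by rewrite mulrC.
Qed.

Lemma ip_curve' n (f : {poly P}) : (size f <= n)%N -> ip n (curve' R) (cf f) = f^`().['X].
Proof.
move=> sf; have e : f = \sum_(a < n) f`_a *: 'X^a.
  rewrite -{1}[f]coefK poly_def (big_ord_widen n (fun a => f`_a *: 'X^a)) // big_mkcond.
  apply: eq_bigr => a _; case: ltnP => // h.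
  by rewrite nth_default // scale0r.
have -> : f^`() = \sum_(a < n) f`_a *: ('X^a)^`().
  by rewrite {1}e raddf_sum; apply: eq_bigr => a _; rewrite /= derivZ.
rewrite horner_sum /ip; apply: eq_bigr => a _.
by rewrite hornerZ derivXn hornerMn hornerXn /curve' derivXn mulrC.
Qed.

Lemma ux_X : ux.['X] = u.
Proof. by rewrite -[RHS]comp_polyXr. Qed.

Lemma ux'_X : ux^`().['X] = u^`().
Proof. by rewrite deriv_map -[RHS]comp_polyXr. Qed.

Lemma xt_X : xt.['X] = 0. Proof. by rewrite hornerXsubC subrr. Qed.

(** Pairing with the curve is evaluation at x = t, where every factor (x - t)^(r+1) u vanishes. *)
Lemma contr_curve_Bt s : contr D.+2 (curve R) Bt s = 0.
Proof.
rewrite /Bt /chain.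
suff h bs t : all (ltn^~ i.+1) bs ->
    contr D.+2 (curve R) (wedges (fun r => wr r.+1) bs (one P)) t = 0.
  by apply: h; apply/allP => r; rewrite mem_rev mem_iota.
elim: bs t => [|r bs IH] t /=; first by rewrite /contr big1 // => a _; rewrite mulr0.
case/andP=> hr hbs; rewrite contr_wedge wedge_r0 ?subr0 => [|t']; last exact: IH.
rewrite ip_curve; last by rewrite (leq_trans (size_xtu _)) //; lia.
by rewrite hornerM horner_exp xt_X expr0n mul0r mul0r.
Qed.

Lemma deriv_wedge (g : nat -> P) al s :
  (wedge g al s)^`() = wedge (fun a => (g a)^`()) al s + wedge g (fun r => (al r)^`()) s.
Proof.
elim: s al => [|a s IH] al /=; first by rewrite deriv0 addr0.
by rewrite derivB derivM IH; ring.
Qed.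

Lemma deriv_wr r a : (wr r.+1 a)^`() = - r.+1%:R * wr r a.
Proof.
pose delta_tensor : {poly P} -> {poly P} := map_poly (deriv (R := R)).
have dM (p q : {poly P}) : delta_tensor (p * q) = delta_tensor p * q + p * delta_tensor q.
  apply/polyP => m; rewrite coefD coef_map !coefM /= raddf_sum -big_split.
  by apply: eq_bigr => b _ /=; rewrite derivM !coef_map.
have dux : delta_tensor ux = 0.
  by apply/polyP => m; rewrite coef_map coef0 /ux coef_map /= derivC.
have dxt : delta_tensor xt = - 1.
  rewrite /delta_tensor /xt raddfB /= map_polyC /= derivX (_ : map_poly _ 'X = 0) ?sub0r ?polyC1 //.
  by apply/polyP => m; rewrite coef_map coefX coef0; case: eqP => _; rewrite /= ?derivC ?deriv0 // -polyC1 derivC.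
have dxr m : delta_tensor (xt ^+ m.+1) = - m.+1%:R * xt ^+ m.
  elim: m => [|m IH]; first by rewrite expr1 expr0 dxt mulr1.
  by rewrite exprS dM IH dxt -[m.+2%:R]natr1 exprS; ring.
transitivity ((delta_tensor (xt ^+ r.+1 * ux))`_a); first by rewrite coef_map.
rewrite dM dux mulr0 addr0 dxr.
have -> : - r.+1%:R * xt ^+ r * ux = - ((xt ^+ r * ux) *+ r.+1).
  by rewrite -mulrA mulNr mulr_natl.
by rewrite coefN coefMn mulNr mulr_natl.
Qed.

Local Notation W2 := (fun r => wr r.+2).

Lemma chain_head q G : chain G q.+1 = wedges (fun r => G r.+1) (rev (iota 0 q)) (wedge (G 0) (one P)).
Proof.
rewrite /chain -[iota 0 q.+1]/(0%N :: iota 1 q) (iotaDl 1 0) rev_cons -map_rev.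
by rewrite /wedges foldr_rcons foldr_map.
Qed.

(** The t-derivative of (x - t)^(r+1) u is -(r + 1) (x - t)^r u, which for r > 0 is a multiple of
    another factor; the factor with r = 0 alone contributes. *)
Lemma deriv_Bt q s : (chain (fun r => wr r.+1) q.+1 s)^`()
  = - wedges W2 (rev (iota 0 q)) (wedge (wr 0) (one P)) s.
Proof.
elim: q s => [|q IH] s.
  rewrite /chain /= deriv_wedge [X in _ + X]wedge_r0 ?addr0.
    rewrite (_ : (fun a => _) = fun a => - 1 * wr 0 a) ?wedgeZl ?mulN1r //.
    by apply: functional_extensionality => a; rewrite deriv_wr.
  by move=> r; rewrite /one; case: (r == _); rewrite ?deriv0 // -polyC1 derivC.
rewrite chainS deriv_wedge.
rewrite (_ : (fun a => _) = fun a => - q.+2%:R * wr q.+1 a); last first.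
  by apply: functional_extensionality => a; rewrite deriv_wr.
rewrite wedgeZl {1}chainS wedgegg // mulr0 add0r.
rewrite (_ : rev (iota 0 q.+1) = q :: rev (iota 0 q)); last by rewrite -addn1 iotaD rev_cat.
by rewrite /= -wedgeN; apply: wedge_eq.
Qed.

Definition At b s : P := 'X^b * Bt s.

(** Pairing with [curve'] is the x-derivative at x = t: it gives u' on u, u on (x - t) u, and 0 on
    higher powers of x - t. In the two terms of the derivative of t^b Bt the factor of order 1,
    respectively 0, is therefore removed; the coefficients combine to W(u, t^b), and the factors of
    order at least 2 remain. *)
Lemma contr_At b s : contr D.+2 (curve' R) (fun s => (At b s)^`()) s
  = (-1) ^+ i * (Wr u 'X^b * sl D.+1 (lx R) (sl D (lx R) Cs) s).
Proof.
have d1 (f : {poly P}) : (xt * f)^`().['X] = f.['X].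
  rewrite derivM hornerD !hornerM xt_X mul0r addr0.
  by rewrite derivB derivX derivC subr0 hornerC mul1r.
have ip0 r : (r < i)%N -> ip D.+2 (curve' R) (W2 r) = 0.
  move=> hr; rewrite ip_curve'; last by rewrite (leq_trans (size_xtu _)) //; lia.
  by rewrite exprS exprS -!mulrA d1 hornerM xt_X mul0r.
have ip1 : ip D.+2 (curve' R) (wr 1) = u.
  rewrite ip_curve'; last by rewrite (leq_trans (size_xtu _)) //; lia.
  by rewrite expr1 d1 ux_X.
have ip00 : ip D.+2 (curve' R) (wr 0) = u^`().
  rewrite ip_curve'; last by rewrite (leq_trans (size_xtu _)) //; lia.
  by rewrite expr0 mul1r ux'_X.
have cw g : contr D.+2 (curve' R) (wedges W2 (rev (iota 0 i)) (wedge g (one P))) s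
    = (-1) ^+ i * (ip D.+2 (curve' R) g * chain W2 i s).
  rewrite /chain.
  transitivity ((-1) ^+ size (rev (iota 0 i)) * wedges W2 (rev (iota 0 i)) (fun t => ip D.+2 (curve' R) g * one P t) s).
    have : all (ltn^~ i) (rev (iota 0 i)) by apply/allP => r; rewrite mem_rev mem_iota.
    elim: (rev _) s => [|r bs IH] s /=.
      move=> _; rewrite mul1r contr_wedge wedge_r0 ?subr0 // => t.
      by rewrite /contr big1 // => a _; rewrite mulr0.
    case/andP=> hr hbs; rewrite contr_wedge ip0 // mul0r sub0r.
    by rewrite (wedge_eq _ (fun t => IH t hbs)) wedgeZ exprS; ring.
  by rewrite size_rev size_iota wedgesZ.
have -> : sl D.+1 (lx R) (sl D (lx R) Cs) s = chain W2 i s.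
  rewrite -(@eq_chain _ (fun r => wr (r + 1).+1)); last by move=> r _ a; rewrite addn1.
  rewrite (@chain_wrS i 1 D.+1); last by lia.
  apply: sl_eq => t.
  rewrite -(@eq_chain _ (fun r => wr (r + 0).+1)); last by move=> r _ a; rewrite addn0 addn1.
  rewrite (@chain_wrS i 0 D); last by lia.
  apply: sl_eq => t'; rewrite /Cs -chain_omC -chain_wr; apply: eq_chain => r _ a.
  by rewrite addn0.
have -> : (fun s => (At b s)^`()) = fun s =>
    ('X^b)^`() * wedges W2 (rev (iota 0 i)) (wedge (wr 1) (one P)) s
    + - 'X^b * wedges W2 (rev (iota 0 i)) (wedge (wr 0) (one P)) s.
  apply: functional_extensionality => t.
  rewrite /At derivM /Bt deriv_Bt {1}chain_head; ring.
by rewrite contrD !contrZ !cw ip1 ip00 /Wr; ring.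
Qed.

End Family.

Lemma span_dual (k : fieldType) (I J : finType) (V : I -> J -> k) (b : J -> k) :
  (forall la : J -> k, (forall x, \sum_j V x j * la j = 0) -> \sum_j b j * la j = 0) ->
  exists c : I -> k, forall j, b j = \sum_x c x * V x j.
Proof.
move=> h.
pose M := \matrix_(x < #|I|, j < #|J|) V (enum_val x) (enum_val j).
pose r := \row_(j < #|J|) b (enum_val j).
have : (r <= M)%MS.
  rewrite submxE; move: (mulmx_coker M); move: (cokermx M) => K hK.
  apply/eqP/rowP => c; rewrite !mxE.
  have e (f : J -> k) : \sum_j f j * K (enum_rank j) c
      = \sum_(j < #|J|) f (enum_val j) * K j c.
    rewrite (reindex_onto enum_val enum_rank) /=; last by move=> j _; apply: enum_rankK.
    by apply: eq_big => [j|j _]; rewrite enum_valK ?eqxx.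
  transitivity (\sum_j b j * K (enum_rank j) c).
    by rewrite e; apply: eq_bigr => j _; rewrite !mxE.
  apply: h => x; rewrite e.
  have /matrixP/(_ (enum_rank x) c) := hK; rewrite !mxE => hh; rewrite -[RHS]hh.
  by apply: eq_bigr => j _; rewrite !mxE enum_rankK.
case/submxP => d hd; exists (fun x => d ord0 (enum_rank x)) => j.
have /rowP/(_ (enum_rank j)) := hd; rewrite !mxE enum_rankK => ->.
rewrite [RHS](reindex_onto enum_val enum_rank) /=; last by move=> x _; apply: enum_rankK.
apply: eq_big => [x|x _]; first by rewrite enum_valK eqxx.
by rewrite !mxE enum_valK enum_rankK.
Qed.

Section CoefMap.
Variables (k : fieldType) (n : nat) (mu : 'X_{1..n}).
Local Notation Q := {mpoly k[n]}.

(** Extracts the coefficient of the monomial mu in the coefficients of u. It is compatible with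
    multiplication by t and with the derivative, so identities for the generic u can be read off
    over k. *)
Definition cm : {poly Q} -> {poly k} := map_poly (mcoeff mu).
HB.instance Definition _ := GRing.Additive.copy cm (map_poly (mcoeff mu)).

Lemma cmB x y : cm (x - y) = cm x - cm y. Proof. exact: raddfB. Qed.
Lemma cmMn x e : cm (x *+ e) = cm x *+ e. Proof. exact: raddfMn. Qed.
Lemma cm0 : cm 0 = 0. Proof. exact: raddf0. Qed.

Lemma coef_cm x e : (cm x)`_e = (x`_e)@_mu.
Proof. by rewrite coef_map. Qed.

Lemma cm_Xn a x : cm ('X^a * x) = 'X^a * cm x.
Proof.
apply/polyP => e; rewrite coef_cm !coefXnM; case: ifP => _; first exact: mcoeff0.
by rewrite coef_cm.
Qed.

Lemma cm_X x : cm ('X * x) = 'X * cm x. Proof. exact: (cm_Xn 1 x). Qed.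

Lemma cm_curve a x : cm (curve _ a * x) = curve _ a * cm x. Proof. exact: cm_Xn. Qed.

Lemma cm_curve' a x : cm (curve' _ a * x) = curve' _ a * cm x.
Proof. by rewrite /curve' !derivXn !mulrnAl cmMn cm_Xn. Qed.

Lemma cm_lx a m x : cm (lx _ a m * x) = lx _ a m * cm x.
Proof.
by rewrite /lx !mulrBl cmB !mulrnAl !cmMn cm_X !mul1r.
Qed.

Lemma cm_deriv x : cm (x^`()) = (cm x)^`().
Proof. by apply/polyP => e; rewrite coef_cm !coef_deriv coef_cm raddfMn. Qed.

Lemma size_cm x : (size (cm x) <= size x)%N. Proof. exact: size_poly. Qed.

End CoefMap.

Lemma Wr_gen_homog (k : closedFieldType) N b e : (Wr (gen_poly k N) 'X^b)`_e \is 1.-homog.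
Proof.
have gh c : (gen_poly k N)`_c \is 1.-homog.
  rewrite coef_poly; case: ifP => _; last exact: rpred0.
  by rewrite dhomogX; apply/eqP; apply: mdeg1.
rewrite /Wr coefB !coefM; apply: rpredB; apply: rpred_sum => i _; rewrite -[1%N]addn0.
  apply: dhomogM; first exact: gh.
  rewrite coef_deriv coefXn; apply: rpredMn; case: eqP => _; [exact: dhomog1 | exact: rpred0].
apply: dhomogM; first by rewrite coef_deriv; apply: rpredMn; apply: gh.
by rewrite coefXn; case: eqP => _; [exact: dhomog1 | exact: rpred0].
Qed.

Lemma chain_gen_homog (k : closedFieldType) N i s : chain (om (gen_poly k N)) i s \is i.-homog.
Proof.
have gh c : (gen_poly k N)`_c \is 1.-homog.
  rewrite coef_poly; case: ifP => _; last exact: rpred0.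
  by rewrite dhomogX; apply/eqP; apply: mdeg1.
elim: i s => [|i IH] s.
  by rewrite /chain /= /one; case: (s == _); [apply: dhomog1 | apply: rpred0].
rewrite chainS; elim: s (chain _ _) IH => [|a s IHs] al IH /=; first exact: rpred0.
apply: rpredB; last exact: IHs.
rewrite -[i.+1]add1n; apply: dhomogM => //.
by rewrite /om coefXnM; case: ifP => _; rewrite ?rpred0.
Qed.

Lemma two_reg_poly (R : idomainType) : (2%:R : R) != 0 ->
  forall x : {poly R}, x + x = 0 -> x = 0.
Proof.
move=> h x; rewrite -mulr2n -mulr_natl => /eqP; rewrite mulf_eq0 => /orP[|/eqP //].
by rewrite -polyC_natr polyC_eq0 (negbTE h).
Qed.

Section Image.
Variables (k : closedFieldType) (N i : nat).
Hypothesis N0 : (0 < N)%N.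
Hypothesis two : (2%:R : k) != 0.
Local Notation D := (N + i)%N.
Local Notation Q := {mpoly k[N.+1]}.
Hypothesis relE0 : forall F : nat -> Q, wronskian_rel F ->
  (forall e, (e < N.*2.-1)%N -> F e \is i.-homog) ->
  forall e, (e < N.*2.-1)%N -> F e = 0.

Lemma twoQ : (2%:R : Q) != 0.
Proof. by rewrite -mpolyC_nat mpolyC_eq0. Qed.

Definition Am (b : nat) (mu : 'X_{1..N.+1}) s : {poly k} := cm mu (At i (gen_poly k N) b s).
Definition Vm (b : nat) (mu : 'X_{1..N.+1}) s : {poly k} :=
  cm mu (Wr (gen_poly k N) 'X^b * (chain (om (gen_poly k N)) i s)%:P).

Lemma coef_Vm b mu s e :
  (Vm b mu s)`_e = ((Wr (gen_poly k N) 'X^b)`_e * chain (om (gen_poly k N)) i s)@_mu.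
Proof. by rewrite coef_cm coefMC. Qed.

Lemma alt_Am b mu : alt (Am b mu).
Proof.
move=> s1 x y s2; rewrite /Am /At /Bt alt_chain mulrN.
exact: raddfN.
Qed.

Lemma supp_Am b mu : supp D.+2 (Am b mu).
Proof.
by move=> s hs; rewrite /Am /At (supp_Bt (size_gen_poly k N)) // mulr0; apply: raddf0.
Qed.

Lemma tdeg_Am b mu : tdeg i.+1 (Am b mu).
Proof.
by move=> s hs; rewrite /Am /At /Bt (@tdeg_chain _ _ i.+1) // mulr0; apply: raddf0.
Qed.

Lemma size_Am b mu s : (b <= N)%N -> (size (Am b mu s) <= D.+2)%N.
Proof.
move=> hb; rewrite (leq_trans (size_cm _ _)) // /At (leq_trans (size_polyMleq _ _)) //.
rewrite size_polyXn /=.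
have h := size_Bt (two_reg_poly twoQ) i (size_gen_poly k N) s.
by apply: leq_trans (leq_add hb h) _; rewrite !addnS.
Qed.

Lemma contr_curve_Am b mu s : contr D.+2 (curve k) (Am b mu) s = 0.
Proof.
rewrite -(@contr_map _ _ (cm mu) D.+2 (curve Q)); last by move=> a x; apply: cm_curve.
by rewrite contrZ (contr_curve_Bt i (size_gen_poly k N)) mulr0; apply: raddf0.
Qed.

Lemma contr_curve'_Am b mu s : contr D.+2 (curve' k) (fun s => (Am b mu s)^`()) s
  = (-1) ^+ i * sl D.+1 (lx k) (sl D (lx k) (Vm b mu)) s.
Proof.
transitivity (cm mu (contr D.+2 (curve' Q) (fun s => (At i (gen_poly k N) b s)^`()) s)).
  rewrite (@contr_map _ _ (cm mu) D.+2 (curve' Q) (curve' k)); last by move=> a x; apply: cm_curve'.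
  by apply: eq_bigr => a _; rewrite /Am -cm_deriv.
rewrite (contr_At (two_reg_poly twoQ) i (size_gen_poly k N)).
have -> (x : {poly Q}) : cm mu ((-1) ^+ i * x) = (-1) ^+ i * cm mu x.
  by rewrite -signr_odd -[in RHS]signr_odd; case: odd; rewrite ?expr1 ?mulN1r ?mul1r; [exact: raddfN|].
congr (_ * _); rewrite -slZ.
rewrite (@sl_map _ _ (cm mu) D.+1 (lx Q) (lx k)); last by move=> a m x _; apply: cm_lx.
apply: sl_eq => t; rewrite /= -slZ.
by rewrite (@sl_map _ _ (cm mu) D (lx Q) (lx k)) // => a m x _; apply: cm_lx.
Qed.

(** By [span_dual] it suffices that a functional la killing all [Vm] kills be. Applied to the
    coordinates of u /\ x u /\ ..., la yields forms F_e of degree i with the Wronskian relations, so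
    F = 0. By [chain_span] every coefficient of be is a combination of such products for special u,
    on which la takes the values F_e(u). *)
Lemma curve'_contraction_surj (be : seq nat -> {poly k}) : alt be -> supp D be -> tdeg i be ->
  (forall s, (size (be s) <= N.*2.-1)%N) ->
  exists A : seq nat -> {poly k}, [/\ alt A, supp D.+2 A, tdeg i.+1 A, forall s, (size (A s) <= D.+2)%N
    & (forall s, contr D.+2 (curve k) A s = 0) /\
      forall s, contr D.+2 (curve' k) (fun s => (A s)^`()) s
        = sl D.+1 (lx k) (sl D (lx k) be) s].
Proof.
move=> h1 h2 h3 h4.
(* The entries of [Vm] come from forms of degree i + 1 in the coefficients of u, whence the bound i
   + 2 on the monomials. *)
pose I : finType := ('I_N.+1 * 'X_{1..N.+1 < i.+2})%type.
pose J : finType := ({set 'I_D} * 'I_(N.*2.-1))%type.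
pose V (x : I) (y : J) : k := (Vm x.1 (x.2 : 'X_{1..N.+1}) (enl y.1))`_(y.2).
pose b (y : J) : k := (be (enl y.1))`_(y.2).
have [la hla|c hc] := @span_dual k I J V b.
  pose F (e : nat) : Q := if insub e is Some e' then
    \sum_(S : {set 'I_D}) la (S, e') *: chain (om (gen_poly k N)) i (enl S) else 0.
  have FE (e : 'I_(N.*2.-1)) :
      F e = \sum_(S : {set 'I_D}) la (S, e) *: chain (om (gen_poly k N)) i (enl S).
    by rewrite /F valK.
  have F0 e : (e < N.*2.-1)%N -> F e = 0.
    apply: relE0 => [b' hb'|e' he']; last first.
      rewrite -[e']/(val (Ordinal he')) FE; apply: rpred_sum => S _; apply: rpredZ.
      exact: chain_gen_homog.
    have h1' : ip N.*2.-1 F (cf (Wr (gen_poly k N) 'X^b')) \is i.+1.-homog.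
      apply: rpred_sum => e' _; rewrite FE mulr_suml; apply: rpred_sum => S _.
      rewrite mulrC -[i.+1]add1n; apply: dhomogM; first exact: Wr_gen_homog.
      by apply: rpredZ; apply: chain_gen_homog.
    apply/mpolyP => mu; rewrite mcoeff0.
    have [hmu|hmu] := eqVneq (mdeg mu) i.+1; last by rewrite (dhomog_nemf_coeff h1').
    have hb : (b' < N.+1)%N by rewrite ltnS.
    have hm : (mdeg mu < i.+2)%N by rewrite hmu.
    rewrite -[RHS](hla (Ordinal hb, BMultinom hm)) raddf_sum /=.
    rewrite (eq_bigr (fun p : J => V (Ordinal hb, BMultinom hm) (p.1, p.2) * la (p.1, p.2))); last by case.
    rewrite -(pair_bigA _ (fun S e => V (Ordinal hb, BMultinom hm) (S, e) * la (S, e))) /=.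
    rewrite exchange_big; apply: eq_bigr => e' _.
    rewrite FE mulr_suml raddf_sum /=; apply: eq_bigr => S _.
    rewrite /V /= coef_Vm -scalerAl mcoeffZ [chain _ _ _ * _]mulrC mulrC; exact: mulrC.
  rewrite (eq_bigr (fun p : J => b (p.1, p.2) * la (p.1, p.2))); last by case.
  rewrite -(pair_bigA _ (fun S e => b (S, e) * la (S, e))) /= exchange_big big1 // => e _ /=.
  pose ga s := (be s)`_e.
  have [c [u [su hga]]] := @chain_span k N i two N0 ga
    (fun s1 x y s2 => etrans (congr1 (fun p : {poly k} => p`_e) (h1 s1 x y s2)) (coefN _ _))
    (fun s hs => etrans (congr1 (fun p : {poly k} => p`_e) (h2 s hs)) (coef0 _ _))
    (fun s hs => etrans (congr1 (fun p : {poly k} => p`_e) (h3 s hs)) (coef0 _ _)).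
  rewrite /b /=.
  transitivity (\sum_A c A * \sum_(S : {set 'I_D}) la (S, e) * chain (om (u A)) i (enl S)).
    under [RHS]eq_bigr do rewrite mulr_sumr.
    rewrite [RHS]exchange_big; apply: eq_bigr => S _; rewrite -/(ga _) hga mulr_suml.
    by apply: eq_bigr => A _; ring.
  rewrite big1 // => A _.
  pose x (j : 'I_N.+1) := (u A)`_j.
  have hu : map_poly (meval x) (gen_poly k N) = u A.
    apply/polyP => j; rewrite coef_map /=; have [hj|hj] := ltnP j N.+1.
      by rewrite -[j]/(val (Ordinal hj)) gen_poly_coef mevalXU.
    rewrite nth_default ?(leq_trans (size_gen_poly k N)) // meval0 nth_default //.
    exact: leq_trans (su A) hj.
  have := congr1 (meval x) (F0 e (ltn_ord e)); rewrite meval0 FE raddf_sum /= => h.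
  suff -> : \sum_(S : {set 'I_D}) la (S, e) * chain (om (u A)) i (enl S) = 0 by rewrite mulr0.
  rewrite -[RHS]h.
  apply: eq_bigr => S _; rewrite mevalZ; congr (_ * _).
  have : forall q s, chain (om (u A)) q s = (chain (om (gen_poly k N)) q s).@[x]; last by [].
  elim=> [|q IH] s; first by rewrite /chain /= /one; case: (s == _); rewrite ?meval1 ?meval0.
  rewrite !chainS (@wedge_map _ _ (meval x) (om (gen_poly k N) q) (om (u A) q)).
    by apply: wedge_eq => t; rewrite IH.
  move=> a y /=; rewrite mevalM; congr (_ * _).
  have e' : 'X^q * u A = map_poly (meval x) ('X^q * gen_poly k N) by rewrite rmorphM /= map_polyXn hu.
  by rewrite /om e' coef_map.
exists (fun s => \sum_(x : I) ((-1) ^+ i * (c x)%:P) * Am x.1 (x.2 : 'X_{1..N.+1}) s); split.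
- by move=> s1 x y s2; rewrite -sumrN; apply: eq_bigr => z _; rewrite alt_Am mulrN.
- by move=> s hs; rewrite big1 // => z _; rewrite supp_Am // mulr0.
- by move=> s hs; rewrite big1 // => z _; rewrite tdeg_Am // mulr0.
- move=> s; rewrite (leq_trans (size_sum _ _ _)) //; apply/bigmax_leqP => z _.
  have -> : (-1) ^+ i * (c z)%:P = ((-1) ^+ i * c z)%:P.
    by rewrite polyCM rmorphXn rmorphN1.
  rewrite mul_polyC (leq_trans (size_scale_leq _ _)) // size_Am //.
  by rewrite -ltnS ltn_ord.
split=> s.
  by rewrite contr_lin big1 // => z _; rewrite contr_curve_Am mulr0.
transitivity (\sum_(x : I) ((-1) ^+ i * (c x)%:P)
    * contr D.+2 (curve' k) (fun s => (Am x.1 (x.2 : 'X_{1..N.+1}) s)^`()) s).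
  rewrite -contr_lin; apply: eq_bigr => a _; congr (_ * _).
  rewrite raddf_sum; apply: eq_bigr => z _ /=.
  have -> : (-1) ^+ i * (c z)%:P = ((-1) ^+ i * c z)%:P.
    by rewrite polyCM rmorphXn rmorphN1.
  by rewrite !mul_polyC derivZ.
have hbe : be =1 fun s => \sum_(x : I) (c x)%:P * Vm x.1 (x.2 : 'X_{1..N.+1}) s.
  apply: (alt_ext (two_reg_poly two) (n := D)) => //.
  - move=> s1 a b' s2; rewrite -sumrN; apply: eq_bigr => z _; rewrite -mulrN; congr (_ * _).
    by rewrite /Vm alt_chain polyCN mulrN; apply: raddfN.
  - move=> t ht; rewrite big1 // => z _.
    rewrite /Vm (@supp_chain _ D) ?polyC0 ?mulr0 ?cm0 ?mulr0 // => r a hr ha.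
    rewrite /om coefXnM; case: ifP => // _.
    by rewrite nth_default // (leq_trans (size_gen_poly k N)) //; lia.
  move=> S; apply/polyP => e; rewrite coef_sum.
  have [he|he] := ltnP e N.*2.-1; last first.
    rewrite nth_default ?(leq_trans (h4 _)) // big1 // => z _.
    rewrite coefCM coef_Vm nth_default ?mul0r ?mcoeff0 ?mulr0 //.
    have sz : (z.1 <= N)%N by rewrite -ltnS ltn_ord.
    apply: leq_trans he; apply: size_Wr; first exact: size_gen_poly.
    by rewrite size_polyXn.
  have := hc (S, Ordinal he); rewrite /b /V /= => ->.
  by apply: eq_bigr => z _; rewrite coefCM.
transitivity (sl D.+1 (lx k) (sl D (lx k)
     (fun s => \sum_(x : I) (c x)%:P * Vm x.1 (x.2 : 'X_{1..N.+1}) s)) s); last first.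
  by apply: sl_eq => t; apply: sl_eq => t'; rewrite hbe.
rewrite (@sl_eq _ D.+1 (lx k) _ (fun t => \sum_(x : I) (c x)%:P
    * sl D (lx k) (Vm x.1 (x.2 : 'X_{1..N.+1})) t)); last by move=> t; rewrite sl_lin.
rewrite sl_lin; apply: eq_bigr => z _; rewrite contr_curve'_Am.
have sq : (-1) ^+ i * (-1) ^+ i = 1 :> {poly k} by rewrite -exprMn mulrNN mulr1 expr1n.
by rewrite mulrACA sq mul1r.
Qed.

End Image.

(** * Vanishing outside the range *)

Section Vanish.
Variables (k : closedFieldType) (g i : nat).
Hypothesis two : (2%:R : k) != 0.
Local Notation P := {poly k}.
Local Notation cv := (curve k).
Local Notation cv' := (curve' k).
Local Notation lx := (lx k).
Local Notation hx := (hx k).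
Implicit Types (al be A : seq nat -> P).

Let twoP := two_reg_poly two.

Lemma size_wedge1 m al d s : (forall s, (size (al s) <= d)%N) ->
  (size (wedge (ev1 P m) al s) <= d)%N.
Proof.
elim: s al => [|a s IH] al h /=; first by rewrite size_poly0.
rewrite (leq_trans (size_polyD _ _)) // size_polyN geq_max IH // andbT.
by rewrite /ev1; case: (a == m); rewrite ?mul1r ?mul0r ?size_poly0.
Qed.

Lemma alt_many al n j : alt al -> supp n al -> tdeg j al -> (n < j)%N -> al = fun=> 0.
Proof.
move=> h1 h2 h3 nj; apply: functional_extensionality => s.
have [sj|sj] := eqVneq (size s) j; last by rewrite h3.
have [hs|hs] := boolP (all (ltn^~ n) s); last by rewrite h2.
apply: (alt_uniq twoP h1); apply/negP => us.
have := uniq_leq_size us (s2 := iota 0 n); rewrite size_iota sj leqNgt nj.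
by move=> h; suff: false by []; apply: h => a /(allP hs) ha; rewrite mem_iota.
Qed.

(** Divide al by x - t, split the quotient by powers t^d, and wedge each piece with e_m for m =
    min(d, g), whose pairing with the curve is t^m. The largest possible m keeps the degree in t at
    most g. For i > g the quotient is zero, an alternating tensor of degree i in dimension g. *)
Lemma curve_contraction_surj al : alt al -> supp g.+1 al -> tdeg i al ->
  (forall s, (size (al s) <= g.*2.+1)%N) -> (forall s, contr g.+1 cv al s = 0) ->
  exists A, [/\ alt A, supp g.+1 A, tdeg i.+1 A, forall s, (size (A s) <= g.+1)%N
    & forall s, contr g.+1 cv A s = al s].
Proof.
move=> h1 h2 h3 h4 h5.
pose a' := sl g.+1 hx al.
have alt' : alt a' by apply: alt_sl.
have supp' : supp g a' by apply: supp_hx.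
have deg' : tdeg i a' by apply: tdeg_sl.
have size' s : (size (a' s) <= g.*2.+1 - i)%N.
  have [e|e] := eqVneq (size s) i; last by rewrite deg' // size_poly0.
  by rewrite -e; apply: size_divide.
have alE s : sl g lx a' s = al s by apply: divide.
have [gi|gi] := ltnP g i.
  have a0 : a' = fun=> 0 by apply: (alt_many alt' supp' deg').
  exists (fun=> 0); split=> //.
  - by move=> *; rewrite oppr0.
  - by move=> s; rewrite size_poly0.
  - by move=> s; rewrite -alE a0 sl0 /contr big1 // => a _; rewrite mulr0.
pose Y (d : nat) s : P := sl g lx (fun s => ((a' s)`_d)%:P) s.
have altY d : alt (Y d).
  by apply: alt_sl => s1 x y s2; rewrite alt' coefN polyCN.
have suppY d : supp g.+1 (Y d) by apply: supp_lx.
have degY d : tdeg i (Y d) by apply: tdeg_sl => s hs; rewrite deg' // coef0 polyC0.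
have sizeY d s : (size (Y d s) <= i.+1)%N.
  have [e|e] := eqVneq (size s) i; last by rewrite degY // size_poly0.
  rewrite -e -add1n; apply: size_sl_lx => t; exact: size_polyC_leq1.
have contrY d s : contr g.+1 cv (Y d) s = 0.
  rewrite contr_sl; apply: sl_r0 => t; rewrite /contr big1 // => m _.
  by rewrite curve_lx // mul0r.
exists (fun s => \sum_(d < g.*2.+1 - i) 'X^(d - minn d g) * wedge (ev1 P (minn d g)) (Y d) s).
split.
- by move=> s1 x y s2; rewrite -sumrN; apply: eq_bigr => d _; rewrite (alt_wedge _ (altY d)) mulrN.
- move=> s hs; rewrite big1 // => d _; rewrite (supp_wedge _ (suppY d)) ?mulr0 // => a ha.
  by rewrite /ev1 gtn_eqF // (leq_trans _ ha) // ltnS geq_minr.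
- by move=> s hs; rewrite big1 // => d _; rewrite (tdeg_wedge (ev1 P (minn d g)) (degY d)) // mulr0.
- move=> s; rewrite (leq_trans (size_sum _ _ _)) //; apply/bigmax_leqP => d _.
  rewrite (leq_trans (size_polyMleq _ _)) // size_polyXn /=.
  apply: leq_trans (leq_add (leqnn _) (@size_wedge1 (minn d g) (Y d) i.+1 s (sizeY d))) _.
  by have := ltn_ord d; lia.
move=> s; rewrite contr_lin -alE.
transitivity (sl g lx (fun s => \sum_(d < g.*2.+1 - i) 'X^d * ((a' s)`_d)%:P) s).
  rewrite sl_lin; apply: eq_bigr => d _; rewrite contr_wedge wedge_r0 ?subr0; last exact: contrY.
  have hm : (minn d g < g.+1)%N by rewrite ltnS geq_minr.
  rewrite /ip (bigD1 (Ordinal hm)) //= /ev1 eqxx mulr1 big1 ?addr0 => [|a].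
    by rewrite mulrA /cv -exprD subnK ?geq_minl.
  by rewrite -val_eqE /= => /negbTE ->; rewrite mulr0.
apply: sl_eq => t; rewrite -[RHS]coefK poly_def (big_ord_widen _ (fun d => (a' t)`_d *: 'X^d) (size' t)).
rewrite [RHS]big_mkcond; apply: eq_bigr => d _.
by rewrite mulrC mul_polyC; case: ltnP => // h; rewrite nth_default // scale0r.
Qed.

Lemma contr_deriv n (f : nat -> P) A s :
  (contr n f A s)^`() = contr n (fun a => (f a)^`()) A s + contr n f (fun s => (A s)^`()) s.
Proof.
rewrite /contr raddf_sum -big_split; apply: eq_bigr => a _.
by rewrite /= derivM.
Qed.

Lemma alt_deriv A : alt A -> alt (fun s => (A s)^`()).
Proof. by move=> h s1 a b s2; rewrite h derivN. Qed.

Lemma boundary_cycle A n : alt A ->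
  let a := contr n cv A in let b := contr n cv' (fun s => (A s)^`()) in
  forall s, contr n cv b s + contr n cv' (fun s => (a s)^`()) s = 0 /\ contr n cv' b s = 0.
Proof.
move=> hA a b s; split; last first.
  by apply: twoP; rewrite /b {1}(contrC n cv' cv' (alt_deriv hA)) addNr.
have h0 t : contr n cv' (contr n cv' A) t = 0.
  by apply: twoP; rewrite {1}(contrC n cv' cv' hA) addNr.
have -> : (fun s => (a s)^`()) = fun s => contr n cv' A s + contr n cv (fun s => (A s)^`()) s.
  by apply: functional_extensionality => t; rewrite /a contr_deriv.
by rewrite contrD h0 add0r /b (contrC n cv cv' (alt_deriv hA)) addNr.
Qed.

(** A term with curve index a receives the factor a (e + 2 - a) from the two derivatives. In the top
    degree both factors are g, and one degree lower they are g and g - 1 in some order, so the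
    factor is the same for all terms. *)
Lemma top_coef A e s : (forall s, (size (A s) <= g.+1)%N) -> (g.*2 <= e.+3)%N -> (2 < g)%N ->
  (contr g.+1 cv' (fun s => (A s)^`()) s)`_e
  = (if e.+2 == g.*2 then g * g else if e.+3 == g.*2 then g * g.-1 else 0)%:R
    * (contr g.+1 cv A s)`_e.+2.
Proof.
move=> sA he g2; rewrite /contr !coef_sum mulr_sumr; apply: eq_bigr => a _.
have ag : (a <= g)%N by rewrite -ltnS ltn_ord.
rewrite /curve /curve' coefXnM; have -> : (e.+2 < a)%N = false by lia.
rewrite derivXn [in LHS]mulrnAl coefMn coefXnM; have -> : (e < a.-1)%N = false by lia.
case: (posnP a) => [->|a0].
  by rewrite mulr0n nth_default ?mulr0 // (leq_trans (sA _)) //; lia.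
rewrite coef_deriv (_ : (e - a.-1).+1 = e.+2 - a)%N; last by have := ltn_ord a; lia.
rewrite -mulrnA.
have [l|l] := ltnP g (e.+2 - a).
  by rewrite nth_default ?mul0rn ?mulr0 // (leq_trans (sA _)).
rewrite mulr_natl; congr (_ *+ _).
case: eqP => e2.
  by have -> : (a : nat) = g by [lia]; congr (_ * _)%N; lia.
have e3 : e.+3 = g.*2 by lia.
rewrite e3 eqxx.
have [h|h] : (a : nat) = g \/ (a : nat) = g.-1 by lia.
  by rewrite h mulnC; congr (_ * _)%N; lia.
by rewrite h; congr (_ * _)%N; lia.
Qed.

(* The coefficients of w^0, w^2 and w^3 in the contraction of
   [al + al' w + be w^2] with [t^m + m t^(m-1) w]; that of w^1 is the derivative
   of the first. *)
Definition pair_cycle al be := [/\ (forall s, contr g.+1 cv al s = 0),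
  (forall s, contr g.+1 cv be s + contr g.+1 cv' (fun s => (al s)^`()) s = 0)
  & forall s, contr g.+1 cv' be s = 0].

(** The conditions that [section2_form] imposes on the two components of a section of O(2). *)
Definition pair_bound al be := [/\ (forall s, (size (al s) <= g.*2.+1)%N),
  (forall s, (size (be s) <= g.*2.-1)%N)
  & forall s, (be s)`_(g.*2 - 2) = (g * g)%:R * (al s)`_(g.*2)
    /\ (be s)`_(g.*2 - 3) = (g * g.-1)%:R * (al s)`_(g.*2.-1)].

(** Once al is removed, the proportionality of the top coefficients, shared by boundaries by
    [top_coef], lowers the degree of b to 2 g - 4. Two divisions by x - t in i slots leave 2 g - 4 -
    2 i = 2 N - 2, the range of [curve'_contraction_surj]. *)
Lemma pair_vanish al be : (2 < g)%N ->
  (forall N, (0 < N)%N -> (N + i).+1 = g -> forall F : nat -> {mpoly k[N.+1]}, wronskian_rel F ->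
    (forall e, (e < N.*2.-1)%N -> F e \is i.-homog) ->
    forall e, (e < N.*2.-1)%N -> F e = 0) ->
  alt al -> supp g.+1 al -> tdeg i al -> alt be -> supp g.+1 be -> tdeg i be ->
  pair_cycle al be -> pair_bound al be ->
  exists A, [/\ alt A, supp g.+1 A, tdeg i.+1 A, forall s, (size (A s) <= g.+1)%N
    & (forall s, contr g.+1 cv A s = al s) /\
      (forall s, contr g.+1 cv' (fun s => (A s)^`()) s = be s)].
Proof.
move=> g2 relE0 a1 a2 a3 b1 b2 b3 [c1 c2 c3] [d1 d2 d3].
have [A [A1 A2 A3 A4 A5]] := curve_contraction_surj a1 a2 a3 d1 c1.
pose b s := be s - contr g.+1 cv' (fun s => (A s)^`()) s.
have altb : alt b.
  by move=> s1 x y s2; rewrite /b b1 (alt_contr g.+1 cv' (alt_deriv A1)) opprB addrC opprK.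
have suppb : supp g.+1 b.
  move=> s hs; rewrite /b b2 // (@supp_contr _ g.+1 g.+1 cv' (fun s => (A s)^`())) ?subrr // => t ht.
  by rewrite A2 // deriv0.
have degb : tdeg i b.
  move=> s hs; rewrite /b b3 // (@tdeg_contr _ i g.+1 cv' (fun s => (A s)^`())) ?subrr // => t ht.
  by rewrite A3 // deriv0.
have hA : contr g.+1 cv A = al by apply: functional_extensionality.
have [bc1 bc2] : (forall s, contr g.+1 cv b s = 0) /\ (forall s, contr g.+1 cv' b s = 0).
  have B s := boundary_cycle g.+1 A1 s; split=> s; have [B1 B2] := B s.
    rewrite /b (contrD _ _ be (fun s => - _)) contrN.
    apply/eqP; rewrite subr_eq0; apply/eqP; apply: (addIr (contr g.+1 cv' (fun s => (al s)^`()) s)).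
    by rewrite c2; move: B1; rewrite hA => ->.
  by rewrite /b (contrD _ _ be (fun s => - _)) contrN c3 B2 subrr.
have sizeb s : (size (b s) <= g.*2 - 3)%N.
  apply/leq_sizeP => e he; rewrite /b coefB.
  rewrite top_coef //; last by lia.
  rewrite A5; have [d3a d3b] := d3 s.
  case: eqP => e2.
    have ee : e = (g.*2 - 2)%N by lia.
    by rewrite e2 ee d3a subrr.
  case: eqP => e3.
    have ee : e = (g.*2 - 3)%N by lia.
    by rewrite (_ : e.+2 = g.*2.-1) ?ee ?d3b ?subrr //; lia.
  by rewrite mul0r subr0 nth_default // (leq_trans (d2 s)) //; lia.
pose b' := sl g.+1 hx b.
have altb' : alt b' by apply: alt_sl.
have suppb' : supp g b' by apply: supp_hx.
have degb' : tdeg i b' by apply: tdeg_sl.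
have sizeb' s : (size (b' s) <= g.*2 - 3 - i)%N.
  have [e|e] := eqVneq (size s) i; last by rewrite degb' // size_poly0.
  by rewrite -e; apply: size_divide.
have bE : b =1 sl g lx b' by move=> s; rewrite divide.
have gS : g = g.-1.+1 by lia.
(* [curve'] pairs with (x - t) f as [curve] pairs with f, so the second cycle condition on b makes
   b' divisible by x - t again. *)
have b'c s : contr g cv b' s = 0.
  have suppc : supp g (contr g cv b') by apply: supp_contr.
  rewrite -(undivide (alt_contr g cv altb') suppc); apply: sl_r0 => t.
  transitivity (contr g.+1 cv' b t); last exact: bc2.
  rewrite (_ : b = sl g lx b'); last exact: functional_extensionality.
  rewrite contr_sl; apply: sl_eq => r; apply: eq_bigr => m _.
  by rewrite curve'_lx.
pose b'' := sl g hx b'.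
have b'E : b' =1 sl g.-1 lx b''.
  by move=> s; rewrite /b'' gS divide -?gS.
have altb'' : alt b'' by apply: alt_sl.
have suppb'' : supp g.-1 b'' by rewrite /b'' {2}gS; apply: supp_hx.
have degb'' : tdeg i b'' by apply: tdeg_sl.
have sizeb'' s : (size (b'' s) <= g.*2 - 3 - i - i)%N.
  have [e|e] := eqVneq (size s) i; last by rewrite degb'' // size_poly0.
  by rewrite -{2}e /b'' gS; apply: size_divide => // t; rewrite -gS.
have bEE : b =1 sl g lx (sl g.-1 lx b'').
  by move=> s; rewrite bE; apply: sl_eq.
have [C [C1 C2 C3 C4 [C5 C6]]] : exists C : seq nat -> P, [/\ alt C, supp g.+1 C, tdeg i.+1 C,
    forall s, (size (C s) <= g.+1)%N
    & (forall s, contr g.+1 cv C s = 0) /\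
      (forall s, contr g.+1 cv' (fun s => (C s)^`()) s = b s)].
  (* For g <= i + 1 the degree bound on b'' is negative, so b = 0. *)
  have [gi|gi] := leqP g i.+1.
    have b0 s : b s = 0.
      rewrite bEE; apply: sl_r0 => t; apply: sl_r0 => r; apply/eqP.
      by rewrite -size_poly_eq0 -leqn0 (leq_trans (sizeb'' r)) //; lia.
    exists (fun=> 0); split=> //; first by move=> *; rewrite oppr0.
      by move=> s; rewrite size_poly0.
    split=> s; rewrite /contr big1 ?b0 // => a _; rewrite ?deriv0 mulr0 //.
  pose N := (g - i.+1)%N.
  have N0 : (0 < N)%N by rewrite /N; lia.
  have eN : (N + i).+1 = g by rewrite /N; lia.
  have eN1 : (N + i)%N = g.-1 by lia.
  have := @curve'_contraction_surj k N i N0 two (relE0 N N0 eN) b'' altb''.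
  rewrite eN1 -gS => H.
  have [|C [C1 C2 C3 C4 [C5 C6]]] := H suppb'' degb''.
    by move=> s; rewrite (leq_trans (sizeb'' s)) // /N; lia.
  by exists C; split=> //; split=> // s; rewrite C6 bEE.
exists (fun s => A s + C s); split.
- by move=> s1 x y s2; rewrite A1 C1 opprD.
- by move=> s hs; rewrite A2 // C2 // addr0.
- by move=> s hs; rewrite A3 // C3 // addr0.
- by move=> s; rewrite (leq_trans (size_polyD _ _)) // geq_max A4 C4.
split=> s; first by rewrite contrD A5 C5 addr0.
rewrite (_ : (fun s => (A s + C s)^`()) = fun s => (A s)^`() + (C s)^`()); last first.
  by apply: functional_extensionality => t; rewrite derivD.
by rewrite contrD C6 /b addrCA subrr addr0.
Qed.

End Vanish.

Section VanishRange.
Variables (k : closedFieldType) (g i : nat).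
Hypothesis g2 : (2 < g)%N.
Hypothesis charP : forall l, (0 < l)%N -> (2 * l < g + 2)%N -> (l%:R : k) != 0.

Lemma two_neq0_char : (2%:R : k) != 0. Proof. by apply: charP; lia. Qed.

(** For i >= g - 1 no N > 0 occurs. For i = g - 2 one has N = 1, and the relation with b = 1 reads
    u_0 F_0 = 0. *)
Theorem pair_boundary al be : (2 * i < g - 2)%N \/ (g - 3 < i)%N ->
  alt al -> supp g.+1 al -> tdeg i al -> alt be -> supp g.+1 be -> tdeg i be ->
  pair_cycle g al be -> pair_bound g al be ->
  exists A : seq nat -> {poly k}, [/\ alt A, supp g.+1 A, tdeg i.+1 A, forall s, (size (A s) <= g.+1)%N
    & (forall s, contr g.+1 (curve k) A s = al s) /\
      (forall s, contr g.+1 (curve' k) (fun s => (A s)^`()) s = be s)].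
Proof.
move=> hi; apply: (pair_vanish two_neq0_char g2) => N N0 eN F hF hFh.
case: hi => hi.
  apply: (@wronskian_rel_eq0 k N i) => //; first by lia.
  by move=> l l0 hl; apply: charP => //; lia.
have N1 : N = 1%N by lia.
move: F hF hFh; rewrite N1 => F hF hFh [|e] // _.
have := hF 1%N isT; rewrite /ip big_ord1 /cf coef_WrXn // eqxx mulr1n => /eqP.
rewrite mulf_eq0 => /orP[/eqP -> //|].
by rewrite -[0%N]/(val (ord0 : 'I_2)) gen_poly_coef -msupp_eq0 msuppX.
Qed.

End VanishRange.

Lemma row_relation (k : fieldType) (I J : finType) (V : I -> J -> k) : (#|J| < #|I|)%N ->
  exists2 c : I -> k, exists x, c x != 0 & forall j, \sum_x c x * V x j = 0.
Proof.
move=> h.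
pose M := \matrix_(x < #|I|, j < #|J|) V (enum_val x) (enum_val j).
have : kermx M != 0.
  rewrite kermx_eq0 /row_free; apply: contraTneq h => e.
  by rewrite -leqNgt -e rank_leq_col.
case/rowV0Pn => r /sub_kermxP hr nr.
exists (fun x => r ord0 (enum_rank x)).
  have [y hy] : exists y, r ord0 y != 0.
    apply/existsP; apply: contraNT nr => /existsPn h'; apply/eqP/rowP => y.
    by rewrite mxE; apply/eqP; rewrite -[_ == _]negbK h'.
  by exists (enum_val y); rewrite enum_valK.
move=> j; have /rowP/(_ (enum_rank j)) := hr; rewrite !mxE => e; rewrite -[RHS]e.
rewrite (reindex_onto enum_val enum_rank) /=; last by move=> x _; apply: enum_rankK.
apply: eq_big => [x|x _]; first by rewrite enum_valK eqxx.
by rewrite !mxE enum_valK enum_rankK.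
Qed.

(** On the left, the numbers that determine a tensor killed by the curve: N + 1 values of t, and at
    each the coefficients left by [point_eq0]. On the right, the tensors available in
    [cycle_not_boundary]. With g = N + i + 1 the hypotheses are the range of the theorem. *)
Lemma bin_count N i : (2 <= N)%N -> (N <= i.+1)%N ->
  (N.+1 * 'C((N + i).+1, i.+1) < 'C((N + i).+2, i.+2) + 'C(N + i, i) * N.*2.-1)%N.
Proof.
move=> hN hi.
have c0 : (0 < 'C(N + i, i))%N by rewrite bin_gt0 leq_addl.
have e1 := mul_bin_diag (N + i).+1 i; have e2 := mul_bin_diag (N + i).+2 i.+1.
rewrite /= in e1 e2.
have [M hM] : exists M, N = M.+2 by exists N.-2; lia.
have [f hf] : exists f, i = (M.+1 + f)%N by exists (i - M.+1)%N; lia.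
move: e1 e2 c0; move: 'C(N + i, i) 'C((N + i).+1, i.+1) 'C((N + i).+2, i.+2) => c b a e1 e2 c0.
have eN : N.*2.-1 = (2 * M + 3)%N by lia.
rewrite eN hM hf in e1 e2 *.
clear hN hi eN hM hf N i.
(* After multiplication by (i + 1) (i + 2) the absorption identities reduce both sides to multiples
   of C(N + i, i). *)
rewrite -(ltn_pmul2l (m := (M.+1 + f).+1 * (M.+1 + f).+2)) //.
have -> : ((M.+1 + f).+1 * (M.+1 + f).+2 * (M.+3 * b) = (M.+1 + f).+2 * M.+3 * ((M.+1 + f).+1 * b))%N by ring.
have -> : ((M.+1 + f).+1 * (M.+1 + f).+2 * (a + c * (2 * M + 3)) =
   (M.+1 + f).+1 * ((M.+1 + f).+2 * a) + (M.+1 + f).+1 * (M.+1 + f).+2 * (2 * M + 3) * c)%N by ring.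
rewrite -e2.
have -> : ((M.+1 + f).+1 * ((M.+2 + (M.+1 + f)).+2 * b) = (M.+2 + (M.+1 + f)).+2 * ((M.+1 + f).+1 * b))%N by ring.
rewrite -e1.
nia.
Qed.

(** * Non-vanishing by a dimension count *)

Section Nonvanish.
Variables (k : closedFieldType) (N i : nat).
Hypothesis two : (2%:R : k) != 0.
Hypothesis N2 : (2 <= N)%N.
Hypothesis Ni : (N <= i.+1)%N.
Local Notation D := (N + i)%N.
Local Notation P := {poly k}.
Local Notation cv := (curve k).
Local Notation cv' := (curve' k).
Local Notation lx := (lx k).
Local Notation hx := (hx k).

Let twoP := two_reg_poly two.
Let twok := two_regk two.

(* A tensor killed by contraction with (1, t, t^2, ...) is determined at t = tau
   by its coefficients on lists not containing 0. *)
Lemma point_eq0 (z : seq nat -> k) tau j n : alt z -> supp n.+1 z -> tdeg j z ->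
  (forall s, contr n.+1 (fun m => tau ^+ m) z s = 0) ->
  (forall U : {set 'I_n}, #|U| = j -> z (map succn (enl U)) = 0) -> forall s, z s = 0.
Proof.
move=> h1 h2 h3 h4 h5.
have hS l : z (map succn l) = 0.
  apply: (alt_ext twok (n := n) (al := fun l => z (map succn l)) (be := fun=> 0)) => //.
  - by move=> s1 a b s2; rewrite !map_cat /= h1.
  - by move=> s1 a b s2; rewrite oppr0.
  - move=> s hs; apply: h2; apply: contra hs => /allP hs; apply/allP => a ha.
    by have := hs _ (map_f succn ha).
  move=> U; have [hU|hU] := eqVneq #|U| j; first exact: h5.
  by rewrite h3 // size_map size_enl.
have hn s : 0%N \notin s -> z s = 0.
  move=> h0; have -> : s = map succn (map predn s); last exact: hS.
  rewrite -map_comp -[LHS]map_id; apply/eq_in_map => a ha /=.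
  by rewrite prednK // lt0n; apply: contraNneq h0 => <-.
move=> s; have [us|us] := boolP (uniq s); last exact: (alt_uniq twok h1).
have [s0|] := boolP (0%N \in s); last exact: hn.
case/path.splitPr: s0 us => s1 s2 us; rewrite alt_front //.
suff -> : z (0%N :: s1 ++ s2) = 0 by rewrite mulr0.
have := h4 (s1 ++ s2); rewrite /contr big_ord_recl expr0 mul1r /= big1 ?addr0 // => m _.
rewrite hn ?mulr0 // inE /=.
by move: us; rewrite uniq_catC /= mem_cat => /andP[]; rewrite mem_cat orbC.
Qed.

(** Dividing by the product of the t - tau over the given points leaves degree below j in t, and
    division by x - t in j slots would lower it by j more. *)
Lemma kernel_eq0 (Z : seq nat -> P) j (pts : seq k) n : alt Z -> supp n.+1 Z -> tdeg j Z ->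
  (forall s, contr n.+1 cv Z s = 0) -> uniq pts ->
  (forall s, (size (Z s) <= j + size pts)%N) ->
  (forall s t, t \in pts -> (Z s).[t] = 0) -> forall s, Z s = 0.
Proof.
move=> h1 h2 h3 h4 up hs hr.
pose W : P := \prod_(t <- pts) ('X - t%:P).
have W0 : W != 0 by rewrite monic_neq0 // monic_prod_XsubC.
have WZ s : Z s = (Z s %/ W) * W.
  rewrite divpK //; apply: uniq_roots_dvdp; last by rewrite uniq_rootsE.
  by apply/allP => t ht; rewrite rootE hr.
pose q s := Z s %/ W.
have altq : alt q by move=> s1 a b s2; rewrite /q h1 divpN.
have suppq : supp n.+1 q by move=> s h; rewrite /q h2 // div0p.
have degq : tdeg j q by move=> s h; rewrite /q h3 // div0p.
have cq s : contr n.+1 cv q s = 0.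
  apply: (mulIf W0); rewrite mul0r -[RHS](h4 s) /contr mulr_suml.
  by apply: eq_bigr => a _; rewrite -mulrA -WZ.
have sq s : (size (q s) <= j)%N.
  rewrite /q size_divp // /W size_prod_XsubC /= leq_subLR addnC; exact: hs.
move=> s; rewrite WZ -/(q s) -(divide altq suppq cq).
suff -> : sl n lx (sl n.+1 hx q) s = 0 by rewrite mul0r.
apply: sl_r0 => t; have [e|e] := eqVneq (size t) j; last by rewrite (@tdeg_sl _ j n.+1 hx q degq).
apply/eqP; rewrite -size_poly_eq0 -leqn0 -(subnn j) -{2}e.
by apply: size_divide.
Qed.

(** The cycles (al, be) with al = 0, for g = D + 1. *)
Definition cycle2 (be : seq nat -> P) := [/\ alt be, supp D.+2 be, tdeg i be,
  (forall s, (size (be s) <= D.*2.-1)%N)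
  & (forall s, contr D.+2 cv be s = 0) /\ (forall s, contr D.+2 cv' be s = 0)].

Definition bounds2 (A be : seq nat -> P) := [/\ alt A, supp D.+2 A, tdeg i.+1 A,
  (forall s, (size (A s) <= D.+2)%N)
  & (forall s, contr D.+2 cv A s = 0) /\
    (forall s, contr D.+2 cv' (fun s => (A s)^`()) s = be s)].

Definition delta_tensor n (T : {set 'I_n}) : seq nat -> k := lst (fun S => (S == T)%:R).

Lemma tdeg_delta_tensor n (T : {set 'I_n}) : tdeg #|T| (delta_tensor T).
Proof. by apply: tdeg_lst => A hA; case: eqP => // e; rewrite e eqxx in hA. Qed.

Lemma delta_tensor_enl n (S T : {set 'I_n}) : delta_tensor T (enl S) = (S == T)%:R.
Proof. exact: lst_enl. Qed.

Definition basis_cycle (S : {set 'I_D}) (e : nat) : seq nat -> P :=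
  sl D.+1 lx (sl D lx (fun s => 'X^e * (delta_tensor S s)%:P)).

Lemma basis_cycleP (S : {set 'I_D}) e : #|S| = i -> (e < N.*2.-1)%N -> cycle2 (basis_cycle S e).
Proof.
move=> hS he.
have altd : alt (fun s => 'X^e * (delta_tensor S s)%:P : P).
  by move=> s1 a b s2; rewrite /delta_tensor alt_lst polyCN mulrN.
have degd : tdeg i (fun s => 'X^e * (delta_tensor S s)%:P : P).
  by move=> s hs; rewrite (tdeg_delta_tensor (T := S)) ?hS // polyC0 mulr0.
have hdeg : tdeg i (basis_cycle S e) by apply: tdeg_sl; apply: tdeg_sl.
split.
- by apply: alt_sl; apply: alt_sl.
- exact: supp_lx.
- exact: hdeg.
- move=> s; have [es|es] := eqVneq (size s) i; last by rewrite hdeg // size_poly0.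
  pose al : seq nat -> P := fun s => 'X^e * (delta_tensor S s)%:P.
  have h0 t : (size (al t) <= e.+1)%N.
    rewrite /al (leq_trans (size_polyMleq _ _)) // size_polyXn /=.
    by apply: leq_trans (leq_add (leqnn e) (size_polyC_leq1 _)) _; rewrite addn1.
  have h1 t : (size (sl D lx al t) <= e.+1 + i)%N.
    have [et|et] := eqVneq (size t) i; last by rewrite (@tdeg_sl _ i D lx _ degd) // size_poly0.
    by rewrite -{2}et; apply: size_sl_lx.
  by apply: leq_trans (@size_sl_lx _ _ _ (e.+1 + i) s h1) _; rewrite es; lia.
have z n (al : seq nat -> P) t : contr n.+1 cv (sl n lx al) t = 0.
  rewrite contr_sl; apply: sl_r0 => r; rewrite /contr big1 // => m _.
  by rewrite curve_lx // mul0r.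
split=> s; first exact: z.
rewrite contr_sl; apply: sl_r0 => t.
rewrite -[RHS](z D (fun s => 'X^e * (delta_tensor S s)%:P) t) /contr; apply: eq_bigr => m _.
by rewrite curve'_lx.
Qed.

(** If all these cycles were boundaries, tensors bounding the cycles [basis_cycle], together with
    the contractions of constant tensors with the curve, which have zero boundary, would be linearly
    independent and all killed by the curve. [kernel_eq0] and [point_eq0] leave fewer coordinates
    than there are such tensors. *)
Theorem cycle_not_boundary : ~ (forall be, cycle2 be -> exists A, bounds2 A be).
Proof.
move=> hyp.
pose IT : finType := {T : {set 'I_D.+2} | #|T| == i.+2}.
pose IS : finType := ({S : {set 'I_D} | #|S| == i} * 'I_(N.*2.-1))%type.
pose I : finType := (IT + IS)%type.
pose J : finType := ('I_N.+1 * {U : {set 'I_D.+1} | #|U| == i.+1})%type.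
have choiceA (x : IS) : {A | bounds2 A (basis_cycle (val x.1) x.2)}.
  apply: constructive_indefinite_description; apply: hyp.
  by apply: basis_cycleP; [exact/eqP/(valP x.1) | exact: ltn_ord].
pose AS x := sval (choiceA x).
have hAS x : bounds2 (AS x) (basis_cycle (val x.1) x.2) by apply: (svalP (choiceA x)).
pose AT (T : IT) s : P := contr D.+2 cv (fun s => (delta_tensor (val T) s)%:P) s.
have altC (T : IT) : alt (fun s => (delta_tensor (val T) s)%:P : P).
  by move=> s1 a b s2; rewrite /delta_tensor alt_lst polyCN.
have hAT T : bounds2 (AT T) (fun=> 0).
  split.
  - exact: alt_contr.
  - by apply: supp_contr => s hs; rewrite /delta_tensor supp_lst.
  - apply: tdeg_contr => s hs; rewrite (tdeg_delta_tensor (T := val T)) ?polyC0 //.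
    by rewrite (eqP (valP T)).
  - move=> s; rewrite (leq_trans (size_sum _ _ _)) //; apply/bigmax_leqP => a _.
    rewrite (leq_trans (size_polyMleq _ _)) // size_polyXn /=.
    apply: leq_trans (leq_add (leqnn _) (size_polyC_leq1 _)) _.
    by rewrite addn1 ltn_ord.
  have cc f s : contr D.+2 f (contr D.+2 f (fun s => (delta_tensor (val T) s)%:P : P)) s = 0.
    by apply: twoP; rewrite {1}(contrC D.+2 f f (altC T)) addNr.
  split=> s; first exact: cc.
  rewrite -[RHS](cc cv' s); congr (contr _ _ _ s); apply: functional_extensionality => t.
  rewrite /AT contr_deriv [X in _ + X](_ : _ = 0) ?addr0 //.
  by rewrite /contr big1 // => a _; rewrite derivC mulr0.
pose AA (x : I) : seq nat -> P := match x with inl T => AT T | inr y => AS y end.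
pose BB (x : I) : seq nat -> P := match x with inl T => fun=> 0 | inr y => basis_cycle (val y.1) y.2 end.
have hAA x : bounds2 (AA x) (BB x) by case: x => [T|y]; [exact: hAT | exact: hAS].
have [pts up sp] := closed_points k N.+1.
pose V (x : I) (y : J) : k := (AA x (map succn (enl (val y.2)))).[pts`_(y.1)].
have cardlt : (#|J| < #|I|)%N.
  rewrite card_sum card_prod card_ord card_sig card_prod card_sig card_ord card_sig.
  have cd n m : #|[pred S : {set 'I_n} | #|S| == m]| = 'C(n, m).
    by rewrite -[in RHS](card_ord n) -card_draws; apply: eq_card => S; rewrite !inE.
  rewrite !cd; exact: bin_count.
have [c [x0 cx0] hc] := row_relation V cardlt.
pose Z s := \sum_(x : I) (c x)%:P * AA x s.
have Z0 s : Z s = 0.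
  move: s; have Z1 : alt Z.
    move=> s1 a b s2; rewrite -sumrN; apply: eq_bigr => x _.
    by have [h1 _ _ _ _] := hAA x; rewrite h1 mulrN.
  have Z2 : supp D.+2 Z.
    by move=> s hs; rewrite /Z big1 // => x _; have [_ h _ _ _] := hAA x; rewrite h // mulr0.
  have Z3 : tdeg i.+1 Z.
    by move=> s hs; rewrite /Z big1 // => x _; have [_ _ h _ _] := hAA x; rewrite h // mulr0.
  have Z4 s : contr D.+2 cv Z s = 0.
    by rewrite contr_lin big1 // => x _; have [_ _ _ _ [h _]] := hAA x; rewrite h mulr0.
  apply: (kernel_eq0 Z1 Z2 Z3 Z4 up).
    move=> s; rewrite (leq_trans (size_sum _ _ _)) //; apply/bigmax_leqP => x _.
    rewrite mul_polyC (leq_trans (size_scale_leq _ _)) //.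
    have [_ _ _ h _] := hAA x; rewrite (leq_trans (h s)) // sp; lia.
  move=> s t /(nthP 0)[r]; rewrite sp => hr <-; move: s.
  apply: (@point_eq0 (fun s => (Z s).[pts`_r]) pts`_r i.+1 D.+1).
  - by move=> s1 a b s2; rewrite Z1 hornerN.
  - by move=> s hs; rewrite Z2 // horner0.
  - by move=> s hs; rewrite Z3 // horner0.
  - move=> s; have := congr1 (horner^~ pts`_r) (Z4 s); rewrite horner0 horner_sum => h.
    by rewrite -[RHS]h; apply: eq_bigr => m _; rewrite hornerM hornerXn.
  move=> U /eqP hU; rewrite -[RHS](hc (Ordinal hr, Sub U hU)) /Z horner_sum.
  by apply: eq_bigr => x _; rewrite hornerM hornerC.
(* Taking boundaries removes the contractions of constant tensors; undoing the two multiplications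
   by x - t isolates the coefficients. *)
have cS (y : IS) : c (inr y) = 0.
  pose be s : P := \sum_(y : IS) (c (inr y))%:P * ('X^(y.2) * (delta_tensor (val y.1) s)%:P).
  have altbe : alt be.
    move=> s1 a b s2; rewrite -sumrN; apply: eq_bigr => z _.
    by rewrite /delta_tensor alt_lst polyCN !mulrN.
  have suppbe : supp D be.
    by move=> s hs; rewrite /be big1 // => z _; rewrite /delta_tensor supp_lst // polyC0 !mulr0.
  have e0 s : sl D.+1 lx (sl D lx be) s = 0.
    transitivity (\sum_(x : I) (c x)%:P * BB x s).
      rewrite big_sumType /= big1 ?add0r => [|T _]; last by rewrite mulr0.
      rewrite (@sl_eq _ D.+1 lx _ (fun t => \sum_(y : IS) (c (inr y))%:P *
         sl D lx (fun s => 'X^(y.2) * (delta_tensor (val y.1) s)%:P) t)); last by move=> t; rewrite sl_lin.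
      by rewrite sl_lin.
    transitivity (contr D.+2 cv' (fun s => (Z s)^`()) s); last first.
      by rewrite /contr big1 // => a _; rewrite Z0 deriv0 mulr0.
    transitivity (\sum_(x : I) (c x)%:P * contr D.+2 cv' (fun s => (AA x s)^`()) s).
      by apply: eq_bigr => x _; have [_ _ _ _ [_ h]] := hAA x; rewrite h.
    rewrite -contr_lin; congr (contr _ _ _ s); apply: functional_extensionality => t.
    by rewrite raddf_sum; apply: eq_bigr => x _; rewrite /= derivM derivC mul0r add0r.
  have be0 s : be s = 0.
    rewrite -(undivide altbe suppbe) -(@sl_eq _ D.+1 hx (fun=> 0)) ?sl0 // => t.
    have suppt : supp D.+1 (sl D lx be) by apply: supp_lx.
    rewrite -(undivide (@alt_sl _ D lx be altbe) suppt); symmetry; apply: sl_r0 => r; exact: e0.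
  have := congr1 (fun p : P => p`_(y.2)) (be0 (enl (val y.1))).
  rewrite coef0 coef_sum (bigD1 y) //= delta_tensor_enl eqxx mulr1 coefCM coefXn eqxx mulr1.
  rewrite big1 ?addr0 // => z hz; rewrite delta_tensor_enl coefCM coefMC coefXn.
  have [e1|] := eqVneq (val y.1) (val z.1); last by rewrite mulr0 mulr0.
  have [e2|] := eqVneq (y.2 : nat) (z.2 : nat); last by rewrite mul0r mulr0.
  by case/eqP: hz; case: (y) (z) e1 e2 => [a1 a2] [b1 b2] /= /val_inj -> /val_inj ->.
(* The contraction of a constant tensor b is sum_m t^m b_m, which vanishes only if every b_m
   does. *)
have cT (T : IT) : c (inl T) = 0.
  pose b s : k := \sum_(T : IT) c (inl T) * delta_tensor (val T) s.
  have hb s : \sum_(m < D.+2) 'X^m * (b (val m :: s))%:P = 0 :> P.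
    rewrite -[RHS](Z0 s) /Z big_sumType /= [X in _ = _ + X]big1 ?addr0 => [|y _]; last first.
      by rewrite cS polyC0 mul0r.
    rewrite -contr_lin; apply: eq_bigr => m _; congr (_ * _).
    by rewrite /b raddf_sum; apply: eq_bigr => T' _; rewrite /= polyCM.
  have hb0 m s : (m < D.+2)%N -> b (m :: s) = 0.
    move=> hm; have := congr1 (fun p : P => p`_m) (hb s).
    rewrite coef0 coef_sum (bigD1 (Ordinal hm)) //= coefXnM ltnn subnn coefC eqxx.
    rewrite big1 ?addr0 // => m' hm'; rewrite coefXnM; case: ltnP => // h.
    rewrite coefC; case: eqP => // e; move: hm'; rewrite -val_eqE /= => /eqP []; lia.
  have : b (enl (val T)) = 0.
    have := enl_lt (val T); have := size_enl (val T); rewrite (eqP (valP T)).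
    by case: (enl _) => // m s _ /= /andP[hm _]; apply: hb0.
  rewrite /b (bigD1 T) //= delta_tensor_enl eqxx mulr1 big1 ?addr0 // => T' hT'.
  rewrite delta_tensor_enl; case: eqP => [/val_inj e|_]; last by rewrite mulr0.
  by rewrite e eqxx in hT'.
by case: x0 cx0 => [T|y]; rewrite ?cT ?cS eqxx.
Qed.

End Nonvanish.

Lemma dual_mul (R : comNzRingType) (a a' b b' x : R) :
  (a + a' * x) * (b + b' * x) = a * b + (a' * b + a * b') * x + a' * b' * x ^+ 2.
Proof. by ring. Qed.

(** * Sections of O(1) and O(2) *)

Section Sections.
Variables (k : fieldType) (g : nat).
Local Notation R3 := {mpoly k[3]}.
Local Notation K := (tangent_field k g).
Local Notation S := {mpoly k[g.+1]}.
Local Notation T := {poly {poly k}}.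
Implicit Types (X Y : T) (p q : S).

(* With w = v / u, an element of degree d of the coordinate ring is u^d times a
   polynomial in t and w, kept here as an element of k[t][w]. *)
Definition zh (i : nat) : T := ('X^i)%:P + (('X^i)^`())%:P * 'X.
Definition ph p : T := (map_mpoly (polyC \o polyC) p).@[fun i => zh (i : 'I_g.+1)].
HB.instance Definition _ := GRing.RMorphism.copy ph
  (meval (fun i => zh (i : 'I_g.+1)) \o map_mpoly (polyC \o polyC)).

Lemma ph_X i : ph 'X_i = zh i.
Proof. by rewrite /ph map_mpolyX mevalXU. Qed.

Lemma phM p q : ph (p * q) = ph p * ph q. Proof. exact: rmorphM. Qed.
Lemma phB p q : ph (p - q) = ph p - ph q. Proof. exact: rmorphB. Qed.
Lemma phC c : ph c%:MP = c%:P%:P. Proof. by rewrite /ph map_mpolyC mevalC. Qed.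

Lemma ph_E p : ph p = \sum_(m <- msupp p) (p@_m)%:P%:P * \prod_i zh (i : 'I_g.+1) ^+ m i.
Proof.
rewrite {1}[p]mpolyE rmorph_sum /=; apply: eq_bigr => m _.
by rewrite /ph map_mpolyZ mevalZ map_mpolyX mevalX.
Qed.

Definition tb : K := tofrac ('X_(inord 0) : R3).
Definition ub : K := tofrac ('X_(inord 1) : R3).
Definition vb : K := tofrac ('X_(inord 2) : R3).

Lemma ub_neq0 : ub != 0.
Proof. by rewrite /ub tofrac_eq0 -msupp_eq0 msuppX. Qed.

Definition kK (c : k) : K := tofrac (c%:MP : R3).
HB.instance Definition _ := GRing.RMorphism.copy kK (@tofrac _ \o @mpolyC 3 k).

Definition th0 (a : {poly k}) : K := (map_poly kK a).[tb].
HB.instance Definition _ := GRing.RMorphism.copy th0 (horner_eval tb \o map_poly kK).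

Definition th X : K := (map_poly th0 X).[vb / ub].
HB.instance Definition _ := GRing.RMorphism.copy th (horner_eval (vb / ub) \o map_poly th0).

Lemma thD X Y : th (X + Y) = th X + th Y. Proof. exact: rmorphD. Qed.
Lemma thM X Y : th (X * Y) = th X * th Y. Proof. exact: rmorphM. Qed.
Lemma thB X Y : th (X - Y) = th X - th Y. Proof. exact: rmorphB. Qed.
Lemma thXn X n : th (X ^+ n) = th X ^+ n. Proof. exact: rmorphXn. Qed.
Lemma thN1 : th (-1) = -1.
Proof. by rewrite -[-1]sub0r thB (rmorph0 th) (rmorph1 th) sub0r. Qed.
Lemma th0Xn a n : th0 (a ^+ n) = th0 a ^+ n. Proof. exact: rmorphXn. Qed.
Lemma th0Mn a n : th0 (a *+ n) = th0 a *+ n. Proof. exact: rmorphMn. Qed.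

Lemma th0_X : th0 'X = tb.
Proof. by rewrite /th0 map_polyX hornerX. Qed.

Lemma th_C a : th a%:P = th0 a.
Proof. by rewrite /th map_polyC hornerC. Qed.

Lemma th_X : th 'X = vb / ub.
Proof. by rewrite /th map_polyX hornerX. Qed.

HB.instance Definition _ := GRing.RMorphism.copy (@tangent_inj k g)
  (@tofrac _ \o comp_mpoly [tuple ('X_(inord 1) : R3) * 'X_(inord 0) ^+ i
     + ('X_(inord 2) * 'X_(inord 0) ^+ i.-1) *+ i | i < g.+1]).

Lemma tiM p q : tangent_inj (p * q) = tangent_inj p * tangent_inj q.
Proof. exact: (rmorphM (@tangent_inj k g)). Qed.

Lemma tangent_inj_X i : tangent_inj 'X_i = ub * th (zh i).
Proof.
rewrite /tangent_inj /tangent_map comp_mpolyXU -tnth_nth tnth_mktuple.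
rewrite /zh thD thM !th_C th_X derivXn th0Mn !th0Xn th0_X.
rewrite tofracD tofracMn !tofracM !tofracXn -/tb -/ub -/vb.
rewrite mulrDr; congr (_ + _).
have u0 := ub_neq0; rewrite !mulrnAl !mulrnAr; congr (_ *+ _).
by rewrite [RHS]mulrCA [ub * (vb / ub)]mulrC divfK // mulrC.
Qed.

Lemma tangent_injC c : tangent_inj (c%:MP : S) = kK c.
Proof. by rewrite /tangent_inj /tangent_map comp_mpolyC. Qed.

Lemma th_CC c : th c%:P%:P = kK c.
Proof. by rewrite th_C /th0 map_polyC hornerC. Qed.

Lemma tangent_inj_homog p d : p \is d.-homog -> tangent_inj p = ub ^+ d * th (ph p).
Proof.
move=> /dhomogP hp; rewrite ph_E {1}[p]mpolyE (rmorph_sum (@tangent_inj k g)) (rmorph_sum th) mulr_sumr !big_seq.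
apply: eq_bigr => m hm /=; rewrite -mul_mpolyC tiM tangent_injC thM th_CC.
rewrite mulrCA; congr (_ * _); rewrite mpolyXE_id (rmorph_prod (@tangent_inj k g)) (rmorph_prod th).
have hd : mdeg m = d := hp m hm.
rewrite -hd mdegE.
rewrite (big_morph (fun e => ub ^+ e) (exprD ub) (expr0 ub)) -big_split /=.
by apply: eq_bigr => i _; rewrite thXn rmorphXn /= tangent_inj_X exprMn.
Qed.

Definition psv (i : 'I_3) : T :=
  if i == inord 0 then ('X)%:P else if i == inord 1 then 1 else 'X.
(** Setting u = 1 recovers X from u^m X(t, v / u); this is how [th] is seen to be injective. *)
Definition ps (f : R3) : T := (map_mpoly (polyC \o polyC) f).@[psv].
HB.instance Definition _ := GRing.RMorphism.copy ps (meval psv \o map_mpoly (polyC \o polyC)).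

Lemma psC c : ps c%:MP = c%:P%:P.
Proof. by rewrite /ps map_mpolyC mevalC. Qed.
Lemma psX i : ps 'X_i = psv i.
Proof. by rewrite /ps map_mpolyX mevalXU. Qed.
Lemma psM (p q : R3) : ps (p * q) = ps p * ps q. Proof. exact: rmorphM. Qed.
Lemma psXn (p : R3) n : ps (p ^+ n) = ps p ^+ n. Proof. exact: rmorphXn. Qed.

Lemma th_inj X : th X = 0 -> X = 0.
Proof.
move=> hX.
pose em (a : {poly k}) : R3 := (map_poly (@mpolyC 3 k) a).['X_(inord 0)].
have emE a : em a = \sum_(j < size a) a`_j *: 'X_(inord 0) ^+ j.
  rewrite /em (horner_coef_wide _ (size_poly _ _)); apply: eq_bigr => j _.
  by rewrite coef_map mul_mpolyC.
have emK a : tofrac (em a) = th0 a :> K.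
  rewrite emE (rmorph_sum (@tofrac R3)) /th0 (horner_coef_wide _ (size_poly _ _)).
  apply: eq_bigr => j _; rewrite coef_map /= -mul_mpolyC tofracM tofracXn.
  by [].
have emP a : ps (em a) = a%:P.
  rewrite emE (rmorph_sum ps) -[in RHS](coefK a) poly_def (rmorph_sum polyC).
  apply: eq_bigr => j _ /=; rewrite -mul_mpolyC psM psXn psC psX /psv eqxx.
  by rewrite -mul_polyC polyCM -polyC_exp.
pose F : R3 := \sum_(j < size X) em X`_j * ('X_(inord 1) ^+ (size X - j) * 'X_(inord 2) ^+ j).
have FK : tofrac F = ub ^+ size X * th X.
  rewrite /F (rmorph_sum (@tofrac R3)) /th (horner_coef_wide _ (size_poly _ _)) mulr_sumr.
  apply: eq_bigr => j _; rewrite coef_map /= !tofracM !tofracXn emK -/ub -/vb.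
  rewrite [RHS]mulrCA; congr (_ * _); rewrite exprMn exprVn mulrCA mulrC; congr (_ * _).
  have u0 := ub_neq0; apply: (mulIf (expf_neq0 j u0)).
  by rewrite divfK ?expf_neq0 // -exprD subnK // ltnW.
have F0 : F = 0 by apply/eqP; rewrite -(@tofrac_eq0 R3) FK hX mulr0.
have : ps F = X.
  rewrite /F (rmorph_sum ps) -[RHS]coefK poly_def; apply: eq_bigr => j _.
  rewrite /= !psM emP !psXn !psX /psv.
  have -> : (inord 1 == inord 0 :> 'I_3) = false by rewrite -val_eqE /= !inordK.
  have -> : (inord 2 == inord 0 :> 'I_3) = false by rewrite -val_eqE /= !inordK.
  have -> : (inord 2 == inord 1 :> 'I_3) = false by rewrite -val_eqE /= !inordK.
  by rewrite eqxx expr1n mul1r mul_polyC.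
by rewrite F0 (rmorph0 ps).
Qed.

Definition is_hom d X := exists2 p, p \is d.-homog & X = ph p.

(** Since z_0 = u, the chart of z_0 already gives f = u^n X with X polynomial in t and w; the other
    charts become conditions on X. *)
Lemma section_form n f : tangent_section n f ->
  exists X, f = ub ^+ n * th X /\
    forall i : 'I_g.+1, exists N, is_hom (n + N) (X * zh i ^+ N).
Proof.
move=> hf; have [N0 [p0 [hp0 e0]]] := hf ord0.
have f0 : f = ub ^+ n * th (ph p0).
  have u0 := ub_neq0; have u1 : ub ^+ N0 != 0 by rewrite expf_neq0.
  apply: (mulIf u1); move: e0; rewrite tangent_inj_X (tangent_inj_homog hp0).
  rewrite /zh expr0 -polyC1 derivC polyC0 mul0r addr0 (rmorph1 th) mulr1 => ->.
  by rewrite exprD mulrAC.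
exists (ph p0); split=> // i; have [N [p [hp e]]] := hf i.
exists N, p => //; apply/eqP; rewrite -subr_eq0; apply/eqP; apply: th_inj.
have u1 : ub ^+ (n + N) != 0 by rewrite expf_neq0 // ub_neq0.
apply: (mulfI u1); rewrite mulr0 thB mulrBr -(tangent_inj_homog hp) -e.
rewrite f0 tangent_inj_X thM thXn exprMn exprD; apply/eqP; rewrite subr_eq0; apply/eqP; ring.
Qed.

Lemma section_hom n p : p \is n.-homog -> tangent_section n (ub ^+ n * th (ph p)).
Proof.
move=> hp i; exists 0%N, p; rewrite addn0; split=> //.
by rewrite expr0 mulr1 (tangent_inj_homog hp).
Qed.

Lemma hom_ind (Q : nat -> T -> Prop) :
  (forall d, Q d 0) -> (forall d X Y, Q d X -> Q d Y -> Q d (X + Y)) ->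
  (forall c : k, Q 0%N c%:P%:P) ->
  (forall d (i : 'I_g.+1) X, Q d X -> Q d.+1 (zh i * X)) ->
  forall d X, is_hom d X -> Q d X.
Proof.
move=> h0 hD h1 hM d X [p /dhomogP hp ->]; rewrite ph_E big_seq.
elim/big_ind: _ => [|x y|m hm]; [exact: h0 | exact: hD |].
have hd : mdeg m = d := hp m hm.
rewrite -hd mdegE.
have hi (i : 'I_g.+1) j e Y : Q e Y -> Q (j + e)%N (zh i ^+ j * Y).
  move=> hY; elim: j => [|j IH]; first by rewrite expr0 mul1r.
  by rewrite exprS -mulrA addSn; apply: hM.
have : forall r, Q (\sum_(i <- r) m i)%N ((p@_m)%:P%:P * \prod_(i <- r) zh (i : 'I_g.+1) ^+ m i).
  elim=> [|i r IH]; first by rewrite !big_nil mulr1.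
  by rewrite !big_cons mulrCA; apply: hi.
exact.
Qed.

(** The condition along the cuspidal edge w = 0: it holds for t^i + (t^i)' w and is stable under
    products by the Leibniz rule. *)
Lemma hom_cusp d X : is_hom d X -> X`_1 = (X`_0)^`().
Proof.
move: d X; apply: hom_ind.
- by move=> _; rewrite !coef0 deriv0.
- by move=> _ X Y hX hY; rewrite !coefD hX hY derivD.
- by move=> c; rewrite !coefC /= derivC.
move=> _ i X hX; rewrite /zh mulrDl mulrAC !coefD !coefMX !coefCM /= hX.
by rewrite addr0 derivM addrC.
Qed.

Lemma hom_size d X : is_hom d X -> (size X <= d.+1)%N.
Proof.
move: d X; apply: hom_ind.
- by move=> d; rewrite size_poly0.
- by move=> d X Y hX hY; rewrite (leq_trans (size_polyD _ _)) // geq_max hX hY.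
- by move=> c; apply: size_polyC_leq1.
move=> d i X hX; rewrite (leq_trans (size_polyMleq _ _)) //.
have sz : (size (zh i) <= 2)%N.
  rewrite /zh (leq_trans (size_polyD _ _)) // geq_max.
  rewrite (leq_trans (size_polyC_leq1 _)) //=.
  rewrite (leq_trans (size_polyMleq _ _)) // size_polyX addnC /=.
  by rewrite ltnS size_polyC_leq1.
by move: (leq_add sz hX); rewrite addnC; lia.
Qed.

(* Weights: t and v have weight 1, u has weight 0, and z_i has weight i.  With
   w = t y the weight is the degree in t. *)
Definition c0 (a : {poly k}) : T := map_poly polyC a.
HB.instance Definition _ := GRing.RMorphism.copy c0 (map_poly (@polyC k)).
(** The outer variable of [ch X] is t, so that outer coefficients are the weight components, and the
    inner one is y = w / t. *)
Definition ch X : T := (map_poly c0 X).['X * ('X)%:P].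
HB.instance Definition _ := GRing.RMorphism.copy ch (horner_eval ('X * ('X)%:P : T) \o map_poly c0).

Lemma chM X Y : ch (X * Y) = ch X * ch Y. Proof. exact: rmorphM. Qed.
Lemma chD X Y : ch (X + Y) = ch X + ch Y. Proof. exact: rmorphD. Qed.
Lemma chXn X n : ch (X ^+ n) = ch X ^+ n. Proof. exact: rmorphXn. Qed.

Lemma ch_coef X e j : ((ch X)`_e)`_j = if (j <= e)%N then (X`_j)`_(e - j) else 0.
Proof.
rewrite /ch (horner_coef_wide _ (size_poly _ _)) !coef_sum.
have E (l : nat) : (((map_poly c0 X)`_l * ('X * ('X)%:P) ^+ l)`_e)`_j
    = if (l == j) && (j <= e)%N then (X`_j)`_(e - j) else 0.
  rewrite coef_map /= exprMn -polyC_exp mulrA coefMC coefMXn.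
  case: ltnP => [h|h]; first by case: eqP => // e1; move: h; rewrite e1 ltnn.
  rewrite coefMXn; case: (ltnP e l) => [h'|h'].
    by rewrite coef0; case: eqP => //= <-; rewrite leqNgt h'.
  rewrite coef_map /= coefC subn_eq0; case: (eqVneq l j) => [<-|hl] /=.
    by rewrite leqnn h'.
  by rewrite leqNgt ltn_neqAle hl h.
have [hj|hj] := ltnP j (size X).
  rewrite (bigD1 (Ordinal hj)) //= E eqxx big1 ?addr0 // => l.
  by rewrite E -val_eqE /= => /negbTE ->.
rewrite big1 => [|l _]; first by rewrite [X`_j]nth_default // coef0 if_same.
by rewrite E ltn_eqF // (leq_trans (ltn_ord l)).
Qed.

Definition ly (i : nat) : {poly k} := 1 + 'X *+ i.

Lemma ch_zh i : ch (zh i) = (ly i)%:P * 'X^i.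
Proof.
rewrite /zh chD chM /ch !map_polyC map_polyX !hornerC hornerX /= /c0.
rewrite derivXn map_polyXn raddfMn /= map_polyXn /ly polyCD polyC1 mulrDl mul1r.
congr (_ + _); case: i => [|i]; first by rewrite !mulr0n polyC0 !mul0r.
by rewrite polyCMn !mulrnAl exprSr /=; congr (_ *+ _); ring.
Qed.

Lemma ly_neq0 i : ly i != 0.
Proof.
apply/eqP => /(congr1 (fun p : {poly k} => p`_0)); rewrite /ly coefD coefMn coefX coefC mul0rn addr0 coef0.
by move/eqP; rewrite oner_eq0.
Qed.

(** Among the monomials of degree d, weight g d occurs only for z_g^d and weight g d - 1 only for
    z_g^(d-1) z_(g-1). *)
Definition topw d X := [/\ forall e, (g * d < e)%N -> (ch X)`_e = 0,
  exists c : k, (ch X)`_(g * d) = c%:P * ly g ^+ d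
  & forall e, e.+1 = (g * d)%N -> exists c : k, (ch X)`_e = c%:P * ly g ^+ d.-1 * ly g.-1].

Lemma hom_topw d X : (0 < g)%N -> is_hom d X -> topw d X.
Proof.
move=> g0; move: d X; apply: hom_ind.
- move=> d; have h e : (ch 0)`_e = 0 by rewrite (rmorph0 ch) coef0.
  by split=> [e _||e _]; rewrite ?h //; exists 0; rewrite ?polyC0 ?mul0r.
- move=> d X Y [X1 [c X2] X3] [Y1 [c' Y2] Y3]; split.
  + by move=> e he; rewrite chD coefD X1 // Y1 // addr0.
  + by exists (c + c'); rewrite chD coefD X2 Y2 polyCD mulrDl.
  move=> e he; have [a ha] := X3 e he; have [b hb] := Y3 e he.
  by exists (a + b); rewrite chD coefD ha hb polyCD !mulrDl.
- move=> c; have h e : (ch c%:P%:P)`_e = if e == 0%N then c%:P else 0.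
    by rewrite /ch map_polyC hornerC /= /c0 map_polyC /= coefC.
  split=> [e|| e]; rewrite ?muln0 //; rewrite ?h.
  + by case: e.
  + by exists c; rewrite mulr1.
move=> d i X [X1 [c X2] X3].
have hi : (i <= g)%N by rewrite -ltnS.
have E e : (ch (zh i * X))`_e = if (e < i)%N then 0 else ly i * (ch X)`_(e - i).
  by rewrite chM ch_zh -mulrA coefCM coefXnM; case: ifP; rewrite ?mulr0.
split.
- move=> e he; rewrite E; case: ifP => // _; rewrite X1 ?mulr0 //.
  by move: he; rewrite mulnS; lia.
- rewrite E mulnS ltnNge (leq_trans hi (leq_addr _ _)) /=.
  have [hig|hig] := eqVneq (i : nat) g.
    by exists c; rewrite hig addKn X2 exprS; ring.
  by exists 0; rewrite X1 ?mulr0 ?polyC0 ?mul0r //; lia.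
move=> e; rewrite mulnS => he; rewrite E.
case: ltnP => h1; first by exists 0; rewrite polyC0 !mul0r.
have [hig|hig] := eqVneq (i : nat) g.
  case: d X1 X2 X3 he => [|d] X1 X2 X3 he; first by lia.
  have [|a ha] := X3 (e - g)%N; first by lia.
  by exists a; rewrite hig ha /= exprS; ring.
have [hig1|hig1] := eqVneq (i : nat) g.-1.
  exists c; rewrite hig1 (_ : e - g.-1 = g * d)%N; last by lia.
  by rewrite X2 /=; ring.
by exists 0; rewrite X1 ?mulr0 ?polyC0 ?mul0r //; lia.
Qed.

(* The weight of a section is read off at the point z_g = 1. *)
Lemma section_topw n X : (0 < g)%N ->
  (exists N, is_hom (n + N) (X * zh g ^+ N)) -> topw n X.
Proof.
move=> g0 [N /(hom_topw g0) [h1 [c h2] h3]].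
have E e : (ch X)`_e * ly g ^+ N = (ch (X * zh g ^+ N))`_(e + g * N).
  rewrite chM chXn ch_zh exprMn -polyC_exp -exprM mulrA coefMXn.
  by rewrite ltnNge leq_addl /= addnK coefMC.
have lN : ly g ^+ N != 0 by rewrite expf_neq0 // ly_neq0.
split.
- by move=> e he; apply: (mulIf lN); rewrite E mul0r h1 // mulnDr ltn_add2r.
- by exists c; apply: (mulIf lN); rewrite E -mulnDr h2 exprD mulrA.
move=> e he; have [|a ha] := h3 (e + g * N)%N; first by rewrite mulnDr -he addSn.
exists a; apply: (mulIf lN); rewrite E ha.
have n0 : (0 < n)%N by move: he; case: (n); rewrite ?muln0.
rewrite (_ : (n + N).-1 = n.-1 + N)%N; last by lia.
by rewrite exprD; ring.
Qed.

(** With u set to 1: z_0 = 1 gives the cusp condition, z_1 = t + w, monic in w, bounds the degree in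
    w, and z_g bounds the weights. *)
Lemma section_poly n f : (0 < g)%N -> tangent_section n f -> exists X,
  [/\ f = ub ^+ n * th X, X`_1 = (X`_0)^`(), (size X <= n.+1)%N & topw n X].
Proof.
move=> g0 hf; have [X [-> hX]] := section_form hf; exists X; split=> //.
- have [N] := hX ord0; rewrite /zh expr0 -polyC1 derivC polyC0 mul0r addr0 expr1n mulr1.
  exact: hom_cusp.
- have g1 : (1 < g.+1)%N by [].
  have [N] := hX (Ordinal g1).
  have e1 : zh 1 = 'X - (- 'X)%:P by rewrite /zh expr1 derivX polyC1 mul1r polyCN opprK addrC.
  rewrite /= e1 => /hom_size.
  have [->|X0] := eqVneq X 0; first by rewrite size_poly0.
  rewrite size_Mmonic ?monic_exp ?monicXsubC // size_exp_XsubC addnS /=.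
  by rewrite -addSn leq_add2r.
by apply: section_topw => //; have := hX ord_max.
Qed.

Definition sA (A : {poly k}) : T := A%:P + (A^`())%:P * 'X.

Lemma poly_eq2 X : (size X <= 2)%N -> X = (X`_0)%:P + (X`_1)%:P * 'X.
Proof.
move=> sX; apply/polyP => -[|[|e]]; rewrite coefD coefC coefMX coefC /= ?addr0 ?add0r //.
by rewrite nth_default // (leq_trans sX).
Qed.

Lemma section1_form f : (0 < g)%N -> tangent_section 1 f ->
  exists2 A : {poly k}, (size A <= g.+1)%N & f = ub * th (sA A).
Proof.
move=> g0 /(section_poly g0)[X [-> hc sX [h1 _ _]]]; exists X`_0.
  apply/leq_sizeP => e he; have := ch_coef X e 0; rewrite h1; last by rewrite muln1.
  by rewrite coef0 /= subn0 => <-.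
by rewrite expr1 /sA -hc -poly_eq2.
Qed.

Lemma sA_sum (A : {poly k}) : (size A <= g.+1)%N ->
  sA A = ph (\sum_(i < g.+1) A`_i *: 'X_i).
Proof.
move=> hA; rewrite (rmorph_sum ph) /sA -{1 2}[A]coefK poly_def.
rewrite (big_ord_widen g.+1 (fun i => A`_i *: 'X^i)) // big_mkcond /=.
rewrite (raddf_sum (@deriv _)) !(rmorph_sum polyC) mulr_suml -big_split; apply: eq_bigr => i _ /=.
rewrite -mul_mpolyC rmorphM /= ph_X.
have -> : ph (A`_i)%:MP = (A`_i)%:P%:P by rewrite /ph map_mpolyC mevalC.
case: ltnP => h; last by rewrite nth_default // !polyC0 deriv0 polyC0 !mul0r addr0.
by rewrite /zh derivZ -!mul_polyC !polyCM; ring.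
Qed.

Lemma section1_of_poly (A : {poly k}) : (size A <= g.+1)%N -> tangent_section 1 (ub * th (sA A)).
Proof.
move=> hA; rewrite (sA_sum hA); set p := \sum_(_ < _) _.
have hp : p \is 1.-homog.
  rewrite /p; apply: rpred_sum => i _; apply: rpredZ.
  by rewrite dhomogX; apply/eqP; apply: mdeg1.
by have := section_hom hp; rewrite expr1.
Qed.

Definition sAB (a b : {poly k}) : T := sA a + b%:P * 'X^2.

Lemma ly2 i j : ly i * ly j = 1 + 'X *+ (i + j) + 'X^2 *+ (i * j).
Proof.
rewrite /ly mulrDl mul1r mulrDr mulr1 mulrnAl mulrnAr -mulrnA mulnC.
by rewrite addrA -(addrA 1) -mulrnDr addnC.
Qed.

Lemma ly2_coef0 i j : (ly i * ly j)`_0 = 1.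
Proof. by rewrite ly2 !coefD !coefMn coefXn coefX coef1 /= !mul0rn !addr0. Qed.

Lemma ly2_coef2 i j : (ly i * ly j)`_2 = (i * j)%:R.
Proof. by rewrite ly2 !coefD !coefMn coefXn coefX coef1 /= mul0rn !add0r. Qed.

(** The factors g g and g (g - 1) are the y^2-coefficients of (1 + g y)^2 and (1 + g y) (1 + (g - 1)
    y), whose constant terms are 1. *)
Lemma section2_form f : (2 < g)%N -> tangent_section 2 f -> exists a b : {poly k},
  [/\ f = ub ^+ 2 * th (sAB a b), (size a <= g.*2.+1)%N, (size b <= g.*2.-1)%N,
     b`_(g.*2 - 2) = (g * g)%:R * a`_(g.*2)
     & b`_(g.*2 - 3) = (g * g.-1)%:R * a`_(g.*2.-1)].
Proof.
move=> g2 /(section_poly (ltnW (ltnW g2)))[X [-> hc sX [h1 [c h2] h3]]].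
have g2E : (g * 2 = g.*2)%N by rewrite muln2.
rewrite g2E in h1 h2 h3.
have cX j e : (j <= e)%N -> (X`_j)`_(e - j) = ((ch X)`_e)`_j by move=> je; rewrite ch_coef je.
exists X`_0, X`_2; split.
- congr (_ * th _); rewrite /sAB /sA -hc; apply/polyP => -[|[|[|e]]];
    rewrite !coefD coefC coefMX coefC coefCM coefXn /= ?mulr0 ?mulr1 ?addr0 ?add0r //.
  by rewrite nth_default // (leq_trans sX).
- apply/leq_sizeP => e he; have := cX 0%N e isT; rewrite subn0 => ->.
  by rewrite h1 ?coef0.
- apply/leq_sizeP => e he; have h2' : (2 <= e.+2)%N by [].
  have := cX 2%N e.+2 h2'; rewrite (_ : e.+2 - 2 = e)%N; last by lia.
  by move=> ->; rewrite h1 ?coef0 //; lia.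
- have hh : (2 <= g.*2)%N by lia.
  rewrite cX // -[in RHS](subn0 g.*2) cX // h2 expr2.
  by rewrite !coefCM ly2_coef2 ly2_coef0 mulr1 mulrC.
have hh : (2 <= g.*2.-1)%N by lia.
have [|c' e'] := h3 g.*2.-1; first by lia.
rewrite (_ : g.*2 - 3 = g.*2.-1 - 2)%N; last by lia.
rewrite cX // -[in RHS](subn0 g.*2.-1) cX // e' /= expr1 -mulrA.
by rewrite !coefCM ly2_coef2 ly2_coef0 mulr1 mulrC.
Qed.

Lemma zh_mul i j m : (i + j = m.+2)%N ->
  zh i * zh j = sA 'X^(m.+2) + ('X^m *+ (i * j))%:P * 'X^2.
Proof.
move=> e.
have E : ('X^i : {poly k})^`() * ('X^j)^`() = 'X^m *+ (i * j).
  rewrite !derivXn mulrnAl mulrnAr -mulrnA mulnC.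
  case: i e => [|i] e; first by rewrite !mul0n.
  case: j e => [|j] e; first by rewrite !muln0.
  by rewrite -exprD /= (_ : i + j = m)%N //; lia.
by rewrite -E /sA -e exprD derivM polyCD !polyCM /zh dual_mul.
Qed.

(** If i + j = i' + j' = m + 2, then z_i z_j - z_i' z_j' = (i j - i' j') u^2 t^m w^2. Indices as
    equal as possible make the factor 1 for even m and 2 for odd m. *)
Lemma section2_of_poly (b : {poly k}) : (2%:R : k) != 0 -> (2 < g)%N -> (size b <= g.*2 - 3)%N ->
  tangent_section 2 (ub ^+ 2 * th (b%:P * 'X^2)).
Proof.
move=> two g2 hb.
have hX2 (i j : 'I_g.+1) : ('X_i * 'X_j : S) \is 2.-homog.
  have h (l : 'I_g.+1) : ('X_l : S) \is 1.-homog by rewrite dhomogX; apply/eqP; apply: mdeg1.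
  exact: (dhomogM (h i) (h j)).
have hq m i j i' j' c : (i <= g)%N -> (j <= g)%N -> (i' <= g)%N -> (j' <= g)%N ->
    (i + j = m.+2)%N -> (i' + j' = m.+2)%N -> (i * j = i' * j' + c)%N -> (c%:R : k) != 0 ->
    exists2 p : S, p \is 2.-homog & ('X^m)%:P * 'X^2 = ph p.
  move=> h1 h2 h3 h4 e1 e2 ec c0.
  exists ((c%:R^-1)%:MP * ('X_(inord i) * 'X_(inord j) - 'X_(inord i') * 'X_(inord j'))).
    by rewrite mul_mpolyC rpredZ // rpredB.
  rewrite phM (phB ('X_(inord i) * 'X_(inord j))) !phM !ph_X !inordK // phC.
  rewrite (zh_mul e1) (zh_mul e2) opprD addrACA subrr add0r -mulrBl -polyCB ec mulrnDr.
  rewrite addrC addKr [RHS]mulrA -polyCM mulrnAr -mulrnAl -polyCMn -(mulr_natl c%:R^-1) mulfV //.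
  by rewrite polyC1 mul1r.
have hm m : (m < g.*2 - 3)%N -> exists2 p : S, p \is 2.-homog & ('X^m)%:P * 'X^2 = ph p.
  move=> hm; have [hp|hp] := boolP (odd m).
    pose r := m./2; have mE : m = r.*2.+1 by rewrite /r -[LHS]odd_double_half hp.
    by apply: (hq m r.+2 r.+1 r.+3 r 2) => //; nia.
  pose r := m./2; have mE : m = r.*2 by rewrite /r -[LHS]odd_double_half (negbTE hp).
  by apply: (hq m r.+1 r.+1 r.+2 r 1%N); rewrite ?oner_neq0 //; nia.
have [p hp ->] : exists2 p : S, p \is 2.-homog & b%:P * 'X^2 = ph p.
  rewrite -[b]coefK poly_def (rmorph_sum polyC) mulr_suml.
  elim/big_ind: _ => [|_ _ [p hp ->] [q hq' ->]|i _].
  - by exists 0; [apply: rpred0 | rewrite (rmorph0 ph)].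
  - by exists (p + q); [apply: rpredD | rewrite (rmorphD ph)].
  have [|p hp e] := hm i; first by rewrite (leq_trans (ltn_ord i)).
  exists ((b`_i)%:MP * p); first by rewrite mul_mpolyC rpredZ.
  by rewrite phM -e phC [RHS]mulrA -polyCM [(b`_i)%:P * _]mul_polyC /=.
exact: (section_hom hp).
Qed.

End Sections.

(** * Independence of the resolution *)

Section FreeMaps.
Variable S : comNzRingType.

Definition rowd (B : finType) (b : B) : {ffun B -> S^o} := [ffun c => (c == b)%:R].

Lemma free_map0 (M : lmodType S) (B B' : finType) (phi : B -> B' -> S) :
  free_map phi (0 : {ffun B -> M}) = 0.
Proof. by apply/ffunP => b'; rewrite !ffunE big1 // => b _; rewrite ffunE scaler0. Qed.

Lemma free_mapD (M : lmodType S) (B B' : finType) (phi : B -> B' -> S) (x y : {ffun B -> M}) :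
  free_map phi (x + y) = free_map phi x + free_map phi y.
Proof.
apply/ffunP => b'; rewrite !ffunE -big_split; apply: eq_bigr => b _ /=.
by rewrite ffunE scalerDr.
Qed.

Lemma free_mapN (M : lmodType S) (B B' : finType) (phi : B -> B' -> S) (x : {ffun B -> M}) :
  free_map phi (- x) = - free_map phi x.
Proof.
apply/ffunP => b'; rewrite !ffunE -sumrN; apply: eq_bigr => b _ /=.
by rewrite ffunE scalerN.
Qed.

Lemma free_mapB (M : lmodType S) (B B' : finType) (phi : B -> B' -> S) (x y : {ffun B -> M}) :
  free_map phi (x - y) = free_map phi x - free_map phi y.
Proof. by rewrite free_mapD free_mapN. Qed.

Lemma eq_free_map (M : lmodType S) (B B' : finType) (phi psi : B -> B' -> S) :
  phi =2 psi -> free_map phi =1 (free_map psi : {ffun B -> M} -> _).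
Proof. by move=> e x; apply/ffunP => b'; rewrite !ffunE; apply: eq_bigr => b _; rewrite e. Qed.

Lemma free_map_comp (M : lmodType S) (B B' B'' : finType)
    (F : B -> {ffun B' -> S^o}) (phi : B' -> B'' -> S) (x : {ffun B -> M}) :
  free_map (fun b => free_map phi (F b)) x = free_map phi (free_map F x).
Proof.
apply/ffunP => b''; rewrite !ffunE.
under [RHS]eq_bigr do rewrite ffunE scaler_sumr.
rewrite exchange_big; apply: eq_bigr => b _ /=.
rewrite ffunE scaler_suml; apply: eq_bigr => b' _.
by rewrite scalerA.
Qed.

Lemma free_map_row (B B' : finType) (F : B -> {ffun B' -> S^o}) b :
  free_map F (rowd b) = F b.
Proof.
apply/ffunP => b'; rewrite ffunE (bigD1 b) //= ffunE eqxx big1 ?addr0 => [|c /negbTE h].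
  by rewrite /GRing.scale /= mulr1.
by rewrite ffunE h /GRing.scale /= mulr0.
Qed.

Lemma free_map_rowd (M : lmodType S) (B : finType) (x : {ffun B -> M}) :
  free_map (@rowd B) x = x.
Proof.
apply/ffunP => b; rewrite ffunE (bigD1 b) //= ffunE eqxx scale1r big1 ?addr0 // => c /negbTE h.
by rewrite ffunE eq_sym h scale0r.
Qed.

Lemma free_map_sub (M : lmodType S) (B B' : finType) (F G : B -> {ffun B' -> S^o})
    (x : {ffun B -> M}) :
  free_map (fun b => F b - G b) x = free_map F x - free_map G x.
Proof.
apply/ffunP => b'; rewrite !ffunE -sumrB; apply: eq_bigr => b _.
by rewrite !ffunE -scalerBl.
Qed.

End FreeMaps.

Section Comparison.
Variables (k : fieldType) (n : nat).
Local Notation S := {mpoly k[n]}.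
Definition hgr e (p : S^o) : Prop := (p : S) \is e.-homog.

Definition drow (P : residue_res k n) i (b : res_basis P i.+1) : {ffun res_basis P i -> S^o} :=
  [ffun b' => res_d b b'].

Definition grow (B : finType) (dg : B -> nat) (Q : residue_res k n) j
    (F : B -> {ffun res_basis Q j -> S^o}) := forall b, tensor_deg hgr (dg b) (F b).

Lemma free_map_drow (M : lmodType S) (P : residue_res k n) i (x : {ffun res_basis P i.+1 -> M}) :
  free_map (@drow P i) x = free_map (@res_d _ _ P i) x.
Proof. by apply: eq_free_map => b b'; rewrite ffunE. Qed.

Lemma grow_drow (P : residue_res k n) i : grow (@res_deg _ _ P i.+1) (@drow P i).
Proof.
move=> b b'; rewrite ffunE; have := res_d_homog b b'.
by case: ifP => // _ /eqP.
Qed.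

Section Module.
Variables (M : lmodType S) (Mgr : nat -> M -> Prop).
Hypothesis Mgr0 : forall d, Mgr d 0.
Hypothesis MgrD : forall d x y, Mgr d x -> Mgr d y -> Mgr d (x + y).
Hypothesis MgrZ : forall d e p x, p \is d.-homog -> Mgr e x -> Mgr (d + e)%N (p *: x).

Lemma MgrN d x : Mgr d x -> Mgr d (- x).
Proof.
move=> h; rewrite -scaleN1r -[d]add0n; apply: MgrZ => //.
by rewrite rpredN dhomog1.
Qed.

Lemma tensor_degD (P : residue_res k n) i d (x y : {ffun res_basis P i -> M}) :
  tensor_deg Mgr d x -> tensor_deg Mgr d y -> tensor_deg Mgr d (x + y).
Proof.
move=> hx hy b; rewrite ffunE; move: (hx b) (hy b); case: ifP => _; first exact: MgrD.
by move=> -> ->; rewrite addr0.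
Qed.

Lemma tensor_degN (P : residue_res k n) i d (x : {ffun res_basis P i -> M}) :
  tensor_deg Mgr d x -> tensor_deg Mgr d (- x).
Proof.
move=> hx b; rewrite ffunE; move: (hx b); case: ifP => _; first exact: MgrN.
by move=> ->; rewrite oppr0.
Qed.

Lemma tensor_deg0 (P : residue_res k n) i d : tensor_deg Mgr d (0 : {ffun res_basis P i -> M}).
Proof. by move=> b; rewrite ffunE; case: ifP. Qed.

Lemma grow_deg (P Q : residue_res k n) i j (F : res_basis P i -> {ffun res_basis Q j -> S^o})
    d (x : {ffun res_basis P i -> M}) :
  grow (@res_deg _ _ P i) F -> tensor_deg Mgr d x -> tensor_deg Mgr d (free_map F x).
Proof.
move=> hF hx b'; rewrite ffunE; case: leqP => h.
  elim/big_ind: _ => [||b _]; [exact: Mgr0 | exact: MgrD |].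
  move: (hF b b') (hx b); case: leqP => h1; case: leqP => h2; first last.
  - by move=> _ ->; rewrite scaler0; apply: Mgr0.
  - by move=> ->; rewrite scale0r => _; apply: Mgr0.
  - by move=> _ ->; rewrite scaler0; apply: Mgr0.
  move=> h3 h4; have := MgrZ h3 h4.
  by rewrite (_ : _ + _ = d - res_deg b')%N //; lia.
apply: big1 => b _; move: (hF b b') (hx b); case: leqP => h1; case: leqP => h2; first last.
- by move=> _ ->; rewrite scaler0.
- by move=> -> _; rewrite scale0r.
- by move=> _ ->; rewrite scaler0.
by move: (leq_ltn_trans (leq_trans h1 h2) h); rewrite ltnn.
Qed.

End Module.

Lemma hgr0 d : hgr d 0. Proof. exact: rpred0. Qed.
Lemma hgrD d x y : hgr d x -> hgr d y -> hgr d (x + y). Proof. exact: rpredD. Qed.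
Lemma hgrZ d e p x : p \is d.-homog -> hgr e x -> hgr (d + e)%N (p *: x).
Proof. exact: dhomogM. Qed.

Lemma grow_comp (P Q : residue_res k n) (B : finType) (dg : B -> nat) i j
    (F : B -> {ffun res_basis P i -> S^o}) (G : res_basis P i -> {ffun res_basis Q j -> S^o}) :
  grow dg F -> grow (@res_deg _ _ P i) G -> grow dg (fun b => free_map G (F b)).
Proof. by move=> hF hG b; apply: (grow_deg hgr0 hgrD hgrZ hG (hF b)). Qed.

Lemma grow_rowd (P : residue_res k n) i : grow (@res_deg _ _ P i) (@rowd _ (res_basis P i)).
Proof.
move=> b b'; rewrite ffunE; case: eqVneq => [->|_]; last by case: ifP => // _; apply: hgr0.
by rewrite leqnn subnn; apply: dhomog1.
Qed.

Lemma grow_sub (P : residue_res k n) (B : finType) (dg : B -> nat) i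
    (F G : B -> {ffun res_basis P i -> S^o}) :
  grow dg F -> grow dg G -> grow dg (fun b => F b - G b).
Proof.
move=> hF hG b; apply: (tensor_degD hgrD) (hF b) _.
exact: (tensor_degN hgrZ) (hG b).
Qed.

Lemma pihomogM (p q : S) e e' : q \is e'.-homog ->
  pihomog mdeg e (p * q) = if (e' <= e)%N then pihomog mdeg (e - e') p * q else 0.
Proof.
move=> hq; rewrite [p]mpolyE mulr_suml !raddf_sum /=.
have E (m : 'X_{1..n}) : pihomog mdeg e (p@_m *: 'X_[m] * q) =
    if (e' <= e)%N then pihomog mdeg (e - e') (p@_m *: 'X_[m]) * q else 0.
  have h : p@_m *: 'X_[m] * q \is (mdeg m + e')%N.-homog.
    by apply: dhomogM => //; rewrite rpredZ // dhomogX.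
  rewrite [pihomog _ (e - e') _]linearZ /= pihomogX.
  case: leqP => he.
    case: eqVneq => hm.
      have -> : e = (mdeg m + e')%N by move: hm he; rewrite /=; lia.
      by rewrite pihomog_dE.
    by rewrite scaler0 mul0r (@pihomog_ne0 _ _ _ _ _ _ _ h) //; apply: contra hm => /eqP <-; rewrite addnK.
  by rewrite (@pihomog_ne0 _ _ _ _ _ _ _ h) //; apply/eqP; move: he; rewrite ltnNge => /negP he e1; apply: he; rewrite -e1 leq_addl.
under eq_bigr do rewrite E.
by case: ifP => _; [rewrite -mulr_suml | rewrite big1].
Qed.

Definition is_lift (Q : residue_res k n) (B : finType) (dg : B -> nat) j
    (F : B -> {ffun res_basis Q j -> S^o}) (G : B -> {ffun res_basis Q j.+1 -> S^o}) :=
  grow dg G /\ forall b, free_map (@res_d _ _ Q j) (G b) = F b.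

(** Chosen by [epsilon], so that [comparison] and [homotopy] can be defined by recursion before
    their properties are proved. *)
Definition lift (Q : residue_res k n) (B : finType) (dg : B -> nat) j
    (F : B -> {ffun res_basis Q j -> S^o}) : B -> {ffun res_basis Q j.+1 -> S^o} :=
  epsilon (inhabits (fun _ => 0)) (is_lift dg F).

Lemma liftP (Q : residue_res k n) (B : finType) (dg : B -> nat) j
    (F : B -> {ffun res_basis Q j -> S^o}) :
  grow dg F -> (forall b, exists y, F b = free_map (@res_d _ _ Q j) y) ->
  is_lift dg F (lift dg F).
Proof.
move=> hF /fin_all_exists[y hy]; apply: epsilon_spec.
(* The homogeneous components of a lift form a graded lift. *)
exists (fun b => [ffun c => if (res_deg c <= dg b)%N then
  pihomog mdeg (dg b - res_deg c) (y b c) else 0]).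
split=> [b c|b].
  by rewrite ffunE; case: (res_deg c <= dg b)%N => //; apply: pihomogP.
apply/ffunP => b'; rewrite ffunE.
have := hF b b'; case: leqP => h.
  rewrite /hgr => /pihomog_dE <-; rewrite hy ffunE raddf_sum /=.
  apply: eq_bigr => c _; rewrite ffunE /GRing.scale /=.
  rewrite mulrC [in RHS]mulrC; have := res_d_homog c b'; case: leqP => h1.
    move=> h2; rewrite (pihomogM _ _ h2) leq_sub2rE // (_ : _ - _ - _ = dg b - res_deg c)%N; last by lia.
    by case: ifP => //; rewrite mul0r.
  by move=> /eqP ->; rewrite !mulr0 raddf0.
move=> ->; apply: big1 => c _; rewrite ffunE /GRing.scale /=.
case: leqP => h1; last by rewrite mulr0.
have := res_d_homog c b'; rewrite leqNgt (leq_ltn_trans h1 h) => /eqP ->.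
by rewrite mul0r.
Qed.

Definition aug (P : residue_res k n) (x : {ffun res_basis P 0 -> S^o}) : k :=
  \sum_b (x b : S)@_0%MM * res_aug b.

Lemma augB (P : residue_res k n) x y : @aug P (x - y) = aug x - aug y.
Proof.
rewrite /aug -sumrB; apply: eq_bigr => b _.
by rewrite !ffunE mcoeffB mulrBl.
Qed.

Lemma aug_rowd (P : residue_res k n) b : @aug P (rowd _ b) = res_aug b.
Proof.
rewrite /aug (bigD1 b) //= ffunE eqxx mcoeff1 eqxx mul1r big1 ?addr0 // => c /negbTE h.
by rewrite ffunE h mcoeff0 mul0r.
Qed.

Lemma aug_drow (P : residue_res k n) b : aug (@drow P 0 b) = 0.
Proof.
apply/res_exact0; exists (rowd _ b); apply/ffunP => c.
by rewrite -free_map_drow free_map_row.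
Qed.

Lemma drow_cycle (P : residue_res k n) i b : free_map (@res_d _ _ P i) (@drow P i.+1 b) = 0.
Proof.
apply/res_exact; exists (rowd _ b); apply/ffunP => c.
by rewrite -free_map_drow free_map_row.
Qed.

Definition unit_base (Q : residue_res k n) : res_basis Q 0 :=
  epsilon (let: ex_intro b _ := res_aug_surj Q in inhabits b) (fun b => res_aug b != 0).

Lemma unit_baseP (Q : residue_res k n) : res_aug (unit_base Q) != 0.
Proof. exact: epsilon_spec (res_aug_surj Q). Qed.

(** Lifts the identity of k through a single generator of Q with nonzero augmentation. *)
Definition comp0 (P Q : residue_res k n) (b : res_basis P 0) : {ffun res_basis Q 0 -> S^o} :=
  [ffun c => if c == unit_base Q then (res_aug b / res_aug (unit_base Q))%:MP else 0].

Fixpoint comparison (P Q : residue_res k n) i : res_basis P i -> {ffun res_basis Q i -> S^o} :=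
  if i is i'.+1 then
    lift (@res_deg _ _ P i'.+1) (fun b => free_map (@comparison P Q i') (@drow P i' b))
  else @comp0 P Q.

Lemma aug_comp0 (P Q : residue_res k n) x : aug (free_map (@comp0 P Q) x) = aug x.
Proof.
rewrite /aug (bigD1 (unit_base Q)) //= big1 ?addr0 => [|c /negbTE hc]; last first.
  rewrite ffunE big1 ?mcoeff0 ?mul0r // => b _.
  by rewrite ffunE hc scale0r.
rewrite ffunE raddf_sum mulr_suml; apply: eq_bigr => b _ /=.
rewrite ffunE eqxx /GRing.scale /= mcoeffCM mulrAC divfK ?unit_baseP //.
exact: mulrC.
Qed.

Lemma comparisonP (P Q : residue_res k n) i :
  grow (@res_deg _ _ P i) (@comparison P Q i) /\
  grow (@res_deg _ _ P i.+1) (@comparison P Q i.+1) /\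
  forall b, free_map (@res_d _ _ Q i) (@comparison P Q i.+1 b)
    = free_map (@comparison P Q i) (@drow P i b).
Proof.
elim: i => [|i [IH1 [IH2 IH3]]].
  have h0 : grow (@res_deg _ _ P 0) (@comparison P Q 0).
    move=> b c; rewrite ffunE; case: eqVneq => [->|_]; last by case: ifP => // _; apply: hgr0.
    rewrite (res_aug_homog (unit_baseP Q)) /= subn0.
    have [->|/res_aug_homog ->] := eqVneq (res_aug b) 0.
      by rewrite mul0r mpolyC0; apply: hgr0.
    by rewrite /hgr -[_%:MP]mulr1 mul_mpolyC rpredZ // dhomog1.
  split=> //; apply: liftP; first exact: grow_comp (@grow_drow P 0) h0.
  by move=> b; apply/res_exact0; rewrite -/(aug _) aug_comp0 aug_drow.
split=> //; apply: liftP; first exact: grow_comp (@grow_drow P i.+1) IH2.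
move=> b; apply/res_exact; rewrite -free_map_comp.
rewrite (eq_free_map (psi := fun b => free_map (@comparison P Q i) (@drow P i b))); last first.
  by move=> c c'; rewrite IH3.
by rewrite free_map_comp free_map_drow drow_cycle free_map0.
Qed.

Lemma comparison_grow (P Q : residue_res k n) i : grow (@res_deg _ _ P i) (@comparison P Q i).
Proof. by case: (comparisonP P Q i). Qed.

Lemma comparison_d (M : lmodType S) (P Q : residue_res k n) i (x : {ffun res_basis P i.+1 -> M}) :
  free_map (@res_d _ _ Q i) (free_map (@comparison P Q i.+1) x)
  = free_map (@comparison P Q i) (free_map (@res_d _ _ P i) x).
Proof.
have [_ [_ h]] := comparisonP P Q i.
by rewrite -free_map_comp -free_map_drow -free_map_comp; apply: eq_free_map => b c; rewrite h.
Qed.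

Section Homotopy.
Variables (P Q : residue_res k n).

Definition round i (b : res_basis P i) : {ffun res_basis P i -> S^o} :=
  rowd _ b - free_map (@comparison Q P i) (@comparison P Q i b).

Lemma round_grow i : grow (@res_deg _ _ P i) (@round i).
Proof.
apply: grow_sub (@grow_rowd P i) _.
exact: grow_comp (@comparison_grow P Q i) (@comparison_grow Q P i).
Qed.

Lemma free_map_round (M : lmodType S) i (x : {ffun res_basis P i -> M}) :
  free_map (@round i) x = x - free_map (@comparison Q P i) (free_map (@comparison P Q i) x).
Proof. by rewrite free_map_sub free_map_rowd free_map_comp. Qed.

Lemma round_d (M : lmodType S) i (x : {ffun res_basis P i.+1 -> M}) :
  free_map (@res_d _ _ P i) (free_map (@round i.+1) x)
  = free_map (@round i) (free_map (@res_d _ _ P i) x).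
Proof. by rewrite !free_map_round free_mapB !comparison_d. Qed.

Fixpoint homotopy i : res_basis P i -> {ffun res_basis P i.+1 -> S^o} :=
  lift (@res_deg _ _ P i) (fun b => round b -
    match i return res_basis P i -> {ffun res_basis P i -> S^o} with
    | 0%N => fun _ => 0
    | i'.+1 => fun b => free_map (@homotopy i') (@drow P i' b)
    end b).

(** The composite of d with the homotopy one degree lower, absent in degree 0: the inner match of
    [homotopy], under a name. *)
Definition homotopy_tail i : res_basis P i -> {ffun res_basis P i -> S^o} :=
  match i return res_basis P i -> {ffun res_basis P i -> S^o} with
  | 0%N => fun _ => 0
  | i'.+1 => fun b => free_map (@homotopy i') (@drow P i' b)
  end.

Lemma homotopyP i :
  is_lift (@res_deg _ _ P i) (fun b => round b - homotopy_tail b) (@homotopy i).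
Proof.
elim: i => [|i [IH1 IH2]].
  apply: liftP.
    apply: grow_sub (@round_grow 0) _ => b; by apply: (tensor_deg0 hgr0).
  move=> b; apply/res_exact0; rewrite -/(aug _) subr0 augB aug_rowd.
  rewrite aug_comp0.
  have := aug_comp0 Q (rowd _ b); rewrite free_map_row aug_rowd => ->.
  by rewrite subrr.
apply: liftP.
  exact: grow_sub (@round_grow i.+1) (grow_comp (@grow_drow P i) IH1).
move=> b; apply/res_exact; rewrite free_mapB -free_map_comp.
rewrite -[X in free_map _ X - _]free_map_row round_d -free_map_drow free_map_row.
rewrite [X in _ - X](eq_free_map (psi := fun b => @round i b - @homotopy_tail i b)); last by move=> c c'; rewrite IH2.
rewrite [X in _ - X]free_map_sub opprB addrC addrNK.
case: i b IH1 IH2 => [|i] b IH1 IH2.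
  by apply/ffunP => c; rewrite ffunE [RHS]ffunE big1 // => c' _; rewrite ffunE scale0r.
by rewrite free_map_comp free_map_drow drow_cycle free_map0.
Qed.

End Homotopy.

(** The image of z over Q is a boundary, and so is its image back over P; by the homotopy formula
    the difference from z is a boundary as well, since z is a cycle. *)
Theorem cycle_boundary_transfer (P Q : residue_res k n) (M : lmodType S) (Mgr : nat -> M -> Prop) i d :
  (forall d, Mgr d 0) -> (forall d x y, Mgr d x -> Mgr d y -> Mgr d (x + y)) ->
  (forall d e p x, p \is d.-homog -> Mgr e x -> Mgr (d + e)%N (p *: x)) ->
  (forall z, @tor_cycle _ _ Q M Mgr i d z -> tor_boundary Mgr d z) ->
  (forall z, @tor_cycle _ _ P M Mgr i d z -> tor_boundary Mgr d z).
Proof.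
move=> M0 MD MZ hQ z hz.
have zdeg : tensor_deg Mgr d z by case: (i) z hz => [|j] z // [].
have fdeg := grow_deg M0 MD MZ (@comparison_grow P Q i) zdeg.
have [y hy ey] : tor_boundary Mgr d (free_map (@comparison P Q i) z).
  apply: hQ; case: (i) z hz zdeg fdeg => [|j] z // [_ hz] _ fdeg; split=> //.
  by rewrite comparison_d hz free_map0.
have [hg hh] := homotopyP P Q i.
exists (free_map (@comparison Q P i.+1) y + free_map (@homotopy P Q i) z).
  apply: (tensor_degD MD); first exact: grow_deg (@comparison_grow Q P i.+1) hy.
  exact: grow_deg hg zdeg.
rewrite free_mapD comparison_d -ey -[X in _ + X]free_map_comp.
rewrite [X in _ + X](eq_free_map (psi := fun b => @round P Q i b - @homotopy_tail P Q i b)); last by move=> b c; rewrite hh.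
rewrite free_map_sub free_map_round addrC.
suff -> : free_map (@homotopy_tail P Q i) z = 0 by rewrite subr0 subrK.
case: (i) z hz {zdeg fdeg hh ey} => [|j] z hz.
  by apply/ffunP => c; rewrite ffunE [RHS]ffunE big1 // => c' _; rewrite ffunE scale0r.
by rewrite free_map_comp free_map_drow; case: hz => _ ->; rewrite free_map0.
Qed.

End Comparison.

(** * The Koszul complex of the tangential variety *)

Section QuotDim.
Variables (k : fieldType) (n : nat) (V : lmodType {mpoly k[n]}) (Z B : V -> Prop).

Lemma has_quot_dim0 : has_quot_dim Z B 0 <-> forall z, Z z -> B z.
Proof.
split=> [[v [_ _ h]] z hz|h].
  by have [c] := h z hz; rewrite big_ord0 subr0.
exists (fun=> 0); split=> [[]|c _ []|z hz] //.
by exists (fun=> 0); rewrite big_ord0 subr0; apply: h.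
Qed.

(** [epsilon] needs an admissible value to exist first. If all cycles are boundaries, a positive
    dimension is impossible: a basis vector would be a boundary. *)
Lemma quot_dim0 : quot_dim Z B = Some 0%N <-> forall z, Z z -> B z.
Proof.
rewrite -has_quot_dim0 /quot_dim; set Q := fun o : option nat => _.
have /(epsilon_spec (inhabits None)) hQ : exists o, Q o.
  have [[m hm]|h] := excluded_middle_informative (exists m, has_quot_dim Z B m).
    by exists (Some m).
  by exists None => m hm; apply: h; exists m.
split=> [e|h0]; first by move: hQ; rewrite e.
case: (epsilon (inhabits None) Q) hQ => [[|m]|] //=; last by case/(_ 0%N).
case=> [v [hv hi _]].
have := hi (fun j => (j == ord0)%:R); rewrite (bigD1 ord0) //= big1 => [|j /negbTE ->]; last first.
  by rewrite mpolyC0 scale0r.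
rewrite mpolyC1 scale1r addr0.
move=> /(_ (has_quot_dim0.1 h0 _ (hv _)) ord0) /eqP.
by rewrite eqxx oner_eq0.
Qed.

End QuotDim.

Section LstMap.
Variables (R R' : comNzRingType) (n : nat).

Lemma sgn_sign s : exists e, forall R'' : comNzRingType, sgn R'' s = (-1) ^+ e.
Proof.
elim: s => [|a s [e he]]; first by exists 0%N.
by exists (count (ltn^~ a) s + e)%N => R'' /=; rewrite he exprD.
Qed.

Lemma lst_map2 (f : R -> R -> R') (x y : {set 'I_n} -> R) s : f 0 0 = 0 ->
  (forall a b, f (- a) (- b) = - f a b) ->
  lst (fun A => f (x A) (y A)) s = f (lst x s) (lst y s).
Proof.
move=> f0 fN; rewrite /lst; case: ifP => // _; have [e he] := sgn_sign s.
rewrite !he -signr_odd -[in RHS]signr_odd.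
by case: odd; rewrite ?expr1 ?mulN1r ?fN ?expr0 ?mul1r.
Qed.

Lemma lst_ind2 (Q : R -> R -> Prop) (x y : {set 'I_n} -> R) s : Q 0 0 ->
  (forall a b, Q a b -> Q (- a) (- b)) -> (forall A, Q (x A) (y A)) ->
  Q (lst x s) (lst y s).
Proof.
move=> f0 fN h; rewrite /lst; case: ifP => // _; have [e ->] := sgn_sign s.
rewrite -signr_odd.
by case: odd; rewrite ?expr1 ?mulN1r ?expr0 ?mul1r //; apply: fN.
Qed.

End LstMap.

Section SectionModule.
Variables (k : fieldType) (g : nat).
Local Notation K := (tangent_field k g).
Local Notation section := (@tangent_section k g).

Lemma section0 d : section d 0.
Proof. by move=> i; exists 0%N, 0; split; rewrite ?rpred0 // mul0r (rmorph0 (@tangent_inj k g)). Qed.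

Lemma sectionD d x y : section d x -> section d y -> section d (x + y).
Proof.
move=> hx hy i; have [N [p [hp ep]]] := hx i; have [M [q [hq eq]]] := hy i.
have hX m : ('X_i : {mpoly k[g.+1]}) ^+ m \is m.-homog.
  have h : ('X_i : {mpoly k[g.+1]}) \is 1.-homog by rewrite dhomogX; apply/eqP; apply: mdeg1.
  by have := dhomogMn m h; rewrite mul1n.
exists (N + M)%N, (p * 'X_i ^+ M + q * 'X_i ^+ N); split.
  apply: rpredD; first by rewrite addnA; apply: dhomogM.
  by rewrite [(N + M)%N]addnC addnA; apply: dhomogM.
rewrite (rmorphD (@tangent_inj k g)) /= !tiM !(rmorphXn (@tangent_inj k g)) /= -ep -eq exprD.
by rewrite mulrDl mulrA [in X in _ + X](mulrC (_ ^+ N)) mulrA.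
Qed.

Lemma sectionZ d e (p : {mpoly k[g.+1]}) x : p \is d.-homog -> section e x -> section (d + e)%N (p *: x).
Proof.
move=> hp hx i; have [N [q [hq eq]]] := hx i.
exists N, (p * q); split; first by rewrite -addnA; apply: dhomogM.
by rewrite tiM -eq mulrA.
Qed.

End SectionModule.

Lemma dual_mul2 (R : comNzRingType) (e e' a a' b x : R) :
  (e + e' * x) * (a + a' * x + b * x ^+ 2) =
  e * a + ((e' * a) * x + (e * a') * x) + ((e * b) * x ^+ 2 + (e' * a') * x ^+ 2) + e' * b * x ^+ 3.
Proof. by ring. Qed.

Lemma cubic0 (R : nzRingType) (a b c d : R) :
  a%:P + b%:P * 'X + c%:P * 'X^2 + d%:P * 'X^3 = 0 -> [/\ a = 0, c = 0 & d = 0].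
Proof.
move=> /polyP e; split; [move: (e 0%N) | move: (e 2%N) | move: (e 3%N)];
  by rewrite !coefD !coefCM coefC coefX !coefXn /= !mulr0 ?mulr1 ?add0r ?addr0 coef0.
Qed.

Lemma mul_shuffle (R : comNzRingType) (u a v b w : R) :
  u * (a * v) * (b * w) = a * b * (v * (u * w)).
Proof. by ring. Qed.

(** * Koszul cycles and boundaries as pairs of tensors *)

Section Translate.
Variables (k : closedFieldType) (g : nat).
Hypothesis g2 : (2 < g)%N.
Hypothesis two : (2%:R : k) != 0.
Local Notation P := {poly k}.
Local Notation T := {poly {poly k}}.
Local Notation K := (tangent_field k g).
Local Notation ub := (ub k g).
Local Notation th := (@th k g).
Local Notation zh := (zh k).
Local Notation cv := (curve k).
Local Notation cv' := (curve' k).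
Local Notation ctr := (@contr _ g.+1).
Local Notation B := (koszul_basis g.+1).
Implicit Types (al be : seq nat -> P).

Lemma contr_zh al be s : ctr zh (fun s => sAB (al s) (be s)) s =
  (ctr cv al s)%:P + (ctr cv' al s + ctr cv (fun s => (al s)^`()) s)%:P * 'X
  + (ctr cv be s + ctr cv' (fun s => (al s)^`()) s)%:P * 'X^2 + (ctr cv' be s)%:P * 'X^3.
Proof.
rewrite !polyCD !mulrDl /contr !(rmorph_sum polyC) /= !mulr_suml -!big_split /=.
apply: eq_bigr => a _; rewrite /sAB /sA /zh dual_mul2 -!polyCM.
by [].
Qed.

Lemma contr_zh1 al s : ctr zh (fun s => sA (al s)) s =
  sAB (ctr cv al s) (ctr cv' (fun s => (al s)^`()) s).
Proof.
have -> : (fun s => sA (al s)) = (fun s => sAB (al s) 0).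
  by apply: functional_extensionality => t; rewrite /sAB polyC0 mul0r addr0.
rewrite contr_zh.
have z f t : ctr f (fun=> 0) t = 0 by rewrite /contr big1 // => a _; rewrite mulr0.
rewrite !z polyC0 mul0r addr0 add0r /sAB /sA; congr (_ + _%:P * _ + _).
rewrite /contr -big_split /= (raddf_sum (@deriv _)); apply: eq_bigr => a _ /=.
by rewrite derivM.
Qed.

Lemma sAB_inj a b a' b' : sAB a b = sAB a' b' :> T -> a = a' /\ b = b'.
Proof.
move=> e; split.
  by have := congr1 (fun p : T => p`_0) e; rewrite /sAB /sA !coefD !coefC !coefMX !coefMXn /= !addr0.
have := congr1 (fun p : T => p`_2) e.
by rewrite /sAB /sA !coefD !coefC !coefMX !coefC !coefMXn /= !add0r subnn !coefC.
Qed.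

(** The Koszul differential is contraction with the vector of the z_a = u (t^a + (t^a)' w); the
    factor u raises the exponent. *)
Lemma koszul_map i e (x : {ffun B i.+1 -> K}) (X : {set 'I_g.+1} -> T) :
  (forall b, x b = ub ^+ e * th (X (val b))) ->
  forall b' : B i, free_map (@koszul_d k g.+1 i) x b' =
    ub ^+ e.+1 * th (ctr zh (lst X) (enl (val b'))).
Proof.
move=> hx b'; rewrite ffunE contr_lst (rmorph_sum th) mulr_sumr.
under eq_bigr do rewrite /koszul_d scaler_suml.
rewrite (exchange_big_dep (fun a => a \notin val b')) /=; last by move=> b a _ /andP[].
apply: eq_bigr => a ha.
have hc : #|a |: val b'| == i.+1 by rewrite cardsU1 ha (eqP (valP b')).
rewrite (big_pred1 (Sub (a |: val b') hc : B i.+1)) => [|b] /=; last first.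
  by rewrite ha /= -val_eqE.
rewrite hx /= !thM /GRing.scale /= /tangent_scale tiM tangent_inj_X.
have -> : tangent_inj (koszul_sign k a (val b')) = (-1) ^+ #|[set b in val b' | (b < a)%N]| :> K.
  by rewrite /koszul_sign (rmorphXn (@tangent_inj k g)) (rmorphN1 (@tangent_inj k g)).
have -> : th ((-1) ^+ #|[set b in val b' | (b < a)%N]|) = (-1) ^+ #|[set b in val b' | (b < a)%N]|.
  by rewrite thXn thN1.
by rewrite exprS mul_shuffle.
Qed.

Lemma section_th0 e X : ub ^+ e * th X = 0 -> X = 0.
Proof. by move/eqP; rewrite mulf_eq0 expf_eq0 (negbTE (ub_neq0 k g)) andbF /= => /eqP/th_inj. Qed.

Lemma tdeg_eq j (al be : seq nat -> P) : alt al -> alt be -> supp g.+1 al -> supp g.+1 be ->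
  tdeg j al -> tdeg j be -> (forall b : B j, al (enl (val b)) = be (enl (val b))) -> al =1 be.
Proof.
move=> a1 a2 s1 s2 t1 t2 h; apply: (@alt_ext _ (two_reg_poly two) g.+1) => // A.
have [hA|hA] := boolP (#|A| == j); last by rewrite t1 ?t2 // size_enl.
exact: (h (Sub A hA)).
Qed.

Definition setfun i (a : B i -> P) (A : {set 'I_g.+1}) : P :=
  if insub A is Some b then a b else 0.

Lemma setfun_val i (a : B i -> P) b : setfun a (val b) = a b.
Proof. by rewrite /setfun valK. Qed.

Lemma tdeg_setfun i (a : B i -> P) : tdeg i (lst (setfun a)).
Proof. by apply: tdeg_lst => A hA; rewrite /setfun insubN. Qed.

Lemma sAB0 : sAB (0 : P) 0 = 0.
Proof. by rewrite /sAB /sA deriv0 !polyC0 !mul0r !addr0. Qed.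

Lemma sABN (a b : P) : sAB (- a) (- b) = - sAB a b.
Proof. by rewrite /sAB /sA derivN !polyCN !mulNr !opprD. Qed.

Lemma lst_sAB (x y : {set 'I_g.+1} -> P) :
  lst (fun A => sAB (x A) (y A)) = fun s => sAB (lst x s) (lst y s).
Proof.
by apply: functional_extensionality => s; apply: lst_map2; [exact: sAB0 | exact: sABN].
Qed.

Local Notation cyc i := (@tor_cycle k g.+1 (koszul_res k g.+1) K (@tangent_section k g) i (i + 2)).
Local Notation bnd i := (@tor_boundary k g.+1 (koszul_res k g.+1) K (@tangent_section k g) i (i + 2)).

Lemma koszul_cycle i z (a c : B i -> P) : cyc i z ->
  (forall b, z b = ub ^+ 2 * th (sAB (a b) (c b))) ->
  pair_cycle g (lst (setfun a)) (lst (setfun c)).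
Proof.
case: i z a c => [|i] z a c hz hac; set al := lst (setfun a); set be := lst (setfun c).
  (* In homological degree 0 every contraction is 0, since the tensors live on the empty list. *)
  have h0 f (y : B 0 -> P) (F : P -> P) s : F 0 = 0 -> ctr f (fun s => F (lst (setfun y) s)) s = 0.
    by move=> F0; rewrite /contr big1 // => j _; rewrite tdeg_setfun // F0 mulr0.
  by split=> s; rewrite ?(h0 _ a id) ?(h0 _ c id) ?(h0 _ a (@deriv _)) ?deriv0 ?addr0.
have [_ hd] := hz.
have zE b : z b = ub ^+ 2 * th (sAB (setfun a (val b)) (setfun c (val b))).
  by rewrite !setfun_val.
have key (b : B i) : ctr zh (fun s => sAB (al s) (be s)) (enl (val b)) = 0.
  have := koszul_map (X := fun A => sAB (setfun a A) (setfun c A)) zE b; rewrite hd ffunE lst_sAB => /esym.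
  exact: section_th0.
have hC (b : B i) : [/\ ctr cv al (enl (val b)) = 0,
    ctr cv be (enl (val b)) + ctr cv' (fun s => (al s)^`()) (enl (val b)) = 0
    & ctr cv' be (enl (val b)) = 0].
  by have := key b; rewrite contr_zh; apply: cubic0.
have a1 : alt al := alt_lst _; have a2 : alt be := alt_lst _.
have s1 : supp g.+1 al := supp_lst _; have s2 : supp g.+1 be := supp_lst _.
have t1 : tdeg i.+1 al := tdeg_setfun _; have t2 : tdeg i.+1 be := tdeg_setfun _.
have d1 : alt (fun s => (al s)^`()) by move=> s x y t; rewrite a1 derivN.
have d2 : supp g.+1 (fun s => (al s)^`()) by move=> s hs; rewrite s1 ?deriv0.
have d3 : tdeg i.+1 (fun s => (al s)^`()) by move=> s hs; rewrite t1 ?deriv0.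
have z1 : alt (fun=> 0 : P) by move=> s x y t; rewrite oppr0.
split.
- apply: (@tdeg_eq i _ (fun=> 0)) => //; [exact: alt_contr | exact: supp_contr | exact: tdeg_contr |].
  by move=> b; have [] := hC b.
- apply: (@tdeg_eq i (fun s => _ + _) (fun=> 0)) => //.
  + by move=> s x y t; rewrite (alt_contr _ _ a2) (alt_contr _ _ d1) opprD.
  + by move=> s hs; rewrite (supp_contr _ _ s2) // (supp_contr _ _ d2) ?addr0.
  + by move=> s hs; rewrite (tdeg_contr _ _ t2) // (tdeg_contr _ _ d3) ?addr0.
  + by move=> b; have [] := hC b.
- apply: (@tdeg_eq i _ (fun=> 0)) => //; [exact: alt_contr | exact: supp_contr | exact: tdeg_contr |].
  by move=> b; have [] := hC b.
Qed.

Lemma koszul_vanish i :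
  (forall l, (0 < l)%N -> (2 * l < g + 2)%N -> (l%:R : k) != 0) ->
  (2 * i < g - 2)%N \/ (g - 3 < i)%N -> forall z, cyc i z -> bnd i z.
Proof.
move=> charP hi z hz.
have zdeg : tensor_deg (@tangent_section k g) (i + 2) z.
  by case: (i) z hz => [|j] z // [].
have z2 b : tangent_section 2 (z b).
  by have := zdeg b; rewrite /= leq_addr addKn.
have /fin_all_exists[a /fin_all_exists[c hac]] := fun b => section2_form g2 (z2 b).
pose al := lst (setfun a); pose be := lst (setfun c).
have zE b : z b = ub ^+ 2 * th (sAB (setfun a (val b)) (setfun c (val b))).
  by rewrite !setfun_val; have [-> _ _ _ _] := hac b.
have hpc : pair_cycle g al be by apply: (koszul_cycle hz) => b; have [] := hac b.
have hpb : pair_bound g al be.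
  pose Q (x y : P) := [/\ (size x <= g.*2.+1)%N, (size y <= g.*2.-1)%N,
    y`_(g.*2 - 2) = (g * g)%:R * x`_(g.*2) & y`_(g.*2 - 3) = (g * g.-1)%:R * x`_(g.*2.-1)].
  have Q0 : Q 0 0 by split; rewrite ?size_poly0 // !coef0 mulr0.
  have hl s : Q (al s) (be s).
    apply: lst_ind2 => // [x y [h1 h2 h3 h4]|A].
      by split; rewrite ?size_polyN // !coefN ?h3 ?h4 mulrN.
    by rewrite /setfun; case: insub => [b|] //; have [_] := hac b.
  by split=> s; have [] := hl s.
have [A [A1 A2 A3 A4 [A5 A6]]] := pair_boundary g2 charP hi (alt_lst _) (supp_lst _) (tdeg_setfun _)
  (alt_lst _) (supp_lst _) (tdeg_setfun _) hpc hpb.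
pose y : {ffun B i.+1 -> K} := [ffun b => ub ^+ 1 * th (sA (A (enl (val b))))].
exists y.
  have y1 b : tangent_section 1 (y b) by rewrite ffunE expr1; apply: section1_of_poly.
  by move=> b; have := y1 b; rewrite /= addn2 leqnSn subSS subSnn.
apply/ffunP => b.
rewrite (koszul_map (e := 1) (X := fun S => sA (A (enl S)))) => [|b']; last by rewrite ffunE.
have ea : setfun a (val b) = ctr cv A (enl (val b)) by rewrite A5 lst_enl.
have ec : setfun c (val b) = ctr cv' (fun s => (A s)^`()) (enl (val b)) by rewrite A6 lst_enl.
rewrite zE ea ec -contr_zh1.
congr (_ * th (ctr _ _ _)).
have -> : (fun S : {set 'I_g.+1} => sA (A (enl S))) = (fun S => sAB (A (enl S)) 0).
  by apply: functional_extensionality => S; rewrite /sAB polyC0 mul0r addr0.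
rewrite lst_sAB; apply: functional_extensionality => s.
rewrite (lst_id (two_reg_poly two) A1 A2) (_ : lst (fun=> 0) s = 0) /sAB ?polyC0 ?mul0r ?addr0 //.
by rewrite /lst mulr0 if_same.
Qed.

(** By [section2_of_poly] the pair (0, be) is a Koszul cycle of sections. A boundary for it consists
    of sections of O(1), and [section1_form] turns these into a tensor with the degree bound g. *)
Lemma koszul_bounding i be : (forall z, cyc i z -> bnd i z) ->
  alt be -> supp g.+1 be -> tdeg i be -> (forall s, (size (be s) <= g.*2 - 3)%N) ->
  (forall s, ctr cv be s = 0) -> (forall s, ctr cv' be s = 0) ->
  exists A : seq nat -> P, [/\ alt A, supp g.+1 A, tdeg i.+1 A, forall s, (size (A s) <= g.+1)%N
    & (forall s, ctr cv A s = 0) /\ (forall s, ctr cv' (fun s => (A s)^`()) s = be s)].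
Proof.
move=> hv b1 b2 b3 b4 b5 b6.
have z0 s : lst (fun=> 0 : P) s = 0 :> P by rewrite /lst mulr0 if_same.
have lbe : lst (fun S : {set 'I_g.+1} => sAB 0 (be (enl S))) = fun s => sAB 0 (be s).
  rewrite (lst_sAB (fun=> 0)); apply: functional_extensionality => s.
  by rewrite (lst_id (two_reg_poly two) b1 b2) z0.
pose x : {ffun B i -> K} := [ffun b => ub ^+ 2 * th (sAB 0 (be (enl (val b))))].
have xE b : x b = ub ^+ 2 * th (sAB 0 (be (enl (val b)))) by rewrite ffunE.
have x2 b : tangent_section 2 (x b).
  have := section2_of_poly two g2 (b4 (enl (val b))).
  by rewrite xE {1}/sAB /sA deriv0 polyC0 mul0r addr0 add0r.
have xdeg : tensor_deg (@tangent_section k g) (i + 2) (x : {ffun res_basis (koszul_res k g.+1) i -> K}).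
  by move=> b; have := x2 b; rewrite /= leq_addr addKn.
have hx : cyc i x.
  case: i {hv b3 x2} x xE xdeg => [|i] x xE xdeg //; split=> //.
  apply/ffunP => b; rewrite [RHS]ffunE /= (koszul_map (e := 2) (X := fun S => sAB 0 (be (enl S)))) //.
  rewrite lbe contr_zh b5 b6.
  have n0 f : ctr f (fun s => (0 : P)^`()) (enl (val b)) = 0.
    by rewrite /contr big1 // => a _; rewrite deriv0 mulr0.
  have n1 f : ctr f (fun s => 0 : P) (enl (val b)) = 0.
    by rewrite /contr big1 // => a _; rewrite mulr0.
  by rewrite !n0 !n1 !addr0 polyC0 !mul0r !addr0 (rmorph0 th) mulr0.
have [y ydeg yE] := hv _ hx.
have y1 b : tangent_section 1 (y b).
  by have := ydeg b; rewrite /= addn2 leqnSn subSS subSnn.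
have g0 : (0 < g)%N by apply: ltn_trans g2.
have /fin_all_exists[A hA] : forall b, exists A : P, (size A <= g.+1)%N /\ y b = ub * th (sA A).
  by move=> b; have [A h1 h2] := section1_form g0 (y1 b); exists A.
have key (b : B i) : ctr cv (lst (setfun A)) (enl (val b)) = 0 /\
    ctr cv' (fun s => (lst (setfun A) s)^`()) (enl (val b)) = be (enl (val b)).
  have e1 : free_map (@koszul_d k g.+1 i) y b = x b by rewrite yE.
  rewrite (koszul_map (e := 1) (X := fun S => sAB (setfun A S) 0)) in e1; last first.
    by move=> b'; rewrite setfun_val; have [_ ->] := hA b'; rewrite /sAB polyC0 mul0r addr0.
  move: e1; rewrite xE lst_sAB => /eqP; rewrite -subr_eq0 -mulrBr -thB => /eqP/section_th0/eqP.
  rewrite subr_eq0 => /eqP.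
  have -> : (fun s => sAB (lst (setfun A) s) (@lst _ g.+1 (fun=> 0 : P) s)) = (fun s => sA (lst (setfun A) s)).
    by apply: functional_extensionality => s; rewrite z0 /sAB polyC0 mul0r addr0.
  by rewrite contr_zh1 => /sAB_inj.
have a1 : alt (lst (setfun A)) := alt_lst _.
have a2 : supp g.+1 (lst (setfun A)) := supp_lst _.
have a3 : tdeg i.+1 (lst (setfun A)) := tdeg_setfun _.
exists (lst (setfun A)); split=> //.
  move=> s; apply: (@lst_ind2 _ _ (fun x _ : P => (size x <= g.+1)%N) (setfun A) (setfun A)).
  - by rewrite size_poly0.
  - by move=> u _ hu; rewrite size_polyN.
  - by move=> S; rewrite /setfun; case: insub => [b|]; [have [] := hA b | rewrite size_poly0].
have d1 : alt (fun s => (lst (setfun A) s)^`()) by move=> s u v t; rewrite a1 derivN.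
have d2 : supp g.+1 (fun s => (lst (setfun A) s)^`()) by move=> s hs; rewrite a2 ?deriv0.
have d3 : tdeg i.+1 (fun s => (lst (setfun A) s)^`()) by move=> s hs; rewrite a3 ?deriv0.
have z1 : alt (fun=> 0 : P) by move=> s u v t; rewrite oppr0.
split.
  apply: (@tdeg_eq i _ (fun=> 0)) => //; [exact: alt_contr | exact: supp_contr | exact: tdeg_contr |].
  by move=> b; have [] := key b.
apply: (@tdeg_eq i) => //; [exact: alt_contr | exact: supp_contr | exact: tdeg_contr |].
by move=> b; have [] := key b.
Qed.

End Translate.

Lemma koszul_nonvanish (k : closedFieldType) (g i : nat) :
  (2 < g)%N -> (2%:R : k) != 0 -> (g - 2 <= 2 * i)%N -> (i <= g - 3)%N ->
  ~ forall z : {ffun res_basis (koszul_res k g.+1) i -> tangent_field k g},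
      tor_cycle (@tangent_section k g) (i + 2) z -> tor_boundary (@tangent_section k g) (i + 2) z.
Proof.
move=> g2 two h1 h2 hv.
have [N gE] : exists N, g = (N + i).+1 by exists (g - i.+1)%N; lia.
subst g; have N2 : (2 <= N)%N by lia.
have Ni : (N <= i.+1)%N by lia.
apply: (cycle_not_boundary two N2 Ni) => be [b1 b2 b3 b4 [b5 b6]].
apply: (koszul_bounding g2 two hv b1 b2 b3 _ b5 b6) => s.
by rewrite (leq_trans (b4 s)) //; lia.
Qed.

Lemma natr_neq0_char (k : fieldType) (g p l : nat) : has_char k p ->
  p = 0%N \/ (g + 2 <= 2 * p)%N -> (0 < l)%N -> (2 * l < g + 2)%N -> (l%:R : k) != 0.
Proof.
rewrite /has_char; case: eqP => [_ /pcharf0P h _ l0 _|p0 hp [//|hg] l0 hl]; first by rewrite h -lt0n.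
rewrite -(dvdn_pcharf hp); apply: contraL hl => /(dvdn_leq l0) h.
by rewrite -leqNgt (leq_trans hg) // leq_pmul2l.
Qed.

Theorem theorem1p6 (g p : nat) (k : closedFieldType)
    (hg : (3 <= g)%N) (hp : has_char k p)
    (hpg : p = 0%N \/ (g + 2 <= 2 * p)%N)
    (P : residue_res k g.+1) (i : nat) :
  tangent_betti P i 2 <> Some 0%N <-> ((g - 2 <= 2 * i)%N /\ (i <= g - 3)%N).
Proof.
have charP l : (0 < l)%N -> (2 * l < g + 2)%N -> (l%:R : k) != 0.
  exact: natr_neq0_char hp hpg.
have two : (2%:R : k) != 0 by apply: charP => //; lia.
have tr (Q Q' : residue_res k g.+1) := @cycle_boundary_transfer k g.+1 Q Q' (tangent_field k g)
  (@tangent_section k g) i (i + 2) (@section0 k g) (@sectionD k g) (@sectionZ k g).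
rewrite /tangent_betti /tor_dim quot_dim0; split=> [h|[h1 h2] h].
  have [hi|hi] := boolP ((g - 2 <= 2 * i)%N && (i <= g - 3)%N); first by case/andP: hi.
  case: h; apply: (tr P (koszul_res k g.+1)); apply: koszul_vanish => //.
  by move: hi; rewrite negb_and -!ltnNge => /orP[]; [left | right].
exact: (koszul_nonvanish hg two h1 h2 (tr (koszul_res k g.+1) P h)).
Qed.
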